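(* Let $\Omega\subset\mathbb R^2$ be a bounded Lipschitz domain that is simply connected with connected boundary. Then $$\boldsymbol H(\operatorname{div}\mathbf{div},\Omega;\mathbb S)=\operatorname{sym}\mathbf{curl}\,\boldsymbol H^1(\Omega;\mathbb R^2)\oplus\boldsymbol\pi\Delta^{-1}L^2(\Omega)$$ (direct sum).
   Context: $\mathbb S$ is the space of symmetric $2\times2$ matrices and $\operatorname{sym}\boldsymbol\tau=(\boldsymbol\tau+\boldsymbol\tau^{\intercal})/2$. $\boldsymbol H(\operatorname{div}\mathbf{div},\Omega;\mathbb S):=\{\boldsymbol\tau\in\boldsymbol L^2(\Omega;\mathbb S):\operatorname{div}\mathbf{div}\boldsymbol\tau\in L^2(\Omega)\}$ with squared norm $\|\boldsymbol\tau\|_0^2+\|\operatorname{div}\mathbf{div}\boldsymbol\tau\|_0^2$. $\mathbf{div}$ is the row-wise divergence of a matrix field; for a scalar $v$, $\operatorname{curl}v=(\partial_2v,-\partial_1v)^{\intercal}$, and $\mathbf{curl}$ of a vector field is the matrix field whose $i$-th row is the curl of the $i$-th component. For a scalar function $v$, $\boldsymbol\pi v:=v\,\boldsymbol I_{2\times2}$. $\Delta^{-1}:H^{-1}(\Omega)\to H_0^1(\Omega)$ is the inverse of the Dirichlet Laplacian $\Delta:H_0^1(\Omega)\to H^{-1}(\Omega)$. Derivatives are distributional. *)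

(* Defs.v *)
From HB Require Import structures.
From mathcomp Require Import all_boot all_order all_algebra.
From mathcomp Require Import all_classical all_reals all_analysis.
Set Implicit Arguments.
Unset Strict Implicit.
Unset Printing Implicit Defensive.
Import Order.TTheory GRing.Theory Num.Theory numFieldNormedType.Exports.
Local Open Scope classical_set_scope.
Local Open Scope ring_scope.

(* Points of the plane are pairs (x_1, x_2) : R * R.  A function on Omega is
   represented by a total function on R * R of which only the values on Omega
   matter, and elements of L^2(Omega) by Borel representatives, compared with
   [ae_eq]. *)

Definition leb2 (R : realType) :=
  (@lebesgue_measure R \x @lebesgue_measure R)%E.

Definition boundary (R : realType) (Omega : set (R * R)) : set (R * R) :=
  closure Omega `\` interior Omega.

(* Near each boundary point, in suitable orthonormal coordinates (xi, eta),
   Omega is the strict epigraph of a Lipschitz function. The coordinates are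
   obtained by a rotation of angle with cosine c and sine s; a reflection
   xi |-> - xi can be absorbed in h. *)
Definition lipschitz_boundary (R : realType) (Omega : set (R * R)) :=
  forall x, boundary Omega x ->
    exists (c s : R) (h : R -> R), [/\ c ^+ 2 + s ^+ 2 = 1, lipschitz h &
      \forall y \near x,
        Omega y <-> h (c * y.1 + s * y.2) < c * y.2 - s * y.1].

Definition bounded_lipschitz_domain (R : realType) (Omega : set (R * R)) :=
  [/\ Omega !=set0, open Omega, connected Omega, bounded_set Omega &
      lipschitz_boundary Omega].

(* Every loop in Omega is contractible in Omega relative to its base point;
   path-connectedness is automatic for the connected open sets considered. *)
Definition simply_connected (R : realType) (Omega : set (R * R)) :=
  let I : set R := `[0, 1]%classic in
  connected Omega /\
  forall gamma : R -> R * R,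
    {within I, continuous gamma} -> (forall t, I t -> Omega (gamma t)) ->
    gamma 0 = gamma 1 ->
    exists H : R * R -> R * R,
      [/\ {within I `*` I, continuous H},
          forall p, (I `*` I) p -> Omega (H p),
          forall t, I t -> H (0, t) = gamma t,
          forall t, I t -> H (1, t) = gamma 0 &
          forall s, I s -> H (s, 0) = gamma 0 /\ H (s, 1) = gamma 0].

Definition unit_vec (R : realType) (i : 'I_2) : R * R :=
  if i == 0 then (1, 0) else (0, 1).

Definition partial (R : realType) (i : 'I_2) (f : R * R -> R) : R * R -> R :=
  fun x => 'D_(unit_vec R i) f x.

Definition smooth (R : realType) (f : R * R -> R) :=
  forall s : seq 'I_2, let g := foldr (@partial R) f s in
    continuous g /\ forall (i : 'I_2) x, derivable g x (unit_vec R i).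

Definition test_function (R : realType) (Omega : set (R * R))
    (f : R * R -> R) :=
  let supp := closure [set x | f x != 0] in
  [/\ smooth f, compact supp & supp `<=` Omega].

(* Distributions on Omega are only ever evaluated at, and compared on, test
   functions of Omega; all those occurring below are derivatives of L^2
   functions. *)
Definition functional (R : realType) := (R * R -> R) -> R.

Definition eq_distr (R : realType) (Omega : set (R * R)) (S T : functional R) :=
  forall f, test_function Omega f -> S f = T f.

Definition distr (R : realType) (Omega : set (R * R)) (u : R * R -> R) :
    functional R :=
  fun f => \int[@leb2 R]_(x in Omega) (u x * f x).

Definition dpartial (R : realType) (i : 'I_2) (T : functional R) :
    functional R :=
  fun f => - T (partial i f).

Definition ddiv (R : realType) (v : 'I_2 -> functional R) : functional R :=
  fun f => \sum_(j < 2) dpartial j (v j) f.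

Definition dbdiv (R : realType) (t : 'I_2 -> 'I_2 -> functional R) :
    'I_2 -> functional R :=
  fun i => ddiv (t i).

Definition dcurl (R : realType) (T : functional R) : 'I_2 -> functional R :=
  fun j => if j == 0 then dpartial 1 T else fun f => - dpartial 0 T f.

Definition dbcurl (R : realType) (v : 'I_2 -> functional R) :
    'I_2 -> 'I_2 -> functional R :=
  fun i => dcurl (v i).

Definition dsym (R : realType) (t : 'I_2 -> 'I_2 -> functional R) :
    'I_2 -> 'I_2 -> functional R :=
  fun i j f => (t i j f + t j i f) / 2.

Definition distr_vec (R : realType) (Omega : set (R * R))
    (v : R * R -> 'cV[R]_2) : 'I_2 -> functional R :=
  fun i => distr Omega (fun x => v x i 0).

Definition distr_mx (R : realType) (Omega : set (R * R))
    (t : R * R -> 'M[R]_2) : 'I_2 -> 'I_2 -> functional R :=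
  fun i j => distr Omega (fun x => t x i j).

Definition L2 (R : realType) (Omega : set (R * R)) : set (R * R -> R) :=
  [set u : R * R -> R | measurable_fun Omega u /\
    (\int[@leb2 R]_(x in Omega) (u x ^+ 2)%:E < +oo)%E].

Definition L2mx (R : realType) (Omega : set (R * R)) :
    set (R * R -> 'M[R]_2) :=
  [set t : R * R -> 'M[R]_2 | forall i j, L2 Omega (fun x => t x i j)].

Definition L2sym (R : realType) (Omega : set (R * R)) :
    set (R * R -> 'M[R]_2) :=
  [set t : R * R -> 'M[R]_2 | L2mx Omega t /\
    ae_eq (@leb2 R) Omega (fun x => (t x)^T) t].

Definition weak_grad (R : realType) (Omega : set (R * R)) (u : R * R -> R)
    (g : 'I_2 -> R * R -> R) :=
  forall i, L2 Omega (g i) /\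
    eq_distr Omega (dpartial i (distr Omega u)) (distr Omega (g i)).

Definition H1 (R : realType) (Omega : set (R * R)) : set (R * R -> R) :=
  [set u : R * R -> R | L2 Omega u /\ exists g, weak_grad Omega u g].

Definition H1vec (R : realType) (Omega : set (R * R)) :
    set (R * R -> 'cV[R]_2) :=
  [set v : R * R -> 'cV[R]_2 | forall i, H1 Omega (fun x => v x i 0)].

Definition H10 (R : realType) (Omega : set (R * R)) : set (R * R -> R) :=
  [set u : R * R -> R | L2 Omega u /\ exists2 g, weak_grad Omega u g &
    forall e : R, 0 < e -> exists2 f, test_function Omega f &
      \int[@leb2 R]_(x in Omega) ((u x - f x) ^+ 2) +
      \sum_(i < 2) \int[@leb2 R]_(x in Omega) ((g i x - partial i f x) ^+ 2)
        < e ^+ 2].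

Definition Hdivdiv (R : realType) (Omega : set (R * R)) :
    set (R * R -> 'M[R]_2) :=
  [set t : R * R -> 'M[R]_2 | L2sym Omega t /\ exists2 q, L2 Omega q &
    eq_distr Omega (ddiv (dbdiv (distr_mx Omega t))) (distr Omega q)].

Definition symcurlH1 (R : realType) (Omega : set (R * R)) :
    set (R * R -> 'M[R]_2) :=
  [set t : R * R -> 'M[R]_2 | L2mx Omega t /\ exists2 v, H1vec Omega v &
    forall i j, eq_distr Omega (dsym (dbcurl (distr_vec Omega v)) i j)
                               (distr_mx Omega t i j)].

(* w = Delta^-1 F, that is w in H^1_0 and Delta w = F in H^-1, where
   <Delta w, v> = - (grad w, grad v) for all v in H^1_0. *)
Definition is_inv_laplacian (R : realType) (Omega : set (R * R))
    (F : functional R) (w : R * R -> R) :=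
  H10 Omega w /\ forall g v h, weak_grad Omega w g ->
    H10 Omega v -> weak_grad Omega v h ->
    F v = - \int[@leb2 R]_(x in Omega) (\sum_(i < 2) g i x * h i x).

Definition pi_mx (R : realType) (v : R * R -> R) : R * R -> 'M[R]_2 :=
  fun x => (v x)%:M.

(* [distr Omega q], i.e. v |-> (q, v), is also the element of H^-1(Omega)
   identified with q in L^2(Omega). *)
Definition pi_inv_laplacian_L2 (R : realType) (Omega : set (R * R)) :
    set (R * R -> 'M[R]_2) :=
  [set t : R * R -> 'M[R]_2 | L2mx Omega t /\ exists q w, [/\ L2 Omega q,
    is_inv_laplacian Omega (distr Omega q) w &
    ae_eq (@leb2 R) Omega t (pi_mx w)]].

(* V is the direct sum of A and B, for spaces of functions modulo equality
   almost everywhere on Omega. *)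
Definition is_direct_sum (R : realType) (Omega : set (R * R))
    (V A B : set (R * R -> 'M[R]_2)) :=
  (forall t, L2mx Omega t ->
    (V t <-> exists a b, [/\ A a, B b &
                            ae_eq (@leb2 R) Omega t (a \+ b)])) /\
  (forall a a' b b', A a -> A a' -> B b -> B b' ->
    ae_eq (@leb2 R) Omega (a \+ b) (a' \+ b') ->
    ae_eq (@leb2 R) Omega a a' /\ ae_eq (@leb2 R) Omega b b').

(* Main.v *)
Require Import Defs.
From HB Require Import structures.
From mathcomp Require Import all_boot all_order all_algebra.
From mathcomp Require Import all_classical all_reals all_analysis.
From mathcomp Require Import measurable_realfun.
From mathcomp Require Import ring lra.
Import Order.TTheory GRing.Theory Num.Theory.
Import numFieldNormedType.Exports.
Set Implicit Arguments.
Unset Strict Implicit.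
Unset Printing Implicit Defensive.
Local Open Scope classical_set_scope.
Local Open Scope ring_scope.

(** Let t be in H(div div) and let w in H^1_0 solve Laplace w = div div t.  Then
    div div (w I) = div div t, so that a = t - w I is a symmetric L^2 field with
    div div a = 0, and everything rests on the claim that such a field is the
    symmetrised curl of some v in H^1 ([divdiv0_symcurl]).  The decomposition is
    direct because a symmetrised curl has no div div: two decompositions of t
    have H^1_0 parts with the same Laplacian, hence the same H^1_0 parts.

    Conjugating by a rotation of a right angle turns the claim into the
    Saint-Venant problem ([saint_venant]): div div a = 0 says that the rotated
    field satisfies the compatibility condition of strains, and it has to be
    the symmetric gradient of some u in H^1; then v = (u_1, - u_0).

    The field is only in L^2.  The Riesz theorem in H^1_0 ([riesz_field])
    provides p and r in H^1_0 such that, after subtraction of the strain of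
    (p, r), the two components of the deviator satisfy the Cauchy-Riemann
    equations weakly and the trace T is weakly harmonic.  By Weyl's lemma
    ([smooth_smoothing], [smoothing_ae]) what remains is smooth.  On a simply
    connected domain closed forms are exact ([closed_form_exact]): this gives
    first a harmonic conjugate s of T, and then a smooth displacement whose
    gradient is made of the deviator, T and s ([smooth_displacement]).

    The remaining point is that s and the displacement are square integrable
    up to the Lipschitz boundary.  The gradients of s and T have the same
    length; the interior gradient estimate for harmonic functions
    ([grad_bound]), integrated with its weight, shows that the distance to the
    boundary times the gradient of T is square integrable near the boundary
    ([collar_harmonic]), and Hardy's inequality along lines transversal to the
    boundary ([collar_hardy]) then bounds s itself ([L2_of_conjugate]).  The
    displacement has a square integrable gradient, and the same inequality
    applies to it ([L2_of_gradient]). *)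

(** * Smooth functions of one and two variables *)

Section slices.
Context {R : realType} {V : normedModType R}.
Implicit Types (f : V -> R) (x v : V).

Lemma is_derive_line f x v (t d : R) :
  is_derive (t *: v + x) v f d -> is_derive t (1 : R) (fun s : R => f (s *: v + x)) d.
Proof.
have E : (fun h : R => h^-1 *: (f (h *: v + (t *: v + x)) - f (t *: v + x))) =
         (fun h : R => h^-1 *: ((fun s : R => f (s *: v + x)) (h *: 1 + t) -
                                (fun s : R => f (s *: v + x)) t)).
  by apply/funext => h /=; rewrite addrA -scalerDl [h *: 1]mulr1.
move=> [df Df]; split.
  by rewrite /derivable -E.
by rewrite /derive -E.
Qed.

(** A derivative along v is the derivative of the restriction to a line, which
    transports the rules of one-variable calculus. *)
Lemma is_derive_line0 f x v (d : R) :
  is_derive x v f d <-> is_derive (0 : R) (1 : R) (fun s : R => f (s *: v + x)) d.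
Proof.
have E : (fun h : R => h^-1 *: (f (h *: v + x) - f x)) =
         (fun h : R => h^-1 *: ((fun s : R => f (s *: v + x)) (h *: 1 + 0) -
                                (fun s : R => f (s *: v + x)) 0)).
  by apply/funext => h /=; rewrite addr0 [h *: 1]mulr1 scale0r add0r.
split=> -[df Df]; split.
- by rewrite /derivable -E.
- by rewrite /derive -E.
- by rewrite /derivable E.
- by rewrite /derive E.
Qed.

Lemma is_derive_compl f (h : R -> R) x v (a b : R) :
  is_derive (f x) 1 h a -> is_derive x v f b -> is_derive x v (h \o f) (a * b).
Proof.
move=> ha /is_derive_line0 fb; apply/is_derive_line0.
apply: (@is_derive1_comp _ h (fun s : R => f (s *: v + x))) => //.
by rewrite scale0r add0r.
Qed.

Lemma is_derive_add f g x v (a b : R) : is_derive x v f a -> is_derive x v g b ->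
  is_derive x v (fun y => f y + g y) (a + b).
Proof. exact: is_deriveD. Qed.

Lemma is_derive_mul f g x v (a b : R) : is_derive x v f a -> is_derive x v g b ->
  is_derive x v (fun y => f y * g y) (a * g x + f x * b).
Proof.
move=> fa gb; have := is_deriveM fa gb.
by rewrite addrC /GRing.scale /= [g x * _]mulrC.
Qed.

End slices.

Section smooth1.
Context {R : realType}.
Implicit Types h : R -> R.

Definition smooth1 h := forall n (x : R), derivable (derive1n n h) x 1.

(** Smoothness follows from membership in any class of functions that is closed
    under derivation. *)
Lemma smooth1_coind (P : (R -> R) -> Prop) :
  (forall h, P h -> exists2 g, P g & forall x : R, is_derive x 1 h (g x)) ->
  forall h, P h -> smooth1 h.
Proof.
move=> H h Ph n.
have : P (derive1n n h).
  elim: n => [|n IH]; first by rewrite derive1n0.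
  have [g Pg hg] := H _ IH; rewrite derive1nS.
  suff -> : derive1 (derive1n n h) = g by [].
  by apply/funext => x; rewrite derive1E; apply: derive_val.
by move=> /H[g _ hg] x; apply: ex_derive.
Qed.

Lemma smooth1P h : smooth1 h -> forall x : R, is_derive x 1 h (derive1 h x).
Proof.
move=> /(_ 0%N) sh x; rewrite derive1E; apply: derivableP; exact: sh.
Qed.

Lemma smooth1_derive h : smooth1 h -> smooth1 (derive1 h).
Proof.
move=> sh n x.
by have := sh n.+1 x; rewrite /derive1n iterSr.
Qed.

Lemma smooth1_continuous h : smooth1 h -> continuous h.
Proof.
move=> sh x; apply: differentiable_continuous; apply/derivable1_diffP.
exact: (sh 0%N).
Qed.

(** The derivative of an expression built from smooth functions by sum, product
    and composition is again such an expression; hence they are all smooth. *)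
Inductive alg1 : (R -> R) -> Prop :=
| alg1_base h : smooth1 h -> alg1 h
| alg1_add f g : alg1 f -> alg1 g -> alg1 (fun x => f x + g x)
| alg1_mul f g : alg1 f -> alg1 g -> alg1 (fun x => f x * g x)
| alg1_comp f g : smooth1 f -> alg1 g -> alg1 (fun x => f (g x)).

Lemma alg1_smooth1 h : alg1 h -> smooth1 h.
Proof.
apply: smooth1_coind => {}h; elim=> {h}.
- by move=> h sh; exists (derive1 h); [exact/alg1_base/smooth1_derive|exact: smooth1P].
- move=> f g af [f' Af' Df] ag [g' Ag' Dg].
  exists (fun x => f' x + g' x); first exact: alg1_add.
  by move=> x; apply: is_derive_add.
- move=> f g af [f' Af' Df] ag [g' Ag' Dg].
  exists (fun x => f' x * g x + f x * g' x).
    by apply: alg1_add; apply: alg1_mul.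
  by move=> x; apply: is_derive_mul.
- move=> f g sf ag [g' Ag' Dg].
  exists (fun x => derive1 f (g x) * g' x).
    by apply: alg1_mul => //; apply: alg1_comp => //; exact: smooth1_derive.
  by move=> x; exact: (is_derive1_comp (smooth1P sf _) (Dg x)).
Qed.

Lemma smooth1_cst (c : R) : smooth1 (fun _ => c).
Proof.
apply: (@smooth1_coind (fun h => exists c, h = fun _ => c)); last by exists c.
move=> _ [d ->]; exists (fun=> 0); first by exists 0.
by move=> x; apply: is_derive_cst.
Qed.

Lemma smooth1_id : smooth1 id.
Proof.
apply: (@smooth1_coind (fun h => h = id \/ exists c, h = fun _ => c)); last by left.
move=> _ [->|[d ->]].
  exists (fun=> 1); first by right; exists 1.
  by move=> x; apply: is_derive_id.
exists (fun=> 0); first by right; exists 0.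
by move=> x; apply: is_derive_cst.
Qed.

Lemma smooth1_expR : smooth1 (@expR R).
Proof.
apply: (@smooth1_coind (fun h => h = @expR R)) => // _ ->.
by exists expR => // x; exact: is_derive_expR.
Qed.

Lemma smooth1D f g : smooth1 f -> smooth1 g -> smooth1 (fun x => f x + g x).
Proof. by move=> ? ?; apply/alg1_smooth1/alg1_add; apply: alg1_base. Qed.

Lemma smooth1M f g : smooth1 f -> smooth1 g -> smooth1 (fun x => f x * g x).
Proof. by move=> ? ?; apply/alg1_smooth1/alg1_mul; apply: alg1_base. Qed.

Lemma smooth1_comp f g : smooth1 f -> smooth1 g -> smooth1 (fun x => f (g x)).
Proof. by move=> ? ?; apply/alg1_smooth1/alg1_comp => //; apply: alg1_base. Qed.

End smooth1.


Section smooth2.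
Context {R : realType}.
Local Notation P2 := (R * R)%type.
Local Notation e := (unit_vec R).
Implicit Types (f g : P2 -> R) (O : set P2).

Definition smooth_on O f := forall s : seq 'I_2, forall x, O x ->
  {for x, continuous (foldr (@partial R) f s)} /\
  forall i, derivable (foldr (@partial R) f s) x (e i).

Lemma smooth_onT f : smooth f <-> smooth_on setT f.
Proof.
split=> sf s.
  by move=> x _; have [c d] := sf s; split; [exact: c|move=> i; exact: d].
by split=> [x|i x]; have [c d] := sf s x I; [exact: c|exact: d].
Qed.

Lemma partial_near f g (x : P2) i : {near x, f =1 g} -> partial i f x = partial i g x.
Proof. exact: near_eq_derive. Qed.

(** The two-variable form of smooth1_coind; as O is open, derivatives need to be
    in the class only up to their values outside O. *)
Lemma smooth_on_coind O (P : (P2 -> R) -> Prop) : open O ->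
  (forall f, P f -> (forall x, O x -> {for x, continuous f}) /\
     forall i, exists2 g, P g & forall x, O x -> is_derive x (e i) f (g x)) ->
  forall f, P f -> smooth_on O f.
Proof.
move=> oO H f Pf s.
have [g Pg fg] : exists2 g, P g & {in O, foldr (@partial R) f s =1 g}.
  elim: s => [|i s [g Pg fg]] /=; first by exists f.
  have [_ /(_ i)[g' Pg' dg]] := H _ Pg; exists g' => // x /set_mem Ox.
  rewrite (@partial_near _ g); first by apply: derive_val; exact: dg.
  by apply: filterS (open_nbhs_nbhs (conj oO Ox)) => y /mem_set; exact: fg.
have nfg x : O x -> {near x, g =1 foldr (@partial R) f s}.
  by move=> Ox; apply: filterS (open_nbhs_nbhs (conj oO Ox)) => y /mem_set/fg ->.
move=> x Ox; have [cg dg] := H _ Pg; split.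
  have gx := cg _ Ox; rewrite /prop_for /continuous_at -(nbhs_singleton (nfg x Ox)).
  apply: cvg_trans gx; apply: near_eq_cvg; exact: nfg.
move=> i; have [g' _ /(_ x Ox) dg'] := dg i.
by apply: near_eq_derivable (nfg x Ox) _; apply: ex_derive.
Qed.

Lemma smooth_onP O f : smooth_on O f -> forall x i, O x -> is_derive x (e i) f (partial i f x).
Proof. by move=> sf x i Ox; apply: derivableP; have [_] := sf [::] x Ox. Qed.

Lemma smooth_on_cont O f : smooth_on O f -> forall x, O x -> {for x, continuous f}.
Proof. by move=> sf x Ox; have [] := sf [::] x Ox. Qed.

Lemma smooth_on_partial O f i : smooth_on O f -> smooth_on O (partial i f).
Proof. by move=> sf s; have := sf (rcons s i); rewrite foldr_rcons. Qed.

Lemma smooth_onS O O' f : O' `<=` O -> smooth_on O f -> smooth_on O' f.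
Proof. by move=> OO sf s x /OO; exact: sf. Qed.

Inductive alg2 O : (P2 -> R) -> Prop :=
| alg2_base f : smooth_on O f -> alg2 O f
| alg2_add f g : alg2 O f -> alg2 O g -> alg2 O (fun x => f x + g x)
| alg2_mul f g : alg2 O f -> alg2 O g -> alg2 O (fun x => f x * g x)
| alg2_comp h g : smooth1 h -> alg2 O g -> alg2 O (fun x => h (g x)).

Lemma alg2_smooth O f : open O -> alg2 O f -> smooth_on O f.
Proof.
move=> oO; apply: smooth_on_coind => // {}f; elim=> {f}.
- move=> f sf; split; first exact: smooth_on_cont.
  move=> i; exists (partial i f); first exact/alg2_base/smooth_on_partial.
  by move=> x Ox; exact: (smooth_onP sf i Ox).
- move=> f g af [cf If] ag [cg Ig]; split.
    by move=> x Ox; apply: cvgD; [exact: cf|exact: cg].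
  move=> i; have [f' Af' Df] := If i; have [g' Ag' Dg] := Ig i.
  exists (fun x => f' x + g' x); first exact: alg2_add.
  by move=> x Ox; exact: (is_derive_add (Df _ Ox) (Dg _ Ox)).
- move=> f g af [cf If] ag [cg Ig]; split.
    by move=> x Ox; apply: cvgM; [exact: cf|exact: cg].
  move=> i; have [f' Af' Df] := If i; have [g' Ag' Dg] := Ig i.
  exists (fun x => f' x * g x + f x * g' x).
    by apply: alg2_add; apply: alg2_mul.
  by move=> x Ox; exact: (is_derive_mul (Df _ Ox) (Dg _ Ox)).
- move=> h g sh ag [cg Ig]; split.
    move=> x Ox; apply: continuous_comp; first exact: cg.
    exact: smooth1_continuous.
  move=> i; have [g' Ag' Dg] := Ig i.
  exists (fun x => derive1 h (g x) * g' x).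
    by apply: alg2_mul => //; apply: alg2_comp => //; exact: smooth1_derive.
  by move=> x Ox; exact: (is_derive_compl (smooth1P sh _) (Dg _ Ox)).
Qed.

Lemma smooth_on_cst O (c : R) : open O -> smooth_on O (fun=> c).
Proof.
move=> oO; apply: (@smooth_on_coind O (fun h => exists c, h = fun _ => c)) => //; last by exists c.
move=> _ [d ->]; split; first by move=> x _; exact: cvg_cst.
move=> i; exists (fun=> 0); first by exists 0.
by move=> x _; apply: is_derive_cst.
Qed.

Lemma smooth_on_add O f g : open O -> smooth_on O f -> smooth_on O g ->
  smooth_on O (fun x => f x + g x).
Proof. by move=> oO ? ?; apply/alg2_smooth => //; apply/alg2_add; apply: alg2_base. Qed.

Lemma smooth_on_mul O f g : open O -> smooth_on O f -> smooth_on O g ->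
  smooth_on O (fun x => f x * g x).
Proof. by move=> oO ? ?; apply/alg2_smooth => //; apply/alg2_mul; apply: alg2_base. Qed.

Lemma smooth_on_comp O (h : R -> R) g : open O -> smooth1 h -> smooth_on O g ->
  smooth_on O (fun x => h (g x)).
Proof.
move=> oO ? ?; apply/alg2_smooth => //; apply/alg2_comp => //.
exact: alg2_base.
Qed.

Lemma smooth_on_scale O (c : R) g : open O -> smooth_on O g ->
  smooth_on O (fun x => c * g x).
Proof. by move=> oO sg; exact: (smooth_on_mul oO (smooth_on_cst c oO) sg). Qed.

Lemma smooth_on_opp O g : open O -> smooth_on O g -> smooth_on O (fun x => - g x).
Proof.
move=> oO /(smooth_on_scale (-1) oO).
by under eq_fun do rewrite mulN1r.
Qed.

Lemma smooth_on_sub O f g : open O -> smooth_on O f -> smooth_on O g ->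
  smooth_on O (fun x => f x - g x).
Proof. by move=> oO sf sg; exact: (smooth_on_add oO sf (smooth_on_opp oO sg)). Qed.

(** The derivatives of f at a point of O depend only on the values of f nearby. *)
Lemma eq_smooth_on O f g : open O -> (forall x, O x -> f x = g x) ->
  smooth_on O f -> smooth_on O g.
Proof.
move=> oO fg sf.
apply: (@smooth_on_coind O (fun h => exists2 k, smooth_on O k & forall x, O x -> k x = h x)) => //;
  last by exists f.
move=> h [k sk kh].
have nkh x : O x -> {near x, k =1 h}.
  by move=> Ox; apply: filterS (open_nbhs_nbhs (conj oO Ox)) => y /kh.
split.
  move=> x Ox; rewrite /prop_for /continuous_at -(kh _ Ox).
  by apply: cvg_trans (smooth_on_cont sk Ox); apply: near_eq_cvg; exact: nkh.
move=> i; exists (partial i k); first by exists (partial i k); [exact: (smooth_on_partial i sk)|by []].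
by move=> x Ox; apply: near_eq_is_derive (nkh x Ox) _; exact: (smooth_onP sk i Ox).
Qed.

(** The existence of smooth partial derivatives does not by itself make f
    continuous, hence the first hypothesis. *)
Lemma smooth_on_prim O f (g : 'I_2 -> P2 -> R) : open O ->
  (forall x, O x -> {for x, continuous f}) -> (forall i, smooth_on O (g i)) ->
  (forall i x, O x -> is_derive x (e i) f (g i x)) -> smooth_on O f.
Proof.
move=> oO cf sg dfg.
apply: (@smooth_on_coind O (fun h => smooth_on O h \/ h = f)) => //; last by right.
move=> h [sh|->]; split => //.
- exact: smooth_on_cont.
- move=> i; exists (partial i h); first by left; exact: smooth_on_partial.
  by move=> x Ox; exact: (smooth_onP sh i Ox).
- by move=> i; exists (g i) => [|x Ox]; [left|exact: dfg].
Qed.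

Lemma smooth_onU O O' f : smooth_on O f -> smooth_on O' f -> smooth_on (O `|` O') f.
Proof. by move=> sf sf' s x [Ox|Ox]; [exact: (sf s x Ox)|exact: (sf' s x Ox)]. Qed.

Lemma is_derive_fst (x : P2) i : is_derive x (e i) fst (i == 0)%:R.
Proof.
apply/is_derive_line0; rewrite /unit_vec; case: ifP => _.
  rewrite (_ : (fun _ => _) = shift x.1); first exact: is_derive_shift.
  by apply/funext => s /=; rewrite [_ *: _]mulr1.
rewrite (_ : (fun _ => _) = cst x.1); first exact: is_derive_cst.
by apply/funext => s /=; rewrite [_ *: _]mulr0 add0r.
Qed.

Lemma is_derive_snd (x : P2) i : is_derive x (e i) snd (i != 0)%:R.
Proof.
apply/is_derive_line0; rewrite /unit_vec; case: ifP => _.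
  rewrite (_ : (fun _ => _) = cst x.2); first exact: is_derive_cst.
  by apply/funext => s /=; rewrite [_ *: _]mulr0 add0r.
rewrite (_ : (fun _ => _) = shift x.2); first exact: is_derive_shift.
by apply/funext => s /=; rewrite [_ *: _]mulr1.
Qed.

Lemma smooth_on_fst O : open O -> smooth_on O fst.
Proof.
move=> oO; apply: (@smooth_on_prim O fst (fun i _ => (i == 0)%:R) oO).
- by move=> x _; exact: cvg_fst.
- by move=> i; exact: smooth_on_cst.
- by move=> i x _; exact: is_derive_fst.
Qed.

Lemma smooth_on_snd O : open O -> smooth_on O snd.
Proof.
move=> oO; apply: (@smooth_on_prim O snd (fun i _ => (i != 0)%:R) oO).
- by move=> x _; exact: cvg_snd.
- by move=> i; exact: smooth_on_cst.
- by move=> i x _; exact: is_derive_snd.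
Qed.

End smooth2.

(** * A flat function *)

Section flat.
Context {R : realType}.

Lemma is_derive_sqr_bound (f : R -> R) (C : R) : f 0 = 0 ->
  (forall h, `|h| <= 1 -> `|f h| <= C * h ^+ 2) -> is_derive (0 : R) (1 : R) f 0.
Proof.
move=> f0 fC.
suff H : (fun h : R => h^-1 *: (f (h *: 1 + 0) - f 0)) @ 0^' --> (0 : R).
  by split; [apply/cvg_ex; exists 0|apply: cvg_lim].
have C0 : 0 <= C.
  have := fC 1; rewrite normr1 expr1n mulr1 => /(_ (lexx _)).
  exact: le_trans.
apply/cvgr0Pnorm_lt => eps eps0; near=> h.
have h0 : h != 0 by near: h; exact: nbhs_dnbhs_neq.
rewrite addr0 [h *: 1]mulr1 f0 subr0 normrM normfV.
rewrite mulrC ltr_pdivrMr ?normr_gt0//.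
have h1 : `|h| <= 1 by near: h; apply: dnbhs0_le.
apply: le_lt_trans (fC _ h1) _.
rewrite -real_normK ?num_real// expr2 mulrA ltr_pM2r ?normr_gt0//.
have : `|h| < eps / (C + 1).
  by near: h; apply: dnbhs0_lt; rewrite divr_gt0// ltr_wpDl.
rewrite ltr_pdivlMr ?ltr_wpDl//; apply: le_lt_trans.
by rewrite mulrDr mulr1 mulrC lerDl.
Unshelve. all: by end_near. Qed.

(** The functions p (1 / x) exp (- 1 / x) extended by 0 form a class closed under
    derivation. *)
Definition flatp (p : {poly R}) (x : R) : R :=
  if 0 < x then p.[x^-1] * expR (- x^-1) else 0.

Lemma horner_le (p : {poly R}) (u : R) : 1 <= u ->
  `|p.[u]| <= (\sum_(i < size p) `|p`_i|) * u ^+ size p.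
Proof.
move=> u1; rewrite horner_coef; apply: le_trans (ler_norm_sum _ _ _) _.
rewrite mulr_suml; apply: ler_sum => i _.
rewrite normrM ler_wpM2l// ger0_norm ?exprn_ge0 ?(le_trans _ u1)//.
by apply: ler_weXn2l => //; exact: ltnW.
Qed.

(** The exponential of u = 1 / h exceeds the term of its series whose degree is
    2 more than that of p. *)
Lemma flatp_bound (p : {poly R}) : exists C, forall h, `|h| <= 1 -> `|flatp p h| <= C * h ^+ 2.
Proof.
pose S : R := \sum_(i < size p) `|p`_i|.
have S0 : 0 <= S by apply: sumr_ge0.
exists (S * ((size p).+2)`!%:R) => h h1; rewrite /flatp.
case: ifPn => h0; last first.
  by rewrite normr0; apply: mulr_ge0 (sqr_ge0 _); apply: mulr_ge0.
rewrite (ger0_norm (ltW h0)) in h1.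
set u := h^-1.
have u1 : 1 <= u by rewrite invf_ge1.
have u0 : 0 < u by rewrite (lt_le_trans _ u1).
rewrite normrM (ger0_norm (expR_ge0 _)) expRN.
have := expR_ge1Dxn (size p).+1 (ltW u0) => eu.
have fu : u ^+ (size p).+2 / ((size p).+2)`!%:R <= expR u.
  by apply: le_trans eu; rewrite lerDr.
have f0 : 0 < ((size p).+2)`!%:R :> R by rewrite ltr0n fact_gt0.
have un : 0 < u ^+ (size p).+2 by rewrite exprn_gt0.
have ei : (expR u)^-1 <= ((size p).+2)`!%:R / u ^+ (size p).+2.
  rewrite -[leRHS]invf_div lef_pV2// ?posrE ?expR_gt0// divr_gt0//.
apply: (@le_trans _ _ (S * u ^+ size p * (((size p).+2)`!%:R / u ^+ (size p).+2))).
  by apply: ler_pM => //; exact: horner_le.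
have -> : h ^+ 2 = u ^- 2 by rewrite /u exprVn invrK.
rewrite -addn2 exprD -subr_ge0 (_ : _ - _ = 0)//; field.
by rewrite !expf_neq0// gt_eqF.
Qed.

Lemma is_derive_flatp (p : {poly R}) (x : R) :
  is_derive x (1 : R) (flatp p) (flatp ('X^2 * (p - p^`())) x).
Proof.
have [x0|x0|<-] := ltgtP 0 x; last 1 first.
- rewrite [X in is_derive _ _ _ X]/flatp ltxx.
  have [C fC] := flatp_bound p.
  by apply: is_derive_sqr_bound fC; rewrite /flatp ltxx.
- rewrite [X in is_derive _ _ _ X]/flatp x0.
  apply: (@near_eq_is_derive _ _ _ ((fun u => p.[u] * expR (- u)) \o (fun y => y^-1))).
    by near=> y; rewrite /flatp (_ : 0 < y)//=; near: y; exact: lt_nbhsr.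
  have xn0 : x != 0 by rewrite gt_eqF.
  have dinv : is_derive x 1 (fun y : R => y^-1) (- x ^- 2).
    have := @is_deriveV R id x 1 1 xn0 (is_derive_id _ _).
    by rewrite /GRing.scale /= mulr1.
  have dp : is_derive x^-1 1 (horner p) (p^`().[x^-1]).
    split; first exact: derivable_horner.
    by rewrite -derive1E -derivE.
  have de : is_derive x^-1 1 (fun u : R => expR (- u)) (- expR (- x^-1)).
    have := @is_derive1_comp _ expR (fun u => - u) x^-1 _ _ (is_derive_expR _)
      (is_deriveN (is_derive_id _ _)).
    by rewrite mulrN1.
  apply: is_derive_eq (is_derive1_comp (is_derive_mul dp de) dinv) _.
  by rewrite hornerM hornerD hornerN hornerXn -exprVn; ring.
- rewrite [X in is_derive _ _ _ X]/flatp ltNge (ltW x0)/=.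
  apply: (@near_eq_is_derive _ _ _ (cst 0)).
  near=> y; rewrite /flatp ifF//=; apply/negbTE; rewrite -leNgt.
  by near: y; exact: lt_le_nbhsl.
Unshelve. all: by end_near. Qed.

Definition flat (x : R) : R := flatp 1 x.

Lemma smooth1_flat : smooth1 flat.
Proof.
apply: (@smooth1_coind _ (fun h => exists p, h = flatp p)); last by exists 1.
move=> _ [p ->]; exists (flatp ('X^2 * (p - p^`()))); first by exists ('X^2 * (p - p^`())).
by move=> x; exact: is_derive_flatp.
Qed.

Lemma flat_gt0 x : (0 < flat x) = (0 < x).
Proof. by rewrite /flat /flatp; case: ifPn => x0; rewrite ?ltxx// hornerC mul1r expR_gt0. Qed.

Lemma flat_ge0 x : 0 <= flat x.
Proof. by rewrite /flat /flatp; case: ifPn => // x0; rewrite hornerC mul1r expR_ge0. Qed.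

Lemma flat_le0 x : x <= 0 -> flat x = 0.
Proof. by rewrite /flat /flatp leNgt => /negbTE ->. Qed.

End flat.

(** * Mean value theorem and symmetry of second derivatives *)

Section mvt.
Context {R : realType} {V : normedModType R}.

Lemma is_derive_addl (f : V -> R) (w x v : V) (d : R) :
  is_derive (w + x) v f d -> is_derive x v (fun y => f (w + y)) d.
Proof.
have E : (fun h : R => h^-1 *: (f (h *: v + (w + x)) - f (w + x))) =
         (fun h : R => h^-1 *: (f (w + (h *: v + x)) - f (w + x))).
  by apply/funext => h; rewrite addrCA.
by move=> [df Df]; split; [rewrite /derivable -E|rewrite /derive -E].
Qed.

Lemma mvt_line (f df : V -> R) (x v : V) (h : R) :
  (forall s : R, `|s| <= `|h| -> is_derive (s *: v + x) v f (df (s *: v + x))) ->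
  exists2 s : R, `|s| <= `|h| & f (h *: v + x) - f x = df (s *: v + x) * h.
Proof.
move=> H.
pose F (s : R) := f (s *: v + x); pose dF (s : R) := df (s *: v + x).
have HF s : `|s| <= `|h| -> is_derive s (1 : R) F (dF s).
  by move=> /H; exact: is_derive_line.
have F0 : F 0 = f x by rewrite /F scale0r add0r.
have [h0|h0] := leP 0 h.
  have B s : s \in `[0, h] -> `|s| <= `|h|.
    by rewrite in_itv/= => /andP[s0 sh]; rewrite !ger0_norm.
  have [s sh E] : exists2 c, c \in `[0, h] & F h - F 0 = dF c * (h - 0).
    apply: MVT_segment => //.
      by move=> s /subset_itv_oo_cc/B; exact: HF.
    apply: derivable_within_continuous => s /B sh.
    by have ? := HF s sh; exact: ex_derive.
  by exists s; [exact: B|rewrite -F0 [LHS]E subr0].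
have B s : s \in `[h, 0] -> `|s| <= `|h|.
  by rewrite in_itv/= => /andP[s0 sh]; rewrite !ler0_norm ?lerN2// ltW.
have [s sh E] : exists2 c, c \in `[h, 0] & F 0 - F h = dF c * (0 - h).
  apply: MVT_segment => //; first exact: ltW.
    by move=> s /subset_itv_oo_cc/B; exact: HF.
  apply: derivable_within_continuous => s /B sh.
  by have ? := HF s sh; exact: ex_derive.
exists s; first exact: B.
by rewrite -F0 -[LHS]opprB E sub0r mulrN opprK.
Qed.

End mvt.

Lemma subBB_swap (R : zmodType) (a b c d : R) : a - b - (c - d) = a - c - (b - d).
Proof. by rewrite !opprB addrACA [RHS]addrACA [- b - c]addrC. Qed.

Lemma ord2 (i : 'I_2) : i = 0 \/ i = 1.
Proof. by case: i => -[|[|//]] ?; [left|right]; apply: val_inj. Qed.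

Section plane_calculus.
Context {R : realType}.
Local Notation P2 := (R * R)%type.
Local Notation e := (unit_vec R).
Implicit Types (f g : P2 -> R) (O : set P2).

Lemma norm_unit_vec i : `|e i| = 1.
Proof.
rewrite /unit_vec; case: ifP => _; rewrite prod_normE/= normr0 normr1.
  by rewrite maxEle ler10 ; apply/eqP.
by rewrite maxEle ler01.
Qed.

Lemma norm_scale_unit_vec (s : R) i : `|s *: e i| = `|s|.
Proof. by rewrite normrZ norm_unit_vec mulr1. Qed.

(** The second difference of f on the square of side h is both d_i d_j f and
    d_j d_i f at some points of that square, times h ^ 2. *)
Lemma partialC O f i j x : open O -> smooth_on O f -> O x ->
  partial i (partial j f) x = partial j (partial i f) x.
Proof.
move=> oO sf Ox.
have cA : {for x, continuous (partial i (partial j f))}.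
  by apply: (smooth_on_cont _ Ox); do 2 apply: smooth_on_partial.
have cB : {for x, continuous (partial j (partial i f))}.
  by apply: (smooth_on_cont _ Ox); do 2 apply: smooth_on_partial.
apply/eqP; rewrite -subr_eq0 -normr_le0; apply/ler_addgt0Pl => eps eps0.
rewrite addr0.
have e2 : 0 < eps / 2 by rewrite divr_gt0.
have /nbhs_ballP[d /= d0 H] : \forall y \near x, [/\ O y,
    `|partial i (partial j f) x - partial i (partial j f) y| < eps / 2 &
    `|partial j (partial i f) x - partial j (partial i f) y| < eps / 2].
  have nO : \forall y \near x, O y by exact: open_nbhs_nbhs.
  have /cvgrPdist_lt/(_ _ e2) nA := cA.
  have /cvgrPdist_lt/(_ _ e2) nB := cB.
  by near=> y; split; [exact: (near nO y)|exact: (near nA y)|exact: (near nB y)].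
pose h := d / 4.
have h0 : 0 < h by rewrite divr_gt0.
have near_x (s t : R) k l : `|s| <= `|h| -> `|t| <= `|h| -> ball x d (t *: e l + (s *: e k + x)).
  move=> sh th; rewrite -ball_normE /ball_ /=.
  rewrite (_ : x - _ = - (t *: e l + s *: e k)); last by rewrite addrA opprD addrCA subrr addr0.
  rewrite normrN (le_lt_trans (ler_normD _ _))// !norm_scale_unit_vec.
  apply: le_lt_trans (lerD th sh) _; rewrite gtr0_norm// /h; lra.
have hh : `|h| <= `|h| by [].
have z0 : `|0 : R| <= `|h| by rewrite normr0.
pose F k l := f (h *: e l + (h *: e k + x)) - f (h *: e k + x) - (f (h *: e l + x) - f x).
have FC : F i j = F j i.
  have Ef : f (h *: e j + (h *: e i + x)) = f (h *: e i + (h *: e j + x)).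
    by congr f; exact: addrCA.
  by move: Ef; rewrite /F => ->; exact: subBB_swap.
have key k l : exists s t, [/\ `|s| <= `|h|, `|t| <= `|h| &
   F k l =
   partial l (partial k f) (t *: e l + (s *: e k + x)) * h ^+ 2].
  pose g y := f (h *: e l + y) - f y.
  have [s sh Es] : exists2 s : R, `|s| <= `|h| & g (h *: e k + x) - g x =
     (partial k f (h *: e l + (s *: e k + x)) - partial k f (s *: e k + x)) * h.
    apply: (@mvt_line R _ g (fun y => partial k f (h *: e l + y) - partial k f y)) => s sh.
    apply: is_deriveB.
      have D : is_derive (h *: e l + (s *: e k + x)) (e k) f (partial k f (h *: e l + (s *: e k + x))).
        by apply: (smooth_onP sf); have [] := H _ (near_x _ _ k l sh hh).
      exact: is_derive_addl.
    apply: (smooth_onP sf); have [] := H _ (near_x s 0 k l sh z0) => //.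
    by rewrite scale0r add0r.
  have [t th Et] : exists2 t : R, `|t| <= `|h| &
      partial k f (h *: e l + (s *: e k + x)) - partial k f (s *: e k + x) =
      partial l (partial k f) (t *: e l + (s *: e k + x)) * h.
    apply: mvt_line => t th.
    apply: (smooth_onP (smooth_on_partial _ sf)).
    by have [] := H _ (near_x _ _ k l sh th).
  by exists s, t; split => //; rewrite -[LHS]/(g (h *: e k + x) - g x) Es Et -mulrA.
have [s [t [sh th E1]]] := key j i; have [s' [t' [sh' th' E2]]] := key i j.
have {E1 E2} E : partial i (partial j f) (t *: e i + (s *: e j + x)) =
  partial j (partial i f) (t' *: e j + (s' *: e i + x)).
  apply: (@mulIf _ (h ^+ 2)); first by rewrite expf_neq0// gt_eqF.
  exact: (etrans (esym E1) (etrans (esym FC) E2)).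
have [_ A1 _] := H _ (near_x _ _ j i sh th).
have [_ _ B1] := H _ (near_x _ _ i j sh' th').
set a := partial i _ x in A1 *; set b := partial j _ x in B1 *.
rewrite E in A1; set c := partial j _ _ in A1 B1.
rewrite (_ : a - b = (a - c) - (b - c)); last first.
  by move: a b c {A1 B1 E} => *; ring.
apply: le_trans (ler_normB _ _) _.
by have := ltrD A1 B1; rewrite -splitr; exact: ltW.
Unshelve. all: by end_near. Qed.

Lemma unit_vecE (v : P2) : v = v.1 *: e 0 + v.2 *: e 1.
Proof.
rewrite /unit_vec /=; case: v => a b; congr pair => /=.
  by rewrite [_ *: _]mulr1 [_ *: _]mulr0 addr0.
by rewrite [_ *: _]mulr0 [_ *: _]mulr1 add0r.
Qed.

(** Go from x to x + h v along the two axes and apply the mean value theorem to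
    each step; the partial derivatives are continuous. *)
Lemma is_derive_dir O f x (v : P2) : open O -> smooth_on O f -> O x ->
  is_derive x v f (v.1 * partial 0 f x + v.2 * partial 1 f x).
Proof.
move=> oO sf Ox.
set L := (X in is_derive _ _ _ X).
suff H : (fun h : R => h^-1 *: (f (h *: v + x) - f x)) @ 0^' --> L.
  by split; [apply/cvg_ex; exists L|apply: cvg_lim].
apply/cvgrPdist_le => eps eps0.
pose N := `|v.1| + `|v.2| + 1.
have N0 : 0 < N by rewrite ltr_wpDl ?addr_ge0.
have e2 : 0 < eps / N by rewrite divr_gt0.
have c i : {for x, continuous (partial i f)}.
  by apply: (smooth_on_cont _ Ox); apply: smooth_on_partial.
have /nbhs_ballP[d /= d0 H] : \forall y \near x, O y /\ forall i,
    `|partial i f x - partial i f y| <= eps / N.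
  have nO : \forall y \near x, O y by exact: open_nbhs_nbhs.
  have n0 : \forall y \near x, `|partial 0 f x - partial 0 f y| <= eps / N.
    by have /cvgrPdist_le/(_ _ e2) := c 0.
  have n1 : \forall y \near x, `|partial 1 f x - partial 1 f y| <= eps / N.
    by have /cvgrPdist_le/(_ _ e2) := c 1.
  near=> y; split; first exact: (near nO y).
  have A0 := near n0 y; have A1 := near n1 y.
  by move=> i; have [->|->] := ord2 i; [exact: A0 _|exact: A1 _].
near=> h.
have h0 : h != 0 by near: h; exact: nbhs_dnbhs_neq.
have hN : `|h| * N < d.
  by rewrite -ltr_pdivlMr//; near: h; apply: dnbhs0_lt; rewrite divr_gt0.
have near_x (s t : R) : `|s| <= `|h * v.1| -> `|t| <= `|h * v.2| ->
    ball x d (s *: e 0 + (t *: e 1 + x)).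
  move=> sh th; rewrite -ball_normE /ball_ /=.
  rewrite (_ : x - _ = - (s *: e 0 + t *: e 1)); last by rewrite addrA opprD addrCA subrr addr0.
  rewrite normrN (le_lt_trans (ler_normD _ _))// !norm_scale_unit_vec.
  apply: le_lt_trans (lerD sh th) (le_lt_trans _ hN).
  by rewrite !normrM -mulrDr ler_wpM2l// lerDl.
have [t th Et] : exists2 t : R, `|t| <= `|h * v.2| &
    f ((h * v.2) *: e 1 + x) - f x = partial 1 f (t *: e 1 + x) * (h * v.2).
  apply: mvt_line => t th; apply: (smooth_onP sf).
  have [] := H _ (near_x 0 t _ th); first by rewrite normr0.
  by rewrite scale0r add0r.
have [s sh Es] : exists2 s : R, `|s| <= `|h * v.1| &
    f ((h * v.1) *: e 0 + ((h * v.2) *: e 1 + x)) - f ((h * v.2) *: e 1 + x) =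
    partial 0 f (s *: e 0 + ((h * v.2) *: e 1 + x)) * (h * v.1).
  apply: mvt_line => s sh; apply: (smooth_onP sf).
  by have [] := H _ (near_x s _ sh (lexx _)).
have -> : h *: v + x = (h * v.1) *: e 0 + ((h * v.2) *: e 1 + x).
  by rewrite addrA -!scalerA -scalerDr -unit_vecE.
set A := f (_ + (_ + _)) in Es *; set B := f (_ + x) in Es Et.
have -> : A - f x = (A - B) + (B - f x) by ring.
rewrite Es Et.
have [_ /(_ 0) H0] := H _ (near_x s _ sh (lexx _)).
have [_ /(_ 1) H1] : O (t *: e 1 + x) /\ forall i, `|partial i f x - partial i f (t *: e 1 + x)| <= eps / N.
  apply: H; have := near_x 0 t _ th; rewrite scale0r add0r; apply.
  by rewrite normr0.
set a := partial 0 f (s *: _ + _) in H0 *; set b := partial 1 f (t *: _ + _) in H1 *.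
rewrite [h^-1 *: _](_ : _ = a * v.1 + b * v.2); last by rewrite /GRing.scale /=; field.
rewrite (_ : L - _ = v.1 * (partial 0 f x - a) + v.2 * (partial 1 f x - b)); last first.
  by rewrite /L; ring.
apply: le_trans (ler_normD _ _) _; rewrite !normrM.
apply: (@le_trans _ _ (`|v.1| * (eps / N) + `|v.2| * (eps / N))).
  by apply: lerD; rewrite ler_wpM2l.
rewrite -mulrDl mulrCA ger_pMr// ler_pdivrMr// mul1r.
by rewrite /N lerDl.
Unshelve. all: by end_near. Qed.

End plane_calculus.

(** * Lebesgue measure of the plane *)

Section leb2_sigma_finite.
Context {R : realType}.

HB.instance Definition _ := Measure.on (@leb2 R).

Lemma leb2_sigma_finite : sigma_finite setT (@leb2 R).
Proof.
have /sigma_finiteP[F [TF ndF Foo]] := sigma_finiteT (@lebesgue_measure R).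
exists (fun n => F n `*` F n).
  rewrite -setXTT TF predeqE => -[x y]; split.
    move=> [/= [n _ Fnx] [k _ Gky]]; exists (maxn n k) => //; split.
    - by move: x Fnx; exact/subsetPset/ndF/leq_maxl.
    - by move: y Gky; exact/subsetPset/ndF/leq_maxr.
  by move=> [n _ []/= ? ?]; split; exists n.
move=> k; have [? ?] := Foo k.
split; first exact: measurableX.
by rewrite [leb2 _]product_measure1E// lte_mul_pinfty// ge0_fin_numE.
Qed.

HB.instance Definition _ :=
  Measure_isSigmaFinite.Build _ _ _ (@leb2 R) leb2_sigma_finite.

End leb2_sigma_finite.

Section plane_measure.
Context {R : realType}.
Local Notation P2 := (R * R)%type.
Local Notation mu := (@leb2 R).
Local Notation leb := (@lebesgue_measure R).
Implicit Types (f g : P2 -> R) (O A : set P2).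

Definition box (a b c d : R) : set P2 := `]a, b[ `*` `]c, d[.

Lemma boxP a b c d (x : P2) : box a b c d x <-> (a < x.1 < b) /\ (c < x.2 < d).
Proof. by rewrite /box /= !in_itv/=. Qed.

Lemma ball_boxE (x : P2) r : ball x r = box (x.1 - r) (x.1 + r) (x.2 - r) (x.2 + r).
Proof.
apply/seteqP; split => y.
  move=> [/= y1 y2]; apply/boxP; move: y1 y2.
  by rewrite -!ball_normE /= !ltr_norml; lra.
move=> /boxP H; split; rewrite -ball_normE /= ltr_norml; lra.
Qed.

Lemma measurable_box a b c d : measurable (box a b c d).
Proof. by apply: measurableX; exact: measurable_itv. Qed.

Lemma leb2_box a b c d : a <= b -> c <= d ->
  mu (box a b c d) = ((b - a) * (d - c))%:E.
Proof.
have E x y : x <= y -> leb (`]x, y[)%classic = (y - x)%:E.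
  move=> xy; rewrite lebesgue_measure_itv/= lte_fin.
  by move: xy; rewrite le_eqVlt => /predU1P[->|->]; rewrite ?ltxx ?subrr// EFinB.
move=> ab cd; rewrite EFinM -!E//; apply: product_measure1E; exact: measurable_itv.
Qed.

Lemma box_lty a b c d : (mu (box a b c d) < +oo)%E.
Proof.
have [ab|ba] := leP a b; have [cd|dc] := leP c d; last first.
- by rewrite /box set_itv_ge ?bnd_simp -?leNgt ?ltW// set0X measure0 ltry.
- by rewrite /box set_itv_ge ?bnd_simp -?leNgt ?ltW// set0X measure0 ltry.
- by rewrite /box [X in _ `*` X]set_itv_ge ?bnd_simp -?leNgt ?ltW// setX0 measure0 ltry.
- by rewrite leb2_box// ltry.
Qed.

(** An open set is the union of the rational boxes that it contains. *)
Lemma open_measurable2 O : open O -> measurable O.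
Proof.
move=> oO.
pose F (q : (rat * rat) * (rat * rat)) : set P2 :=
  if `[< box (ratr q.1.1) (ratr q.1.2) (ratr q.2.1) (ratr q.2.2) `<=` O >]
  then box (ratr q.1.1) (ratr q.1.2) (ratr q.2.1) (ratr q.2.2) else set0.
have -> : O = \bigcup_q F q.
  apply/seteqP; split => x; last first.
    by move=> [q _]; rewrite /F; case: asboolP => // H /H.
  move=> Ox; have /nbhs_ballP[r /= r0 rO] : nbhs x O by exact: open_nbhs_nbhs.
  have l z : z - r < z by rewrite ltrBlDr ltrDl.
  have u z : z < z + r by rewrite ltrDl.
  have [a] := rat_in_itvoo (l x.1); have [b] := rat_in_itvoo (u x.1).
  have [c] := rat_in_itvoo (l x.2); have [d] := rat_in_itvoo (u x.2).
  rewrite !in_itv /= => /andP[? ?] /andP[? ?] /andP[? ?] /andP[? ?].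
  exists ((a, b), (c, d)) => //; rewrite /F /=; case: asboolP => [_|].
    by apply/boxP; split; apply/andP.
  case=> y /boxP[/andP[? ?] /andP[? ?]]; apply: rO; rewrite ball_boxE.
  by apply/boxP; split; apply/andP; split; lra.
apply: countable_bigcupT_measurable; first exact: countableP.
by move=> q; rewrite /F; case: asboolP => // _; exact: measurable_box.
Qed.

Lemma cont_measurable O f : open O -> (forall x, O x -> {for x, continuous f}) ->
  measurable_fun O f.
Proof.
move=> oO cf; apply: (measurability _ (RGenOpens.measurableE R)).
move=> _ [_ [a [b ->] <-]]; apply: open_measurable2.
rewrite openE => x [Ox fx]; apply: filterI; first exact: open_nbhs_nbhs.
by apply: (cf x Ox); apply: open_nbhs_nbhs; split => //; exact: interval_open.
Qed.

Lemma smooth_on_measurable O f : open O -> smooth_on O f -> measurable_fun O f.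
Proof. by move=> oO sf; apply: cont_measurable => // x; exact: smooth_on_cont sf x. Qed.

Lemma norm_box (x : P2) (N : R) : (`|x| < N) <-> box (- N) N (- N) N x.
Proof.
rewrite boxP prod_normE gt_max !ltr_norml.
by split => [/andP[-> ->]|[-> ->]].
Qed.

Lemma bounded_sub_box A : bounded_set A ->
  exists2 N : R, 0 < N & A `<=` box (- N) N (- N) N.
Proof.
move=> [M [_ HM]]; exists (`|M| + 2) => [|x Ax]; first by rewrite ltr_wpDl.
apply/norm_box; apply: le_lt_trans (HM (`|M| + 1) _ x Ax) _.
  by rewrite (le_lt_trans (ler_norm _)) ?ltrDl.
by rewrite ltrD2l ltr1n.
Qed.

Lemma bounded_leb2_lty A : measurable A -> bounded_set A -> (mu A < +oo)%E.
Proof.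
move=> mA /bounded_sub_box[N N0 AN].
apply: (@le_lt_trans _ _ (mu (box (- N) N (- N) N))).
  by apply: le_measure; rewrite ?inE//; exact: measurable_box.
exact: box_lty.
Qed.

Lemma compact_box a b c d : compact (`[a, b] `*` `[c, d] : set P2).
Proof. by apply: compact_setX; exact: segment_compact. Qed.

Definition bsupp f := exists2 N : R, 0 < N & forall x, N <= `|x| -> f x = 0.

Lemma bsupp_integrable f : continuous f -> bsupp f -> mu.-integrable setT (EFin \o f).
Proof.
move=> cf [N N0 f0].
have mf : measurable_fun setT f by apply: cont_measurable => [|x _]; [exact: openT|exact: cf].
pose B := box (- N) N (- N) N.
have mB : measurable B by exact: measurable_box.
have -> : EFin \o f = (EFin \o f) \_ B.
  apply/funext => x; rewrite patchE; case: ifPn => //.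
  rewrite notin_setE => Bx /=; rewrite f0//; rewrite leNgt; apply/negP.
  by move/norm_box.
apply: (integrable_mkcond (mu := mu) (EFin \o f) mB).1.
apply: (@measurable_bounded_integrable _ _ _ mu f B mB) => //.
- exact: box_lty.
- exact: measurable_funS mf.
have cK : compact (f @` (`[- N, N] `*` `[- N, N])).
  by apply: continuous_compact; [exact: continuous_subspaceT|exact: compact_box].
have [M [Mr HM]] := compact_bounded cK; exists M; split => // M' /HM H x Bx.
apply: H; exists x => //; move/boxP : Bx => [/andP[? ?] /andP[? ?]].
by split; rewrite /= in_itv/= !ltW.
Qed.

Lemma bsuppW f g : bsupp f -> (forall x, f x = 0 -> g x = 0) -> bsupp g.
Proof. by move=> [N N0 H] fg; exists N => // x /H/fg. Qed.

Lemma partial_near0 f (x : P2) i : (\forall y \near x, f y = 0) -> partial i f x = 0.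
Proof.
move=> H; rewrite (@partial_near _ _ (cst 0))//.
exact: derive_cst.
Qed.

Lemma bsupp_partial f i : bsupp f -> bsupp (partial i f).
Proof.
move=> [N N0 H]; exists (N + 1) => [|x Nx]; first by rewrite addr_gt0.
apply: partial_near0; apply/nbhs_ballP; exists 1 => //= y.
rewrite -ball_normE /= => xy; apply: H.
have := ler_normD (x - y) y; rewrite subrK; lra.
Qed.

Lemma test_bsupp O f : test_function O f -> bsupp f.
Proof.
move=> [_ /compact_bounded[M [Mr HM]] _]; exists (`|M| + 2) => [|x Nx]; first by rewrite ltr_wpDl.
apply/eqP; apply: contraPT Nx => fx; apply/negP; rewrite -ltNge.
have : `|x| <= `|M| + 1.
  apply: HM; first by rewrite (le_lt_trans (ler_norm _))// ltrDl.
  exact: subset_closure.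
by move/le_lt_trans; apply; rewrite ltrD2l ltr1n.
Qed.

Lemma derive_fst f (a b : R) : derivable f (a, b) (1, 0) ->
  is_derive a (1 : R) (fun s => f (s, b)) (partial 0 f (a, b)).
Proof.
move=> /derivableP.
have E : (a, b) = a *: (1, 0) + (0, b) :> P2.
  by apply: injective_projections => /=; rewrite ?[_ *: _]mulr1 ?[_ *: _]mulr0 ?addr0 ?add0r.
rewrite {1}E => /is_derive_line.
rewrite (_ : (fun _ => _) = (fun s => f (s, b)))//; apply/funext => s; congr f.
by apply: injective_projections => /=; rewrite ?[_ *: _]mulr1 ?[_ *: _]mulr0 ?addr0 ?add0r.
Qed.

Lemma derive_snd f (a b : R) : derivable f (a, b) (0, 1) ->
  is_derive b (1 : R) (fun s => f (a, s)) (partial 1 f (a, b)).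
Proof.
move=> /derivableP.
have E : (a, b) = b *: (0, 1) + (a, 0) :> P2.
  by apply: injective_projections => /=; rewrite ?[_ *: _]mulr1 ?[_ *: _]mulr0 ?addr0 ?add0r.
rewrite {1}E => /is_derive_line.
rewrite (_ : (fun _ => _) = (fun s => f (a, s)))//; apply/funext => s; congr f.
by apply: injective_projections => /=; rewrite ?[_ *: _]mulr1 ?[_ *: _]mulr0 ?addr0 ?add0r.
Qed.

(** The fundamental theorem of calculus on a segment containing the support. *)
Lemma int_derive0 (h dh : R -> R) (N : R) : 0 < N -> continuous dh ->
  (forall s : R, is_derive s (1 : R) h (dh s)) ->
  (forall s, N <= `|s| -> h s = 0) -> (forall s, N <= `|s| -> dh s = 0) ->
  (\int[leb]_s (dh s)%:E = 0)%E.
Proof.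
move=> N0 cdh Dh h0 dh0.
have NN : - N < N by lra.
have ch : continuous h.
  by move=> s; apply: differentiable_continuous; apply/derivable1_diffP; have [] := Dh s.
transitivity (\int[leb]_(s in `[(- N)%R, N]) (dh s)%:E)%E.
  rewrite [RHS]integral_mkcond; apply: eq_integral => s _.
  rewrite patchE; case: ifPn => //; rewrite notin_setE /= in_itv/= => sN.
  rewrite dh0//; apply: contra_notT sN; rewrite -ltNge ltr_norml => /andP[? ?].
  by rewrite !ltW.
rewrite (@continuous_FTC2 _ dh h)//.
- by rewrite !h0 ?subee// ?normrN gtr0_norm.
- exact: continuous_subspaceT.
- split.
  + by move=> s _; have [] := Dh s.
  + by apply: cvg_at_right_filter; exact: ch.
  + by apply: cvg_at_left_filter; exact: ch.
- by move=> s _; rewrite derive1E; have [_ ->] := Dh s.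
Qed.

Lemma continuous_pairl (b : R) : continuous (fun s : R => (s, b) : P2).
Proof.
move=> s; have H : (t, b) @[t --> s] --> (nbhs s, nbhs b).
  by apply: cvg_pair; [exact: cvg_id|exact: cvg_cst].
exact: H.
Qed.

Lemma continuous_pairr (a : R) : continuous (fun s : R => (a, s) : P2).
Proof.
move=> s; have H : (a, t) @[t --> s] --> (nbhs a, nbhs s).
  by apply: cvg_pair; [exact: cvg_cst|exact: cvg_id].
exact: H.
Qed.

(** By Fubini, integrate first along the direction of the derivative. *)
Lemma int_partial0 f i : smooth f -> bsupp f -> \int[mu]_x partial i f x = 0.
Proof.
move=> /smooth_onT sf bf; rewrite /Rintegral.
have cp : continuous (partial i f).
  by move=> x; exact: (smooth_on_cont (smooth_on_partial i sf)).
have ip := bsupp_integrable cp (bsupp_partial i bf).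
have [N1 N10 H1] := bf; have [N2 N20 H2] := bsupp_partial i bf.
pose N := Num.max N1 N2.
have N0 : 0 < N by rewrite lt_max N10.
have f0 x : N <= `|x| -> f x = 0 by rewrite ge_max => /andP[/H1].
have p0 x : N <= `|x| -> partial i f x = 0 by rewrite ge_max => /andP[_ /H2].
have n1 (a b : R) : `|a| <= `|(a, b) : P2| by rewrite prod_normE le_max lexx.
have n2 (a b : R) : `|b| <= `|(a, b) : P2| by rewrite prod_normE le_max lexx orbT.
have [i0|i1] := ord2 i.
- have -> : (\int[mu]_x (partial i f x)%:E = 0)%E; last by [].
  rewrite -(@integral21_prod_meas1 _ _ _ _ _ leb leb (EFin \o partial i f) ip).
  apply: integral0_eq => b _; apply: (@int_derive0 (fun s => f (s, b)) (fun s => partial i f (s, b)) N) => //.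
  + by move=> s; apply: (@continuous_comp _ _ _ (fun s : R => (s, b) : P2) (partial i f) s); [exact: continuous_pairl|exact: cp].
  + move=> s; rewrite i0; apply: derive_fst.
    by have [_ /(_ 0)] := sf [::] (s, b) I.
  + by move=> s Ns; apply: f0; exact: le_trans Ns (n1 _ _).
  + by move=> s Ns; apply: p0; exact: le_trans Ns (n1 _ _).
- have -> : (\int[mu]_x (partial i f x)%:E = 0)%E; last by [].
  rewrite -(@integral12_prod_meas1 _ _ _ _ _ leb leb (EFin \o partial i f) ip).
  apply: integral0_eq => a _; apply: (@int_derive0 (fun s => f (a, s)) (fun s => partial i f (a, s)) N) => //.
  + by move=> s; apply: (@continuous_comp _ _ _ (fun s : R => (a, s) : P2) (partial i f) s); [exact: continuous_pairr|exact: cp].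
  + move=> s; rewrite i1; apply: derive_snd.
    by have [_ /(_ 1)] := sf [::] (a, s) I.
  + by move=> s Ns; apply: f0; exact: le_trans Ns (n2 _ _).
  + by move=> s Ns; apply: p0; exact: le_trans Ns (n2 _ _).
Qed.

End plane_measure.

(** * The fundamental lemma of the calculus of variations *)

Section integral_tools.
Context d (T : measurableType d) (R : realType) (mu : {measure set T -> \bar R}).

Lemma Rdominated_cvg (D : set T) (f_ : nat -> T -> R) (f g : T -> R) :
  measurable D -> (forall n, measurable_fun D (f_ n)) ->
  (forall x, D x -> f_ n x @[n --> \oo] --> f x) ->
  mu.-integrable D (EFin \o g) ->
  (forall n x, D x -> `|f_ n x| <= g x) ->
  \int[mu]_(x in D) f_ n x @[n --> \oo] --> \int[mu]_(x in D) f x.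
Proof.
move=> mD mf_ f_f ig fg.
have mf : measurable_fun D f by apply: measurable_fun_cvg f_f.
have [//|||||iF _ H] := @dominated_convergence _ _ _ mu _ mD (fun n x => (f_ n x)%:E) (EFin \o f) (EFin \o g).
- by move=> n; apply/measurable_EFinP.
- exact/measurable_EFinP.
- by apply: aeW => x Dx; apply: cvg_EFin; [exact: nearW|exact: f_f].
- exact: ig.
- by apply: aeW => x n Dx; rewrite lee_fin; exact: fg.
apply: fine_cvg; rewrite fineK; first exact: H.
exact: integrable_fin_num iF.
Qed.

(** Dynkin's pi-lambda theorem for the image under phi of the signed measure of
    density W. *)
Lemma integral0_dynkin d' (T' : measurableType d') (G : set (set T'))
    (phi : T -> T') (W : T -> \bar R) :
  @measurable _ T' = <<s G >> -> setI_closed G -> measurable_fun setT phi ->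
  mu.-integrable setT W -> (\int[mu]_x W x = 0)%E ->
  (forall A, G A -> \int[mu]_(x in phi @^-1` A) W x = 0)%E ->
  forall A, measurable A -> (\int[mu]_(x in phi @^-1` A) W x = 0)%E.
Proof.
move=> mG GI mphi iW W0 WG A mA; have := mA; rewrite mG.
have mp B : measurable B -> measurable (phi @^-1` B).
  by move=> mB; rewrite -[_ @^-1` _]setTI; exact: mphi.
have iWs B : measurable B -> mu.-integrable (phi @^-1` B) W.
  by move=> mB; apply: integrableS iW => //; exact: mp.
apply: (@dynkin_induction _ _ G (fun A => \int[mu]_(x in phi @^-1` A) W x = 0)%E) => //.
- move=> B mB IB.
  have : (\int[mu]_(x in phi @^-1` B `|` phi @^-1` (~` B)) W x = 0)%E.
    by rewrite -preimage_setU setUCr preimage_setT.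
  rewrite integral_setU ?IB ?add0e//; first exact: mp.
  + by apply: mp; exact: measurableC.
  + by rewrite -preimage_setU setUCr preimage_setT; exact: (measurable_int mu).
  + by apply/disj_setPS => x [].
- move=> F mF tF F0; rewrite preimage_bigcup integral_bigcup//.
  + by apply: eseries0 => n _ _; exact: F0.
  + apply/trivIsetP => i j _ _ ij; rewrite -preimage_setI.
    by move/trivIsetP : tF => /(_ i j I I ij) ->; rewrite preimage_set0.
  + by move=> k; exact: mp.
  + by rewrite -preimage_bigcup; apply: iWs; exact: bigcup_measurable.
Qed.

End integral_tools.

Section fundamental_lemma.
Context {R : realType}.
Local Notation P2 := (R * R)%type.
Local Notation mu := (@leb2 R).
Local Notation leb := (@lebesgue_measure R).
Implicit Types (f g : P2 -> R) (O A : set P2).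

Definition cbox (a b c d : R) : set P2 := `[a, b] `*` `[c, d].

Lemma cboxP a b c d (x : P2) : cbox a b c d x <-> (a <= x.1 <= b) /\ (c <= x.2 <= d).
Proof. by rewrite /cbox /= !in_itv/=. Qed.

Lemma box_cbox a b c d : box a b c d `<=` cbox a b c d.
Proof. by move=> x /boxP[/andP[? ?] /andP[? ?]]; apply/cboxP; rewrite !ltW. Qed.

Lemma closed_cbox a b c d : closed (cbox a b c d).
Proof.
apply: compact_closed; first exact: norm_hausdorff.
exact: compact_box.
Qed.

(** As k grows these increase to the indicator of the open box. *)
Definition bump (a b c d : R) (k : R) (x : P2) : R :=
  1 - expR (- (k * (flat (x.1 - a) * flat (b - x.1) * (flat (x.2 - c) * flat (d - x.2))))).

Lemma bump_ge0 a b c d k x : 0 <= k -> 0 <= bump a b c d k x <= 1.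
Proof.
move=> k0; rewrite /bump subr_ge0 -{1}expR0 ler_expR oppr_le0.
by rewrite mulr_ge0 ?mulr_ge0 ?flat_ge0//= gerBl expR_ge0.
Qed.

Lemma bump_out a b c d k x : ~ box a b c d x -> bump a b c d k x = 0.
Proof.
move=> nx; rewrite /bump; apply/eqP; rewrite subr_eq0 eq_sym -expR0; apply/eqP.
congr expR; apply/eqP; rewrite oppr_eq0 !mulf_eq0; apply: contra_notT nx.
rewrite !negb_or => /andP[_ /andP[/andP[h1 h2] /andP[h3 h4]]].
have H (y : R) : flat y != 0 -> 0 < y by move=> ?; rewrite -flat_gt0 lt_def flat_ge0 andbT.
by apply/boxP; move: (H _ h1) (H _ h2) (H _ h3) (H _ h4); lra.
Qed.

Lemma smooth_bump a b c d k : smooth_on setT (bump a b c d k).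
Proof.
have oT : open [set: P2] by exact: openT.
have s1 : smooth_on setT (fun x : P2 => x.1) by exact: smooth_on_fst.
have s2 : smooth_on setT (fun x : P2 => x.2) by exact: smooth_on_snd.
have cst (r : R) : smooth_on setT (fun=> r : R) by exact: smooth_on_cst.
have F g : smooth_on setT g -> smooth_on setT (fun x => flat (g x)).
  by move=> sg; apply: smooth_on_comp => //; exact: smooth1_flat.
have sb g (r : R) : smooth_on setT g -> smooth_on setT (fun x => flat (g x - r)).
  by move=> sg; exact: (F _ (smooth_on_sub oT sg (cst r))).
have sb' g (r : R) : smooth_on setT g -> smooth_on setT (fun x => flat (r - g x)).
  by move=> sg; exact: (F _ (smooth_on_sub oT (cst r) sg)).
have H := smooth_on_mul oT (cst k) (smooth_on_mul oT
  (smooth_on_mul oT (sb _ a s1) (sb' _ b s1)) (smooth_on_mul oT (sb _ c s2) (sb' _ d s2))).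
exact: (smooth_on_sub oT (cst 1) (smooth_on_comp oT smooth1_expR (smooth_on_opp oT H))).
Qed.

Lemma bump_cvg a b c d x : bump a b c d n%:R x @[n --> \oo] --> (\1_(box a b c d) x : R).
Proof.
have [bx|bx] := pselect (box a b c d x); last first.
  rewrite indicE memNset// (_ : (fun n => _) = cst 0); first exact: cvg_cst.
  by apply/funext => n; rewrite bump_out.
rewrite indicE mem_set//= -[X in _ --> X]subr0; apply: cvgB; first exact: cvg_cst.
set z := flat _ * _ * _.
have z0 : 0 < z.
  by move/boxP : bx => [/andP[? ?] /andP[? ?]]; rewrite !mulr_gt0 ?flat_gt0 ?subr_gt0.
apply: (@cvg_comp _ _ _ (fun n : nat => n%:R * z) (fun y : R => expR (- y)) _ +oo _ _ (@cvgr_expR R)).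
apply/cvgryPge => A; near=> n; rewrite -ler_pdivrMr//.
by near: n; exact: nbhs_infty_ger.
Unshelve. all: by end_near. Qed.

(** The support is a closed subset of the closed box, which is compact. *)
Lemma test_box O a b c d f : smooth_on setT f -> cbox a b c d `<=` O ->
  (forall x, ~ box a b c d x -> f x = 0) -> test_function O f.
Proof.
move=> sf bO f0.
have sub : closure [set x | f x != 0] `<=` cbox a b c d.
  rewrite closureE => x; apply; split; first exact: closed_cbox.
  move=> y /= fy; apply: box_cbox; apply: contrapT => /f0 E.
  by rewrite E eqxx in fy.
split; first exact/smooth_onT.
  by apply: subclosed_compact sub; [exact: closed_closure|exact: compact_box].
exact: subset_trans sub bO.
Qed.

Lemma open_cbox_cover O : open O -> exists F : nat -> R * R * (R * R),
  (forall n, cbox (F n).1.1 (F n).1.2 (F n).2.1 (F n).2.2 `<=` O) /\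
  O = \bigcup_n box (F n).1.1 (F n).1.2 (F n).2.1 (F n).2.2.
Proof.
move=> oO.
pose r4 (q : (rat * rat) * (rat * rat)) : R * R * (R * R) :=
  ((ratr q.1.1, ratr q.1.2), (ratr q.2.1, ratr q.2.2)).
pose bad : R * R * (R * R) := ((1, 0), (1, 0)).
pose F n := if @unpickle ((rat * rat) * (rat * rat))%type n is Some q then
    if `[< cbox (r4 q).1.1 (r4 q).1.2 (r4 q).2.1 (r4 q).2.2 `<=` O >] then r4 q else bad
  else bad.
have bE x : ~ cbox bad.1.1 bad.1.2 bad.2.1 bad.2.2 x.
  by move=> /cboxP[]; rewrite /bad /=; lra.
exists F; split.
  move=> n; rewrite /F; case: unpickle => [q|]; last by move=> x /bE.
  by case: asboolP => // _ x /bE.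
apply/seteqP; split => x; last first.
  move=> [n _]; rewrite /F; case: unpickle => [q|]; last by move=> /box_cbox /bE.
  by case: asboolP => [H /box_cbox/H//|_ /box_cbox /bE].
move=> Ox; have /nbhs_ballP[r /= r0 rO] : nbhs x O by exact: open_nbhs_nbhs.
have l z : z - r < z by rewrite ltrBlDr ltrDl.
have u z : z < z + r by rewrite ltrDl.
have [a] := rat_in_itvoo (l x.1); have [b] := rat_in_itvoo (u x.1).
have [c] := rat_in_itvoo (l x.2); have [d] := rat_in_itvoo (u x.2).
rewrite !in_itv /= => /andP[? ?] /andP[? ?] /andP[? ?] /andP[? ?].
exists (pickle ((a, b), (c, d))) => //; rewrite /F pickleK; case: asboolP => [_|].
  by apply/boxP; rewrite /r4 /=; split; apply/andP.
case=> y /cboxP[/=/andP[? ?] /andP[? ?]]; apply: rO; rewrite ball_boxE.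
by apply/boxP; split; apply/andP; split; lra.
Qed.

Lemma integral_restrict0 (W : P2 -> \bar R) (B E : set P2) :
  (\int[mu]_(x in E `&` B) W x = \int[mu]_(x in E) (W \_ B) x)%E.
Proof. by rewrite integral_mkcondr. Qed.

(** Dominated convergence along the bumps of the box, which are test functions. *)
Lemma fund_lemma_box O w a b c d : cbox a b c d `<=` O -> open O ->
  mu.-integrable (box a b c d) (EFin \o w) ->
  (forall f, test_function O f -> \int[mu]_(x in O) (w x * f x) = 0) ->
  (\int[mu]_(x in box a b c d) (w x)%:E = 0)%E.
Proof.
move=> bO oO iw w0.
have mB := measurable_box a b c d.
have mw : measurable_fun (box a b c d) w by apply/measurable_EFinP; exact: (measurable_int mu).
have E n : \int[mu]_(x in box a b c d) (w x * bump a b c d n%:R x) = 0.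
  rewrite -[RHS](w0 (bump a b c d n%:R)); last first.
    by apply: test_box (smooth_bump _ _ _ _ _) bO _ => x; exact: bump_out.
  rewrite Rintegral_mkcond [RHS]Rintegral_mkcond; apply: eq_Rintegral => x _.
  rewrite !patchE; have [bx|bx] := pselect (box a b c d x).
    by rewrite !mem_set//; exact/bO/box_cbox.
  by rewrite memNset// bump_out// mulr0; case: ifP.
have H : \int[mu]_(x in box a b c d) (w x * bump a b c d n%:R x) @[n --> \oo] -->
    \int[mu]_(x in box a b c d) (w x * \1_(box a b c d) x).
  apply: (@Rdominated_cvg _ _ _ mu _ _ _ (fun x => `|w x|)) => //.
  - move=> n; apply: measurable_funM => //; apply: (@measurable_funS _ _ _ _ setT) => //.
    by apply: smooth_on_measurable; [exact: openT|exact: smooth_bump].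
  - by move=> x _; apply: cvgMr; exact: bump_cvg.
  - by apply: (integrable_abse iw).
  - move=> n x _; rewrite normrM ler_piMr//.
    by have /andP[h1 h2] := bump_ge0 a b c d x (ler0n R n); rewrite ger0_norm.
have {}H : \int[mu]_(x in box a b c d) (w x * \1_(box a b c d) x) = 0.
  apply/esym; apply: cvg_unique H => //.
  rewrite (_ : (fun n : nat => _) = cst 0); first exact: cvg_cst.
  by apply/funext => n; exact: E.
have : \int[mu]_(x in box a b c d) w x = 0.
  rewrite -[RHS]H; apply: eq_Rintegral => x bx.
  by rewrite indicE bx mulr1.
rewrite /Rintegral => /eqP; rewrite fine_eq0; first by move/eqP.
exact: integrable_fin_num iw.
Qed.

Lemma boxI (a b c d a' b' c' d' : R) : box a b c d `&` box a' b' c' d' =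
  box (Num.max a a') (Num.min b b') (Num.max c c') (Num.min d d').
Proof.
apply/seteqP; split => x.
  move=> [/boxP[/andP[? ?] /andP[? ?]] /boxP[/andP[? ?] /andP[? ?]]].
  by apply/boxP; rewrite !gt_max !lt_min; split; apply/andP; split; apply/andP.
move=> /boxP; rewrite !gt_max !lt_min => -[/andP[/andP[? ?] /andP[? ?]] /andP[/andP[? ?] /andP[? ?]]].
by split; apply/boxP; split; apply/andP.
Qed.

Lemma itvoo_setI_closed : setI_closed (@RGenOpens.G R).
Proof.
move=> _ _ [a [b ->]] [c [d ->]]; exists (Num.max a c), (Num.min b d).
apply/seteqP; split => x /=; rewrite !in_itv/= gt_max lt_min.
  by move=> [/andP[-> ->] /andP[-> ->]].
by move=> /andP[/andP[-> ->] /andP[-> ->]].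
Qed.

(** The fundamental lemma of the calculus of variations: the signed measure
    w dx vanishes on the open boxes, hence on all Borel sets, of a box whose
    closure lies in O. *)
Lemma fund_lemma O w : open O -> measurable_fun O w ->
  (forall a b c d, cbox a b c d `<=` O -> mu.-integrable (box a b c d) (EFin \o w)) ->
  (forall f, test_function O f -> \int[mu]_(x in O) (w x * f x) = 0) ->
  ae_eq mu O w (cst 0).
Proof.
move=> oO mw iw w0.
have loc a b c d : cbox a b c d `<=` O -> ae_eq mu (box a b c d) w (cst 0).
  move=> bO; set Q := box a b c d.
  have mQ : measurable Q by exact: measurable_box.
  have iQ := iw _ _ _ _ bO.
  pose W : P2 -> \bar R := (EFin \o w) \_ Q.
  have iW : mu.-integrable setT W by apply: (integrable_mkcond (mu := mu) (EFin \o w) mQ).1.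
  have WI E : (\int[mu]_(x in E) W x = \int[mu]_(x in E `&` Q) (w x)%:E)%E.
    by rewrite [RHS]integral_mkcondr.
  have mst : measurable_fun setT (@fst R R) by exact: measurable_fst.
  have msn : measurable_fun setT (@snd R R) by exact: measurable_snd.
  have W_oo a' b' c' d' : (\int[mu]_(x in box a' b' c' d') W x = 0)%E.
    rewrite WI /Q boxI; apply: (@fund_lemma_box O) => //.
      move=> x; rewrite /cbox /= !in_itv/= !ge_max !le_min => -[/andP[/andP[_ ?] /andP[_ ?]] /andP[/andP[_ ?] /andP[_ ?]]].
      by apply: bO; apply/cboxP; split; apply/andP.
    by rewrite -boxI; apply: integrableS iQ => //; apply: measurableI => //; exact: measurable_box.
  have W_T : (\int[mu]_x W x = 0)%E by rewrite WI setTI; exact: fund_lemma_box w0.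
  have step1 (A : set R) (c' d' : R) : measurable A ->
      (\int[mu]_(x in A `*` [set` `]c', d'[%R]) W x = 0)%E.
    move=> mA.
    have mS : measurable (@snd R R @^-1` `]c', d'[) by rewrite -[_ @^-1` _]setTI; apply: msn.
    have -> : A `*` `]c', d'[%classic = (@fst R R @^-1` A) `&` (@snd R R @^-1` `]c', d'[) by [].
    rewrite integral_restrict0.
    apply: (@integral0_dynkin _ _ _ mu _ _ (@RGenOpens.G R) fst) => //.
    - exact: RGenOpens.measurableE.
    - exact: itvoo_setI_closed.
    - by apply/integrable_restrict => //; apply: integrableS iW => //; exact: measurableI.
    - rewrite -integral_restrict0 setTI -(setTI (snd @^-1` _)) WI setTI.
      have -> : snd @^-1` `]c', d'[ `&` Q = box a b c' d' `&` Q.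
        apply/seteqP; split => x; last by move=> [[]].
        by move=> [x2 Qx]; split => //; split => //; case: Qx.
      by rewrite -WI.
    - move=> _ [a' [b' ->]]; rewrite -integral_restrict0; exact: W_oo.
  have step2 (A B : set R) : measurable A -> measurable B -> (\int[mu]_(x in A `*` B) W x = 0)%E.
    move=> mA mB.
    have mS : measurable (@fst R R @^-1` A) by rewrite -[_ @^-1` _]setTI; apply: mst.
    have -> : A `*` B = (@snd R R @^-1` B) `&` (@fst R R @^-1` A) by rewrite setIC.
    rewrite integral_restrict0.
    apply: (@integral0_dynkin _ _ _ mu _ _ (@RGenOpens.G R) snd) => //.
    - exact: RGenOpens.measurableE.
    - exact: itvoo_setI_closed.
    - by apply/integrable_restrict => //; apply: integrableS iW => //; exact: measurableI.
    - rewrite -integral_restrict0 setTI WI.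
      have -> : fst @^-1` A `&` Q = (A `*` `]c, d[) `&` Q.
        apply/seteqP; split => x; last by move=> [[]].
        by move=> [x1 Qx]; split => //; split => //; case: Qx.
      by rewrite -WI; exact: step1.
    - by move=> _ [c' [d' ->]]; rewrite -integral_restrict0 setIC; exact: step1.
  have step3 E : measurable E -> (\int[mu]_(x in E) W x = 0)%E.
    apply: (@integral0_dynkin _ _ _ mu _ _ [set A `*` B | A in measurable & B in measurable] id) => //.
    - exact: measurable_prod_measurableType.
    - move=> _ _ [A1 mA1 [B1 mB1 <-]] [A2 mA2 [B2 mB2 <-]].
      exists (A1 `&` A2); first exact: measurableI.
      by exists (B1 `&` B2); [exact: measurableI|rewrite setXI].
    - by move=> _ [A mA [B mB <-]]; exact: step2.
  have : ae_eq mu Q (EFin \o w) (cst 0%E).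
    apply: integral_ae_eq => // E EQ mE.
    rewrite integral0 -[RHS](step3 E)// WI; congr (integral _ _ _).
    by apply/esym/setIidPl.
  by apply: filterS => x H /H [].
have [F [FO OE]] := open_cbox_cover oO.
rewrite {1}OE.
have /negligible_bigcup : forall k, mu.-negligible [set x | ~ (box (F k).1.1 (F k).1.2 (F k).2.1 (F k).2.2 x -> w x = cst 0 x)].
  by move=> k; exact: loc (FO k).
apply: negligibleS => x /= /not_implyP[[n _ bx] wx]; exists n => //.
exact/not_implyP.
Qed.

End fundamental_lemma.

(** * Square integrable functions *)

Lemma geometric_cvg (R : realType) (a : nat -> R) (c : R) :
  (forall j, `|a j.+1 - a j| <= c / 2 ^+ j) ->
  exists2 l, a n @[n --> \oo] --> l & forall j, `|a j - l| <= 2 * c / 2 ^+ j.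
Proof.
move=> H.
pose b j := a j + 2 * c / 2 ^+ j; pose b' j := a j - 2 * c / 2 ^+ j.
have E j : 2 * c / 2 ^+ j.+1 = c / 2 ^+ j.
  by rewrite exprS invfM mulrA [2 * c]mulrC mulfK// pnatr_eq0.
have E' j : 2 * c / 2 ^+ j = c / 2 ^+ j + c / 2 ^+ j by rewrite -mulrA mulr2n mulrDl mul1r.
have db : nonincreasing_seq b.
  apply/nonincreasing_seqP => j; rewrite /b E E'.
  by have := H j; rewrite ler_norml => /andP[_]; lra.
have ib : nondecreasing_seq b'.
  apply/nondecreasing_seqP => j; rewrite /b' E E'.
  by have := H j; rewrite ler_norml => /andP[+ _]; lra.
have c0 : 0 <= c by have := H 0%N; rewrite expr0 divr1; exact: le_trans.
have g0 j : 0 <= 2 * c / 2 ^+ j by rewrite divr_ge0 ?mulr_ge0 ?exprn_ge0.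
have bb j k : b' j <= b k.
  have jm : (j <= maxn j k)%N by rewrite leq_maxl.
  have km : (k <= maxn j k)%N by rewrite leq_maxr.
  apply: le_trans (ib _ _ jm) (le_trans _ (db _ _ km)).
  by rewrite /b /b'; have := g0 (maxn j k); lra.
have cb : cvgn b.
  apply: nonincreasing_is_cvgn => //; exists (b' 0%N) => _ [k _ <-]; exact: bb.
have gc : 2 * c / 2 ^+ j @[j --> \oo] --> (0 : R).
  have := @cvg_geometric R (2 * c) 2^-1.
  rewrite ger0_norm ?invr_ge0// invf_lt1// ltr1n => /(_ isT).
  rewrite (_ : geometric _ _ = (fun j => 2 * c / 2 ^+ j))//.
  by apply/funext => j; rewrite /geometric /= exprVn.
exists (limn b) => [|j].
  have -> : a = (fun j => b j - 2 * c / 2 ^+ j) by apply/funext => j; rewrite /b addrK.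
  by rewrite -[X in _ --> X]subr0; exact: cvgB.
have := nonincreasing_cvgn_ge db cb j.
have : b' j <= limn b by apply: limr_ge => //; apply: nearW => k; exact: bb.
by rewrite ler_norml /b /b'; lra.
Qed.

Section L2_space.
Context {R : realType}.
Local Notation P2 := (R * R)%type.
Local Notation mu := (@leb2 R).
Context (D : set P2) (mD : measurable D).
Let mDm : @measurable _ (measurableTypeR R * measurableTypeR R)%type D := mD.
Implicit Types (u v w : P2 -> R).

(** The L^2 inner product and the squared norm. *)
Definition ip u v : R := \int[mu]_(x in D) (u x * v x).
Definition nsq u : R := ip u u.

Lemma L2_mul_integrable u v : L2 D u -> L2 D v ->
  mu.-integrable D (EFin \o (fun x => u x * v x)).
Proof.
move=> [mu1 iu] [mv iv].
have sq (w : P2 -> R) : measurable_fun D w -> (\int[mu]_(x in D) (w x ^+ 2)%:E < +oo)%E ->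
    mu.-integrable D (EFin \o (fun x => w x ^+ 2)).
  move=> mw iw; apply/integrableP; split.
    by apply/measurable_EFinP; exact: measurable_funX.
  by under eq_integral do rewrite /= ger0_norm ?sqr_ge0//.
apply: (@le_integrable _ _ _ mu D mD _ (EFin \o (fun x => u x ^+ 2 + v x ^+ 2))).
- by apply/measurable_EFinP; exact: measurable_funM.
- move=> x Dx; rewrite /= lee_fin [leRHS]ger0_norm ?addr_ge0 ?sqr_ge0// ler_norml.
  have h1 := sqr_ge0 (u x + v x); rewrite sqrrD in h1.
  have h2 := sqr_ge0 (u x - v x); rewrite sqrrB in h2.
  by have := sqr_ge0 (u x); have := sqr_ge0 (v x); lra.
- by have := integrableD mDm (sq _ mu1 iu) (sq _ mv iv).
Qed.

Lemma L2_meas u : L2 D u -> measurable_fun D u. Proof. by case. Qed.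

Lemma L2P u : measurable_fun D u -> mu.-integrable D (EFin \o (fun x => u x * u x)) -> L2 D u.
Proof.
move=> mu1 /integrableP[_ H]; split => //; move: H; congr (_ < _)%E.
by apply: eq_integral => x _; rewrite /= ger0_norm ?expr2// -expr2 sqr_ge0.
Qed.

Lemma L2_0 : L2 D (fun=> 0).
Proof.
apply: L2P; first exact: measurable_cst.
by rewrite (_ : _ \o _ = cst 0%E); [exact: integrable0|apply/funext => x /=; rewrite mulr0].
Qed.

Lemma L2_add u v : L2 D u -> L2 D v -> L2 D (fun x => u x + v x).
Proof.
move=> Lu Lv; apply: L2P.
  by apply: measurable_funD; exact: L2_meas.
have H := integrableD mDm (integrableD mDm (L2_mul_integrable Lu Lu) (L2_mul_integrable Lu Lv))
  (integrableD mDm (L2_mul_integrable Lv Lu) (L2_mul_integrable Lv Lv)).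
apply: eq_integrable H => // x _ /=; rewrite -!EFinD; congr EFin; ring.
Qed.

Lemma L2_scale (c : R) u : L2 D u -> L2 D (fun x => c * u x).
Proof.
move=> Lu; apply: L2P.
  by apply: measurable_funM => //; exact: L2_meas.
have H := integrableZl mDm (c * c) (L2_mul_integrable Lu Lu).
apply: eq_integrable H => // x _ /=; rewrite -!EFinM; congr EFin; ring.
Qed.

Lemma L2_opp u : L2 D u -> L2 D (fun x => - u x).
Proof. by move=> /(L2_scale (-1)); under eq_fun do rewrite mulN1r. Qed.

Lemma L2_sub u v : L2 D u -> L2 D v -> L2 D (fun x => u x - v x).
Proof. by move=> Lu Lv; apply: L2_add => //; exact: L2_opp. Qed.

Lemma ipC u v : ip u v = ip v u.
Proof. by apply: eq_Rintegral => x _; rewrite mulrC. Qed.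

Lemma ipDl u v w : L2 D u -> L2 D v -> L2 D w ->
  ip (fun x => u x + v x) w = ip u w + ip v w.
Proof.
move=> Lu Lv Lw; rewrite /ip -RintegralD//; [|exact: L2_mul_integrable..].
by apply: eq_Rintegral => x _; rewrite mulrDl.
Qed.

Lemma ipZl (c : R) u v : L2 D u -> L2 D v -> ip (fun x => c * u x) v = c * ip u v.
Proof.
move=> Lu Lv; rewrite /ip -RintegralZl//; last exact: L2_mul_integrable.
by apply: eq_Rintegral => x _; rewrite mulrA.
Qed.

Lemma ipNl u v : L2 D u -> L2 D v -> ip (fun x => - u x) v = - ip u v.
Proof.
move=> Lu Lv; rewrite -[RHS]mulN1r -ipZl//.
by apply: eq_Rintegral => x _; rewrite mulN1r.
Qed.

Lemma ipBl u v w : L2 D u -> L2 D v -> L2 D w ->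
  ip (fun x => u x - v x) w = ip u w - ip v w.
Proof. by move=> Lu Lv Lw; rewrite ipDl ?ipNl//; exact: L2_opp. Qed.

Lemma ipDr u v w : L2 D u -> L2 D v -> L2 D w ->
  ip w (fun x => u x + v x) = ip w u + ip w v.
Proof. by move=> *; rewrite ipC ipDl// ipC [ip v w]ipC. Qed.

Lemma ipZr (c : R) u v : L2 D u -> L2 D v -> ip v (fun x => c * u x) = c * ip v u.
Proof. by move=> *; rewrite ipC ipZl// ipC. Qed.

Lemma ipNr u v : L2 D u -> L2 D v -> ip v (fun x => - u x) = - ip v u.
Proof. by move=> *; rewrite ipC ipNl// ipC. Qed.

Lemma ipBr u v w : L2 D u -> L2 D v -> L2 D w ->
  ip w (fun x => u x - v x) = ip w u - ip w v.
Proof. by move=> *; rewrite ipC ipBl// ipC [ip v w]ipC. Qed.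

Lemma nsq_ge0 u : 0 <= nsq u.
Proof. by apply: Rintegral_ge0 => x _; rewrite -expr2 sqr_ge0. Qed.

Lemma nsqD u v : L2 D u -> L2 D v ->
  nsq (fun x => u x + v x) = nsq u + 2 * ip u v + nsq v.
Proof.
move=> Lu Lv; have Luv := L2_add Lu Lv.
by rewrite /nsq ipDl// !ipDr// [ip v u]ipC; ring.
Qed.

Lemma nsqZ (c : R) u : L2 D u -> nsq (fun x => c * u x) = c ^+ 2 * nsq u.
Proof. by move=> Lu; rewrite /nsq ipZl ?ipZr//; [ring|exact: L2_scale]. Qed.

Lemma nsqN u : L2 D u -> nsq (fun x => - u x) = nsq u.
Proof. by move=> Lu; apply: eq_Rintegral => x _; rewrite mulrNN. Qed.

Lemma nsqB u v : L2 D u -> L2 D v ->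
  nsq (fun x => u x - v x) = nsq u - 2 * ip u v + nsq v.
Proof.
move=> Lu Lv; rewrite (nsqD Lu (L2_opp Lv)) nsqN// ipNr//; ring.
Qed.

Lemma nsqD_le u v : L2 D u -> L2 D v ->
  nsq (fun x => u x + v x) <= 2 * nsq u + 2 * nsq v.
Proof.
move=> Lu Lv; have := nsq_ge0 (fun x => u x - v x).
by rewrite (nsqB Lu Lv) (nsqD Lu Lv); lra.
Qed.

(** Expand nsq (u - c v) >= 0 at the minimising c; when v has norm zero, every
    multiple of v may be subtracted. *)
Lemma cauchy_schwarz u v : L2 D u -> L2 D v -> ip u v ^+ 2 <= nsq u * nsq v.
Proof.
move=> Lu Lv; have [v0|v0] := eqVneq (nsq v) 0.
  have H (t : R) : 0 <= nsq u - 2 * t * ip u v.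
    have := nsq_ge0 (fun x => u x - t * v x).
    by rewrite nsqB//; [rewrite nsqZ// v0 mulr0 addr0 ipZr// mulrA|exact: L2_scale].
  have := H ((nsq u + 1) / 2 / ip u v); rewrite v0 mulr0.
  have [->|uv] := eqVneq (ip u v) 0; first by rewrite expr0n.
  have -> : 2 * ((nsq u + 1) / 2 / ip u v) * ip u v = nsq u + 1 by field.
  lra.
have vp : 0 < nsq v by rewrite lt_def v0 nsq_ge0.
have := nsq_ge0 (fun x => u x - (ip u v / nsq v) * v x).
rewrite nsqB//; last exact: L2_scale.
rewrite nsqZ// ipZr//.
have -> : nsq u - 2 * (ip u v / nsq v * ip u v) + (ip u v / nsq v) ^+ 2 * nsq v
  = (nsq u * nsq v - ip u v ^+ 2) / nsq v by field.
by rewrite pmulr_lge0 ?invr_gt0// subr_ge0.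
Qed.

Lemma cauchy_schwarz_norm u v (a b : R) : L2 D u -> L2 D v -> 0 <= a -> 0 <= b ->
  nsq u <= a ^+ 2 -> nsq v <= b ^+ 2 -> `|ip u v| <= a * b.
Proof.
move=> Lu Lv a0 b0 ua vb; rewrite -(@ler_pXn2r _ 2)// ?nnegrE ?mulr_ge0//.
rewrite real_normK ?num_real// exprMn; apply: le_trans (cauchy_schwarz Lu Lv) _.
by apply: ler_pM => //; exact: nsq_ge0.
Qed.

Lemma nsq_fine u : L2 D u -> (\int[mu]_(x in D) (u x * u x)%:E)%E = (nsq u)%:E.
Proof.
move=> Lu; rewrite /nsq /ip /Rintegral fineK//.
exact: (integrable_fin_num mDm (L2_mul_integrable Lu Lu)).
Qed.

Lemma nsq_eq0 u : L2 D u -> nsq u = 0 -> ae_eq mu D u (cst 0).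
Proof.
move=> Lu u0.
have H : (\int[mu]_(x in D) `|(u x * u x)%:E| = 0)%E.
  transitivity ((nsq u)%:E); last by rewrite u0.
  rewrite -nsq_fine//; apply: eq_integral => x _.
  by rewrite /= ger0_norm// -expr2 sqr_ge0.
have : ae_eq mu D (EFin \o (fun x => u x * u x)) (cst 0%E).
  apply/(ae_eq_integral_abs mu mD) => //.
  by apply: (measurable_int mu); exact: L2_mul_integrable.
apply: filterS => x Hx Dx; have [/eqP] := Hx Dx.
by rewrite mulf_eq0 orbb => /eqP.
Qed.

Lemma ae_eq_ip u u' v : measurable_fun D u -> measurable_fun D u' -> measurable_fun D v ->
  ae_eq mu D u u' -> ip u v = ip u' v.
Proof.
move=> mu1 mu2 mv uu; congr fine; apply: ae_eq_integral => //.
- by apply/measurable_EFinP; exact: measurable_funM.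
- by apply/measurable_EFinP; exact: measurable_funM.
- by apply: filterS uu => x Hx Dx; rewrite /= Hx.
Qed.

Lemma L2_ae_eq u v : measurable_fun D v -> ae_eq mu D u v -> L2 D u -> L2 D v.
Proof.
move=> mv uv Lu; split => //; have [mu1 H] := Lu; move: H; congr (_ < _)%E.
apply: ge0_ae_eq_integral => //.
- by apply/measurable_EFinP; exact: measurable_funX.
- by apply/measurable_EFinP; exact: measurable_funX.
- by move=> x _; rewrite lee_fin sqr_ge0.
- by move=> x _; rewrite lee_fin sqr_ge0.
- by apply: filterS uv => x Hx Dx; rewrite Hx.
Qed.

Lemma L2_bounded u (M : R) : (mu D < +oo)%E -> measurable_fun D u ->
  (forall x, D x -> `|u x| <= M) -> L2 D u.
Proof.
move=> Doo mu1 uM; apply: L2P => //; apply: measurable_bounded_integrable => //.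
  exact: measurable_funM.
exists (M * M); split; first exact: num_real.
by move=> N MN x Dx; rewrite /= normrM (le_trans _ (ltW MN))// ler_pM// uM.
Qed.

Lemma L2_integrable u : (mu D < +oo)%E -> L2 D u -> mu.-integrable D (EFin \o u).
Proof.
move=> Doo Lu; have L1 : L2 D (fun=> 1).
  by apply: (@L2_bounded _ 1) => // x _; rewrite normr1.
by have := L2_mul_integrable Lu L1; apply: eq_integrable => // x _ /=; rewrite mulr1.
Qed.

Lemma L2_mul_bounded u v (M : R) : L2 D u -> measurable_fun D v ->
  (forall x, D x -> `|v x| <= M) -> L2 D (fun x => v x * u x).
Proof.
move=> Lu mv vM; apply: L2P; first by apply: measurable_funM => //; exact: L2_meas.
apply: (@le_integrable _ _ _ mu D mD _ (EFin \o (fun x => M ^+ 2 * (u x * u x)))).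
- by apply/measurable_EFinP; do 2 apply: measurable_funM => //; exact: L2_meas.
- move=> x Dx; rewrite /= lee_fin.
  rewrite (_ : v x * u x * (v x * u x) = v x ^+ 2 * (u x * u x)); last by ring.
  rewrite !normrM ler_wpM2r ?mulr_ge0//.
  have M0 : 0 <= M by exact: le_trans (vM x Dx).
  have vM' : `|v x| <= `|M| by rewrite [leRHS]ger0_norm//; exact: vM.
  by apply: ler_pM.
- have := integrableZl mDm (M ^+ 2) (L2_mul_integrable Lu Lu).
  by apply: eq_integrable => // x _ /=; rewrite EFinM.
Qed.

(** Riesz--Fischer for rapidly converging sequences: the weighted sum S of the
    squared increments is integrable, so that it is finite almost everywhere,
    and where it is finite it controls the distance of v_j to its limit. *)
Lemma L2_complete_fast (v : nat -> P2 -> R) : (forall j, L2 D (v j)) ->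
  (forall j, 4 ^+ j * nsq (fun x => v j.+1 x - v j x) <= (2 ^ j.+1)%:R^-1) ->
  exists2 u, L2 D u & forall j, nsq (fun x => v j x - u x) <= 4 / 4 ^+ j.
Proof.
move=> Lv fv.
pose s j x : R := 4 ^+ j * ((v j.+1 x - v j x) * (v j.+1 x - v j x)).
have s0 j x : 0 <= s j x by rewrite mulr_ge0 ?exprn_ge0// -expr2 sqr_ge0.
have Ld j : L2 D (fun x => v j.+1 x - v j x) by exact: L2_sub.
have ms j : measurable_fun D (fun x => (s j x)%:E).
  apply/measurable_EFinP; apply: measurable_funM => //.
  by apply: measurable_funM; exact: L2_meas.
pose S x : \bar R := (\sum_(0 <= j <oo) (s j x)%:E)%E.
have S0 x : (0 <= S x)%E by apply: nneseries_ge0 => n _ _; rewrite lee_fin.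
have mS : measurable_fun D S.
  by apply: ge0_emeasurable_sum => // n x _ _; rewrite lee_fin.
have IS : (\int[mu]_(x in D) S x <= 1)%E.
  rewrite integral_nneseries//; last by move=> n x _; rewrite lee_fin.
  apply: (@le_trans _ _ (\sum_(0 <= j <oo) (0%:E + (1 / (2 ^ j.+1)%:R)%:E))%E).
    apply: lee_nneseries => [j _ _|j _].
      by apply: integral_ge0 => x _; rewrite lee_fin.
    rewrite add0e div1r (le_trans _ (_ : (4 ^+ j * nsq (fun x => v j.+1 x - v j x))%:E <= _)%E)//.
      rewrite EFinM -nsq_fine//.
      have m1 : measurable_fun (D : set (measurableTypeR R * measurableTypeR R)%type)
          (fun x => ((v j.+1 x - v j x) * (v j.+1 x - v j x))%:E).
        by apply: (measurable_int mu); exact: L2_mul_integrable.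
      have h1 x : D x -> (0 <= ((v j.+1 x - v j x) * (v j.+1 x - v j x))%:E)%E.
        by rewrite lee_fin -expr2 sqr_ge0.
      have h2 : (0 <= (4 ^+ j : R)%:E)%E by rewrite lee_fin exprn_ge0.
      rewrite -(ge0_integralZl mu mDm m1 h1 h2).
      by under [X in (_ <= X)%E]eq_integral do rewrite -EFinM.
    by rewrite lee_fin.
  apply: le_trans (@epsilon_trick _ (fun=> 0%E) 1 xpredT _ ler01) _ => //.
  by rewrite eseries0// add0e.
have iS : mu.-integrable D S.
  apply/integrableP; split => //; apply: le_lt_trans (ltry 1).
  by under eq_integral do rewrite gee0_abs//.
have [N [mN N0 SN]] := integrable_ae mDm iS.
have Sfin x : D x -> ~ N x -> S x = (fine (S x))%:E.
  move=> Dx Nx; rewrite fineK//; apply: contrapT => H; apply: Nx; apply: SN => /= /(_ Dx).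
  exact: H.
pose h j : P2 -> R := v j \_ (~` N).
have mh j : measurable_fun D (h j).
  apply/(measurable_restrict (v j) (measurableC mN) mD).
  by apply: measurable_funS (L2_meas (Lv j)) => //; exact: subIsetl.
have hlim x : exists l, D x -> h n x @[n --> \oo] --> l /\
    forall j, (h j x - l) ^+ 2 <= 4 / 4 ^+ j * fine (S x).
  have [Dx|Dx] := pselect (D x); last by exists 0.
  have [Nx|Nx] := pselect (N x).
    exists 0 => _; have hE j : h j x = 0 by rewrite /h patchE memNset//; exact.
    split; first by under eq_fun do rewrite hE; exact: cvg_cst.
    move=> j; rewrite hE subr0 expr0n mulr_ge0 ?divr_ge0 ?exprn_ge0//.
    by rewrite fine_ge0.
  have hE j : h j x = v j x by rewrite /h patchE mem_set.
  have c0 : 0 <= fine (S x) by rewrite fine_ge0.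
  have [j|l cl Hl] := @geometric_cvg R (fun j => h j x) (Num.sqrt (fine (S x))).
    rewrite !hE ler_pdivlMr ?exprn_gt0// -[leRHS]ger0_norm ?sqrtr_ge0//.
    rewrite -ler_sqr ?nnegrE ?mulr_ge0 ?exprn_ge0// ger0_norm ?sqrtr_ge0//.
    rewrite sqr_sqrtr// exprMn real_normK ?num_real//.
    rewrite -lee_fin -Sfin//.
    have G : (\sum_(0 <= i < j.+1) (s i x)%:E <= S x)%E.
      by apply: nneseries_lim_ge => n _ _; rewrite lee_fin.
    apply: le_trans G.
    rewrite big_nat_recr//= -[leLHS]add0e; apply: leeD.
      by apply: sume_ge0 => i _; rewrite lee_fin.
    rewrite lee_fin /s -expr2 mulrC -exprM mulnC exprM.
    by rewrite (_ : 2 ^+ 2 = 4 :> R)// -natrX.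
  exists l => _; split => // j.
  have := Hl j; rewrite -ler_sqr ?nnegrE ?mulr_ge0 ?invr_ge0 ?exprn_ge0 ?sqrtr_ge0//.
  rewrite real_normK ?num_real//; move/le_trans; apply.
  rewrite !exprMn sqr_sqrtr// exprVn -exprM mulnC exprM (_ : 2 ^+ 2 = 4 :> R); last first.
    by rewrite -natrX.
  by rewrite mulrAC.
have [u Hu] := choice hlim.
have mu1 : measurable_fun D u by apply: (measurable_fun_cvg mh) => x Dx; have [] := Hu x Dx.
have vh j : ae_eq mu D (fun x => v j x - u x) (fun x => h j x - u x).
  exists N; split => // x /= H; apply: contrapT => Nx; apply: H => Dx.
  by rewrite /h patchE mem_set.
have mvu j : measurable_fun D (fun x => v j x - u x).
  by apply: measurable_funB => //; exact: L2_meas.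
have mhu j : measurable_fun D (fun x => h j x - u x) by exact: measurable_funB.
have ihu j : (\int[mu]_(x in D) ((h j x - u x) * (h j x - u x))%:E <= (4 / 4 ^+ j)%:E)%E.
  have c0 : 0 <= 4 / 4 ^+ j :> R by rewrite divr_ge0 ?exprn_ge0.
  apply: (@le_trans _ _ (\int[mu]_(x in D) ((4 / 4 ^+ j)%:E * S x))%E).
    have m1 : measurable_fun D (fun x => ((h j x - u x) * (h j x - u x))%:E).
      by apply/measurable_EFinP; apply: measurable_funM; exact: mhu.
    have h1 x : D x -> (0 <= ((h j x - u x) * (h j x - u x))%:E)%E.
      by rewrite lee_fin -expr2 sqr_ge0.
    have m2 : measurable_fun D (fun x => ((4 / 4 ^+ j)%:E * S x)%E) by exact: measurable_funeM.
    have h2 x : D x -> (0 <= (4 / 4 ^+ j)%:E * S x)%E by rewrite mule_ge0// lee_fin.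
    apply: (@ae_ge0_le_integral _ _ _ mu D mDm _ _ h1 m1 h2 m2).
    exists N; split => // x /= H; apply: contrapT => Nx; apply: H => Dx.
    by rewrite Sfin// -EFinM lee_fin -expr2; have [_] := Hu x Dx; apply.
  rewrite ge0_integralZl ?lee_fin// -[leRHS]mule1.
  by apply: lee_pmul => //; exact: integral_ge0.
have Lvu j : L2 D (fun x => v j x - u x).
  apply: (@L2_ae_eq (fun x => h j x - u x)) => //.
    by apply: filterS (vh j) => x Hx Dx; rewrite Hx.
  split => //; under eq_integral do rewrite expr2.
  exact: le_lt_trans (ihu j) (ltry _).
exists u => [|j].
  have := L2_sub (Lv 0%N) (Lvu 0%N); congr (L2 D _); apply/funext => x; ring.
rewrite -lee_fin -nsq_fine//; apply: le_trans (ihu j).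
rewrite le_eqVlt; apply/orP; left; apply/eqP; apply: ge0_ae_eq_integral => //.
- by apply/measurable_EFinP; apply: measurable_funM; exact: mvu.
- by apply/measurable_EFinP; apply: measurable_funM; exact: mhu.
- by move=> x _; rewrite lee_fin -expr2 sqr_ge0.
- by move=> x _; rewrite lee_fin -expr2 sqr_ge0.
- by apply: filterS (vh j) => x Hx Dx; rewrite Hx.
Qed.

End L2_space.

(** * Test functions, weak gradients and the space H^1_0 *)

Section test_functions.
Context {R : realType}.
Local Notation P2 := (R * R)%type.
Local Notation mu := (@leb2 R).
Implicit Types (f g : P2 -> R) (O : set P2).

Lemma test_smooth O f : test_function O f -> smooth_on setT f.
Proof. by move=> [/smooth_onT]. Qed.

Lemma test_cont O f : test_function O f -> continuous f.
Proof. by move=> tf x; exact: (smooth_on_cont (test_smooth tf)). Qed.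

Lemma test_out O f x : test_function O f -> ~ O x -> f x = 0.
Proof.
move=> [_ _ sO] Ox; apply/eqP; apply: contra_notT Ox => fx.
by apply: sO; exact: subset_closure.
Qed.

Lemma test_sub O f g : test_function O f -> smooth_on setT g ->
  closure [set x | g x != 0] `<=` closure [set x | f x != 0] -> test_function O g.
Proof.
move=> [_ cf fO] sg gf; split; first exact/smooth_onT.
  by apply: subclosed_compact gf => //; exact: closed_closure.
exact: subset_trans gf fO.
Qed.

Lemma test_sub0 O f g : test_function O f -> smooth_on setT g ->
  (forall x, f x = 0 -> g x = 0) -> test_function O g.
Proof.
move=> tf sg fg; apply: test_sub tf sg _; apply: closure_subset => x /=.
by apply: contra_neq; exact: fg.
Qed.

Lemma partial_nsupp f x i : ~ closure [set x | f x != 0] x -> partial i f x = 0.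
Proof.
move=> nx; apply: partial_near0.
have : open_nbhs x (~` closure [set x | f x != 0]).
  by split => //; apply: closed_openC; exact: closed_closure.
move/open_nbhs_nbhs; apply: filterS => y /= ny; apply/eqP; apply: contra_notT ny => fy.
exact: subset_closure.
Qed.

Lemma test_partial O f i : test_function O f -> test_function O (partial i f).
Proof.
move=> tf; apply: test_sub (tf) (smooth_on_partial i (test_smooth tf)) _.
rewrite [X in _ `<=` X](_ : _ = closure (closure [set x | f x != 0])); last first.
  by apply/(closure_id _).1; exact: closed_closure.
apply: closure_subset => x /= px; apply: contrapT => /(@partial_nsupp _ _ i) E.
by rewrite E eqxx in px.
Qed.

Lemma test_scale O f (c : R) : test_function O f -> test_function O (fun x => c * f x).
Proof.
move=> tf; apply: test_sub0 (tf) _ _ => [|x ->]; last by rewrite mulr0.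
by apply: smooth_on_scale; [exact: openT|exact: test_smooth tf].
Qed.

Lemma test_add O f g : test_function O f -> test_function O g ->
  test_function O (fun x => f x + g x).
Proof.
move=> tf tg; have [_ cf fO] := tf; have [_ cg gO] := tg.
have sub : closure [set x | f x + g x != 0] `<=`
    closure [set x | f x != 0] `|` closure [set x | g x != 0].
  rewrite -closureU; apply: closure_subset => x /= H.
  apply/orP; rewrite -negb_and; apply: contra H => /andP[/eqP -> /eqP ->].
  by rewrite addr0.
split.
- by apply/smooth_onT/smooth_on_add; [exact: openT|exact: test_smooth tf|exact: test_smooth tg].
- by apply: subclosed_compact sub; [exact: closed_closure|exact: compactU].
- by apply: subset_trans sub _ => x [/fO|/gO].
Qed.

Lemma test0 O : test_function O (fun=> 0).
Proof.
have E : closure [set x : P2 | (0 : R) != 0] = set0.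
  by rewrite (_ : [set x | _] = set0) ?closure0//; apply/seteqP; split => x //=; rewrite eqxx.
split; rewrite ?E//; last exact: compact0.
by apply/smooth_onT/smooth_on_cst; exact: openT.
Qed.

Lemma partialD O f g i x : test_function O f -> test_function O g ->
  partial i (fun y => f y + g y) x = partial i f x + partial i g x.
Proof.
move=> tf tg; have [_ E] := is_derive_add (smooth_onP (test_smooth tf) i (I : setT x))
  (smooth_onP (test_smooth tg) i (I : setT x)).
exact: E.
Qed.

Lemma partialZ O f (c : R) i x : test_function O f ->
  partial i (fun y => c * f y) x = c * partial i f x.
Proof.
move=> tf; have [_ E] := is_derive_mul (is_derive_cst c x (unit_vec R i))
  (smooth_onP (test_smooth tf) i (I : setT x)).
by rewrite /partial -[LHS]/('D_(unit_vec R i) (fun y => cst c y * f y) x) E mul0r add0r.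
Qed.

(** The extension by zero is smooth on O, and on the complement of the support of
    f, where it vanishes; these two open sets cover the plane. *)
Lemma test_mul O f g : open O -> test_function O f -> smooth_on O g ->
  test_function O (fun x => if x \in O then g x * f x else 0).
Proof.
move=> oO tf sg; have [_ _ fO] := tf.
set h := (fun x => _).
have h0 x : f x = 0 -> h x = 0 by rewrite /h => ->; rewrite mulr0 if_same.
apply: test_sub0 (tf) _ (h0).
have -> : setT = O `|` ~` closure [set x | f x != 0].
  apply/seteqP; split => // x _; have [Ox|Ox] := pselect (O x); first by left.
  by right => /fO.
apply: smooth_onU.
  apply: (@eq_smooth_on _ _ (fun x => g x * f x) _ oO) => [x Ox|].
    by rewrite /h mem_set.
  exact: (smooth_on_mul oO sg (smooth_onS (@subsetT _ O) (test_smooth tf))).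
have oC : open (~` closure [set x | f x != 0]).
  by apply: closed_openC; exact: closed_closure.
apply: (@eq_smooth_on _ _ (fun=> 0)) => // [x nx|]; last exact: smooth_on_cst.
rewrite h0//; apply/eqP; apply: contra_notT nx => fx.
exact: subset_closure.
Qed.

Lemma int_test_partial O f i : test_function O f -> \int[mu]_(x in O) partial i f x = 0.
Proof.
move=> tf; rewrite -[RHS](@int_partial0 R f i); last 2 first.
- by case: tf.
- exact: test_bsupp tf.
rewrite Rintegral_mkcond; apply: eq_Rintegral => x _; rewrite patchE.
case: ifPn => //; rewrite notin_setE => Ox.
by rewrite (test_out (test_partial i tf) Ox).
Qed.

Lemma test_L2 O f : open O -> (mu O < +oo)%E -> test_function O f -> L2 O f.
Proof.
move=> oO Ofin tf; have mO := open_measurable2 oO.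
have mf : measurable_fun O f.
  by apply: smooth_on_measurable => //; apply: smooth_onS (test_smooth tf).
have [_ cf _] := tf.
have /compact_bounded[M [Mr HM]] : compact (f @` closure [set x | f x != 0]).
  by apply: continuous_compact => //; apply: continuous_subspaceT; exact: test_cont tf.
apply: (@L2_bounded _ _ mO _ (`|M| + 1)) => // x Ox.
have [->|fx] := eqVneq (f x) 0; first by rewrite normr0 addr_ge0.
apply: HM; first by rewrite (le_lt_trans (ler_norm _))// ltrDl.
by exists x => //; exact: subset_closure.
Qed.

Lemma test_mul_integrable O f g : open O -> test_function O f -> smooth_on O g ->
  mu.-integrable O (EFin \o (fun x => g x * f x)).
Proof.
move=> oO tf sg; have mO := open_measurable2 oO.
have th := test_mul oO tf sg.
have := bsupp_integrable (test_cont th) (test_bsupp th) => ih.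
have := integrableS (measurableT : measurable [set: measurableTypeR R * measurableTypeR R])
  (mO : @measurable _ (measurableTypeR R * measurableTypeR R)%type O) (@subsetT _ O) ih.
by apply: eq_integrable => // x Ox /=; rewrite Ox.
Qed.

(** The product g f is a test function, so that the integral of its derivative
    vanishes. *)
Lemma int_by_parts O f g i : open O -> test_function O f -> smooth_on O g ->
  \int[mu]_(x in O) (g x * partial i f x) = - \int[mu]_(x in O) (partial i g x * f x).
Proof.
move=> oO tf sg; have mO := open_measurable2 oO.
apply/eqP; rewrite -addr_eq0; apply/eqP.
rewrite -RintegralD//; last 2 first.
- exact: (test_mul_integrable oO (test_partial i tf) sg).
- exact: (test_mul_integrable oO tf (smooth_on_partial i sg)).
rewrite -[RHS](int_test_partial i (test_mul oO tf sg)).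
apply: eq_Rintegral => x /set_mem Ox.
have [_ E] := is_derive_mul (smooth_onP sg i Ox) (smooth_onP (test_smooth tf) i (I : setT x)).
transitivity (partial i (fun y => g y * f y) x); first by rewrite /partial E addrC.
apply: partial_near.
near=> y; rewrite mem_set//; near: y; exact: open_nbhs_nbhs.
Unshelve. all: by end_near. Qed.

End test_functions.

Lemma poincare_arith (R : realFieldType) (n I k0 k1 N : R) :
  0 <= n -> 0 <= k0 -> 0 <= k1 -> I = - (n + I) -> I ^+ 2 <= n * (N ^+ 2 * k0) ->
  n <= (4 * N ^+ 2 + 1) * (k0 + k1).
Proof.
move=> n0 h0 h1 E cs; have {}E : n = - 2 * I by lra.
have H : n * n <= n * (4 * N ^+ 2 * k0).
  by rewrite {1 2}E; move: cs; rewrite (_ : - 2 * I * (- 2 * I) = 4 * I ^+ 2); [lra|ring].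
have {}H : n <= 4 * N ^+ 2 * k0.
  have [->|nf] := eqVneq n 0; first by rewrite mulr_ge0// mulr_ge0 ?sqr_ge0.
  by move: H; rewrite ler_pM2l// lt_def nf.
apply: le_trans H _; rewrite mulrDl mul1r mulrDr.
have : 0 <= 4 * N ^+ 2 * k1 by rewrite mulr_ge0// mulr_ge0 ?sqr_ge0.
lra.
Qed.

Lemma sum_lt_arith (R : realFieldType) (x y z a0 a1 a2 b0 b1 b2 e : R) :
  a0 + (a1 + a2) < e / 4 -> b0 + (b1 + b2) < e / 4 ->
  x <= 2 * a0 + 2 * b0 -> y <= 2 * a1 + 2 * b1 -> z <= 2 * a2 + 2 * b2 ->
  x + (y + z) < e.
Proof. lra. Qed.

Section sobolev.
Context {R : realType}.
Local Notation P2 := (R * R)%type.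
Local Notation mu := (@leb2 R).
Context (O : set P2) (oO : open O) (bO : bounded_set O).
Implicit Types (f u v w : P2 -> R) (g h : 'I_2 -> P2 -> R).
Let mO : measurable O := open_measurable2 oO.
Let Ofin : (mu O < +oo)%E := bounded_leb2_lty mO bO.
Local Notation ip := (ip O).
Local Notation nsq := (nsq O).
Local Notation test := (test_function O).

Definition energy h : R := nsq (h 0) + nsq (h 1).
Definition ipg g h : R := ip (g 0) (h 0) + ip (g 1) (h 1).
Definition grad f : 'I_2 -> P2 -> R := fun i => partial i f.

Lemma testL2 f : test f -> L2 O f. Proof. exact: test_L2. Qed.
Lemma gradL2 f i : test f -> L2 O (grad f i).
Proof. by move=> tf; apply: testL2; exact: test_partial. Qed.

(** The integral of the derivative of x_1 f ^ 2 vanishes, and x_1 is bounded on O. *)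
Lemma poincare : exists2 K : R, 1 <= K & forall f, test f -> nsq f <= K * energy (grad f).
Proof.
have [N N0 ON] := bounded_sub_box bO.
exists (4 * N ^+ 2 + 1) => [|f tf]; first by rewrite lerDr mulr_ge0 ?sqr_ge0.
have s1 : smooth_on O (fun x : P2 => x.1 * f x).
  apply: smooth_on_mul => //; first exact: smooth_on_fst.
  by apply: smooth_onS (test_smooth tf).
have Lf := testL2 tf; have Lg := gradL2 0 tf.
have m1 : measurable_fun O (fun x : P2 => x.1).
  exact: (smooth_on_measurable oO (smooth_on_fst oO)).
have b1 x : O x -> `|x.1| <= N.
  by move=> /ON/boxP[/andP[? ?] _]; rewrite ler_norml; apply/andP; split; lra.
have Lx : L2 O (fun x => x.1 * partial 0 f x) by apply: (L2_mul_bounded mO Lg m1 b1).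
have := int_by_parts 0 oO tf s1.
have -> : \int[mu]_(x in O) (x.1 * f x * partial 0 f x) = ip f (fun x => x.1 * partial 0 f x).
  by apply: eq_Rintegral => x _; ring.
have -> : \int[mu]_(x in O) (partial 0 (fun x : P2 => x.1 * f x) x * f x) =
    nsq f + ip (fun x => x.1 * partial 0 f x) f.
  rewrite /nsq /ip -RintegralD//; [|exact: L2_mul_integrable..].
  apply: eq_Rintegral => x _.
  have [_ E] := is_derive_mul (is_derive_fst x 0) (smooth_onP (test_smooth tf) 0 (I : setT x)).
  by rewrite /partial E eqxx mul1r mulrDl.
rewrite [ip _ f]ipC => E.
have cs : ip f (fun x => x.1 * partial 0 f x) ^+ 2 <= nsq f * (N ^+ 2 * nsq (grad f 0)).
  apply: le_trans (cauchy_schwarz mO Lf Lx) _; apply: ler_wpM2l; first exact: nsq_ge0.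
  rewrite -nsqZ//; apply: le_Rintegral => //.
  - exact: L2_mul_integrable.
  - by apply: L2_mul_integrable => //; exact: L2_scale.
  - move=> x Ox; rewrite -!expr2 !exprMn ler_wpM2r ?sqr_ge0//.
    by rewrite -[x.1 ^+ 2]real_normK ?num_real// lerXn2r ?nnegrE ?normr_ge0 ?(ltW N0)// b1.
apply: (poincare_arith (nsq_ge0 _ _) (nsq_ge0 _ _) (nsq_ge0 _ _) E cs).
Qed.

(** H^1_0 with the weak gradient as an explicit argument. *)
Definition H10g u g := [/\ L2 O u, weak_grad O u g & forall e : R, 0 < e ->
  exists2 f, test f & nsq (fun x => u x - f x) + energy (fun i x => g i x - partial i f x) < e].

Lemma weak_gradP u g : weak_grad O u g <->
  (forall i, L2 O (g i)) /\ (forall i f, test f -> ip u (partial i f) = - ip (g i) f).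
Proof.
split=> [H|[Lg H]].
  split=> [i|i f tf]; first by have [] := H i.
  have [_ /(_ f tf)] := H i; rewrite /dpartial /distr => E.
  by rewrite /ip -E opprK.
by move=> i; split => // f tf; rewrite /dpartial /distr -/(ip _ _) H// opprK.
Qed.

Lemma H10_H10g u : H10 O u <-> exists g, H10g u g.
Proof.
have E v : nsq v = \int[mu]_(x in O) (v x ^+ 2).
  by apply: eq_Rintegral => x _; rewrite expr2.
have E2 v g f : nsq (fun x => v x - f x) + energy (fun i x => g i x - partial i f x) =
  \int[mu]_(x in O) ((v x - f x) ^+ 2) +
      \sum_(i < 2) \int[mu]_(x in O) ((g i x - partial i f x) ^+ 2).
  rewrite E /energy !E big_ord_recl big_ord1.
  by rewrite (_ : lift ord0 ord0 = 1)//; apply: val_inj.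
split=> [[Lu [g wg Hg]]|[g [Lu wg Hg]]].
  exists g; split => // e e0; have [|f tf H] := Hg (Num.sqrt e); first by rewrite sqrtr_gt0.
  by exists f => //; rewrite E2; move: H; rewrite sqr_sqrtr// ltW.
split => //; exists g => // e e0; have [|f tf H] := Hg (e ^+ 2); first by rewrite exprn_gt0.
by exists f => //; rewrite -E2.
Qed.

Lemma ae_sub0 u v : measurable_fun O u -> measurable_fun O v ->
  ae_eq mu O (fun x => u x - v x) (cst 0) -> ae_eq mu O u v.
Proof.
move=> mu1 mv; apply: filterS => x H Ox; apply/eqP; rewrite -subr_eq0.
by apply/eqP; exact: H.
Qed.

(** The fundamental lemma applied to u - v. *)
Lemma L2_distr_eq u v : L2 O u -> L2 O v -> eq_distr O (distr O u) (distr O v) ->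
  ae_eq mu O u v.
Proof.
move=> Lu Lv uv; apply: ae_sub0; [exact: L2_meas Lu|exact: L2_meas Lv|].
have Luv := L2_sub mO Lu Lv.
apply: fund_lemma => //; first exact: L2_meas Luv.
  move=> a b c d bsub; have := L2_integrable mO Ofin Luv; apply: integrableS => //.
  - exact: measurable_box.
  - exact: subset_trans (@box_cbox _ _ _ _ _) bsub.
move=> f tf; have := uv f tf; rewrite /distr => E.
by rewrite -[LHS]/(ip (fun x => u x - v x) f) (ipBl mO Lu Lv (testL2 tf)) /ip E subrr.
Qed.

Lemma weak_grad_unique u g h i : weak_grad O u g -> weak_grad O u h -> ae_eq mu O (g i) (h i).
Proof.
move=> /weak_gradP[Lg Hg] /weak_gradP[Lh Hh]; apply: L2_distr_eq => // f tf.
rewrite -[LHS]/(ip (g i) f) -[RHS]/(ip (h i) f).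
by apply: oppr_inj; rewrite -Hg// -Hh.
Qed.

Lemma nsq_ae u v : L2 O u -> L2 O v -> ae_eq mu O u v -> nsq u = nsq v.
Proof.
move=> Lu Lv uv; rewrite /nsq (ae_eq_ip mO (L2_meas Lu) (L2_meas Lv) (L2_meas Lu) uv).
rewrite ipC; exact: (ae_eq_ip mO (L2_meas Lu) (L2_meas Lv) (L2_meas Lv) uv).
Qed.

Lemma H10g_grad u g h : H10g u g -> weak_grad O u h -> H10g u h.
Proof.
move=> [Lu wg Hg] wh; split => // e e0; have [f tf H] := Hg e e0; exists f => //.
have Lg i : L2 O (g i) by have [] := wg i.
have Lh i : L2 O (h i) by have [] := wh i.
have E i : nsq (fun x => h i x - partial i f x) = nsq (fun x => g i x - partial i f x).
  apply: nsq_ae; [exact: L2_sub (gradL2 i tf)|exact: L2_sub (gradL2 i tf)|].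
  by apply: filterS (weak_grad_unique i wh wg) => x Hx Ox; rewrite Hx.
by rewrite (_ : energy _ = energy (fun i x => g i x - partial i f x))//; congr (_ + _); exact: E.
Qed.

Lemma weak_grad_test f : test f -> weak_grad O f (grad f).
Proof.
move=> tf; apply/weak_gradP; split=> [i|i k tk]; first exact: gradL2.
by apply: int_by_parts => //; apply: smooth_onS (test_smooth tf).
Qed.

Lemma H10g_test f : test f -> H10g f (grad f).
Proof.
move=> tf; split; [exact: testL2|exact: weak_grad_test|move=> e e0].
exists f => //; have Z (u : P2 -> R) : nsq (fun x => u x - u x) = 0.
  by rewrite /nsq /ip (@eq_Rintegral _ _ _ _ _ (cst 0)) ?Rintegral_cst ?mul0r// => x _;
    rewrite subrr mulr0.
by rewrite /energy (Z f) (Z (partial 0 f)) (Z (partial 1 f)) !addr0.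
Qed.

Lemma weak_gradB u v g h : L2 O u -> L2 O v -> weak_grad O u g -> weak_grad O v h ->
  weak_grad O (fun x => u x - v x) (fun i x => g i x - h i x).
Proof.
move=> Lu Lv /weak_gradP[Lg Hg] /weak_gradP[Lh Hh]; apply/weak_gradP; split=> [i|i f tf].
  exact: L2_sub.
by rewrite !ipBl// ?Hg ?Hh//; [lra|exact: testL2|exact: gradL2 tf].
Qed.

Lemma weak_gradD u v g h : L2 O u -> L2 O v -> weak_grad O u g -> weak_grad O v h ->
  weak_grad O (fun x => u x + v x) (fun i x => g i x + h i x).
Proof.
move=> Lu Lv /weak_gradP[Lg Hg] /weak_gradP[Lh Hh]; apply/weak_gradP; split=> [i|i f tf].
  exact: L2_add.
by rewrite !ipDl// ?Hg ?Hh//; [lra|exact: testL2|exact: gradL2 tf].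
Qed.

Lemma weak_gradN u g : L2 O u -> weak_grad O u g ->
  weak_grad O (fun x => - u x) (fun i x => - g i x).
Proof.
move=> Lu /weak_gradP[Lg Hg]; apply/weak_gradP; split=> [i|i f tf].
  exact: L2_opp.
by rewrite !ipNl// ?Hg//; [exact: testL2|exact: gradL2 tf].
Qed.

Lemma H10gB u v g h : H10g u g -> H10g v h ->
  H10g (fun x => u x - v x) (fun i x => g i x - h i x).
Proof.
move=> [Lu wg Hu] [Lv wh Hv]; split; [exact: L2_sub|exact: weak_gradB|].
move=> e e0; have e4 : 0 < e / 4 by rewrite divr_gt0.
have [a ta Ha] := Hu _ e4; have [b tb Hb] := Hv _ e4.
have Lg i : L2 O (g i) by have [] := wg i.
have Lh i : L2 O (h i) by have [] := wh i.
have tb' := test_scale (-1) tb.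
exists (fun x => a x + -1 * b x); first exact: test_add.
have La := testL2 ta; have Lb := testL2 tb.
have bound (p q p' q' : P2 -> R) : L2 O p -> L2 O q -> L2 O p' -> L2 O q' ->
    nsq (fun x => p x - q x - (p' x - q' x)) <= 2 * nsq (fun x => p x - p' x) + 2 * nsq (fun x => q x - q' x).
  move=> Lp Lq Lp' Lq'.
  have := nsqD_le mO (L2_sub mO Lp Lp') (L2_opp mO (L2_sub mO Lq Lq')).
  rewrite nsqN//; last exact: L2_sub.
  by congr (_ <= _); apply: eq_Rintegral => x _; ring.
have E0 : nsq (fun x => u x - v x - (a x + -1 * b x)) = nsq (fun x => u x - v x - (a x - b x)).
  by apply: eq_Rintegral => x _; rewrite mulN1r.
have Ei i : nsq (fun x => g i x - h i x - partial i (fun y => a y + -1 * b y) x) =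
   nsq (fun x => g i x - h i x - (partial i a x - partial i b x)).
  by apply: eq_Rintegral => x _; rewrite (partialD i x ta tb') (partialZ _ i x tb) mulN1r.
rewrite /energy E0 !Ei.
have B0 := bound _ _ _ _ Lu Lv La Lb.
have B1 i := bound _ _ _ _ (Lg i) (Lh i) (gradL2 i ta) (gradL2 i tb).
exact: (sum_lt_arith Ha Hb B0 (B1 0) (B1 1)).
Qed.

End sobolev.

(** * The Dirichlet problem *)

Section small_arith.
Context {R : realType}.

Lemma pow4_sqr j : 4 / 4 ^+ j = (2 / 2 ^+ j) ^+ 2 :> R.
Proof.
rewrite exprMn exprVn -exprM mulnC exprM.
by rewrite (_ : 2 ^+ 2 = 4 :> R)// -natrX.
Qed.

Lemma pow2_cvg0 (c : R) : c / 2 ^+ j @[j --> \oo] --> (0 : R).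
Proof.
have := @cvg_geometric R c 2^-1.
rewrite ger0_norm ?invr_ge0// invf_lt1// ltr1n => /(_ isT).
rewrite (_ : geometric _ _ = (fun j => c / 2 ^+ j))//.
by apply/funext => j; rewrite /geometric /= exprVn.
Qed.

Lemma small_eq0 (x c : R) : (forall j, `|x| <= c / 2 ^+ j) -> x = 0.
Proof.
move=> H; apply/eqP; rewrite -normr_le0.
rewrite -(cvg_lim _ (pow2_cvg0 c))//.
by apply: limr_ge; [exact: cvgP (pow2_cvg0 c)|apply: nearW].
Qed.

(** For a quadratic functional J bounded below by m, of second differential E in
    the direction from a to b, values of J close to m at a and b force E to be
    small, because the value at the midpoint is at least m. *)
Lemma parallelogram_arith (m Ja Jb Jm D E ea eb : R) :
  Jb = Ja + 1 * D + 1 ^+ 2 / 2 * E -> Jm = Ja + 2^-1 * D + 2^-1 ^+ 2 / 2 * E ->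
  m <= Jm -> Ja < m + ea -> Jb < m + eb -> E <= 4 * (ea + eb).
Proof. by move=> -> -> h1 h2 h3; rewrite -subr_ge0; nra. Qed.

Lemma triangle_arith (a b p q c A B D : R) :
  `|q - a| <= A -> `|p - b| <= B -> `|q + p - c| <= D -> `|a + b - c| <= A + B + D.
Proof. by rewrite !ler_norml; lra. Qed.

Lemma ext_arith (a b A B X Y e : R) : 0 <= A -> 0 <= B -> 0 <= X -> 0 <= Y ->
  a ^+ 2 <= 2 * A * X -> b ^+ 2 <= B * Y -> (Y + X) * (4 * A + 2 * B + 1) < e ->
  (a - b) ^+ 2 <= e.
Proof.
move=> n1 n2 n3 n4 H1 H2 Hf.
have H3 : (a - b) ^+ 2 <= 2 * a ^+ 2 + 2 * b ^+ 2.
  by have := sqr_ge0 (a + b); rewrite sqrrD sqrrB; lra.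
have h1 : 0 <= A * Y by exact: mulr_ge0.
have h2 : 0 <= B * X by exact: mulr_ge0.
have E : (Y + X) * (4 * A + 2 * B + 1) =
  4 * (A * Y) + 4 * (A * X) + 2 * (B * Y) + 2 * (B * X) + Y + X by ring.
by rewrite E in Hf; rewrite -mulrA in H1; lra.
Qed.

Lemma energy_arith (n0 n1 a0 a1 b0 b1 i0 i1 c : R) : n0 = a0 + 2 * c * i0 + c ^+ 2 * b0 ->
  n1 = a1 + 2 * c * i1 + c ^+ 2 * b1 ->
  n0 + n1 = (a0 + a1) + 2 * c * (i0 + i1) + c ^+ 2 * (b0 + b1).
Proof. by move=> -> ->; ring. Qed.

(** J is minimal up to t ^ 2 at v; compare its values at v + t f and v - t f. *)
Lemma euler_arith (m J D E t : R) : 0 < t ->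
  m <= J + t * D + t ^+ 2 / 2 * E -> m <= J + (- t) * D + (- t) ^+ 2 / 2 * E ->
  J < m + t ^+ 2 -> `|D| <= t * (1 + E / 2).
Proof.
move=> t0 h1 h2 h3; rewrite -(ler_pM2l t0) -{1}(gtr0_norm t0) -normrM ler_norml.
rewrite (_ : t * (t * (1 + E / 2)) = t ^+ 2 + t ^+ 2 / 2 * E); last by field.
rewrite sqrrN in h2.
by apply/andP; split; lra.
Qed.

End small_arith.

Section riesz.
Context {R : realType}.
Local Notation P2 := (R * R)%type.
Local Notation mu := (@leb2 R).
Context (O : set P2) (oO : open O) (bO : bounded_set O).
Implicit Types (f u v w : P2 -> R) (g h : 'I_2 -> P2 -> R).
Let mO : measurable O := open_measurable2 oO.
Let Ofin : (mu O < +oo)%E := bounded_leb2_lty mO bO.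
Local Notation ip := (ip O).
Local Notation nsq := (nsq O).
Local Notation test := (test_function O).
Local Notation energy := (energy O).
Local Notation ipg := (ipg O).
Let tL2 f : test f -> L2 O f. Proof. exact: testL2. Qed.
Let gL2 f i : test f -> L2 O (grad f i). Proof. exact: gradL2. Qed.

Definition axpy f (c : R) (k : P2 -> R) : P2 -> R := fun x => f x + c * k x.

Lemma test_axpy f c k : test f -> test k -> test (axpy f c k).
Proof. by move=> tf tk; apply: test_add => //; exact: test_scale. Qed.

Lemma grad_axpy f c k i x : test f -> test k ->
  grad (axpy f c k) i x = grad f i x + c * grad k i x.
Proof.
by move=> tf tk; rewrite /grad (partialD i x tf (test_scale c tk)) (partialZ c i x tk).
Qed.

Lemma energy_ge0 h : 0 <= energy h.
Proof. by apply: addr_ge0; exact: nsq_ge0. Qed.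

Lemma nsq_le_energy h i : nsq (h i) <= energy h.
Proof.
have [->|->] := ord2 i.
  by rewrite lerDl; exact: nsq_ge0.
by rewrite lerDr; exact: nsq_ge0.
Qed.

Lemma nsq_axpy u v c : L2 O u -> L2 O v ->
  nsq (axpy u c v) = nsq u + 2 * c * ip u v + c ^+ 2 * nsq v.
Proof.
move=> Lu Lv; have Lcv := L2_scale mO c Lv.
by rewrite (nsqD mO Lu Lcv) (nsqZ mO c Lv) (ipZr mO c Lv Lu) mulrA.
Qed.

Lemma energy_axpy f c k : test f -> test k ->
  energy (grad (axpy f c k)) = energy (grad f) + 2 * c * ipg (grad f) (grad k) + c ^+ 2 * energy (grad k).
Proof.
move=> tf tk.
have E i : nsq (grad (axpy f c k) i) = nsq (grad f i) + 2 * c * ip (grad f i) (grad k i) + c ^+ 2 * nsq (grad k i).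
  rewrite -(nsq_axpy c (gL2 i tf) (gL2 i tk)); apply: eq_Rintegral => x _.
  by rewrite /axpy (grad_axpy c i x tf tk).
exact: (energy_arith (E 0) (E 1)).
Qed.

Lemma ip_lim (p : nat -> P2 -> R) q f : (forall j, L2 O (p j)) -> L2 O q -> L2 O f ->
  (forall j, nsq (fun x => p j x - q x) <= 4 / 4 ^+ j) ->
  forall j, `|ip (p j) f - ip q f| <= 2 * (1 + nsq f) / 2 ^+ j.
Proof.
move=> Lp Lq Lf H j; rewrite -(ipBl mO (Lp j) Lq Lf).
have n0 := nsq_ge0 O f.
rewrite -mulrA [_ * 2 ^- _]mulrC mulrA.
apply: (cauchy_schwarz_norm mO (L2_sub mO (Lp j) Lq) Lf) => //.
- by rewrite addr_ge0.
- by rewrite -pow4_sqr.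
- by move: (nsq f) n0 => n n0; nra.
Qed.

(** The Riesz representation theorem in H^1_0: a minimising sequence of
    energy f / 2 - l f is a Cauchy sequence by the parallelogram law. *)
Lemma riesz (l : (P2 -> R) -> R) (C : R) :
  (forall f k c, test f -> test k -> l (axpy f c k) = l f + c * l k) ->
  (forall f, test f -> l f ^+ 2 <= C * energy (grad f)) ->
  exists u g, H10g O u g /\ forall f, test f -> ipg g (grad f) = l f.
Proof.
move=> llin lC; have [K K1 HK] := poincare oO bO.
have K0 : 0 < K by exact: lt_le_trans K1.
pose J f := energy (grad f) / 2 - l f.
have JE f c k : test f -> test k ->
    J (axpy f c k) = J f + c * (ipg (grad f) (grad k) - l k) + c ^+ 2 / 2 * energy (grad k).
  move=> tf tk; rewrite /J energy_axpy// llin//.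
  by move: (energy _) (energy _) (ipg _ _) (l f) (l k) => *; field.
pose S := [set J f | f in test].
have Jlb f : test f -> - (`|C| / 2) <= J f.
  move=> tf; have e0 := energy_ge0 (grad f).
  have H : l f ^+ 2 <= ((`|C| + energy (grad f)) / 2) ^+ 2.
    apply: le_trans (lC f tf) _.
    apply: (@le_trans _ _ (`|C| * energy (grad f))); first by rewrite ler_wpM2r// ler_norm.
    move: (energy _) (`|C|) => e c.
    have -> : ((c + e) / 2) ^+ 2 = c * e + ((c - e) / 2) ^+ 2 by field.
    by rewrite lerDl sqr_ge0.
  have H2 : l f <= (`|C| + energy (grad f)) / 2.
    have e1 : 0 <= (`|C| + energy (grad f)) / 2.
      by apply: divr_ge0 => //; apply: addr_ge0.
    apply: le_trans (ler_norm _) _; rewrite -ler_sqr ?nnegrE//.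
    by rewrite (real_normK (num_real (l f))).
  by rewrite /J; move: (energy _) H2 => e; lra.
have hS : has_inf S.
  split; first by exists (J (fun=> 0)), (fun=> 0) => //; exact: test0.
  by exists (- (`|C| / 2)) => _ [f tf <-]; exact: Jlb.
pose m := inf S.
have Jm f : test f -> m <= J f by move=> tf; apply: ge_inf hS.2 _ _; exists f.
(* Small enough for the increments of the minimising sequence to satisfy the
   hypothesis of L2_complete_fast. *)
pose ep j : R := (16 * K * 4 ^+ j * 2 ^+ j.+1)^-1.
have ep0 j : 0 < ep j by rewrite invr_gt0 !mulr_gt0// exprn_gt0.
have : forall j, exists f, test f /\ J f < m + ep j.
  by move=> j; have [_ [f tf <-] H] := inf_adherent (ep0 j) hS; exists f.
move=> /choice[v Hv].
have tv j : test (v j) by have [] := Hv j.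
have Jv j : J (v j) < m + ep j by have [] := Hv j.
pose d j := axpy (v j.+1) (-1) (v j).
have td j : test (d j) by exact: test_axpy.
have Ed j : energy (grad (d j)) <= 4 * (ep j + ep j.+1).
  have E1 : v j.+1 = axpy (v j) 1 (d j) by apply/funext => x; rewrite /axpy /d /axpy; ring.
  have J1 := JE (v j) 1 (d j) (tv j) (td j); rewrite -E1 in J1.
  have J2 := JE (v j) 2^-1 (d j) (tv j) (td j).
  exact: (parallelogram_arith J1 J2 (Jm _ (test_axpy _ (tv j) (td j))) (Jv j) (Jv j.+1)).
have epS j : ep j.+1 <= ep j.
  have P k : 0 < 16 * K * 4 ^+ k * 2 ^+ k.+1 by rewrite !mulr_gt0// exprn_gt0.
  rewrite /ep lef_pV2 ?posrE ?P//.
  rewrite (_ : 16 * K * 4 ^+ j.+1 * 2 ^+ j.+2 = 8 * (16 * K * 4 ^+ j * 2 ^+ j.+1)).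
    by rewrite ler_peMl ?(ltW (P j))// ler1n.
  by rewrite [4 ^+ j.+1]exprS [2 ^+ j.+2]exprS; ring.
have Ed' j : 4 ^+ j * (K * energy (grad (d j))) <= (2 ^ j.+1)%:R^-1.
  have : K * energy (grad (d j)) <= K * (8 * ep j).
    by rewrite ler_pM2l//; move: (Ed j) (epS j); move: (energy _) => e; lra.
  have p4 : 0 < 4 ^+ j :> R by rewrite exprn_gt0.
  have p2 : 0 < 2 ^+ j.+1 :> R by rewrite exprn_gt0.
  rewrite -(ler_pM2l p4) => /le_trans; apply; rewrite /ep natrX.
  rewrite (_ : 4 ^+ j * _ = (2 ^+ j.+1)^-1 / 2); last by field; rewrite !gt_eqF.
  by rewrite ler_pdivrMr// ler_peMr ?invr_ge0 ?(ltW p2)// ler1n.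
have nd j : 4 ^+ j * nsq (fun x => v j.+1 x - v j x) <= (2 ^ j.+1)%:R^-1.
  apply: le_trans (Ed' j); rewrite ler_wpM2l ?exprn_ge0//.
  apply: le_trans (HK _ (td j)); rewrite le_eqVlt; apply/orP; left; apply/eqP.
  by apply: eq_Rintegral => x _; rewrite /d /axpy mulN1r.
have ndi i j : 4 ^+ j * nsq (fun x => grad (v j.+1) i x - grad (v j) i x) <= (2 ^ j.+1)%:R^-1.
  apply: le_trans (Ed' j); rewrite ler_wpM2l ?exprn_ge0//.
  apply: (@le_trans _ _ (energy (grad (d j)))); last by rewrite ler_peMl// energy_ge0.
  apply: le_trans (nsq_le_energy _ i); rewrite le_eqVlt; apply/orP; left; apply/eqP.
  by apply: eq_Rintegral => x _; rewrite /d (grad_axpy (-1) i x (tv j.+1) (tv j)) mulN1r.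
have [u Lu Hu] := L2_complete_fast mO (fun j => tL2 (tv j)) nd.
have : forall i, exists w, L2 O w /\ forall j, nsq (fun x => grad (v j) i x - w x) <= 4 / 4 ^+ j.
  by move=> i; have [w Lw Hw] := L2_complete_fast mO (fun j => gL2 i (tv j)) (ndi i); exists w.
move=> /choice[g Hg].
have Lg i : L2 O (g i) by have [] := Hg i.
have Hgi i := (Hg i).2.
have wg : weak_grad O u g.
  apply/weak_gradP; split => // i f tf.
  have Lf := tL2 tf; have Lf' := gL2 i tf.
  have H1 := ip_lim (fun j => tL2 (tv j)) Lu Lf' Hu.
  have H2 := ip_lim (fun j => gL2 i (tv j)) (Lg i) Lf (Hgi i).
  apply/eqP; rewrite -addr_eq0; apply/eqP.
  apply: (@small_eq0 _ _ (2 * (1 + nsq (grad f i)) + 2 * (1 + nsq f))) => j.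
  have E : ip (v j) (grad f i) = - ip (grad (v j) i) f.
    by have /weak_gradP[_] := weak_grad_test oO bO (tv j); exact.
  have := H1 j; have := H2 j; rewrite E.
  move: (ip (grad (v j) i) f) (ip (g i) f) (ip u _) => a b c h1 h2.
  rewrite [X in _ <= X]mulrDl (_ : c + b = - (- a - c) - (a - b)); last by ring.
  by apply: le_trans (ler_normB _ _) _; rewrite normrN; apply: lerD.
exists u, g; split.
  split => // e e0.
  have c0 : 12 / 4 ^+ j @[j --> \oo] --> (0 : R).
    have := @cvg_geometric R 12 4^-1.
    rewrite ger0_norm ?invr_ge0// invf_lt1// ltr1n => /(_ isT).
    rewrite (_ : geometric _ _ = (fun j => 12 / 4 ^+ j))//.
    by apply/funext => j; rewrite /geometric /= exprVn.
  have /cvgr_lt/(_ _ e0) [N _ /(_ N (leqnn N)) HN] := c0.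
  exists (v N) => //; apply: le_lt_trans HN.
  have E k w : nsq (fun x => k x - w x) = nsq (fun x => w x - k x).
    by apply: eq_Rintegral => x _; ring.
  rewrite E /energy (E (g 0)) (E (g 1)).
  have := Hu N; have := Hgi 0 N; have := Hgi 1 N.
  move: (nsq _) (nsq _) (nsq _) => a b c; rewrite (_ : 12 / 4 ^+ N = 4 / 4 ^+ N + (4 / 4 ^+ N + 4 / 4 ^+ N)).
    by move=> *; rewrite lerD// lerD.
  by field; rewrite expf_neq0.
move=> f tf.
have H1 i := ip_lim (fun j => gL2 i (tv j)) (Lg i) (gL2 i tf) (Hgi i).
apply/eqP; rewrite -subr_eq0; apply/eqP.
apply: (@small_eq0 _ _ (2 * (1 + nsq (grad f 0)) + 2 * (1 + nsq (grad f 1)) + (1 + energy (grad f) / 2))) => j.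
have t0 : 0 < 2 ^- j :> R by rewrite invr_gt0 exprn_gt0.
have e2 : ep j <= (2 ^- j) ^+ 2.
  rewrite exprVn -exprM mulnC exprM (_ : 2 ^+ 2 = 4 :> R) -?natrX//.
  rewrite lef_pV2 ?posrE ?mulr_gt0 ?exprn_gt0// natrX.
  rewrite -mulrA mulrCA ler_peMr ?exprn_ge0//.
  have p1 : 1 <= 2 ^+ j.+1 :> R by rewrite exprn_ege1// ler1n.
  by have := ler_wpM2l (ltW K0) p1; rewrite mulr1; lra.
(* The Euler equation, by displacements of 2 ^- j f on both sides of v j. *)
have Jt := Jm _ (test_axpy (2 ^- j) (tv j) tf).
have Jt' := Jm _ (test_axpy (- 2 ^- j) (tv j) tf).
rewrite JE// in Jt; rewrite JE// in Jt'.
have Jlt : J (v j) < m + (2 ^- j) ^+ 2 by apply: lt_le_trans (Jv j) _; rewrite lerD2l.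
have T : `|ipg g (grad f) - l f| <= _ :=
  triangle_arith (H1 0 j) (H1 1 j) (euler_arith t0 Jt Jt' Jlt).
apply: (le_trans T).
move: (nsq _) (nsq _) (energy _) (2 ^- j) => a b c e.
by rewrite le_eqVlt; apply/orP; left; apply/eqP; ring.
Qed.

Lemma ipg_lin f c k g : (forall i, L2 O (g i)) -> test f -> test k ->
  ipg g (grad (axpy f c k)) = ipg g (grad f) + c * ipg g (grad k).
Proof.
move=> Lg tf tk; have E i : ip (g i) (grad (axpy f c k) i) =
    ip (g i) (grad f i) + c * ip (g i) (grad k i).
  rewrite -(ipZr mO c (gL2 i tk) (Lg i)) -(ipDr mO (gL2 i tf) (L2_scale mO c (gL2 i tk)) (Lg i)).
  by apply: eq_Rintegral => x _; rewrite (grad_axpy c i x tf tk).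
by rewrite /ipg (E 0) (E 1); move: (ip _ _) (ip _ _) (ip _ _) (ip _ _) => *; ring.
Qed.

Lemma ipg_le g h : (forall i, L2 O (g i)) -> (forall i, L2 O (h i)) ->
  ipg g h ^+ 2 <= 2 * energy g * energy h.
Proof.
move=> Lg Lh; have H0 := cauchy_schwarz mO (Lg 0) (Lh 0).
have H1 := cauchy_schwarz mO (Lg 1) (Lh 1).
have a0 := nsq_ge0 O (g 0); have a1 := nsq_ge0 O (g 1).
have b0 := nsq_ge0 O (h 0); have b1 := nsq_ge0 O (h 1).
rewrite /ipg /energy.
move: (ip (g 0) _) (ip (g 1) _) (nsq (g 0)) (nsq (g 1)) (nsq (h 0)) (nsq (h 1)) H0 H1 a0 a1 b0 b1
  => p q a b c d H0 H1 a0 b0 c0 d0.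
have := sqr_ge0 (p - q); rewrite sqrrB => hh.
have h1 : 0 <= a * d by exact: mulr_ge0.
have h2 : 0 <= b * c by exact: mulr_ge0.
rewrite sqrrD (_ : 2 * (a + b) * (c + d) = 2 * (a * c) + 2 * (b * d) + 2 * (a * d) + 2 * (b * c)); last by ring.
lra.
Qed.

Lemma ipgBr g h k : (forall i, L2 O (g i)) -> (forall i, L2 O (h i)) -> (forall i, L2 O (k i)) ->
  ipg g (fun i x => h i x - k i x) = ipg g h - ipg g k.
Proof.
move=> Lg Lh Lk; rewrite /ipg !(ipBr mO) //.
by move: (ip _ _) (ip _ _) (ip _ _) (ip _ _) => *; ring.
Qed.

(** Test functions exhaust H^1_0: a relation tested on them extends. *)
Lemma H10g_ext g q v h : (forall i, L2 O (g i)) -> L2 O q -> H10g O v h ->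
  (forall f, test f -> ipg g (grad f) = ip q f) -> ipg g h = ip q v.
Proof.
move=> Lg Lq [Lv wh Hv] H; have Lh i : L2 O (h i) by have [] := wh i.
apply/eqP; rewrite -subr_eq0 -sqrf_eq0 -normr_le0; apply/ler_addgt0Pl => e e0.
rewrite addr0.
pose M := 4 * energy g + 2 * nsq q + 1.
have M0 : 0 < M by rewrite ltr_wpDl// addr_ge0 ?mulr_ge0 ?nsq_ge0 ?energy_ge0.
have [f tf Hf] := Hv (e / M) (divr_gt0 e0 M0).
have Lf := tL2 tf; have Lgf i := gL2 i tf.
have E : ipg g h - ip q v = ipg g (fun i x => h i x - grad f i x) - ip q (fun x => v x - f x).
  by rewrite ipgBr// (ipBr mO Lv Lf Lq) (H f tf); move: (ipg _ _) (ip _ _) (ip _ _) => *; ring.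
rewrite E ger0_norm ?sqr_ge0//.
have H1 := ipg_le Lg (fun i => L2_sub mO (Lh i) (Lgf i)).
have H2 := cauchy_schwarz mO Lq (L2_sub mO Lv Lf).
have n1 := energy_ge0 g; have n2 := nsq_ge0 O q.
have n3 := energy_ge0 (fun i x => h i x - grad f i x); have n4 := nsq_ge0 O (fun x => v x - f x).
move: Hf; rewrite ltr_pdivlMr// => Hf.
exact: (ext_arith n1 n2 n3 n4 H1 H2 Hf).
Qed.

(** By density of the test functions. *)
Lemma H10g_poincare : exists2 K : R, 1 <= K & forall v h, H10g O v h -> nsq v <= K * energy h.
Proof.
have [K K1 HK] := poincare oO bO; exists (4 * K) => [|v h [Lv wh Hv]]; first by lra.
have Lh i : L2 O (h i) by have [] := wh i.
apply/ler_addgt0Pl => e e0.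
have K0 : 0 < 4 * K by lra.
have [f tf Hf] := Hv (e / (4 * K)) (divr_gt0 e0 K0).
have Lf := tL2 tf; have Lgf i := gL2 i tf.
have b1 (p q : P2 -> R) : L2 O p -> L2 O q -> nsq p <= 2 * nsq (fun x => p x - q x) + 2 * nsq q.
  move=> Lp Lq; have := nsqD_le mO (L2_sub mO Lp Lq) Lq.
  by congr (_ <= _); apply: eq_Rintegral => x _; ring.
have b2 (p q : P2 -> R) : L2 O p -> L2 O q -> nsq q <= 2 * nsq (fun x => p x - q x) + 2 * nsq p.
  move=> Lp Lq; have := nsqD_le mO (L2_opp mO (L2_sub mO Lp Lq)) Lp.
  rewrite (nsqN (L2_sub mO Lp Lq)).
  by congr (_ <= _); apply: eq_Rintegral => x _; ring.
have B0 := b1 _ _ Lv Lf; have B1 := HK f tf.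
have C0 := b2 _ _ (Lh 0) (Lgf 0); have C1 := b2 _ _ (Lh 1) (Lgf 1).
have n0 := nsq_ge0 O (fun x => v x - f x).
have m0 := nsq_ge0 O (fun x => h 0 x - grad f 0 x).
have m1 := nsq_ge0 O (fun x => h 1 x - grad f 1 x).
move: Hf B1; rewrite ltr_pdivlMr// /energy.
rewrite -[partial 0 f]/(grad f 0) -[partial 1 f]/(grad f 1).
move: B0 C0 C1 n0 m0 m1.
generalize (nsq (fun x => v x - f x)) (nsq v) (nsq f) (nsq (fun x => h 0 x - grad f 0 x))
 (nsq (fun x => h 1 x - grad f 1 x)) (nsq (grad f 0)) (nsq (grad f 1)) (nsq (h 0)) (nsq (h 1)).
move=> a n t p q c d x y B0 C0 C1 n0 m0 m1 Hf B1.
have : K * (c + d) <= K * (2 * p + 2 * x + (2 * q + 2 * y)) by rewrite ler_wpM2l; lra.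
have : a <= K * a by rewrite ler_peMl.
move: (ler_wpM2l (ltW (lt_le_trans ltr01 K1)) n0) (ler_wpM2l (ltW (lt_le_trans ltr01 K1)) m0)
  (ler_wpM2l (ltW (lt_le_trans ltr01 K1)) m1); rewrite mulr0.
nra.
Qed.

(** By density v may be tested against itself, which gives zero energy; conclude by
    the Poincare inequality. *)
Lemma H10g_harmonic0 v h : H10g O v h -> (forall f, test f -> ipg h (grad f) = 0) ->
  ae_eq mu O v (cst 0).
Proof.
move=> Hv H0; have [K _ HK] := H10g_poincare; have [Lv wh _] := Hv.
have Lh i : L2 O (h i) by have [] := wh i.
apply: nsq_eq0 => //; apply/eqP; rewrite eq_le nsq_ge0 andbT.
apply: le_trans (HK _ _ Hv) _.
have -> : energy h = ipg h h by [].
have L0 := L2_0 O.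
have ip0 (w : P2 -> R) : ip (fun=> 0) w = 0.
  by rewrite /ip (@eq_Rintegral _ _ _ _ _ (cst 0)) ?Rintegral_cst ?mul0r// => x _; rewrite mul0r.
by rewrite (H10g_ext Lh L0 Hv) ?ip0 ?mulr0// => f tf; rewrite H0// ip0.
Qed.

(** The Riesz representative of the functional - q; by density its equation holds
    against all of H^1_0. *)
Lemma inv_laplacian_exists q : L2 O q -> exists w g,
  [/\ H10g O w g, is_inv_laplacian O (distr O q) w &
      forall f, test f -> ipg g (grad f) = - ip q f].
Proof.
move=> Lq; have [K K1 HK] := poincare oO bO.
have Lq' := L2_opp mO Lq.
have [||w [g [Hw Hg]]] := @riesz (fun f => ip (fun x => - q x) f) (nsq q * K).
- move=> f k c tf tk; rewrite (ipDr mO (tL2 tf) (L2_scale mO c (tL2 tk)) Lq').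
  by rewrite (ipZr mO c (tL2 tk) Lq').
- move=> f tf; apply: le_trans (cauchy_schwarz mO Lq' (tL2 tf)) _.
  by rewrite (nsqN Lq) -mulrA ler_wpM2l ?nsq_ge0//; exact: HK.
exists w, g; split => //.
- split; first by apply/H10_H10g; exists g.
  move=> g' v h wg' /H10_H10g[h' Hv] wh.
  have Hw' := H10g_grad oO bO Hw wg'; have Hv' := H10g_grad oO bO Hv wh.
  have Lg' i : L2 O (g' i) by have [] := wg' i.
  have Lh i : L2 O (h i) by have [] := wh i.
  have [Lv _ _] := Hv'; have [_ wg _] := Hw.
  have Lg i : L2 O (g i) by have [] := wg i.
  have E : ipg g' h = ip (fun x => - q x) v.
    apply: (H10g_ext Lg' Lq' Hv') => f tf; rewrite -(Hg f tf).
    have Ei i : ip (g' i) (grad f i) = ip (g i) (grad f i).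
      apply: (ae_eq_ip mO (L2_meas (Lg' i)) (L2_meas (Lg i)) (L2_meas (gL2 i tf))).
      exact: (weak_grad_unique oO bO i wg' wg).
    by rewrite /ipg (Ei 0) (Ei 1).
  rewrite -[LHS]/(ip q v); apply: oppr_inj; rewrite opprK -(ipNl mO Lq Lv) -E.
  rewrite /ipg /ip -RintegralD//; [|exact: L2_mul_integrable..].
  apply: eq_Rintegral => x _; rewrite big_ord_recl big_ord1.
  by rewrite (_ : lift ord0 ord0 = 1)//; apply: val_inj.
- by move=> f tf; rewrite (Hg f tf) (ipNl mO Lq (tL2 tf)).
Qed.

Lemma inv_laplacian_H10g q w : L2 O q -> is_inv_laplacian O (distr O q) w ->
  exists2 g, H10g O w g & forall f, test f -> ipg g (grad f) = - ip q f.
Proof.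
move=> Lq [/H10_H10g[g Hw] H]; exists g => // f tf.
have [_ wg _] := Hw; have Lg i : L2 O (g i) by have [] := wg i.
have Hf : H10 O f by apply/H10_H10g; exists (grad f); exact: H10g_test.
have := H g f (grad f) wg Hf (weak_grad_test oO bO tf).
rewrite -[distr O q f]/(ip q f) => ->; rewrite opprK /ipg /ip.
rewrite -RintegralD//; [|by apply: L2_mul_integrable => //; exact: gL2..].
apply: eq_Rintegral => x _; rewrite big_ord_recl big_ord1.
by rewrite (_ : lift ord0 ord0 = 1)//; apply: val_inj.
Qed.

End riesz.

(** * Radial kernels *)

Section kernel1.
Context {R : realType}.
Local Notation leb := (@lebesgue_measure R).
Implicit Types f g h F : R -> R.

Lemma smooth1_of_derive F f : (forall t : R, is_derive t (1 : R) F (f t)) -> smooth1 f -> smooth1 F.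
Proof.
move=> DF sf; apply: (@smooth1_coind _ (fun h => h = F \/ smooth1 h)); last by left.
move=> h [->|sh]; first by exists f; [right|].
by exists (derive1 h); [right; exact: smooth1_derive|exact: smooth1P].
Qed.

Lemma is_derive_unique (f : R -> R) (x a b : R) :
  is_derive x (1 : R) f a -> is_derive x (1 : R) f b -> a = b.
Proof. by move=> [_ <-] [_ <-]. Qed.

(** The primitive that vanishes to the right of the support. *)
Lemma smooth1_prim f (a b : R) : smooth1 f -> (forall t, t <= a -> f t = 0) ->
  (forall t, b <= t -> f t = 0) ->
  exists F, (forall t : R, is_derive t (1 : R) F (f t)) /\ (forall t, b <= t -> F t = 0).
Proof.
move=> sf fa fb; have cf := smooth1_continuous sf.
pose G t := \int[leb]_(s in `[a - 1, t]) f s.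
have DG t : is_derive t (1 : R) G (f t).
  have [ta|ta] := ltP t a.
    rewrite fa ?ltW//; apply: (@near_eq_is_derive _ _ _ (cst 0)).
    near=> s; rewrite /G /Rintegral integral0_eq// => y /=; rewrite in_itv/= => /andP[_ ys].
    by rewrite fa// (le_trans ys)//; near: s; exact: lt_le_nbhsl.
  have ct : {for t, continuous f} by exact: cf.
  have iG : leb.-integrable `[a - 1, t + 1] (EFin \o f).
    by apply: continuous_compact_integrable; [exact: segment_compact|exact: continuous_subspaceT].
  have t1 : t < t + 1 by rewrite ltrDl.
  have at1 : a - 1 < t by rewrite (lt_le_trans _ ta)// ltrBlDr ltrDl.
  have [d1 d2] := continuous_FTC1_closed t1 iG at1 ct.
  by split; [exact: d1|rewrite -derive1E; exact: d2].
exists (fun t => G t - G b); split.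
  move=> t; have := is_deriveB (DG t) (is_derive_cst (G b) t 1).
  by rewrite subr0.
move=> t bt.
have [s sb] : exists2 s, s \in `[b, t] & G t - G b = f s * (t - b).
  apply: (MVT_segment bt (fun s _ => DG s)).
  by apply: derivable_within_continuous => s _; have [] := DG s.
by move: sb; rewrite in_itv/= => /andP[bs _] ->; rewrite fb// mul0r.
Unshelve. all: by end_near. Qed.

Section division.
Context (a : R) (a0 : 0 < a).

(** Functions vanishing to the left of a > 0 can be divided by t without losing
    smoothness: the class closed under this operation is closed under derivation. *)
Inductive divalg : (R -> R) -> Prop :=
| divalg_base f : smooth1 f -> (forall t, t < a -> f t = 0) -> divalg f
| divalg_div f : divalg f -> divalg (fun t => f t / t)
| divalg_sub f g : divalg f -> divalg g -> divalg (fun t => f t - g t).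

Lemma divalg0 f : divalg f -> forall t, t < a -> f t = 0.
Proof.
elim=> {f} [//|f _ IH t ta|f g _ IHf _ IHg t ta]; first by rewrite IH// mul0r.
by rewrite IHf// IHg// subr0.
Qed.

Lemma divalg_derive0 f (t : R) : divalg f -> t < a -> is_derive t (1 : R) f 0.
Proof.
move=> df ta; apply: (@near_eq_is_derive _ _ _ (cst 0)).
by near=> s; rewrite (divalg0 df)//; near: s; exact: lt_nbhsl.
Unshelve. all: by end_near. Qed.

Lemma divalg_smooth1 f : divalg f -> smooth1 f.
Proof.
move: f; apply: smooth1_coind => h; elim=> {h}.
- move=> f sf f0; exists (derive1 f); last exact: smooth1P.
  apply: divalg_base; first exact: smooth1_derive.
  move=> t ta; apply: (is_derive_unique (smooth1P sf t)).
  by apply: divalg_derive0 => //; exact: divalg_base.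
- move=> f af [f' af' Df].
  exists (fun t => f' t / t - f t / t / t).
    by apply: divalg_sub; [exact: divalg_div|do 2 apply: divalg_div].
  move=> t; have [ta|ta] := ltP t a.
    rewrite (divalg0 af ta) (divalg0 af' ta) !mul0r subr0.
    by apply: divalg_derive0 => //; exact: divalg_div.
  have t0 : t != 0 by rewrite gt_eqF// (lt_le_trans a0).
  have dinv : is_derive t 1 (fun y : R => y^-1) (- t ^- 2).
    have := @is_deriveV R id t 1 1 t0 (is_derive_id _ _).
    by rewrite /GRing.scale /= mulr1.
  apply: is_derive_eq (is_derive_mul (Df t) dinv) _.
  by rewrite -[_ / t / t]mulrA -invfM -expr2 mulrN.
- move=> f g af [f' af' Df] ag [g' ag' Dg].
  exists (fun t => f' t - g' t); first exact: divalg_sub.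
  by move=> t; exact: (is_deriveB (Df t) (Dg t)).
Qed.

End division.

(** The profile of the kernels as a function of the squared distance; it vanishes
    near 0, which makes the division by t in kernel_diff possible. *)
Definition bump1 (t : R) : R := flat (t - 4^-1) * flat (1 - t).

Lemma smooth1_sub (r : R) : smooth1 (fun t : R => t - r).
Proof. exact: (smooth1D (@smooth1_id R) (@smooth1_cst R (- r))). Qed.

Lemma smooth1_rsub (r : R) : smooth1 (fun t : R => r - t).
Proof.
have H := smooth1D (@smooth1_cst R r) (smooth1M (@smooth1_cst R (-1)) (@smooth1_id R)).
by have -> : (fun t : R => r - t) = (fun t => r + -1 * id t) by apply/funext => t; rewrite mulN1r.
Qed.

Lemma smooth1_bump1 : smooth1 bump1.
Proof.
by apply: smooth1M; apply: smooth1_comp; rewrite ?smooth1_flat//;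
  [exact: smooth1_flat|exact: smooth1_sub|exact: smooth1_flat|exact: smooth1_rsub].
Qed.

Lemma bump1_le t : t <= 4^-1 -> bump1 t = 0.
Proof. by move=> t4; rewrite /bump1 flat_le0 ?mul0r// subr_le0. Qed.

Lemma bump1_ge t : 1 <= t -> bump1 t = 0.
Proof. by move=> t4; rewrite /bump1 [flat (1 - t)]flat_le0 ?mulr0// subr_le0. Qed.

Lemma bump1_ge0 t : 0 <= bump1 t. Proof. by rewrite mulr_ge0 ?flat_ge0. Qed.

Lemma derive1_supp0 h (t : R) (A : set R) : open A -> A t -> smooth1 h ->
  (forall s, A s -> h s = 0) -> derive1 h t = 0.
Proof.
move=> oA At sh h0; apply: (is_derive_unique (smooth1P sh t)).
apply: (@near_eq_is_derive _ _ _ (cst 0)).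
by apply: filterS (open_nbhs_nbhs (conj oA At)) => s /h0 ->.
Qed.

Lemma derive1_bump1_ge t : 1 <= t -> derive1 bump1 t = 0.
Proof.
rewrite le_eqVlt => /predU1P[<-|t1]; last first.
  apply: (@derive1_supp0 _ _ `]1, +oo[%classic); [exact: interval_open|by rewrite /= in_itv/= t1|exact: smooth1_bump1|].
  by move=> s /=; rewrite in_itv/= andbT => /ltW/bump1_ge.
have c := smooth1_continuous (smooth1_derive smooth1_bump1).
apply/eqP; rewrite -normr_le0; apply/ler_addgt0Pl => e e0; rewrite addr0.
have /cvgrPdist_lt/(_ _ e0)/nbhs_ballP[d /= d0 H] := c 1.
have /= := H (1 + d / 2); rewrite -ball_normE /= opprD addrA subrr add0r normrN.
have d2 : 0 < d / 2 by rewrite divr_gt0.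
rewrite (gtr0_norm d2) => /(_ _)/ltW; have -> : derive1 bump1 (1 + d / 2) = 0.
  apply: (@derive1_supp0 _ _ `]1, +oo[%classic); [exact: interval_open|by rewrite /= in_itv/= ltrDl d2|exact: smooth1_bump1|].
  by move=> s /=; rewrite in_itv/= andbT => /ltW/bump1_ge.
by rewrite subr0; apply; lra.
Qed.

Lemma bounded_on_itv h (A B : R) : continuous h -> exists2 M : R, 0 <= M & forall t, A <= t <= B -> `|h t| <= M.
Proof.
move=> ch; have := continuous_compact (continuous_subspaceT ch) (@segment_compact R A B).
move=> /compact_bounded[M [Mr HM]]; exists (`|M| + 1) => [|t tAB]; first by rewrite addr_ge0.
apply: HM; first by rewrite (le_lt_trans (ler_norm _))// ltrDl.
by exists t => //; rewrite /= in_itv/=.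
Qed.

(** The scaling gives all radial kernels the same mass on the plane. *)
Definition kprof (r t : R) : R := bump1 (t / r ^+ 2) / r ^+ 2.

Lemma smooth1_kprof r : smooth1 (kprof r).
Proof.
have H := smooth1M (smooth1_comp smooth1_bump1 (smooth1M (@smooth1_id R) (@smooth1_cst R (r ^- 2))))
  (@smooth1_cst R (r ^- 2)).
exact: H.
Qed.

Lemma kprof_ge0 r t : 0 < r -> 0 <= kprof r t.
Proof. by move=> r0; rewrite divr_ge0 ?bump1_ge0// exprn_ge0// ltW. Qed.

Lemma kprof_ge r t : 0 < r -> r ^+ 2 <= t -> kprof r t = 0.
Proof.
by move=> r0 rt; rewrite /kprof bump1_ge ?mul0r// ler_pdivlMr ?mul1r// exprn_gt0.
Qed.

(** The difference of two kernels is a Laplacian: with t = |y - x| ^ 2, the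
    Laplacian of g (t) is 4 (t g' (t))', and t g' (t) has compact support
    away from 0 because the kernels have the same mass. *)
Lemma kernel_diff (r s : R) : 0 < r -> 0 < s -> exists g g' g'' : R -> R,
  [/\ smooth1 g, forall t : R, is_derive t (1 : R) g (g' t),
      forall t : R, is_derive t (1 : R) g' (g'' t),
      forall t, Num.max (r ^+ 2) (s ^+ 2) <= t -> g t = 0 &
      forall t, 4 * g' t + 4 * t * g'' t = kprof r t - kprof s t].
Proof.
move=> r0 s0.
have [m [Dm m1]] := smooth1_prim smooth1_bump1 bump1_le bump1_ge.
have sm : smooth1 m by exact: smooth1_of_derive Dm smooth1_bump1.
have mc t : t < 4^-1 -> m t = m 0.
  move=> t4.
  have cm : {within `[Num.min t 0, Num.max t 0], continuous m}.
    by apply: derivable_within_continuous => y _; have [] := Dm y.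
  have tm : Num.min t 0 <= Num.max t 0 by rewrite ge_min !le_max lexx.
  have [y] := MVT_segment tm (fun y _ => Dm y) cm.
  rewrite in_itv/= => /andP[_]; rewrite le_max => ymax.
  rewrite bump1_le; last first.
    by case/orP : ymax => yt; rewrite (le_trans yt)// ?(ltW t4)// invr_ge0.
  rewrite mul0r => /eqP; rewrite subr_eq0 => /eqP.
  by rewrite /Num.min /Num.max; case: ltP => _ ->.
have r2 : 0 < r ^+ 2 by rewrite exprn_gt0.
have s2 : 0 < s ^+ 2 by rewrite exprn_gt0.
(* P will be t g' (t). *)
pose P t := 4^-1 * (m (t / r ^+ 2) - m (t / s ^+ 2)).
have Dms q (t : R) : is_derive t (1 : R) (fun t : R => m (t / q ^+ 2)) (kprof q t).
  have D1 : is_derive t (1 : R) (fun t : R => t / q ^+ 2) (q ^- 2).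
    have := is_derive_mul (is_derive_id t 1) (is_derive_cst (q ^- 2 : R) t 1).
    by rewrite mul1r mulr0 addr0.
  exact: (is_derive1_comp (Dm _) D1).
have DP (t : R) : is_derive t (1 : R) P (4^-1 * (kprof r t - kprof s t)).
  have := is_derive_mul (is_derive_cst (4^-1 : R) t 1) (is_deriveB (Dms r t) (Dms s t)).
  by rewrite mul0r add0r.
have sP : smooth1 P.
  apply: smooth1_of_derive DP _; apply: smooth1M; first exact: smooth1_cst.
  have -> : (fun t => kprof r t - kprof s t) = (fun t => kprof r t + -1 * kprof s t).
    by apply/funext => t; rewrite mulN1r.
  apply: smooth1D; first exact: smooth1_kprof.
  by apply: smooth1M; [exact: smooth1_cst|exact: smooth1_kprof].
pose a := Num.min (r ^+ 2) (s ^+ 2) / 4; pose b := Num.max (r ^+ 2) (s ^+ 2).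
have a0 : 0 < a by rewrite divr_gt0// lt_min r2.
have Pa t : t < a -> P t = 0.
  rewrite ltr_pdivlMr// lt_min => /andP[tr ts].
  rewrite /P !mc ?subrr ?mulr0//.
    by rewrite ltr_pdivrMr// mulrC ltr_pdivlMr.
  by rewrite ltr_pdivrMr// mulrC ltr_pdivlMr.
have Pb t : b <= t -> P t = 0.
  rewrite ge_max => /andP[rt st].
  by rewrite /P !m1 ?subrr ?mulr0// ler_pdivlMr ?mul1r.
pose Q t := P t / t.
have sQ : smooth1 Q by apply: (divalg_smooth1 a0); apply: divalg_div; exact: divalg_base.
have Qa t : t <= a / 2 -> Q t = 0.
  by move=> ta; rewrite /Q Pa ?mul0r// (le_lt_trans ta)// ltr_pdivrMr// ltr_pMr// ltr1n.
have Qb t : b <= t -> Q t = 0 by move=> bt; rewrite /Q Pb// mul0r.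
have [g [Dg gb]] := smooth1_prim sQ Qa Qb.
exists g, Q, (derive1 Q); split.
- exact: smooth1_of_derive Dg sQ.
- exact: Dg.
- exact: smooth1P.
- exact: gb.
- move=> t.
  have [t0|t0] := eqVneq t 0.
    rewrite t0 mulr0 mul0r addr0 Qa ?mulr0; last by rewrite ltW// divr_gt0.
    rewrite /kprof !mul0r bump1_le; last by rewrite invr_ge0.
    by rewrite !mul0r subrr.
  have D1 : is_derive t (1 : R) (fun t : R => t * Q t) (Q t + t * derive1 Q t).
    have := is_derive_mul (is_derive_id t 1) (smooth1P sQ t).
    by rewrite mul1r.
  have D2 : is_derive t (1 : R) (fun t : R => t * Q t) (4^-1 * (kprof r t - kprof s t)).
    have -> : (fun t : R => t * Q t) = P; last exact: DP.
    apply/funext => y; rewrite /Q mulrCA; have [->|y0] := eqVneq y 0; last by rewrite divff// mulr1.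
    by rewrite mul0r mulr0 Pa.
  by rewrite -mulrA -mulrDr (is_derive_unique D1 D2); field.
Qed.

End kernel1.

Section radial_functions.
Context {R : realType}.
Local Notation P2 := (R * R)%type.
Local Notation e := (unit_vec R).
Implicit Types (h : R -> R) (O : set P2).

Definition pcoord (i : 'I_2) (z : P2) : R := if i == 0 then z.1 else z.2.
Definition dist2 (x y : P2) : R := (y.1 - x.1) ^+ 2 + (y.2 - x.2) ^+ 2.
Definition radial h (x y : P2) : R := h (dist2 x y).
Definition sbox (x : P2) (r : R) : set P2 := cbox (x.1 - r) (x.1 + r) (x.2 - r) (x.2 + r).

Lemma sboxP (x y : P2) r : sbox x r y <-> `|y.1 - x.1| <= r /\ `|y.2 - x.2| <= r.
Proof. by rewrite /sbox; split => [/cboxP|[] H1 H2]; [rewrite !ler_norml; lra|apply/cboxP; move: H1 H2; rewrite !ler_norml; lra]. Qed.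

Lemma is_derive_coord (y : P2) i j : is_derive y (e j) (pcoord i) (i == j)%:R.
Proof.
rewrite /pcoord; case: i => -[|[|//]] Hi /=.
  have -> : (Ordinal Hi == j) = (j == 0) by rewrite eq_sym.
  exact: is_derive_fst.
have -> : (Ordinal Hi == j) = (j != 0).
  by case: j => -[|[|//]] Hj.
exact: is_derive_snd.
Qed.

Lemma is_derive_dist2 (x y : P2) i : is_derive y (e i) (dist2 x) (2 * (pcoord i y - pcoord i x)).
Proof.
have D1 j : is_derive y (e i) (fun y => pcoord j y - pcoord j x) (j == i)%:R.
  have := is_deriveB (is_derive_coord y j i) (is_derive_cst (pcoord j x) y (e i)).
  by rewrite subr0.
have D2 j := is_derive_mul (D1 j) (D1 j).
have := is_derive_add (D2 0) (D2 1).
have -> : (fun y0 : P2 => (pcoord 0 y0 - pcoord 0 x) * (pcoord 0 y0 - pcoord 0 x) +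
            (pcoord 1 y0 - pcoord 1 x) * (pcoord 1 y0 - pcoord 1 x)) = dist2 x.
  by apply/funext => z; rewrite /dist2 !expr2.
move=> H; apply: is_derive_eq H _.
by case: i D1 D2 => -[|[|//]] Hi _ _ /=; rewrite /pcoord /=; ring.
Qed.

Lemma is_derive_rad h h' (x y : P2) i : (forall t : R, is_derive t (1 : R) h (h' t)) ->
  is_derive y (e i) (radial h x) (h' (dist2 x y) * (2 * (pcoord i y - pcoord i x))).
Proof. by move=> Dh; exact: (is_derive_compl (Dh _) (is_derive_dist2 x y i)). Qed.

Lemma smooth_on_dist2 x : smooth_on setT (dist2 x).
Proof.
have oT : open [set: P2] by exact: openT.
have s1 := smooth_on_sub oT (smooth_on_fst oT) (smooth_on_cst x.1 oT).
have s2 := smooth_on_sub oT (smooth_on_snd oT) (smooth_on_cst x.2 oT).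
have := smooth_on_add oT (smooth_on_mul oT s1 s1) (smooth_on_mul oT s2 s2).
by under eq_fun do rewrite -!expr2.
Qed.

Lemma smooth_rad h x : smooth1 h -> smooth_on setT (radial h x).
Proof. by move=> sh; exact: (smooth_on_comp openT sh (smooth_on_dist2 x)). Qed.

Lemma rad_out h x y r : 0 < r -> (forall t, r ^+ 2 <= t -> h t = 0) -> ~ box (x.1 - r) (x.1 + r) (x.2 - r) (x.2 + r) y ->
  radial h x y = 0.
Proof.
move=> r0 hr ny; apply: hr; rewrite /dist2.
have [h1|h1] := leP r `|y.1 - x.1|.
  rewrite -[leLHS]addr0 lerD ?sqr_ge0// -[leRHS]real_normK ?num_real//.
  by rewrite ler_sqr ?nnegrE ?(ltW r0).
have [h2|h2] := leP r `|y.2 - x.2|.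
  rewrite -[leLHS]add0r lerD ?sqr_ge0// -[leRHS]real_normK ?num_real//.
  by rewrite ler_sqr ?nnegrE ?(ltW r0).
exfalso; apply: ny; apply/boxP; move: h1 h2; rewrite !ltr_norml; lra.
Qed.

Lemma test_rad O h x r : 0 < r -> smooth1 h -> (forall t, r ^+ 2 <= t -> h t = 0) ->
  sbox x r `<=` O -> test_function O (radial h x).
Proof.
move=> r0 sh hr xO; apply: test_box (smooth_rad x sh) xO _ => y.
exact: rad_out.
Qed.

Lemma laplacian_rad g g' g'' (x y : P2) : (forall t : R, is_derive t (1 : R) g (g' t)) ->
  (forall t : R, is_derive t (1 : R) g' (g'' t)) ->
  partial 0 (partial 0 (radial g x)) y + partial 1 (partial 1 (radial g x)) y =
  4 * g' (dist2 x y) + 4 * dist2 x y * g'' (dist2 x y).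
Proof.
move=> Dg Dg'.
have E i : partial i (radial g x) = fun y => radial g' x y * (2 * (pcoord i y - pcoord i x)).
  by apply/funext => z; have [_ E] := is_derive_rad x z i Dg; exact: E.
have D i : partial i (partial i (radial g x)) y =
    g'' (dist2 x y) * (2 * (pcoord i y - pcoord i x)) * (2 * (pcoord i y - pcoord i x)) + 2 * g' (dist2 x y).
  rewrite E.
  have D1 : is_derive y (e i) (fun y => 2 * (pcoord i y - pcoord i x)) 2.
    have := is_derive_mul (is_derive_cst (2 : R) y (e i))
      (is_deriveB (is_derive_coord y i i) (is_derive_cst (pcoord i x) y (e i))).
    by rewrite eqxx subr0 mul0r add0r mulr1.
  have [_ E2] := is_derive_mul (is_derive_rad x y i Dg') D1.
  rewrite /partial E2.
  by rewrite /radial mulrC [X in _ + X]mulrC; ring.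
by rewrite !D /dist2 /pcoord /=; ring.
Qed.

End radial_functions.

(** * Differentiation under the integral sign *)

Section bounds.
Context {R : realType}.
Local Notation P2 := (R * R)%type.
Local Notation mu := (@leb2 R).
Local Notation e := (unit_vec R).
Implicit Types (f g u b N : P2 -> R) (O : set P2).

Lemma RintD O f g : measurable O -> mu.-integrable O (EFin \o f) -> mu.-integrable O (EFin \o g) ->
  \int[mu]_(x in O) (f x + g x) = \int[mu]_(x in O) f x + \int[mu]_(x in O) g x.
Proof. by move=> mO i1 i2; rewrite RintegralD. Qed.

Lemma RintB O f g : measurable O -> mu.-integrable O (EFin \o f) -> mu.-integrable O (EFin \o g) ->
  \int[mu]_(x in O) (f x - g x) = \int[mu]_(x in O) f x - \int[mu]_(x in O) g x.
Proof. by move=> mO i1 i2; rewrite RintegralB. Qed.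

Lemma RintZ O (c : R) f : measurable O -> mu.-integrable O (EFin \o f) ->
  \int[mu]_(x in O) (c * f x) = c * \int[mu]_(x in O) f x.
Proof. by move=> mO i1; rewrite RintegralZl. Qed.

Lemma le_Rint O f g : measurable O -> mu.-integrable O (EFin \o f) -> mu.-integrable O (EFin \o g) ->
  (forall x, O x -> f x <= g x) -> \int[mu]_(x in O) f x <= \int[mu]_(x in O) g x.
Proof. by move=> mO i1 i2 fg; apply: le_Rintegral. Qed.

Lemma integrable2B O f g : measurable O -> mu.-integrable O (EFin \o f) -> mu.-integrable O (EFin \o g) ->
  mu.-integrable O (EFin \o (fun x => f x - g x)).
Proof.
move=> mO i1 i2; have mOm : @measurable _ (measurableTypeR R * measurableTypeR R)%type O := mO.
by have := integrableB mOm i1 i2; apply: eq_integrable.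
Qed.

Lemma integrable2D O f g : measurable O -> mu.-integrable O (EFin \o f) -> mu.-integrable O (EFin \o g) ->
  mu.-integrable O (EFin \o (fun x => f x + g x)).
Proof.
move=> mO i1 i2; have mOm : @measurable _ (measurableTypeR R * measurableTypeR R)%type O := mO.
by have := integrableD mOm i1 i2; apply: eq_integrable.
Qed.

Lemma integrable2Z O (c : R) f : measurable O -> mu.-integrable O (EFin \o f) ->
  mu.-integrable O (EFin \o (fun x => c * f x)).
Proof.
move=> mO i1; have mOm : @measurable _ (measurableTypeR R * measurableTypeR R)%type O := mO.
by have := integrableZl mOm c i1; apply: eq_integrable.
Qed.

Lemma quad_is_derive f (x v : P2) (d C : R) :
  (forall h : R, `|h| <= 1 -> `|f (h *: v + x) - f x - h * d| <= C * h ^+ 2) ->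
  is_derive x v f d.
Proof.
move=> H.
suff K : (fun h : R => h^-1 *: (f (h *: v + x) - f x)) @ 0^' --> d.
  by split; [apply/cvg_ex; exists d|apply: cvg_lim].
apply/cvgrPdist_le => eps eps0; near=> h.
have h0 : h != 0 by near: h; exact: nbhs_dnbhs_neq.
have h1 : `|h| <= 1 by near: h; apply: dnbhs0_le.
have C1 : 0 < `|C| + 1 by rewrite ltr_wpDl.
have hC : `|h| * (`|C| + 1) <= eps.
  by rewrite -ler_pdivlMr//; near: h; apply: dnbhs0_le; rewrite divr_gt0.
have -> : d - h^-1 *: (f (h *: v + x) - f x) = - (h^-1 * (f (h *: v + x) - f x - h * d)).
  by rewrite /GRing.scale/= [in RHS]mulrBr mulKf// opprB.
rewrite normrN normrM normfV ler_pdivrMl ?normr_gt0//.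
apply: (le_trans (H _ h1)); rewrite -real_normK ?num_real// expr2 mulrCA ler_wpM2l//.
by apply: le_trans hC; rewrite [leRHS]mulrC ler_wpM2r// (le_trans (ler_norm _))// lerDl.
Unshelve. all: by end_near. Qed.

Lemma cont_bounded_box g (M : R) : continuous g ->
  exists2 B : R, 0 <= B & forall z, `|z| <= M -> `|g z| <= B.
Proof.
move=> cg; have cK : compact (g @` (`[- M, M] `*` `[- M, M])).
  by apply: continuous_compact; [exact: continuous_subspaceT|exact: compact_box].
have [B [Br HB]] := compact_bounded cK; exists (`|B| + 1); first by rewrite addr_ge0.
move=> z zM; apply: HB; first by rewrite (le_lt_trans (ler_norm _))// ltrDl.
exists z => //; move: zM; rewrite prod_normE ge_max !ler_norml => /andP[h1 h2].
by split; rewrite /= in_itv.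
Qed.

Lemma smooth_lip_box N (M : R) : smooth_on setT N -> exists2 L : R, 0 <= L &
  forall z z' : P2, `|z| <= M -> `|z'| <= M -> `|N z' - N z| <= L * `|z' - z|.
Proof.
move=> sN.
have cN i : continuous (partial i N) by move=> x; apply: (smooth_on_cont (smooth_on_partial i sN)).
have [B0 B00 HB0] := cont_bounded_box (3 * M) (cN 0).
have [B1 B10 HB1] := cont_bounded_box (3 * M) (cN 1).
exists (B0 + B1) => [|z z' zM zM']; first exact: addr_ge0.
set v := z' - z.
have vM : `|v| <= 2 * M by rewrite (le_trans (ler_normB _ _))// mulr_natl mulr2n lerD.
have [s s1 Es] := mvt_line (df := fun y => v.1 * partial 0 N y + v.2 * partial 1 N y)
  (x := z) (v := v) (h := 1) (fun s _ => is_derive_dir v openT sN (I : setT (s *: v + z))).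
move: Es; rewrite scale1r mulr1 subrK => ->.
have sM : `|s *: v + z| <= 3 * M.
  rewrite (le_trans (ler_normD _ _))// normrZ.
  have -> : 3 * M = 2 * M + M by ring.
  apply: lerD => //; apply: le_trans vM; rewrite ler_piMl//.
  by rewrite normr1 in s1.
have [v1 v2] : `|v.1| <= `|v| /\ `|v.2| <= `|v| by rewrite prod_normE !le_max !lexx orbT.
rewrite (le_trans (ler_normD _ _))// [leRHS]mulrDl !normrM ![`|_ : R| * `|partial _ _ _|]mulrC.
exact: (lerD (ler_pM (normr_ge0 _) (normr_ge0 _) (HB0 _ sM) v1) (ler_pM (normr_ge0 _) (normr_ge0 _) (HB1 _ sM) v2)).
Qed.

Lemma int_mul_bounded O u b (M : R) : measurable O -> mu.-integrable O (EFin \o u) ->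
  measurable_fun O b -> (forall x, O x -> `|b x| <= M) ->
  mu.-integrable O (EFin \o (fun x => u x * b x)) /\
  `|\int[mu]_(x in O) (u x * b x)| <= M * \int[mu]_(x in O) `|u x|.
Proof.
move=> mO iu mb bM.
have mOm : @measurable _ (measurableTypeR R * measurableTypeR R)%type O := mO.
have mu0 : measurable_fun O u by apply/measurable_EFinP; exact: (measurable_int mu).
have iMu := integrableZl mOm M iu.
have le x : O x -> `|u x * b x| <= M * `|u x|.
  by move=> Ox; rewrite normrM mulrC ler_wpM2r// bM.
have iub : mu.-integrable O (EFin \o (fun x => u x * b x)).
  apply: (@le_integrable _ _ _ mu O mOm _ (fun x => M%:E * (EFin \o u) x)%E) => //.
    by apply/measurable_EFinP; exact: measurable_funM.
  move=> x Ox /=; rewrite lee_fin normrM mulrC [leRHS]normrM ler_wpM2r//.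
  by rewrite (le_trans (bM x Ox))// ler_norm.
have inu : mu.-integrable O (EFin \o (fun x => `|u x|)) by exact: (integrable_abse iu).
split => //; apply: (le_trans (le_normr_Rintegral mOm iub)).
rewrite -(RintZ M mO inu); apply: (le_Rint mO).
- exact: (integrable_abse iub).
- exact: integrable2Z.
- exact: le.
Qed.

End bounds.

Section convolution.
Context {R : realType}.
Local Notation P2 := (R * R)%type.
Local Notation mu := (@leb2 R).
Local Notation e := (unit_vec R).
Context (O : set P2) (u : P2 -> R) (mO : measurable O) (bO : bounded_set O)
  (iu : mu.-integrable O (EFin \o u)).
Let mOm : @measurable _ (measurableTypeR R * measurableTypeR R)%type O := mO.

Definition convol (N : P2 -> R) (x : P2) : R := \int[mu]_(y in O) (u y * N (y - x)).

Lemma bounded_norm : exists2 M : R, 0 < M & forall y, O y -> `|y| <= M.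
Proof.
have [M M0 H] := bounded_sub_box bO; exists M => // y /H/norm_box; exact: ltW.
Qed.

Lemma shift_measurable (N : P2 -> R) x : continuous N -> measurable_fun O (fun y => N (y - x)).
Proof.
move=> cN; apply: (measurable_funS (E := setT)) => //.
apply: cont_measurable; first exact: openT.
by move=> y _; apply: continuous_comp; [apply: cvgB; [exact: cvg_id|exact: cvg_cst]|exact: cN].
Qed.

Lemma conv_integrable (N : P2 -> R) x : continuous N ->
  mu.-integrable O (EFin \o (fun y => u y * N (y - x))).
Proof.
move=> cN; have [M M0 HM] := bounded_norm.
have [B B0 HB] := cont_bounded_box (M + `|x|) cN.
apply: (int_mul_bounded (M := B) mO iu _ _).1; first exact: shift_measurable.
by move=> y Oy; apply: HB; rewrite (le_trans (ler_normB _ _))// lerD2r HM.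
Qed.

(** By the mean value theorem, the difference quotients of N approach its derivative
    at a rate that is uniform for y in the bounded set O. *)
Lemma conv_derive (N : P2 -> R) i x : smooth_on setT N ->
  is_derive x (e i) (convol N) (convol (fun z => - partial i N z) x).
Proof.
move=> sN; have [M M0 HM] := bounded_norm.
have spN := smooth_on_partial i sN.
have cN : continuous N by move=> z; exact: (smooth_on_cont sN).
have cpN : continuous (partial i N) by move=> z; exact: (smooth_on_cont spN).
have cnpN : continuous (fun z => - partial i N z) by move=> z; apply: cvgN; exact: cpN.
have [L L0 HL] := smooth_lip_box (M + `|x| + 1) spN.
apply: (@quad_is_derive _ _ _ _ _ (L * \int[mu]_(y in O) `|u y|)) => h h1.
have i1 := conv_integrable (h *: e i + x) cN.
have i2 := conv_integrable x cN.
have i3 := conv_integrable x cnpN.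
have i3' := integrable2Z h mO i3.
have i12 := integrable2B mO i1 i2.
have -> : convol N (h *: e i + x) - convol N x - h * convol (fun z => - partial i N z) x =
    \int[mu]_(y in O) (u y * (N (y - (h *: e i + x)) - N (y - x) - h * - partial i N (y - x))).
  rewrite /convol -(RintZ h mO i3) -(RintB mO i1 i2) -(RintB mO i12 i3').
  by apply: eq_Rintegral => y _; ring.
rewrite mulrAC; apply: (int_mul_bounded mO iu _ _).2.
  have m1 := shift_measurable (h *: e i + x) cN.
  have m2 := shift_measurable x cN.
  have m3 := shift_measurable x cnpN.
  by apply: measurable_funB; [exact: measurable_funB|exact: measurable_funM].
move=> y Oy; set z := y - x.
have -> : y - (h *: e i + x) = (- h) *: e i + z by rewrite scaleNr opprD addrCA.
have [s sh ->] := mvt_line (h := - h) (x := z) (v := e i) (df := partial i N)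
  (fun s _ => smooth_onP sN i (I : setT (s *: e i + z))).
rewrite normrN in sh.
have -> : partial i N (s *: e i + z) * - h - h * - partial i N z =
   - h * (partial i N (s *: e i + z) - partial i N z) by ring.
rewrite normrM normrN -[h ^+ 2]real_normK ?num_real// expr2 mulrCA ler_wpM2l//.
have zM : `|z| <= M + `|x| by rewrite (le_trans (ler_normB _ _))// lerD2r HM.
apply: (le_trans (HL _ _ _ _)).
- by rewrite (le_trans zM)// lerDl.
- rewrite (le_trans (ler_normD _ _))// norm_scale_unit_vec [leRHS]addrC lerD//.
  exact: le_trans sh h1.
- by rewrite ler_wpM2l// addrK norm_scale_unit_vec.
Qed.

Lemma conv_continuous (N : P2 -> R) : smooth_on setT N -> continuous (convol N).
Proof.
move=> sN x; have [M M0 HM] := bounded_norm.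
have cN : continuous N by move=> z; exact: (smooth_on_cont sN).
have [L L0 HL] := smooth_lip_box (M + `|x| + 1) sN.
set I0 := \int[mu]_(y in O) `|u y|.
have I00 : 0 <= I0 by apply: Rintegral_ge0.
apply/cvgrPdist_le => eps eps0.
have K0 : 0 < L * I0 + 1 by rewrite ltr_wpDl// mulr_ge0.
have d0 : 0 < Num.min 1 (eps / (L * I0 + 1)) by rewrite lt_min ltr01 divr_gt0.
apply: (filterS _ (nbhsx_ballx x _ d0)) => x'; rewrite -ball_normE /= lt_min => /andP[x1 x2].
have -> : convol N x - convol N x' = \int[mu]_(y in O) (u y * (N (y - x) - N (y - x'))).
  rewrite /convol -(RintB mO (conv_integrable x cN) (conv_integrable x' cN)).
  by apply: eq_Rintegral => y _; rewrite mulrBr.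
have H : (L * `|x - x'|) * I0 <= eps.
  rewrite mulrAC; apply: (@le_trans _ _ ((L * I0 + 1) * `|x - x'|)).
    by rewrite ler_wpM2r// lerDl.
  by rewrite mulrC -ler_pdivlMr// ltW.
apply: le_trans H; apply: (int_mul_bounded mO iu _ _).2.
  by apply: measurable_funB; exact: shift_measurable.
have xx : `|x'| <= `|x| + 1.
  have := ler_normB x (x - x'); rewrite opprB addrC subrK => h.
  by rewrite (le_trans h)// lerD2l ltW.
move=> y Oy; apply: (le_trans (HL _ _ _ _)).
- rewrite (le_trans (ler_normB _ _))// -addrA lerD//; exact: HM.
- by rewrite (le_trans (ler_normB _ _))// -addrA lerD ?HM// lerDl.
- by rewrite ler_wpM2l// subBB_swap subrr sub0r normrN.
Qed.

Lemma smooth_conv (N : P2 -> R) : smooth_on setT N -> smooth_on setT (convol N).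
Proof.
move=> sN; apply: (@smooth_on_coind _ _ (fun f => exists2 N, smooth_on setT N & f = convol N)); [exact: openT| |by exists N].
move=> _ [{sN}N sN ->]; split; first by move=> x _; exact: conv_continuous.
move=> i; exists (convol (fun z => - partial i N z)).
  by exists (fun z => - partial i N z); [exact: (smooth_on_opp openT (smooth_on_partial i sN))|].
by move=> x _; exact: conv_derive.
Qed.

End convolution.

(** * Translation invariance and Fubini *)

Section translation.
Context {R : realType}.
Local Notation P2 := (R * R)%type.
Local Notation mu := (@leb2 R).
Local Notation leb := (@lebesgue_measure R).
(* The plane with the product of the Borel structures of the line spelled out. *)
Local Notation M2 := (measurableTypeR R * measurableTypeR R)%type.

Lemma measurable_add (c : R) : measurable_fun [set: measurableTypeR R] (fun x : measurableTypeR R => x + c : measurableTypeR R).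
Proof. by apply: measurable_funD => //; exact: measurable_id. Qed.

Local Notation pushM := measure_function_pushforward__canonical__measure_function_Measure.

Lemma leb_shift (c : R) (A : set (measurableTypeR R)) : measurable A ->
  leb ((fun x => x + c) @^-1` A) = leb A.
Proof.
move=> mA; have H := @lebesgue_measure_unique R (pushM leb (measurable_add c)).
rewrite [RHS]H//= => X [[a b] _ <-]; rewrite /pushforward.
have -> : (fun x : R => x + c) @^-1` [set` `]a, b]%R] = [set` `]a - c, b - c]%R].
  by apply/seteqP; split => x; rewrite /= !in_itv/= ltrBlDr lerBrDr.
rewrite !lebesgue_measure_itv/= !lte_fin ltrD2r.
by case: ltP => // _; rewrite -!EFinB opprB addrA subrK.
Qed.

Lemma measurable_shift (v : P2) : measurable_fun [set: M2] (fun y : M2 => y + v : M2).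
Proof.
exact: (measurable_fun_pair
  (measurableT_comp (measurable_add v.1) (@measurable_fst _ _ (measurableTypeR R) (measurableTypeR R)))
  (measurableT_comp (measurable_add v.2) (@measurable_snd _ _ (measurableTypeR R) (measurableTypeR R)))).
Qed.

(** The product measure is determined by its values on rectangles. *)
Lemma leb2_shift (v : P2) (A : set M2) : measurable A -> mu ((fun y => y + v) @^-1` A) = mu A.
Proof.
move=> mA.
have H := @product_measure_unique _ _ _ _ R leb leb (pushM (@leb2 R) (measurable_shift v)).
rewrite [RHS]H//= => X Y mX mY; rewrite /pushforward.
have -> : (fun y : P2 => y + v) @^-1` (X `*` Y) =
    ((fun x => x + v.1) @^-1` X) `*` ((fun x => x + v.2) @^-1` Y) by [].
rewrite -(leb_shift v.1 mX) -(leb_shift v.2 mY).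
apply: product_measure1E; rewrite -[X in measurable X]setTI; exact: measurable_add.
Qed.

Lemma ge0_int_shift (v : P2) (f : P2 -> \bar R) : measurable_fun [set: M2] f ->
  (forall x, 0 <= f x)%E -> (\int[mu]_x f (x + v)%R = \int[mu]_x f x)%E.
Proof.
move=> mf f0.
have := ge0_integral_pushforward (measurable_shift v) mu measurableT mf (fun y _ => f0 y).
rewrite preimage_setT => <-.
apply: (@eq_measure_integral _ _ _ _ mu (pushM mu (measurable_shift v))) => A mA _.
by rewrite /= /pushforward leb2_shift.
Qed.

Lemma Rint_shift (v : P2) (f : P2 -> R) : measurable_fun [set: P2] f ->
  \int[mu]_x f (x + v) = \int[mu]_x f x.
Proof.
move=> mf; have mE : measurable_fun [set: M2] (EFin \o f) by exact/measurable_EFinP.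
rewrite /Rintegral (integralE mu setT (fun x => (f (x + v))%:E)) (integralE mu setT (fun x => (f x)%:E)).
have := ge0_int_shift v (measurable_funepos mE) (funepos_ge0 _).
have := ge0_int_shift v (measurable_funeneg mE) (funeneg_ge0 _).
have E1 : (fun x => (f (x + v))%:E)^\+%E = (fun x => (EFin \o f)^\+%E (x + v)).
  by apply/funext => x; rewrite !funeposE.
have E2 : (fun x => (f (x + v))%:E)^\-%E = (fun x => (EFin \o f)^\-%E (x + v)).
  by apply/funext => x; rewrite !funenegE.
by rewrite E1 E2 => -> ->.
Qed.

End translation.

Section fubini.
Context {R : realType}.
Local Notation P2 := (R * R)%type.
Local Notation mu := (@leb2 R).
Local Notation M2 := (measurableTypeR R * measurableTypeR R)%type.

Lemma Rfubini (f : P2 * P2 -> R) (g h : P2 -> R) : measurable_fun [set: M2 * M2] f ->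
  mu.-integrable setT (EFin \o g) -> mu.-integrable setT (EFin \o h) ->
  (forall x y, `|f (x, y)| <= g x * h y) ->
  \int[mu]_x (\int[mu]_y f (x, y)) = \int[mu]_y (\int[mu]_x f (x, y)).
Proof.
move=> mf ig ih fgh.
have mT : @measurable _ M2 setT by exact: measurableT.
have mg : measurable_fun [set: M2] g by apply/measurable_EFinP; exact: (measurable_int mu).
have mh : measurable_fun [set: M2] h by apply/measurable_EFinP; exact: (measurable_int mu).
have mEf : measurable_fun [set: M2 * M2] (EFin \o f) by exact/measurable_EFinP.
have mx x : measurable_fun [set: M2] (fun y => f (x, y)) by exact: measurable_fun_pair2.
have my y : measurable_fun [set: M2] (fun x => f (x, y)) by exact: measurable_fun_pair1.
have ix x : mu.-integrable [set: M2] (EFin \o (fun y => f (x, y))).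
  apply: (@le_integrable _ _ _ mu setT mT _ (fun y => (g x)%:E * (EFin \o h) y)%E).
  - by apply/measurable_EFinP; exact: mx.
  - by move=> y _ /=; rewrite lee_fin (le_trans (fgh x y))// ler_norm.
  - exact: integrableZl.
have iy y : mu.-integrable [set: M2] (EFin \o (fun x => f (x, y))).
  apply: (@le_integrable _ _ _ mu setT mT _ (fun x => (h y)%:E * (EFin \o g) x)%E).
  - by apply/measurable_EFinP; exact: my.
  - by move=> x _ /=; rewrite lee_fin (le_trans (fgh x y))// mulrC ler_norm.
  - exact: integrableZl.
have if2 : (mu \x mu)%E.-integrable [set: M2 * M2] (EFin \o f).
  apply/integrable12ltyP => //.
  have ihn := integrable_abse ih; have ign := integrable_abse ig.
  set H := (\int[mu]_y `|(h y)%:E|)%E.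
  have Hf : H \is a fin_num by exact: integrable_fin_num ihn.
  apply: (@le_lt_trans _ _ (\int[mu]_x (`|(g x)%:E| * H))%E).
    apply: ge0_le_integral => //.
    - by move=> x _; exact: integral_ge0.
    - have mabs : measurable_fun [set: M2 * M2] (abse \o (EFin \o f)) by exact: measurableT_comp.
      exact: (@measurable_fun_fubini_tonelli_F _ _ _ _ _ mu _ mabs (fun z => abse_ge0 _)).
    - by apply: emeasurable_funM; [do 2 apply: measurableT_comp => //|exact: measurable_cst].
    move=> x _; rewrite /H -ge0_integralZl//; last by do 2 apply: measurableT_comp => //.
    apply: ge0_le_integral => //.
    - by do 2 apply: measurableT_comp => //.
    - by apply: emeasurable_funM; [exact: measurable_cst|do 2 apply: measurableT_comp => //].
    by move=> y _; rewrite /= lee_fin (le_trans (fgh x y))// -normrM ler_norm.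
  under eq_integral do rewrite muleC.
  rewrite ge0_integralZl//; [|do 2 apply: measurableT_comp => //|exact: integral_ge0].
  have Gf : (\int[mu]_x `|(g x)%:E|)%E \is a fin_num by exact: integrable_fin_num ign.
  by rewrite -(fineK Gf) -(fineK Hf) -EFinM ltry.
have F := Fubini if2.
rewrite /Rintegral; congr fine.
transitivity (\int[mu]_x \int[mu]_y (EFin \o f) (x, y))%E.
  by apply: eq_integral => x _; rewrite fineK//; exact: integrable_fin_num (ix x).
rewrite F; apply: eq_integral => y _; rewrite fineK//; exact: integrable_fin_num (iy y).
Qed.

End fubini.

(** * Continuous functions and averages *)

Section continuous_fundamental_lemma.
Context {R : realType}.
Local Notation P2 := (R * R)%type.
Local Notation mu := (@leb2 R).
Implicit Types (w : P2 -> R) (O : set P2).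

(** A nonzero value of a continuous function persists on a ball, and balls have
    positive measure. *)
Lemma ae_cont0 O w : open O -> (forall x, O x -> {for x, continuous w}) ->
  ae_eq mu O w (cst 0) -> forall x, O x -> w x = 0.
Proof.
move=> oO cw w0 x Ox; apply: contrapT => /eqP wx.
have nO : nbhs x O by exact: open_nbhs_nbhs.
have nw : \forall y \near x, w y != 0.
  have /cvgrPdist_lt/(_ `|w x|) := cw x Ox; rewrite normr_gt0 => /(_ wx).
  apply: filterS => y; apply: contraTN => /eqP ->; by rewrite subr0 ltxx.
have /nbhs_ballP[r /= r0 H] : \forall y \near x, O y /\ w y != 0 by exact: filterI.
move: H; rewrite ball_boxE => H.
have mB := measurable_box (x.1 - r) (x.1 + r) (x.2 - r) (x.2 + r).
have : mu.-negligible (box (x.1 - r) (x.1 + r) (x.2 - r) (x.2 + r)).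
  by apply: negligibleS w0 => y /H [Oy wy] /= /(_ Oy)/eqP; exact/negP.
move/(negligibleP mu mB) => m0.
have := @leb2_box R (x.1 - r) (x.1 + r) (x.2 - r) (x.2 + r).
have -> : mu (box (x.1 - r) (x.1 + r) (x.2 - r) (x.2 + r)) = 0%E by exact: m0.
move=> /(_ ltac:(lra) ltac:(lra)) [/esym/eqP]; apply/negP; rewrite mulf_neq0//; lra.
Qed.

Lemma cbox_integrable O w a b c d : open O -> (forall x, O x -> {for x, continuous w}) ->
  cbox a b c d `<=` O -> measurable_fun O w -> mu.-integrable (box a b c d) (EFin \o w).
Proof.
move=> oO cw bO mw; have mB := measurable_box a b c d.
have cK : compact (w @` cbox a b c d).
  apply: continuous_compact; last exact: compact_box.
  by apply: continuous_in_subspaceT => x /set_mem/bO; exact: cw.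
apply: (@measurable_bounded_integrable _ _ _ mu w _ mB) => //.
- exact: box_lty.
- apply: measurable_funS mw; [exact: open_measurable2|exact: subset_trans (@box_cbox _ _ _ _ _) bO].
have [M [Mr HM]] := compact_bounded cK; exists M; split => // M' /HM H x Bx.
by apply: H; exists x => //; exact: box_cbox.
Qed.

Lemma cont_fund_lemma O w : open O -> (forall x, O x -> {for x, continuous w}) ->
  (forall f, test_function O f -> \int[mu]_(x in O) (w x * f x) = 0) ->
  forall x, O x -> w x = 0.
Proof.
move=> oO cw w0; apply: ae_cont0 => //.
have mw := cont_measurable oO cw.
by apply: fund_lemma => // a b c d bO; exact: cbox_integrable oO cw bO mw.
Qed.

End continuous_fundamental_lemma.

Section mass.
Context {R : realType}.
Local Notation P2 := (R * R)%type.
Local Notation mu := (@leb2 R).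
Implicit Types (h : R -> R) (x y : P2).

Lemma radB h x y : radial h 0 (y - x) = radial h x y.
Proof. by rewrite /radial /dist2 /= !subr0. Qed.

Lemma radC h x y : radial h x y = radial h y x.
Proof. by rewrite /radial /dist2; congr h; ring. Qed.

Lemma rad_cont h x : smooth1 h -> continuous (radial h x).
Proof. by move=> sh y; exact: (smooth_on_cont (smooth_rad x sh)). Qed.

Lemma rad_measurable h x : smooth1 h -> measurable_fun setT (radial h x).
Proof. by move=> sh; apply: cont_measurable => [|y _]; [exact: openT|exact: rad_cont]. Qed.

Lemma rad_far h x y r : 0 < r -> (forall t, r ^+ 2 <= t -> h t = 0) -> radial h x y != 0 -> `|y - x| < r.
Proof.
move=> r0 hr; rewrite -radB; apply: contra_neqT; rewrite -leNgt => ry.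
apply: (rad_out r0 hr); rewrite !sub0r !add0r => /norm_box; apply/negP.
by rewrite -leNgt.
Qed.

Lemma bsupp_rad h x r : 0 < r -> (forall t, r ^+ 2 <= t -> h t = 0) -> bsupp (radial h x).
Proof.
move=> r0 hr; exists (`|x| + r) => [|y yr]; first by rewrite ltr_wpDl.
apply/eqP; apply: contraTT yr => /(rad_far r0 hr) yx; rewrite -ltNge.
have := ler_normD (y - x) x; rewrite subrK => h1; lra.
Qed.

Lemma rad_integrable h x r : 0 < r -> smooth1 h -> (forall t, r ^+ 2 <= t -> h t = 0) ->
  mu.-integrable setT (EFin \o radial h x).
Proof. by move=> r0 sh hr; apply: bsupp_integrable; [exact: rad_cont|exact: bsupp_rad hr]. Qed.

Lemma int_rad h x : smooth1 h -> \int[mu]_y radial h x y = \int[mu]_y radial h 0 y.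
Proof.
move=> sh; have := Rint_shift (- x) (rad_measurable 0 sh).
by under eq_fun do rewrite radB.
Qed.

Definition kmass : R := \int[mu]_y radial (kprof 1) 0 y.

(** The kernels of radii r and 1 differ by the Laplacian of a function of bounded
    support, whose integral vanishes. *)
Lemma int_kprof r x : 0 < r -> \int[mu]_y radial (kprof r) x y = kmass.
Proof.
move=> r0; rewrite int_rad; last exact: smooth1_kprof.
have [g [g' [g'' [sg Dg Dg' g0 gE]]]] := kernel_diff r0 (ltr01 : 0 < 1 :> R).
have sR i : smooth (partial i (radial g 0)).
  by apply/smooth_onT; apply: smooth_on_partial; exact: smooth_rad.
pose N : R := r + 1.
have N0 : 0 < N by rewrite addr_gt0.
have gN t : N ^+ 2 <= t -> g t = 0.
  move=> tN; apply: g0; rewrite ge_max; apply/andP; split; apply: le_trans tN.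
    by rewrite ler_sqr ?nnegrE ?(ltW r0) ?(ltW N0)// lerDl.
  by rewrite ler_sqr ?nnegrE ?ler01 ?(ltW N0)// lerDr ltW.
have bR i : bsupp (partial i (radial g 0)) by apply/bsupp_partial/bsupp_rad/gN.
have cpp i : continuous (partial i (partial i (radial g 0))).
  by move=> y; apply: (smooth_on_cont (smooth_on_partial i ((smooth_onT _).1 (sR i)))).
have ipp i : mu.-integrable setT (EFin \o partial i (partial i (radial g 0))).
  by apply: bsupp_integrable; [exact: cpp|exact: bsupp_partial].
apply/eqP; rewrite -subr_eq0 -RintB//; last 2 first.
- exact: (rad_integrable 0 r0 (@smooth1_kprof R r) (fun t => kprof_ge r0)).
- apply: (rad_integrable 0 ltr01 (@smooth1_kprof R 1) (fun t => kprof_ge ltr01)).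
apply/eqP; transitivity (\int[mu]_y (partial 0 (partial 0 (radial g 0)) y + partial 1 (partial 1 (radial g 0)) y)).
  by apply: eq_Rintegral => y _; rewrite (laplacian_rad _ _ Dg Dg') gE.
rewrite (RintD _ (ipp 0) (ipp 1))//.
transitivity (0 + 0 : R); last exact: addr0.
congr (_ + _); first exact: (int_partial0 0 (sR 0) (bR 0)).
exact: (int_partial0 1 (sR 1) (bR 1)).
Qed.

Lemma kmass_gt0 : 0 < kmass.
Proof.
have rg0 y : 0 <= radial (kprof 1) 0 y by exact: kprof_ge0.
have ir := rad_integrable 0 ltr01 (@smooth1_kprof R 1) (fun t => kprof_ge ltr01).
rewrite lt_neqAle Rintegral_ge0 ?andbT//; apply/eqP => k0.
have H : (\int[mu]_y `|(radial (kprof 1) 0 y)%:E| = 0)%E.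
  transitivity (kmass%:E); last by rewrite -k0.
  rewrite /kmass /Rintegral fineK; last exact: (integrable_fin_num _ ir).
  by apply: eq_integral => y _; rewrite /= ger0_norm.
have : ae_eq mu setT (EFin \o radial (kprof 1) 0) (cst 0%E).
  by apply/(ae_eq_integral_abs mu measurableT) => //; exact: (measurable_int mu ir).
move=> ae0.
have ae1 : ae_eq mu setT (radial (kprof 1) 0) (cst 0).
  by apply: filterS ae0 => y Hy _; have [] := Hy I.
have := ae_cont0 openT (fun y _ => @rad_cont _ 0 (@smooth1_kprof R 1) y) ae1 (I : setT (3 / 4, 0)).
rewrite /radial /dist2 /kprof /= expr1n !divr1 !subr0 expr0n /= addr0.
by apply/eqP; rewrite gt_eqF// /bump1 mulr_gt0// flat_gt0//; lra.
Qed.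

End mass.

(** * Weyl's lemma *)

Section margins.
Context {R : realType}.
Local Notation P2 := (R * R)%type.
Implicit Types (O K : set P2) (x : P2).

Lemma sbox_near x x' (r d : R) : ball x d x' -> sbox x' r `<=` ball x (d + r).
Proof.
by rewrite !ball_boxE => /boxP H y /sboxP; rewrite !ler_norml => h; apply/boxP; split; lra.
Qed.

Lemma sboxS x (r s : R) : r <= s -> sbox x r `<=` sbox x s.
Proof. by move=> rs y /sboxP[h1 h2]; apply/sboxP; split; exact: le_trans rs. Qed.

Lemma margin O x : open O -> O x ->
  exists2 r : R, 0 < r & forall x', ball x r x' -> sbox x' r `<=` O.
Proof.
move=> oO Ox; have /nbhs_ballP[d /= d0 dO] : nbhs x O by exact: open_nbhs_nbhs.
exists (d / 2) => [|x' xx']; first by rewrite divr_gt0.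
by apply: subset_trans dO; rewrite [d in ball _ d](splitr d); exact: sbox_near.
Qed.

Lemma compact_margin K O : compact K -> open O -> K `<=` O ->
  exists2 r : R, 0 < r & forall x, K x -> sbox x r `<=` O.
Proof.
move=> cK oO KO.
have cov x : K x -> \forall x' \near x & r \near (0 : R)^'+, sbox x' r `<=` O.
  move=> /KO Ox; have [d d0 dO] := margin oO Ox.
  exists (ball x d, [set r : R | r < d]); first by split => /=; [exact: nbhsx_ballx|exact: nbhs_right_lt].
  by move=> [x' r] /= [xx' rd]; apply: subset_trans (dO _ xx'); apply: sboxS; exact: ltW.
have H := (compact_near_coveringP K).1 cK _ _ (fun r x => sbox x r `<=` O) _ cov.
have [r [Hr r0]] : exists r : R, (K `<=` fun x => sbox x r `<=` O) /\ 0 < r.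
  apply: (@filter_ex _ (0 : R)^'+); apply: filterI; [exact: H|exact: nbhs_right_gt].
by exists r.
Qed.

End margins.

Section weyl.
Context {R : realType}.
Local Notation P2 := (R * R)%type.
Local Notation mu := (@leb2 R).
Local Notation M2 := (measurableTypeR R * measurableTypeR R)%type.
Local Notation k r := (radial (kprof r) (0 : P2)).

Definition weakly_harmonic (O : set P2) (u : P2 -> R) := forall f, test_function O f ->
  \int[mu]_(x in O) (u x * (partial 0 (partial 0 f) x + partial 1 (partial 1 f) x)) = 0.

Lemma smooth_k (r : R) : smooth_on setT (k r).
Proof. by apply: smooth_rad; exact: (@smooth1_kprof R r). Qed.

Lemma k_cont (r : R) : continuous (k r).
Proof. by apply: rad_cont; exact: (@smooth1_kprof R r). Qed.

Section convolution_symmetry.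
Context (O : set P2) (mO : measurable O) (bO : bounded_set O) (h : R -> R) (sh : smooth1 h)
  (r : R) (r0 : 0 < r) (hr : forall t, r ^+ 2 <= t -> h t = 0).

Lemma radial_bounded : exists2 B : R, 0 <= B & forall x y : P2, `|radial h x y| <= B.
Proof.
have [B B0 HB] := bounded_on_itv 0 (r ^+ 2) (smooth1_continuous sh).
exists B => // x y; rewrite /radial; have [tr|tr] := leP (dist2 x y) (r ^+ 2).
  by apply: HB; rewrite tr addr_ge0// sqr_ge0.
by rewrite hr ?normr0// ltW.
Qed.

(** Fubini, for a kernel that is symmetric in its two arguments. *)
Lemma conv_sym (u p : P2 -> R) : mu.-integrable O (EFin \o u) -> mu.-integrable O (EFin \o p) ->
  \int[mu]_(x in O) (convol O u (radial h 0) x * p x) =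
  \int[mu]_(y in O) (u y * convol O p (radial h 0) y).
Proof.
move=> iu ip; have [B B0 HB] := radial_bounded.
pose f (z : P2 * P2) : R := (u \_ O) z.2 * radial h z.1 z.2 * (p \_ O) z.1.
have ch : continuous (radial h (0 : P2)) by exact: rad_cont.
have iuO : mu.-integrable setT (EFin \o (u \_ O)).
  by have := (integrable_mkcond (mu := mu) (EFin \o u) mO).1 iu; rewrite restrict_EFin.
have ipO : mu.-integrable setT (EFin \o (p \_ O)).
  by have := (integrable_mkcond (mu := mu) (EFin \o p) mO).1 ip; rewrite restrict_EFin.
have mT : @measurable _ M2 setT by exact: measurableT.
have mf : measurable_fun [set: M2 * M2] f.
  have m1 : measurable_fun [set: M2] (u \_ O) by apply/measurable_EFinP; exact: (measurable_int mu).
  have m2 : measurable_fun [set: M2] (p \_ O) by apply/measurable_EFinP; exact: (measurable_int mu).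
  have f1 : measurable_fun [set: M2 * M2] (fun z : M2 * M2 => z.1.1 : measurableTypeR R).
    exact: (measurableT_comp (@measurable_fst _ _ _ _) (@measurable_fst _ _ _ _)).
  have f2 : measurable_fun [set: M2 * M2] (fun z : M2 * M2 => z.1.2 : measurableTypeR R).
    exact: (measurableT_comp (@measurable_snd _ _ _ _) (@measurable_fst _ _ _ _)).
  have f3 : measurable_fun [set: M2 * M2] (fun z : M2 * M2 => z.2.1 : measurableTypeR R).
    exact: (measurableT_comp (@measurable_fst _ _ _ _) (@measurable_snd _ _ _ _)).
  have f4 : measurable_fun [set: M2 * M2] (fun z : M2 * M2 => z.2.2 : measurableTypeR R).
    exact: (measurableT_comp (@measurable_snd _ _ _ _) (@measurable_snd _ _ _ _)).
  have mh : measurable_fun [set: R] h by exact: continuous_measurable_fun (smooth1_continuous sh).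
  apply: measurable_funM; last exact: (measurableT_comp m2 (@measurable_fst _ _ _ _)).
  apply: measurable_funM; first exact: (measurableT_comp m1 (@measurable_snd _ _ _ _)).
  apply: (measurableT_comp mh); rewrite /dist2.
  by apply: measurable_funD; apply: measurable_funX; apply: measurable_funB.
have F := @Rfubini R f (fun x => B * `|(p \_ O) x|) (fun y => `|(u \_ O) y|) mf _ _ _.
transitivity (\int[mu]_x \int[mu]_y f (x, y)); last transitivity (\int[mu]_y \int[mu]_x f (x, y)).
- rewrite Rintegral_mkcond; apply: eq_Rintegral => x _; rewrite /f /= !patchE.
  case: ifPn => xO; last first.
    by rewrite (@eq_Rintegral _ _ _ _ _ (cst 0)) ?Rintegral_cst ?mul0r// => y _; rewrite mulr0.
  rewrite mulrC /convol -(RintZ _ mO (conv_integrable mO bO iu x ch)) Rintegral_mkcond.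
  apply: eq_Rintegral => y _; rewrite !patchE; case: ifPn => yO; last by rewrite !mul0r.
  by rewrite radB mulrC.
- apply: F.
  + by apply: integrable2Z => //; exact: (integrable_abse ipO).
  + exact: (integrable_abse iuO).
  + by move=> x y; rewrite /f /= !normrM mulrAC -mulrA mulrC ler_wpM2r// mulrC ler_wpM2r//.
- rewrite [RHS]Rintegral_mkcond; apply: eq_Rintegral => y _; rewrite /f /= !patchE.
  case: ifPn => yO; last first.
    by rewrite (@eq_Rintegral _ _ _ _ _ (cst 0)) ?Rintegral_cst ?mul0r// => x _; rewrite !mul0r.
  rewrite /convol -(RintZ _ mO (conv_integrable mO bO ip y ch)) [RHS]Rintegral_mkcond.
  apply: eq_Rintegral => x _; rewrite !patchE; case: ifPn => xO; last by rewrite !mulr0.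
  by rewrite radB radC -mulrA [_ * p x]mulrC.
Qed.

End convolution_symmetry.

Section smoothing.
Context (O : set P2) (oO : open O) (bO : bounded_set O) (u : P2 -> R)
  (iu : mu.-integrable O (EFin \o u)) (hu : weakly_harmonic O u).
Let mO : measurable O := open_measurable2 oO.

(** The kernels of the two radii differ by the Laplacian of a test function of O. *)
Lemma conv_radius (r s : R) x : 0 < r -> 0 < s -> sbox x r `<=` O -> sbox x s `<=` O ->
  convol O u (k r) x = convol O u (k s) x.
Proof.
move=> r0 s0 rO sO.
have [g [g' [g'' [sg Dg Dg' g0 gE]]]] := kernel_diff r0 s0.
pose N := Num.max r s.
have N0 : 0 < N by rewrite lt_max r0.
have gN t : N ^+ 2 <= t -> g t = 0.
  move=> Nt; apply: g0; apply: le_trans Nt; rewrite ge_max.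
  by rewrite !ler_sqr ?nnegrE ?(ltW r0) ?(ltW s0) ?(ltW N0)// !le_max !lexx orbT.
have NO : sbox x N `<=` O by rewrite /N /Num.max; case: ifP.
have := hu (test_rad N0 sg gN NO) => E.
apply/eqP; rewrite -subr_eq0 /convol.
rewrite -(RintB mO (conv_integrable mO bO iu x (@k_cont r)) (conv_integrable mO bO iu x (@k_cont s))).
apply/eqP; rewrite -[RHS]E; apply: eq_Rintegral => y _.
by rewrite (laplacian_rad _ _ Dg Dg') gE !radB -mulrBr.
Qed.

(** Some radius of a square around x inside O. *)
Definition inner_radius x : R := xget 1 [set r | 0 < r /\ sbox x r `<=` O].
(** The average of u around x.  By conv_radius it does not depend on the radius, and
    is therefore locally a convolution with one fixed kernel. *)
Definition smoothing x : R := convol O u (k (inner_radius x)) x / @kmass R.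

Lemma smoothingE (r : R) x : 0 < r -> sbox x r `<=` O -> smoothing x = convol O u (k r) x / @kmass R.
Proof.
move=> r0 rO; rewrite /smoothing; congr (_ / _).
have [i0 iO] : [set r | 0 < r /\ sbox x r `<=` O] (inner_radius x) by apply: xgetPex; exists r.
exact: conv_radius.
Qed.

Lemma smooth_smoothing : smooth_on O smoothing.
Proof.
move=> s x Ox; have [r r0 rO] := margin oO Ox.
have oB : open (ball x r) by exact: ball_open.
suff H : smooth_on (ball x r) smoothing by exact: (H s x (ballxx _ r0)).
apply: (eq_smooth_on (f := fun y => (@kmass R)^-1 * convol O u (k r) y) oB).
  by move=> y xy; rewrite (smoothingE r0 (rO _ xy)) mulrC.
apply: smooth_on_scale => //; apply: smooth_onS (@subsetT _ _) _.
exact: (smooth_conv mO bO iu (@smooth_k r)).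
Qed.

(** The kernel has mass kmass and vanishes beyond the distance r, within which f
    varies by at most L r. *)
Lemma conv_test_near f (M L r : R) y : test_function O f -> 0 < r <= 1 ->
  (forall z z' : P2, `|z| <= M + 1 -> `|z'| <= M + 1 -> `|f z' - f z| <= L * `|z' - z|) ->
  0 <= L -> `|y| <= M -> mu.-integrable O (EFin \o f) ->
  `|convol O f (k r) y - @kmass R * f y| <= @kmass R * L * r.
Proof.
move=> tf /andP[r0 r1] HL L0 yM iff.
have sk := @smooth1_kprof R r.
have ik := rad_integrable y r0 sk (fun t => @kprof_ge _ _ t r0).
have mT : measurable [set: P2] by exact: (measurableT : @measurable _ M2 setT).
have ifk : mu.-integrable setT (EFin \o (fun x => f x * radial (kprof r) y x)).
  apply: bsupp_integrable; last by apply: bsuppW (test_bsupp tf) _ => x ->; rewrite mul0r.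
  by move=> x; apply: cvgM; [exact: test_cont tf x|exact: rad_cont].
have iyk := integrable2Z (f y) mT ik.
have -> : convol O f (k r) y = \int[mu]_x (f x * radial (kprof r) y x).
  rewrite /convol Rintegral_mkcond; apply: eq_Rintegral => x _; rewrite patchE radB.
  by case: ifPn => //; rewrite notin_setE => /(test_out tf) ->; rewrite mul0r.
have -> : @kmass R * f y = \int[mu]_x (f y * radial (kprof r) y x).
  by rewrite (RintZ _ mT ik) int_kprof// mulrC.
rewrite -(RintB mT ifk iyk).
have ib := integrable2B mT ifk iyk.
have -> : @kmass R * L * r = \int[mu]_x ((L * r) * radial (kprof r) y x).
  by rewrite (RintZ _ mT ik) int_kprof// mulrC mulrA mulrC mulrA.
apply: (le_trans (le_normr_Rintegral (mT : @measurable _ M2 setT) ib)); apply: (le_Rint mT).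
- exact: (integrable_abse ib).
- exact: integrable2Z.
move=> x _; rewrite -mulrBl normrM [X in _ * X]ger0_norm; last exact: kprof_ge0.
have [->|kx] := eqVneq (radial (kprof r) y x) 0; first by rewrite !mulr0.
have xr := rad_far r0 (fun t => @kprof_ge _ _ t r0) kx.
rewrite ler_wpM2r//; first exact: kprof_ge0.
apply: (le_trans (HL y x _ _)).
- by rewrite (le_trans yM)// lerDl.
- have := ler_normD (x - y) y; rewrite subrK; lra.
- by rewrite ler_wpM2l// ltW.
Qed.

(** Against a test function f, the smoothing is the pairing of u with the averages
    of f at a fixed small radius, which tend uniformly to f as the radius decreases. *)
Lemma smoothing_ae : ae_eq mu O u smoothing.
Proof.
have mu_ : measurable_fun O u by apply/measurable_EFinP; exact: (measurable_int mu).
have cS x : O x -> {for x, continuous smoothing} by exact: smooth_on_cont smooth_smoothing x.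
have mS := cont_measurable oO cS.
apply: ae_sub0 => //; apply: fund_lemma => //.
- exact: measurable_funB.
- move=> a b c d bsub; apply: integrable2B; first exact: measurable_box.
    apply: integrableS iu => //; first exact: measurable_box.
    exact: subset_trans (@box_cbox _ _ _ _ _) bsub.
  exact: cbox_integrable oO cS bsub mS.
move=> f tf; have [sf cf fO] := tf.
have [rho rho0 rhoO] := compact_margin cf oO fO.
have [M M0 HM] := bounded_norm bO.
have [L L0 HL] := smooth_lip_box (M + 1) (test_smooth tf).
set I0 := \int[mu]_(x in O) `|u x|.
have [B B0 HB] : exists2 B : R, 0 <= B & forall x, O x -> `|f x| <= B.
  have [B B0 HB] := cont_bounded_box M (test_cont tf).
  by exists B => // x /HM/HB.
have mf : measurable_fun O f.
  by apply: (cont_measurable oO) => x _; exact: test_cont tf x.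
have [iuf _] := int_mul_bounded mO iu mf HB.
have iSf := test_mul_integrable oO tf smooth_smoothing.
have iff : mu.-integrable O (EFin \o f).
  have := test_mul_integrable oO tf (smooth_on_cst 1 oO).
  by apply: eq_integrable => // x _ /=; rewrite mul1r.
have k0 := @kmass_gt0 R.
under eq_Rintegral do rewrite mulrBl.
rewrite RintB//; pose m := Num.min rho 1.
have m0 : 0 < m by rewrite lt_min rho0 ltr01.
have mrho : m <= rho by rewrite ge_min lexx.
have m1 : m <= 1 by rewrite ge_min lexx orbT.
(* Radii m / 2 ^+ j keep the squares around the support of f inside O. *)
apply: (@small_eq0 _ _ (L * m * I0)) => j.
pose r := m / 2 ^+ j.
have r0 : 0 < r by rewrite divr_gt0// exprn_gt0.
have rm : r <= m by rewrite ler_pdivrMr ?exprn_gt0// ler_peMr ?(ltW m0)// exprn_ege1// ler1n.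
have cc : continuous (convol O f (k r)) by exact: (conv_continuous mO bO iff (@smooth_k r)).
have mc : measurable_fun O (convol O f (k r)) by apply: (cont_measurable oO) => x _; exact: cc.
have mkf : measurable_fun O (fun y => convol O f (k r) y - @kmass R * f y).
  by apply: measurable_funB => //; exact: measurable_funM.
have near_f y : O y -> `|convol O f (k r) y - @kmass R * f y| <= @kmass R * L * r.
  move=> Oy; apply: (conv_test_near (M := M)) => //; last exact: HM.
  by rewrite r0 (le_trans rm).
have [ic bc] := int_mul_bounded mO iu mkf near_f.
have ikf : mu.-integrable O (EFin \o (fun x => u x * (@kmass R * f x))).
  have := integrable2Z (@kmass R) mO iuf; apply: eq_integrable => // x _ /=.
  by rewrite mulrCA.
have iuc : mu.-integrable O (EFin \o (fun x => u x * convol O f (k r) x)).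
  have := integrable2D mO ic ikf; apply: eq_integrable => // x _ /=.
  by rewrite -mulrDr subrK.
have ES : @kmass R * \int[mu]_(x in O) (smoothing x * f x) =
    \int[mu]_(x in O) (u x * convol O f (k r) x).
  rewrite -(conv_sym mO bO (@smooth1_kprof R r) (fun t => @kprof_ge _ r t r0) iu iff).
  rewrite -RintZ//; apply: eq_Rintegral => x _.
  have [->|fx] := eqVneq (f x) 0; first by rewrite !mulr0.
  rewrite (smoothingE r0); first by rewrite mulrA mulrCA divff ?mulr1// gt_eqF.
  apply: subset_trans (rhoO x _); first by apply: sboxS; exact: le_trans mrho.
  exact: subset_closure.
have -> : \int[mu]_(x in O) (u x * f x) - \int[mu]_(x in O) (smoothing x * f x) =
   - (@kmass R)^-1 * \int[mu]_(x in O) (u x * (convol O f (k r) x - @kmass R * f x)).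
  have -> : \int[mu]_(x in O) (u x * (convol O f (k r) x - @kmass R * f x)) =
     \int[mu]_(x in O) (u x * convol O f (k r) x) - @kmass R * \int[mu]_(x in O) (u x * f x).
    rewrite -RintZ// -RintB//; last by apply: integrable2Z.
    by apply: eq_Rintegral => x _; rewrite mulrBr [u x * (_ * _)]mulrCA.
  by rewrite -ES -mulrBr mulNr mulKf ?opprB// gt_eqF.
rewrite normrM normrN normfV (gtr0_norm k0) ler_pdivrMl//.
by apply: (le_trans bc); rewrite le_eqVlt; apply/orP; left; apply/eqP; rewrite -/I0 /r;
  move: (kmass) I0 ((2 ^+ j)^-1 : R) => q1 q2 q3; ring.
Qed.

End smoothing.
End weyl.

(** * Interior gradient estimate *)

Section gradient_estimate.
Context {R : realType}.
Local Notation P2 := (R * R)%type.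
Local Notation mu := (@leb2 R).
Local Notation e := (unit_vec R).
Local Notation k r := (radial (kprof r) (0 : P2)).

Lemma derive1_bump1_bounded : exists2 B : R, 0 <= B & forall t : R, 0 <= t -> `|derive1 (@bump1 R) t| <= B.
Proof.
have [B B0 HB] := bounded_on_itv 0 1 (smooth1_continuous (smooth1_derive (@smooth1_bump1 R))).
exists B => // t t0; have [t1|/ltW t1] := leP t 1; first by apply: HB; rewrite t0.
by rewrite derive1_bump1_ge ?normr0.
Qed.

Lemma is_derive_kprof (r t : R) : 
  is_derive t (1 : R) (kprof r) (derive1 (@bump1 R) (t / r ^+ 2) / r ^+ 2 / r ^+ 2).
Proof.
have D1 : is_derive t (1 : R) (fun t : R => t / r ^+ 2) (r ^- 2).
  have := is_derive_mul (is_derive_id t 1) (is_derive_cst (r ^- 2 : R) t 1).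
  by rewrite mul1r mulr0 addr0.
have D2 := is_derive1_comp (smooth1P (@smooth1_bump1 R) _) D1.
have := is_derive_mul D2 (is_derive_cst (r ^- 2 : R) t 1).
by rewrite mulr0 addr0.
Qed.

Lemma coord_le (z : P2) i : `|pcoord i z| <= `|z|.
Proof. by rewrite /pcoord prod_normE le_max; case: ifP => _; rewrite lexx ?orbT. Qed.

Lemma partial_k_bound : exists2 B : R, 0 <= B & forall (r : R) i z, 0 < r ->
  `|partial i (k r) z| <= B / r ^+ 3 /\ (r <= `|z| -> partial i (k r) z = 0).
Proof.
have [B B0 HB] := derive1_bump1_bounded; exists (B * 2); first by rewrite mulr_ge0.
move=> r i z r0; have [_ E] := is_derive_rad 0 z i (is_derive_kprof r).
have r2 : 0 < r ^+ 2 by rewrite exprn_gt0.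
have r3 : 0 < r ^+ 3 by rewrite exprn_gt0.
have d0 : 0 <= dist2 0 z by rewrite addr_ge0 ?sqr_ge0.
have far : r <= `|z| -> partial i (k r) z = 0.
  move=> rz; rewrite /partial E derive1_bump1_ge ?mul0r// ler_pdivlMr// mul1r /dist2 !subr0.
  move: rz; rewrite prod_normE le_max => /orP[] rz.
    rewrite -[leLHS]addr0 lerD ?sqr_ge0// -[leRHS]real_normK ?num_real//.
    by rewrite ler_sqr ?nnegrE ?(ltW r0).
  rewrite -[leLHS]add0r lerD ?sqr_ge0// -[leRHS]real_normK ?num_real//.
  by rewrite ler_sqr ?nnegrE ?(ltW r0).
split => //; have [/far ->|zr] := leP r `|z|.
  by rewrite normr0 divr_ge0 ?mulr_ge0// ltW.
rewrite /partial E; have -> : pcoord i (0 : P2) = 0 by rewrite /pcoord; case: ifP.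
rewrite subr0 !normrM !normfV !(gtr0_norm r2) (gtr0_norm (ltr0Sn R 1)).
have H1 := HB (dist2 0 z / r ^+ 2) (divr_ge0 d0 (ltW r2)).
have H2 : `|pcoord i z| <= r by apply: le_trans (ltW zr); exact: coord_le.
rewrite (_ : B * 2 / r ^+ 3 = B / r ^+ 2 / r ^+ 2 * (2 * r)); last by field; lra.
apply: ler_pM => //; first by rewrite !mulr_ge0// invr_ge0 ltW.
  by rewrite !ler_wpM2r// invr_ge0 ltW.
by rewrite ler_wpM2l.
Qed.

Lemma leb2_ball (x : P2) (r : R) : 0 <= r -> mu (ball x r) = (2 * r * (2 * r))%:E.
Proof. by move=> r0; rewrite ball_boxE leb2_box; [congr EFin; ring|lra..]. Qed.

(** Differentiating the mean value formula of radius r / 2 and applying the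
    Cauchy-Schwarz inequality. *)
Lemma grad_bound : exists2 C : R, 0 <= C & forall (O : set P2) (u : P2 -> R), open O ->
  bounded_set O -> L2 O u -> smooth_on O u -> weakly_harmonic O u ->
  forall x (r : R) i, 0 < r -> ball x r `<=` O ->
    partial i u x ^+ 2 <= C / r ^+ 4 * nsq (ball x r) u.
Proof.
have [B B0 HB] := partial_k_bound; have k0 := @kmass_gt0 R.
exists (256 * B ^+ 2 / @kmass R ^+ 2); first by apply: divr_ge0; [apply: mulr_ge0; [exact: ler0n|exact: sqr_ge0]|exact: sqr_ge0].
move=> O u oO bO Lu su hu x r i r0 xO.
have mO := open_measurable2 oO; have Ofin := bounded_leb2_lty mO bO.
have iu := L2_integrable mO Ofin Lu.
have uE y : O y -> u y = smoothing O u y.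
  move=> Oy; apply/eqP; rewrite -subr_eq0; apply/eqP.
  have sS := smooth_smoothing oO bO iu hu.
  apply: (ae_cont0 oO (w := fun y => u y - smoothing O u y)) => //.
    by move=> z Oz; apply: (smooth_on_cont (smooth_on_sub oO su sS)).
  by apply: filterS (smoothing_ae oO bO iu hu) => z H Oz; rewrite /= H// subrr.
pose p := r / 2; have p0 : 0 < p by rewrite divr_gt0.
have sboxO y : ball x (r / 4) y -> sbox y p `<=` O.
  move=> xy; apply: subset_trans xO; apply: subset_trans (sbox_near xy) _.
  by apply: le_ball; rewrite /p; lra.
have oB : open (ball x (r / 4)) by exact: ball_open.
have xB : ball x (r / 4) x by apply: ballxx; rewrite divr_gt0.
have BO : ball x (r / 4) `<=` O by apply: subset_trans xO; apply: le_ball; lra.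
have sk := @smooth_k R p.
have Du : is_derive x (e i) u (convol O u (fun z => - partial i (k p) z) x * (@kmass R)^-1).
  apply: (@near_eq_is_derive _ _ _ (fun y => convol O u (k p) y * (@kmass R)^-1)).
    apply: filterS (open_nbhs_nbhs (conj oB xB)) => y xy.
    by rewrite (uE _ (BO _ xy)) (smoothingE oO bO iu hu p0 (sboxO _ xy)).
  apply: is_derive_eq (is_derive_mul (conv_derive mO bO iu i x sk) (is_derive_cst (@kmass R)^-1 x (e i))) _.
  by rewrite mulr0 addr0.
have [_ E] := Du; rewrite /partial E exprMn exprVn.
set K := (fun y : P2 => - partial i (k p) (y - x)).
have oD : open (ball x r) by exact: ball_open.
have mD := open_measurable2 oD.
have Dfin : (mu (ball x r) < +oo)%E by rewrite ball_boxE box_lty.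
have cK : continuous K.
  have cp : continuous (partial i (k p)) by move=> z; exact: (smooth_on_cont (smooth_on_partial i sk)).
  have cs : continuous (fun y : P2 => y - x) by move=> z; apply: cvgB; [exact: cvg_id|exact: cvg_cst].
  by move=> y; apply: cvgN; exact: (continuous_comp (cs y) (cp _)).
have KB y : `|K y| <= B / p ^+ 3 by rewrite normrN; exact: (HB p i (y - x) p0).1.
have mK : measurable_fun (ball x r) K by apply: (cont_measurable oD) => y _; exact: cK.
have LK : L2 (ball x r) K by apply: (L2_bounded mD Dfin mK (M := B / p ^+ 3)) => y _; exact: KB.
have Luu : L2 (ball x r) u.
  have [mu_ uoo] := Lu; split; first exact: measurable_funS mu_.
  apply: le_lt_trans uoo; apply: ge0_subset_integral => //.
    by apply/measurable_EFinP; exact: measurable_funX.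
  by move=> y _; rewrite lee_fin sqr_ge0.
have -> : convol O u (fun z => - partial i (k p) z) x = ip (ball x r) u K.
  rewrite /convol /ip Rintegral_mkcond [RHS]Rintegral_mkcond; apply: eq_Rintegral => y _.
  rewrite !patchE; have [yB|yB] := pselect (ball x r y).
    by rewrite !mem_set//; exact: xO.
  rewrite [in RHS]memNset//; case: ifP => // _.
  rewrite (HB p i (y - x) p0).2 ?oppr0 ?mulr0// leNgt; apply/negP => yx; apply: yB.
  rewrite -ball_normE /= -opprB normrN (lt_trans yx)// /p; lra.
have nK : nsq (ball x r) K <= 256 * B ^+ 2 / r ^+ 4.
  have -> : 256 * B ^+ 2 / r ^+ 4 = (B / p ^+ 3) ^+ 2 * (2 * r * (2 * r)).
    by rewrite /p; field; lra.
  have := int_mul_bounded mD (L2_integrable mD Dfin LK) mK (fun y _ => KB y).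
  move=> [_ H1]; apply: (le_trans (ler_norm _)); apply: (le_trans H1).
  have q0 : 0 <= B / p ^+ 3 by rewrite divr_ge0// exprn_ge0// ltW.
  move: KB q0; move: (B / p ^+ 3) => q KB q0.
  rewrite expr2 -[q * q * _]mulrA; apply: ler_wpM2l => //.
  have L1 : L2 (ball x r) (fun=> 1) by apply: (L2_bounded mD Dfin (M := 1)) => // y _; rewrite normr1.
  have i1 := L2_integrable mD Dfin L1.
  have -> : 2 * r * (2 * r) = \int[mu]_(y in ball x r) 1.
    by rewrite Rintegral_cst// mul1r -[LHS]/(fine (2 * r * (2 * r))%:E) -(leb2_ball x (ltW r0)).
  rewrite -(RintZ _ mD i1); apply: (le_Rint mD).
  - exact: (integrable_abse (L2_integrable mD Dfin LK)).
  - exact: integrable2Z.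
  - by move=> y _; rewrite mulr1.
have CS := cauchy_schwarz mD Luu LK.
have k2 : 0 < @kmass R ^+ 2 by rewrite exprn_gt0.
rewrite ler_pdivrMr//; apply: (le_trans CS).
apply: le_trans (ler_wpM2l (nsq_ge0 _ _) nK) _.
move: (nsq _ _) (kmass) k2 => n q q2; rewrite le_eqVlt; apply/orP; left; apply/eqP.
have q0 : q != 0 by apply: contraTneq q2 => ->; rewrite expr0n ltxx.
by field; rewrite q0 gt_eqF.
Qed.

End gradient_estimate.

(** * Local primitives *)

Section local_primitive.
Context {R : realType}.
Local Notation P2 := (R * R)%type.
Local Notation leb := (@lebesgue_measure R).
Local Notation e := (unit_vec R).
Implicit Types (f : P2 -> R) (O : set P2).

Definition primitive O (g : 'I_2 -> P2 -> R) (F : P2 -> R) :=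
  forall x i, O x -> is_derive x (e i) F (g i x).

Lemma is_derive_e0 f (x : P2) (d : R) :
  is_derive x.1 (1 : R) (fun s => f (s, x.2)) d -> is_derive x (e 0) f d.
Proof.
move=> H; apply/is_derive_line0.
have E : (fun s : R => f (s *: e 0 + x)) = (fun s : R => f (s + x.1, x.2)).
  apply/funext => s; congr f; rewrite /unit_vec /=.
  by apply: injective_projections => /=; rewrite ?[_ *: _]mulr1 ?[_ *: _]mulr0 ?add0r.
rewrite E.
have D : is_derive (0 : R) (1 : R) (fun s : R => s + x.1) 1.
  by have := is_deriveD (is_derive_id (0 : R) (1 : R)) (is_derive_cst x.1 (0 : R) (1 : R)); rewrite addr0.
have := @is_derive1_comp _ (fun s => f (s, x.2)) (fun s : R => s + x.1) 0 d 1.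
by rewrite add0r mulr1; apply.
Qed.

Lemma is_derive_e1 f (x : P2) (d : R) :
  is_derive x.2 (1 : R) (fun s => f (x.1, s)) d -> is_derive x (e 1) f d.
Proof.
move=> H; apply/is_derive_line0.
have E : (fun s : R => f (s *: e 1 + x)) = (fun s : R => f (x.1, s + x.2)).
  apply/funext => s; congr f; rewrite /unit_vec /=.
  by apply: injective_projections => /=; rewrite ?[_ *: _]mulr1 ?[_ *: _]mulr0 ?add0r.
rewrite E.
have D : is_derive (0 : R) (1 : R) (fun s : R => s + x.2) 1.
  by have := is_deriveD (is_derive_id (0 : R) (1 : R)) (is_derive_cst x.2 (0 : R) (1 : R)); rewrite addr0.
have := @is_derive1_comp _ (fun s => f (x.1, s)) (fun s : R => s + x.2) 0 d 1.
by rewrite add0r mulr1; apply.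
Qed.

Lemma is_derive_fst_line f (a b d : R) : is_derive (a, b) (e 0) f d ->
  is_derive a (1 : R) (fun s => f (s, b)) d.
Proof. by move=> [df <-]; exact: derive_fst. Qed.

Lemma is_derive_snd_line f (a b d : R) : is_derive (a, b) (e 1) f d ->
  is_derive b (1 : R) (fun s => f (a, s)) d.
Proof. by move=> [df <-]; exact: derive_snd. Qed.

Lemma mvt_le (F dF : R -> R) (p q B : R) :
  (forall s : R, Num.min p q <= s <= Num.max p q -> is_derive s (1 : R) F (dF s) /\ `|dF s| <= B) ->
  `|F q - F p| <= B * `|q - p|.
Proof.
wlog pq : p q / p <= q => [W H|].
  have [pq|/ltW pq] := leP p q; first exact: W.
  by rewrite distrC [`|q - p|]distrC; apply: W => // s; rewrite minC maxC; exact: H.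
rewrite min_l// max_r// => H.
have D s : s \in `[p, q] -> is_derive s (1 : R) F (dF s) by rewrite in_itv/= => /H[].
have cF : {within `[p, q], continuous F}.
  by apply: derivable_within_continuous => s /D[].
have [s spq ->] := MVT_segment pq (fun s h => D s (subset_itv_oo_cc h)) cF.
by rewrite normrM ler_wpM2r//; move: spq; rewrite in_itv/= => /H[].
Qed.

(** Move along two sides of the rectangle with opposite corners x and y. *)
Lemma box_lip f (g : 'I_2 -> P2 -> R) a b c d (B : R) :
  primitive (box a b c d) g f -> (forall i x, box a b c d x -> `|g i x| <= B) ->
  forall x y, box a b c d x -> box a b c d y ->
    `|f y - f x| <= B * `|y.1 - x.1| + B * `|y.2 - x.2|.
Proof.
move=> pf gB x y /boxP[x1 x2] /boxP[y1 y2].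
have btw (p q s u v : R) : u < p < v -> u < q < v -> Num.min p q <= s <= Num.max p q -> u < s < v.
  move=> /andP[? ?] /andP[? ?] /andP[]; rewrite ge_min le_max => /orP[] ? /orP[] ?; lra.
have L1 : `|f (y.1, x.2) - f (x.1, x.2)| <= B * `|y.1 - x.1|.
  apply: (@mvt_le (fun s => f (s, x.2)) (fun s => g 0 (s, x.2))) => s /(btw _ _ _ _ _ x1 y1) sab.
  have Bs : box a b c d (s, x.2) by apply/boxP.
  by split; [apply: is_derive_fst_line; exact: pf|exact: gB].
have L2 : `|f (y.1, y.2) - f (y.1, x.2)| <= B * `|y.2 - x.2|.
  apply: (@mvt_le (fun s => f (y.1, s)) (fun s => g 1 (y.1, s))) => s /(btw _ _ _ _ _ x2 y2) sab.
  have Bs : box a b c d (y.1, s) by apply/boxP.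
  by split; [apply: is_derive_snd_line; exact: pf|exact: gB].
rewrite -!surjective_pairing in L1 L2.
rewrite [leRHS]addrC; apply: le_trans (lerD L2 L1).
by have := ler_normD (f y - f (y.1, x.2)) (f (y.1, x.2) - f x); rewrite addrA subrK.
Qed.

Lemma box_cst f a b c d : primitive (box a b c d) (fun _ _ => 0) f ->
  forall x y, box a b c d x -> box a b c d y -> f x = f y.
Proof.
move=> pf x y Bx By; apply/eqP; rewrite eq_sym -subr_eq0 -normr_le0.
have := @box_lip f (fun _ _ => 0) a b c d 0 pf (fun _ _ _ => _) x y Bx By.
by rewrite !mul0r addr0; apply => *; rewrite normr0.
Qed.

(** A primitive is Lipschitz wherever its gradient is bounded. *)
Lemma primitive_cont O (g : 'I_2 -> P2 -> R) F : open O -> primitive O g F ->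
  (forall i x, O x -> {for x, continuous (g i)}) -> forall x, O x -> {for x, continuous F}.
Proof.
move=> oO pF cg x Ox.
have [B B0 nB] : exists2 B : R, 0 < B & \forall y \near x, forall i, `|g i y| <= B.
  exists (`|g 0 x| + `|g 1 x| + 1); first by rewrite ltr_wpDl// addr_ge0.
  have n i : \forall y \near x, `|g i y| <= `|g i x| + 1.
    have /cvgrPdist_le/(_ _ (@ltr01 R)) := cg i x Ox; apply: filterS => y H.
    by rewrite -lerBlDl (le_trans _ H)// distrC (le_trans _ (lerB_dist _ _)).
  have n0 := n 0; have n1 := n 1.
  near=> y => i.
  have : `|g 0 y| <= `|g 0 x| + 1 by exact: (near n0 y).
  have : `|g 1 y| <= `|g 1 x| + 1 by exact: (near n1 y).
  have [->|->] := ord2 i.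
    by move=> _ h; rewrite (le_trans h)// lerD2r lerDl.
  by move=> h _; rewrite (le_trans h)// lerD2r lerDr.
have /nbhs_ballP[r /= r0 H] : \forall y \near x, O y /\ (forall i, `|g i y| <= B).
  by apply: filterI nB; exact: open_nbhs_nbhs.
apply/cvgrPdist_le => eps eps0.
have d0 : 0 < Num.min r (eps / (2 * B)) by rewrite lt_min r0 divr_gt0// mulr_gt0.
apply: (filterS _ (nbhsx_ballx x _ d0)) => y; rewrite -ball_normE /= lt_min => /andP[y1 y2].
have xB : ball x r x by exact: ballxx.
have yB : ball x r y by rewrite -ball_normE.
move: H xB yB; rewrite ball_boxE => H xB yB.
have := @box_lip F g _ _ _ _ B (fun z i Bz => pF z i (H z Bz).1) (fun i z Bz => (H z Bz).2 i) y x yB xB.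
move=> h; apply: (le_trans h).
have [h1 h2] : `|x.1 - y.1| <= `|x - y| /\ `|x.2 - y.2| <= `|x - y|.
  by rewrite [`|x - y|]prod_normE !le_max !lexx orbT.
rewrite -mulrDr -ler_pdivlMl//.
have := ltW y2; rewrite invfM mulrA; move: (eps / 2) => q; lra.
Unshelve. all: by end_near. Qed.

(** Integrate along the bottom side and then upwards; the derivative in the first
    variable is taken under the integral sign, and closedness turns it into the
    integral of d_1 (g 0). *)
Lemma local_primitive O (g : 'I_2 -> P2 -> R) a b c d : open O -> cbox a b c d `<=` O ->
  (forall i, smooth_on O (g i)) -> (forall x, O x -> partial 1 (g 0) x = partial 0 (g 1) x) ->
  exists F, primitive (box a b c d) g F.
Proof.
move=> oO bO sg gC.
have cg i x : O x -> {for x, continuous (g i)} by exact: smooth_on_cont (sg i) x.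
have inO (s t : R) : a <= s <= b -> c <= t <= d -> O (s, t) by move=> ? ?; apply/bO/cboxP.
pose k s := \int[leb]_(t in `[a, s]) g 0 (t, c).
pose G (x : P2) := \int[leb]_(t in `[c, x.2]) g 1 (x.1, t).
exists (fun x => G x + k x.1) => x i /boxP[x1 x2].
have [x1a x1b] : a < x.1 /\ x.1 < b by case/andP: x1.
have [x2c x2d] : c < x.2 /\ x.2 < d by case/andP: x2.
have cv (f : P2 -> R) (s : R) : smooth_on O f -> a <= s <= b -> {within `[c, d], continuous (fun t => f (s, t))}.
  move=> sf sab; apply: continuous_in_subspaceT => t /set_mem /=; rewrite in_itv/= => tcd.
  have ct : {for (s, t), continuous f} by apply: smooth_on_cont sf _ _; exact: inO.
  by have := @continuous_comp _ _ _ (fun t : R => (s, t) : P2) f t (@continuous_pairr R s t) ct.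
have chh (f : P2 -> R) (s : R) : smooth_on O f -> c <= s <= d -> {within `[a, b], continuous (fun t => f (t, s))}.
  move=> sf sab; apply: continuous_in_subspaceT => t /set_mem /=; rewrite in_itv/= => tcd.
  have ct : {for (t, s), continuous f} by apply: smooth_on_cont sf _ _; exact: inO.
  by have := @continuous_comp _ _ _ (fun t : R => (t, s) : P2) f t (@continuous_pairl R s t) ct.
have iv (f : P2 -> R) (s u : R) : smooth_on O f -> a <= s <= b -> u <= d ->
    leb.-integrable `[c, u] (EFin \o (fun t => f (s, t))).
  move=> sf sab ud; apply: continuous_compact_integrable; first exact: segment_compact.
  apply: continuous_subspaceW (cv f s sf sab); apply: subset_itvl; by rewrite bnd_simp.
have [->|->] := ord2 i.
  apply: is_derive_e0 => /=.
  have Dk : is_derive x.1 (1 : R) k (g 0 (x.1, c)).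
    have ic : leb.-integrable `[a, b] (EFin \o (fun t => g 0 (t, c))).
      apply: continuous_compact_integrable; first exact: segment_compact.
      by apply: chh => //; rewrite lexx ltW// (lt_trans x2c).
    have cc : {for x.1, continuous (fun t => g 0 (t, c))}.
      have ct : {for (x.1, c), continuous (g 0)}.
        by apply: cg; apply: inO; rewrite ?lexx ?ltW//= (lt_trans x2c).
      by have := @continuous_comp _ _ _ (fun t : R => (t, c) : P2) (g 0) x.1 (@continuous_pairl R c x.1) ct.
    have [d1 d2] := continuous_FTC1_closed x1b ic x1a cc.
    by split; [exact: d1|rewrite -derive1E; exact: d2].
  have DG : is_derive x.1 (1 : R) (fun s => G (s, x.2)) (g 0 x - g 0 (x.1, c)).
    have E1 : \int[leb]_(t in `[c, x.2]) partial 0 (g 1) (x.1, t) = g 0 x - g 0 (x.1, c).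
      have := @continuous_FTC2 R (fun t => partial 1 (g 0) (x.1, t)) (fun t => g 0 (x.1, t)) c x.2 x2c.
      have D t : c <= t <= d -> is_derive t (1 : R) (fun t => g 0 (x.1, t)) (partial 1 (g 0) (x.1, t)).
        move=> tcd; apply: is_derive_snd_line; apply: smooth_onP (sg 0) _ _ _.
        by apply: inO => //; rewrite !ltW.
      have Dc t : c <= t <= d -> {for t, continuous (fun t => g 0 (x.1, t))}.
        by move=> /D[dt _]; apply: differentiable_continuous; exact/derivable1_diffP.
      have sub t : t \in `]c, x.2[ -> c <= t <= d.
        by rewrite in_itv/= => /andP[? ?]; apply/andP; split; lra.
      move=> /(_ _ _ _) F2.
      transitivity (\int[leb]_(t in `[c, x.2]) partial 1 (g 0) (x.1, t)).
        apply: eq_Rintegral => t /set_mem /=; rewrite in_itv/= => /andP[ct tx].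
        have ctd : c <= t <= d by rewrite ct (le_trans tx (ltW x2d)).
        by rewrite gC//; apply: inO => //; rewrite !ltW.
      rewrite /Rintegral F2 //.
      - by rewrite -EFinB /= -surjective_pairing.
      - apply: continuous_subspaceW (cv (partial 1 (g 0)) x.1 (smooth_on_partial 1 (sg 0)) _); last by rewrite !ltW.
        by apply: subset_itvl; rewrite bnd_simp ltW.
      - split.
        + by move=> t /sub/D[].
        + by apply: cvg_at_right_filter; apply: Dc; rewrite lexx ltW// (lt_trans x2c).
        + by apply: cvg_at_left_filter; apply: Dc; rewrite !ltW.
      - by move=> t /sub/D[_ E]; rewrite derive1E E.
    rewrite -E1.
    have [M [Mr HM]] : exists M, M \is Num.real /\ forall N, M < N -> forall z, cbox a b c d z -> `|partial 0 (g 1) z| <= N.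
      have cK : compact (partial 0 (g 1) @` cbox a b c d).
        apply: continuous_compact; last exact: compact_box.
        apply: continuous_in_subspaceT => z /set_mem/bO Oz.
        exact: smooth_on_cont (smooth_on_partial 0 (sg 1)) _ Oz.
      have [M [Mr HM]] := compact_bounded cK; exists M; split => // N /HM H z bz.
      by apply: H; exists z.
    pose f s t := g 1 (s, t).
    have D1 s t : a < s < b -> `[c, x.2]%classic t -> is_derive s (1 : R) (f ^~ t) (partial 0 (g 1) (s, t)).
      move=> /andP[? ?] /=; rewrite in_itv/= => /andP[? ?].
      apply: is_derive_fst_line; apply: smooth_onP (sg 1) _ _ _.
      by apply: inO; lra.
    have PE s t : a < s < b -> `[c, x.2]%classic t -> partial1of2 f s t = partial 0 (g 1) (s, t).
      by move=> sab tc; rewrite partial1of2E; have [_ E] := D1 s t sab tc.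
    have mB : @measurable _ (measurableTypeR R) (`[c, x.2]%classic) by exact: measurable_itv.
    have Ia : (`]a, b[%classic : set R) x.1 by rewrite /= in_itv/= x1.
    have intf s : (`]a, b[%classic : set R) s -> leb.-integrable `[c, x.2] (EFin \o f s).
      by rewrite /= in_itv/= => /andP[? ?]; apply: iv; rewrite ?ltW//; lra.
    have derf s t : (`]a, b[%classic : set R) s -> `[c, x.2]%classic t -> derivable (f ^~ t) s 1.
      by rewrite /= in_itv/= => sab tc; have [] := D1 s t sab tc.
    pose N := `|M| + 1.
    have N0 (t : measurableTypeR R) : 0 <= (cst N t : R) by rewrite addr_ge0.
    have iN : leb.-integrable `[c, x.2] (EFin \o cst N).
      by apply: continuous_compact_integrable; [exact: segment_compact|apply: continuous_subspaceT => ?; exact: cvg_cst].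
    have GN s t : (`]a, b[%classic : set R) s -> `[c, x.2]%classic t -> `|partial1of2 f s t| <= cst N t.
      move=> sab0 tc; have sab : a < s < b by move: sab0; rewrite /= in_itv/=.
      rewrite PE//; apply: HM.
        by rewrite (le_lt_trans (ler_norm _))// ltrDl.
      move: tc; rewrite /= in_itv/= => /andP[ct tx]; case/andP: sab => sa sb.
      by apply/cboxP => /=; rewrite ct (le_trans tx (ltW x2d)) (ltW sa) (ltW sb).
    have d1 := derivable_under_integral mB Ia intf derf N0 iN GN.
    have d2 := differentiation_under_integral mB Ia intf derf N0 iN GN.
    split; first exact: d1.
    rewrite -derive1E; transitivity (\int[leb]_(t in `[c, x.2]) partial1of2 f x.1 t); first exact: d2.
    by apply: eq_Rintegral => t /set_mem tc; rewrite PE.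
  by have := is_derive_add DG Dk; rewrite subrK.
apply: is_derive_e1 => /=.
have cc : {for x.2, continuous (fun t => g 1 (x.1, t))}.
  have ct : {for (x.1, x.2), continuous (g 1)} by apply: cg; apply: inO; rewrite !ltW.
  by have := @continuous_comp _ _ _ (fun t : R => (x.1, t) : P2) (g 1) x.2 (@continuous_pairr R x.1 x.2) ct.
have ab1 : a <= x.1 <= b by rewrite !ltW.
have [d1 d2] := continuous_FTC1_closed x2d (iv (g 1) x.1 d (sg 1) ab1 (lexx d)) x2c cc.
have DG : is_derive x.2 (1 : R) (fun s => G (x.1, s)) (g 1 x).
  split; [exact: d1|rewrite -derive1E [in RHS](surjective_pairing x); exact: d2].
have := is_derive_add DG (is_derive_cst (k x.1) x.2 (1 : R)).
by rewrite addr0.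
Qed.

End local_primitive.

(** * Polygonal chains *)

Section increments.
Context {R : realType}.
Local Notation P2 := (R * R)%type.
Local Notation e := (unit_vec R).
Context (O : set P2) (oO : open O) (g : 'I_2 -> P2 -> R) (sg : forall i, smooth_on O (g i))
  (gC : forall x, O x -> partial 1 (g 0) x = partial 0 (g 1) x).

Lemma ball_primitive x r : sbox x r `<=` O -> ball x r `<=` O /\ exists F, primitive (ball x r) g F.
Proof.
move=> xO; split; last by rewrite ball_boxE; exact: local_primitive oO xO sg gC.
by apply: subset_trans xO; rewrite ball_boxE; exact: box_cbox.
Qed.

(** d is the increment from x to y of the primitives on a square around both. *)
Definition incr x y d := exists z r F, [/\ ball z r `<=` O, primitive (ball z r) g F,
  ball z r x, ball z r y & d = F y - F x].

(** Two squares around x and y meet in a box, on which their primitives differ by a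
    constant. *)
Lemma incr_uniq x y d d' : incr x y d -> incr x y d' -> d = d'.
Proof.
move=> [z [r [F [zO pF zx zy ->]]]] [z' [r' [F' [_ pF' z'x z'y ->]]]].
apply/eqP; rewrite -subr_eq0 subBB_swap subr_eq0; apply/eqP; apply/esym.
move: pF pF' zx zy z'x z'y; rewrite !ball_boxE; set B := box _ _ _ _; set B' := box _ _ _ _ => pF pF' *.
have pD : primitive (B `&` B') (fun _ _ => 0) (fun w => F w - F' w).
  by move=> w i [Bw B'w]; have := is_deriveB (pF w i Bw) (pF' w i B'w); rewrite subrr.
have xx : (B `&` B') x by []; have yy : (B `&` B') y by [].
by move: pD xx yy; rewrite /B /B' boxI => p1 x1 y1; exact: (box_cst p1 x1 y1).
Qed.

Definition adj x y := exists d, incr x y d.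
Definition dd x y : R := xget 0 (incr x y).

Lemma ddP x y : adj x y -> incr x y (dd x y).
Proof. by move=> H; exact: (xgetPex 0 H). Qed.

Lemma ddE z r F x y : ball z r `<=` O -> primitive (ball z r) g F -> ball z r x -> ball z r y ->
  dd x y = F y - F x.
Proof.
move=> zO pF zx zy; have I : incr x y (F y - F x) by exists z, r, F.
by apply: (incr_uniq _ I); apply: ddP; exists (F y - F x).
Qed.

Lemma ddxx x : O x -> dd x x = 0.
Proof.
move=> Ox; have [r r0 rO] := margin oO Ox.
have [bO [F pF]] := ball_primitive (rO x (ballxx x r0)).
by rewrite (ddE bO pF (ballxx x r0) (ballxx x r0)) subrr.
Qed.

Lemma adj_sym x y : adj x y -> adj y x.
Proof. by move=> [d [z [r [F [? ? ? ? _]]]]]; exists (F x - F y), z, r, F. Qed.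

Lemma dd_sym x y : adj x y -> dd y x = - dd x y.
Proof.
by move=> [d [z [r [F [zO pF zx zy _]]]]]; rewrite (ddE zO pF zx zy) (ddE zO pF zy zx) opprB.
Qed.

Lemma adj_near x : O x -> exists2 r : R, 0 < r & forall y, ball x r y -> [/\ O y, adj x y &
  exists F, primitive (ball x r) g F /\ forall y, ball x r y -> dd x y = F y - F x].
Proof.
move=> Ox; have [r r0 rO] := margin oO Ox.
have xx := ballxx x r0.
have [bO [F pF]] := ball_primitive (rO x xx).
exists r => // y xy; split; first exact: bO.
  by exists (F y - F x), x, r, F.
by exists F; split => // z xz; exact: ddE bO pF xx xz.
Qed.

End increments.

Section polygons.
Context {R : realType}.
Local Notation P2 := (R * R)%type.
Implicit Types (x : nat -> P2) (m j : nat).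

Lemma box_convex (a b p q t : R) : a < p < b -> a < q < b -> 0 <= t <= 1 -> a < p + t * (q - p) < b.
Proof.
move=> /andP[ap pb] /andP[aq qb] /andP[t0 t1].
have [pq|qp] := leP p q.
  have h0 : 0 <= t * (q - p) by rewrite mulr_ge0// subr_ge0.
  have h1 : t * (q - p) <= q - p by rewrite ler_piMl// subr_ge0.
  by apply/andP; split; lra.
have h0 : 0 <= t * (p - q) by rewrite mulr_ge0// subr_ge0 ltW.
have h1 : t * (p - q) <= p - q by rewrite ler_piMl// subr_ge0 ltW.
have -> : t * (q - p) = - (t * (p - q)) by ring.
by apply/andP; split; lra.
Qed.

Lemma ball_convex (z p q : P2) (r t : R) : ball z r p -> ball z r q -> 0 <= t <= 1 ->
  ball z r (p + t *: (q - p)).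
Proof.
rewrite ball_boxE => /boxP[p1 p2] /boxP[q1 q2] t01; apply/boxP; split.
  exact: (box_convex p1 q1 t01).
exact: (box_convex p2 q2 t01).
Qed.

Definition clamp (u : R) : R := Num.min 1 (Num.max 0 u).

Lemma clamp_cont : continuous clamp.
Proof.
move=> u; apply: (@continuous_min _ _ (cst 1) (fun u : R => Num.max 0 u)); first exact: cvg_cst.
by apply: (@continuous_max _ _ (cst 0) id); [exact: cvg_cst|exact: cvg_id].
Qed.

(** The path through x 0, ..., x m whose edges take the time 1 / m each. *)
Definition polygon x m (t : R) : P2 :=
  x 0%N + \sum_(0 <= j < m) clamp (m%:R * t - j%:R) *: (x j.+1 - x j).

Lemma polygon_cont x m : continuous (polygon x m).
Proof.
have c j : continuous (fun t : R => clamp (m%:R * t - j%:R) *: (x j.+1 - x j)).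
  have c1 : continuous (fun t : R => m%:R * t - j%:R).
    by move=> t; apply: cvgB; [apply: cvgMl_tmp; exact: cvg_id|exact: cvg_cst].
  by move=> t; apply: cvgZr_tmp; exact: (continuous_comp (c1 t) (@clamp_cont _)).
pose S n (t : R) := \sum_(0 <= j < n) clamp (m%:R * t - j%:R) *: (x j.+1 - x j).
have cS n : continuous (S n).
  elim: n => [|n IH].
    rewrite (_ : S 0%N = fun=> 0); first by move=> t; exact: cvg_cst.
    by apply/funext => t; rewrite /S big_nil.
  rewrite (_ : S n.+1 = fun t => S n t + clamp (m%:R * t - n%:R) *: (x n.+1 - x n)).
    by move=> t; apply: cvgD; [exact: IH|exact: c].
  by apply/funext => t; rewrite /S big_nat_recr.
by move=> t; apply: cvgD; [exact: cvg_cst|exact: cS].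
Qed.

Lemma polygonE x m j (s : R) : (j < m)%N -> 0 <= s <= 1 ->
  polygon x m ((j%:R + s) / m%:R) = x j + s *: (x j.+1 - x j).
Proof.
move=> jm /andP[s0 s1]; have m0 : m%:R != 0 :> R by rewrite pnatr_eq0 -lt0n (leq_ltn_trans _ jm).
rewrite /polygon mulrC divfK//.
rewrite (@big_cat_nat _ _ _ j)//=; last exact: ltnW.
rewrite (@big_cat_nat _ _ _ j.+1 j m)//= big_nat1.
have -> : clamp (j%:R + s - j%:R) = s by rewrite /clamp addrAC subrr add0r max_r// min_r.
have -> : \sum_(0 <= i < j) clamp (j%:R + s - i%:R) *: (x i.+1 - x i) = x j - x 0%N.
  rewrite -telescope_sumr//; apply: eq_big_nat => i /andP[_ ij].
  suff -> : clamp (j%:R + s - i%:R) = 1 by rewrite scale1r.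
  have : i.+1%:R <= j%:R :> R by rewrite ler_nat.
  rewrite -natr1 /clamp => h; rewrite max_r ?min_l//; lra.
rewrite [\sum_(j.+1 <= i < m) _](_ : _ = 0) ?addr0; last first.
  rewrite big_nat big1// => i /andP[ji _].
  suff -> : clamp (j%:R + s - i%:R) = 0 by rewrite scale0r.
  have : j.+1%:R <= i%:R :> R by rewrite ler_nat.
  rewrite -natr1 /clamp => h; rewrite max_l ?min_r//; lra.
by rewrite addrA [x 0%N + _]addrC subrK.
Qed.

Lemma nat_between m (u : R) : (0 < m)%N -> 0 <= u <= m%:R -> exists2 j, (j < m)%N & j%:R <= u <= j.+1%:R.
Proof.
case: m => // m _; elim: m => [|m IH] /andP[u0 um]; first by exists 0%N => //; rewrite u0.
have [um1|um1] := leP u m.+1%:R.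
  by have [|j jm H] := IH _; [rewrite u0|exists j => //; exact: ltnW].
by exists m.+1 => //; rewrite um ltW.
Qed.

Lemma polygon_ends x m : (0 < m)%N -> polygon x m 0 = x 0%N /\ polygon x m 1 = x m.
Proof.
case: m => // m _; have m0 : m.+1%:R != 0 :> R by rewrite pnatr_eq0.
have h0 := @polygonE x m.+1 0%N 0 isT; rewrite add0r mul0r scale0r addr0 lexx ler01 in h0.
have h1 := @polygonE x m.+1 m 1 (ltnSn _); rewrite natr1 divff// scale1r lexx ler01 in h1.
by split; [exact: h0|rewrite h1// addrCA subrr addr0].
Qed.

End polygons.

(** * Closed forms on simply connected domains *)

Section uniform.
Context {R : realType}.
Local Notation P2 := (R * R)%type.

Lemma compact_unif (K : set P2) (f : P2 -> P2) (r : R) : compact K -> {within K, continuous f} ->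
  0 < r -> exists2 d : R, 0 < d & forall z z', K z -> K z' -> ball z d z' -> ball (f z) r (f z').
Proof.
move=> cK cf r0.
pose P (d : R) z := K z -> forall z', K z' -> ball z d z' -> ball (f z) r (f z').
have cov x : K x -> \forall x' \near x & d \near (0 : R)^'+, P d x'.
  move=> Kx; have /(_ x Kx) cfx := (subspace_continuousP K f).1 cf.
  have r2 : 0 < r / 2 by rewrite divr_gt0.
  have /nbhs_ballP[d /= d0 H] : nbhs x [set z | K z -> ball (f x) (r / 2) (f z)].
    exact: (cfx (ball (f x) (r / 2)) (nbhsx_ballx _ _ r2)).
  have d2 : 0 < d / 2 by rewrite divr_gt0.
  exists (ball x (d / 2), [set s : R | s < d / 2]); first by split => /=; [exact: nbhsx_ballx|exact: nbhs_right_lt].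
  move=> [z s] /= [xz sd] Kz z' Kz' zz'.
  have h1 : ball x d z by apply: le_ball xz; lra.
  have h2 : ball x d z'.
    by rewrite (splitr d); apply: ball_triangle xz _; apply: le_ball zz'; exact: ltW.
  by rewrite (splitr r); apply: ball_triangle (H z' h2 Kz'); apply: ball_sym; exact: H.
have H := (compact_near_coveringP K).1 cK _ _ P _ cov.
have [d [Hd d0]] : exists d : R, (K `<=` P d) /\ 0 < d.
  apply: (@filter_ex _ (0 : R)^'+); apply: filterI; [exact: H|exact: nbhs_right_gt].
by exists d => // z z' Kz; exact: Hd.
Qed.

End uniform.

Section global_primitive.
Context {R : realType}.
Local Notation P2 := (R * R)%type.
Local Notation e := (unit_vec R).
Context (O : set P2) (oO : open O) (g : 'I_2 -> P2 -> R) (sg : forall i, smooth_on O (g i))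
  (gC : forall x, O x -> partial 1 (g 0) x = partial 0 (g 1) x).
Local Notation dd := (dd O g).
Local Notation adj := (adj O g).
Local Notation I01 := (`[0, 1]%classic : set R).

(** The sums of increments along the rows of a fine grid on the unit square
    agree: two consecutive rows differ by a telescoping sum. *)
Lemma homotopy_sum (H : P2 -> P2) (a : P2) : {within I01 `*` I01, continuous H} ->
  (forall p, (I01 `*` I01) p -> O (H p)) ->
  (forall t, I01 t -> H (1, t) = a) -> (forall s, I01 s -> H (s, 0) = a /\ H (s, 1) = a) ->
  exists2 N, (0 < N)%N & forall n, (N <= n)%N ->
    \sum_(0 <= k < n) dd (H (0, k%:R / n%:R)) (H (0, k.+1%:R / n%:R)) = 0.
Proof.
move=> cH OH H1 Hs.
have cI : compact (I01 `*` I01) by exact: compact_box.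
have cK : compact (H @` (I01 `*` I01)) by exact: continuous_compact.
have KO : H @` (I01 `*` I01) `<=` O by move=> _ [p Ip <-]; exact: OH.
have [r r0 rO] := compact_margin cK oO KO.
have [d d0 Hd] := compact_unif cI cH r0.
have I0 : I01 0 by rewrite /= in_itv/= lexx ler01.
have I1 : I01 1 by rewrite /= in_itv/= lexx ler01.
have Oa : O a by rewrite -(H1 0 I0); apply: OH.
have [k0 k0d] := ltr_add_invr d0; rewrite add0r in k0d.
exists k0.+1 => // n kn; have n0 : (0 < n)%N by exact: leq_ltn_trans kn.
have nR : 0 < n%:R :> R by rewrite ltr0n.
pose h j k := H (j%:R / n%:R, k%:R / n%:R).
have In (j : nat) : (j <= n)%N -> I01 (j%:R / n%:R).
  by move=> jn; rewrite /= in_itv/= divr_ge0// ler_pdivrMr// mul1r ler_nat.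
have nd : n%:R^-1 < d.
  by apply: le_lt_trans k0d; rewrite lef_pV2 ?posrE// ler_nat.
have near1 j : `|j%:R / n%:R - j.+1%:R / n%:R| < d :> R.
  by rewrite -mulrBl -natr1 opprD addrA subrr sub0r mulN1r normrN gtr0_norm// invr_gt0.
have near0 (x : R) : `|x - x| < d by rewrite subrr normr0.
have pbd (p q p' q' : R) : `|p - p'| < d -> `|q - q'| < d -> ball ((p, q) : P2) d (p', q').
  by move=> h1 h2; split; rewrite -ball_normE.
(* On a small cell of the grid all increments come from one primitive. *)
have cell j k : (j < n)%N -> (k < n)%N ->
    dd (h j.+1 k) (h j.+1 k.+1) - dd (h j k) (h j k.+1) =
    dd (h j k.+1) (h j.+1 k.+1) - dd (h j k) (h j.+1 k).
  move=> jn kn'.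
  have Ijk : (I01 `*` I01) (j%:R / n%:R, k%:R / n%:R) by split; apply: In; exact: ltnW.
  have [bO [F pF]] := ball_primitive oO sg gC (rO (h j k) (ex_intro2 _ _ _ Ijk erefl)).
  have b00 : ball (h j k) r (h j k) by exact: ballxx.
  have b10 : ball (h j k) r (h j.+1 k).
    by apply: Hd => //; [split => /=; apply: In => //; exact: ltnW|exact: pbd].
  have b01 : ball (h j k) r (h j k.+1).
    by apply: Hd => //; [split => /=; apply: In => //; exact: ltnW|exact: pbd].
  have b11 : ball (h j k) r (h j.+1 k.+1).
    by apply: Hd => //; [split => /=; apply: In => //; exact: ltnW|exact: pbd].
  rewrite (ddE bO pF b10 b11) (ddE bO pF b00 b01) (ddE bO pF b01 b11) (ddE bO pF b00 b10).
  ring.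
pose S j := \sum_(0 <= k < n) dd (h j k) (h j k.+1).
have n1 : n%:R / n%:R = 1 :> R by rewrite divff// gt_eqF.
have S1 j : (j < n)%N -> S j.+1 = S j.
  move=> jn; apply/eqP; rewrite -subr_eq0 /S -sumrB; apply/eqP.
  transitivity (\sum_(0 <= k < n) (dd (h j k.+1) (h j.+1 k.+1) - dd (h j k) (h j.+1 k))).
    by apply: eq_big_nat => k /andP[_ kn']; exact: cell.
  rewrite (telescope_sumr (fun k => dd (h j k) (h j.+1 k)))// /h mul0r n1.
  have [-> ->] := Hs _ (In j (ltnW jn)); have [-> ->] := Hs _ (In j.+1 jn).
  by rewrite subrr.
have SE j : (j <= n)%N -> S j = S 0%N.
  by elim: j => // j IH jn; rewrite S1// IH// ltnW.
(* The last row is constant. *)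
have Sn : S n = 0.
  rewrite /S big_nat big1// => k /andP[_ kn']; rewrite /h n1.
  by rewrite !H1 ?(ddxx oO sg gC Oa)//; apply: In; rewrite // ltnW.
have := SE n (leqnn n); rewrite Sn => /esym; rewrite /S /h mul0r; exact.
Qed.

Hypothesis sc : simply_connected O.

(** A closed chain spans a polygonal loop, which is contractible.  Subdividing the
    loop does not change the sum of the increments, because each edge lies in a
    square that has a primitive. *)
Lemma chain_zero (x : nat -> P2) m : (forall j, (j < m)%N -> adj (x j) (x j.+1)) -> x m = x 0%N ->
  \sum_(0 <= j < m) dd (x j) (x j.+1) = 0.
Proof.
case: m => [|m']; first by rewrite big_nil.
set m := m'.+1 => ax xm; have m0 : (0 < m)%N by [].
have mR : 0 < m%:R :> R by rewrite ltr0n.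
pose gam := polygon x m.
have cg : continuous gam by exact: polygon_cont.
have [g0 g1] := polygon_ends x m0.
have seg j (s : R) : (j < m)%N -> 0 <= s <= 1 -> O (gam ((j%:R + s) / m%:R)).
  move=> jm s01; rewrite /gam polygonE//.
  have [_ [z [r [F [zO _ zx zy _]]]]] := ax j jm.
  by apply: zO; exact: ball_convex.
have Og t : I01 t -> O (gam t).
  rewrite /= in_itv/= => /andP[t0 t1].
  have [|j jm /andP[h1 h2]] := @nat_between R m (m%:R * t) m0.
    by rewrite mulr_ge0//= ler_piMr.
  have -> : t = (j%:R + (m%:R * t - j%:R)) / m%:R by rewrite addrCA subrr addr0 mulrAC divff ?mul1r// gt_eqF.
  by apply: seg => //; rewrite -natr1 in h2; apply/andP; split; lra.
have cw : {within I01, continuous gam} by exact: continuous_subspaceT.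
have g01 : gam 0 = gam 1 by rewrite /gam g0 g1.
have [H [cH OH H0 H1 Hs]] := sc.2 gam cw Og g01.
have [N N0 HN] := homotopy_sum cH OH H1 Hs.
have mN : (N <= m * N)%N by rewrite leq_pmull.
have NR : 0 < N%:R :> R by rewrite ltr0n.
have := HN _ mN.
have I0N k : (k <= m * N)%N -> I01 (k%:R / (m * N)%:R).
  move=> kn; rewrite /= in_itv/= divr_ge0// ler_pdivrMr ?ltr0n ?muln_gt0 ?m0//.
  by rewrite mul1r ler_nat.
have -> : \sum_(0 <= k < m * N) dd (H (0, k%:R / (m * N)%:R)) (H (0, k.+1%:R / (m * N)%:R)) =
    \sum_(0 <= k < m * N) dd (gam (k%:R / (m * N)%:R)) (gam (k.+1%:R / (m * N)%:R)).
  by apply: eq_big_nat => k /andP[_ kn]; rewrite !H0//; apply: I0N => //; exact: ltnW.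
have gE j i : (j < m)%N -> (i <= N)%N ->
    gam ((j * N + i)%:R / (m * N)%:R) = x j + (i%:R / N%:R) *: (x j.+1 - x j).
  move=> jm iN; rewrite -(@polygonE R x m j (i%:R / N%:R))//; last by rewrite divr_ge0//= ler_pdivrMr// mul1r ler_nat.
  congr gam; rewrite natrD !natrM; field; rewrite !gt_eqF//.
have sumE j : (j <= m)%N -> \sum_(0 <= k < j * N) dd (gam (k%:R / (m * N)%:R)) (gam (k.+1%:R / (m * N)%:R)) =
    \sum_(0 <= j' < j) dd (x j') (x j'.+1).
  elim: j => [|j IH] jm; first by rewrite mul0n !big_nil.
  rewrite mulSnr (@big_cat_nat _ _ _ (j * N)%N)//=; last exact: leq_addr.
  rewrite IH; last exact: ltnW.
  rewrite [RHS]big_nat_recr//=; congr (_ + _).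
  have [_ [z [r [F [zO pF zx zy _]]]]] := ax j jm.
  have bi i : (i <= N)%N -> ball z r (gam ((j * N + i)%:R / (m * N)%:R)).
    move=> iN; rewrite gE//; apply: ball_convex => //.
    by rewrite divr_ge0//= ler_pdivrMr// mul1r ler_nat.
  rewrite (ddE zO pF zx zy).
  have E0 := gE j 0%N jm (leq0n N); rewrite mul0r scale0r addr0 addn0 in E0.
  have E1 := gE j N jm (leqnn N); rewrite divff ?gt_eqF// scale1r addrCA subrr addr0 in E1.
  rewrite -[in RHS]E0 -[in RHS]E1.
  rewrite -(telescope_sumr (fun k => F (gam (k%:R / (m * N)%:R))))//; last exact: leq_addr.
  apply: eq_big_nat => k /andP[k1 k2].
  have kE : k = (j * N + (k - j * N))%N by rewrite subnKC.
  have kN : (k - j * N < N)%N by rewrite ltn_subLR.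
  have b1 := bi _ (ltnW kN); rewrite -kE in b1.
  have b2 := bi _ kN; rewrite addnS -kE in b2.
  by rewrite (ddE zO pF b1 b2).
by rewrite sumE.
Qed.

(** v is the sum of the increments along some chain from a. *)
Inductive reach (a : P2) : P2 -> R -> Prop :=
| reach0 : reach a a 0
| reachS x y v : reach a x v -> adj x y -> reach a y (v + dd x y).

Lemma reach_trans a b c v w : reach a b v -> reach b c w -> reach a c (v + w).
Proof.
move=> ab; elim=> [|x y u _ IH xy]; first by rewrite addr0.
by rewrite addrA; exact: reachS.
Qed.

Lemma reach_sym a b v : reach a b v -> reach b a (- v).
Proof.
elim=> [|x y u _ IH xy]; first by rewrite oppr0; exact: reach0.
have yx : reach y x (dd y x) by rewrite -[dd _ _]add0r; exact: reachS (reach0 y) (adj_sym xy).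
by have := reach_trans yx IH; rewrite (dd_sym xy) opprD addrC.
Qed.

Lemma reach_chain a b v : reach a b v -> exists x m, [/\ x 0%N = a, x m = b,
  forall j, (j < m)%N -> adj (x j) (x j.+1) & v = \sum_(0 <= j < m) dd (x j) (x j.+1)].
Proof.
elim=> [|y z u _ [x [m [x0 xm ax ->]]] yz].
  by exists (fun=> a), 0%N; split => //; rewrite big_nil.
exists (fun j => if (j <= m)%N then x j else z), m.+1; split.
- by [].
- by rewrite ltnn.
- move=> j; rewrite ltnS => jm; rewrite jm; have [jm'|mj] := ltnP j m; first exact: ax.
  by rewrite (_ : j = m) ?xm//; apply/eqP; rewrite eqn_leq jm.
- rewrite big_nat_recr//= leqnn ltnn xm; congr (_ + _).
  by apply: eq_big_nat => j /andP[_ jm]; rewrite (ltnW jm) jm.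
Qed.

(** One chain followed by the reverse of another is a closed chain. *)
Lemma reach_uniq a b v w : reach a b v -> reach a b w -> v = w.
Proof.
move=> abv abw; apply/eqP; rewrite -subr_eq0; apply/eqP.
have [x [m [x0 xm ax ->]]] := reach_chain (reach_trans abv (reach_sym abw)).
by apply: chain_zero => //; rewrite x0 xm.
Qed.

(** The set of the points that are reached is open and closed in O. *)
Lemma reach_all a b : O a -> O b -> exists v, reach a b v.
Proof.
move=> Oa Ob; pose B := [set x | O x /\ exists v, reach a x v].
suff BE : B = O by have [] : B b by rewrite BE.
have step x y v : reach a x v -> adj x y -> exists v, reach a y v.
  by move=> axv xy; exists (v + dd x y); exact: reachS.
apply: sc.1.
- by exists a; split => //; exists 0; exact: reach0.
- exists B; last by apply/seteqP; split => x; [move=> Bx; split => //; case: Bx|case].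
  rewrite openE => x [Ox [v axv]]; have [r r0 H] := adj_near oO sg gC Ox.
  by apply/nbhs_ballP; exists r => // y /H[Oy xy _]; split => //; exact: step axv xy.
- exists (~` (O `\` B)).
    apply: open_closedC; rewrite openE => x [Ox nB]; have [r r0 H] := adj_near oO sg gC Ox.
    apply/nbhs_ballP; exists r => // y /H[Oy xy _]; split => // -[_ [v ayv]]; apply: nB.
    by split => //; exact: step ayv (adj_sym xy).
  apply/seteqP; split => x; first by move=> Bx; split; [case: Bx|case].
  by move=> [Ox nn]; apply: contrapT => nB; exact: nn.
Qed.

(** The primitive at x is the common value of the sums of increments along the
    chains from a fixed point to x. *)
Lemma closed_form_exact : O !=set0 -> exists2 F, smooth_on O F & primitive O g F.
Proof.
move=> [a Oa].
pose F x := xget 0 (reach a x).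
have FP x : O x -> reach a x (F x).
  by move=> Ox; exact: (xgetPex 0 (reach_all Oa Ox)).
have pF : primitive O g F.
  move=> x i Ox; have [r r0 H] := adj_near oO sg gC Ox.
  have [_ _ [f [pf fE]]] := H x (ballxx x r0).
  apply: (@near_eq_is_derive _ _ _ (fun y => f y + (F x - f x))).
    apply: (filterS _ (nbhsx_ballx x _ r0)) => y xy; have [Oy axy _] := H y xy.
    rewrite (reach_uniq (FP y Oy) (reachS (FP x Ox) axy)) fE//; ring.
  have := is_derive_add (pf x i (ballxx x r0)) (is_derive_cst (F x - f x) x (e i)).
  by rewrite addr0.
exists F => //; apply: (smooth_on_prim oO _ sg (fun i x Ox => pF x i Ox)) => x Ox.
by apply: (primitive_cont oO pF) => // i y Oy; exact: smooth_on_cont (sg i) y Oy.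
Qed.

End global_primitive.

(** * A Hardy inequality on an interval *)

Section hardy.
Context {R : realType}.
Local Notation leb := (@lebesgue_measure R).

(** Integrate the derivative of (s - u') p ^ 2 and complete a square.  The interval
    starts at u' > u because p may be unbounded near u. *)
Lemma hardy_segment (p dp : R -> R) (u u' v : R) : u < u' -> u' < v ->
  (forall s : R, u < s <= v -> is_derive s (1 : R) p (dp s)) ->
  (forall s : R, u < s <= v -> {for s, continuous dp}) ->
  (\int[leb]_(s in `[u', v]) (p s * p s)%:E <= (2 * (v - u) * (p v * p v))%:E +
    4%:E * \int[leb]_(s in `[u', v]) ((s - u) * dp s * ((s - u) * dp s))%:E)%E.
Proof.
move=> uu' u'v Dp cdp.
have sub (s : R) : s \in `[u', v] -> u < s <= v.
  by rewrite in_itv/= => /andP[h1 ->]; rewrite (lt_le_trans uu').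
have cp (s : R) : u < s <= v -> {for s, continuous p}.
  by move=> /Dp[ds _]; apply: differentiable_continuous; exact/derivable1_diffP.
have wi (f : R -> R) : (forall s : R, u < s <= v -> {for s, continuous f}) -> {within `[u', v], continuous f}.
  by move=> cf; apply: continuous_in_subspaceT => s /set_mem /= /sub; exact: cf.
have int (f : R -> R) : (forall s : R, u < s <= v -> {for s, continuous f}) -> leb.-integrable `[u', v] (EFin \o f).
  by move=> cf; apply: continuous_compact_integrable; [exact: segment_compact|exact: wi].
pose g (s : R) := (s - u') * (p s * p s).
pose dg (s : R) := p s * p s + (s - u') * (dp s * p s + p s * dp s).
have Dg (s : R) : u < s <= v -> is_derive s (1 : R) g (dg s).
  move=> us; have D0 : is_derive s (1 : R) (fun s : R => s - u') 1.
    by have := is_deriveB (is_derive_id s (1 : R)) (is_derive_cst u' s (1 : R)); rewrite subr0.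
  have := is_derive_mul D0 (is_derive_mul (Dp s us) (Dp s us)).
  by rewrite mul1r.
have csub (c s : R) : {for s, continuous (fun s : R => s - c)}.
  by apply: cvgB; [exact: cvg_id|exact: cvg_cst].
have cdg (s : R) : u < s <= v -> {for s, continuous dg}.
  move=> us; have c1 := cp s us; have c2 := cdp s us.
  apply: cvgD; first by apply: cvgM.
  by apply: cvgM; [exact: csub|apply: cvgD; apply: cvgM].
have c1 (s : R) : u < s <= v -> {for s, continuous (fun s => p s * p s)}.
  by move=> us; apply: cvgM; exact: cp.
have c2 (s : R) : u < s <= v -> {for s, continuous (fun s => (s - u) * dp s * ((s - u) * dp s))}.
  by move=> us; apply: cvgM; apply: cvgM; first [exact: csub|exact: cdp].
have cg (s : R) : u < s <= v -> {for s, continuous g}.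
  by move=> /Dg[ds _]; apply: differentiable_continuous; exact/derivable1_diffP.
have i1 := int _ c1; have i2 := int _ c2; have i3 := int _ cdg.
have F := @continuous_FTC2 R dg g u' v u'v (wi _ cdg) _ _.
have Ig : \int[leb]_(s in `[u', v]) dg s = (v - u') * (p v * p v).
  rewrite /Rintegral F.
  - by rewrite -EFinB /g subrr mul0r subr0.
  - have u'b : u < u' <= v by rewrite uu' ltW.
    have vb : u < v <= v by rewrite (lt_trans uu') /=.
    split.
    + by move=> s /subset_itv_oo_cc/sub/Dg[].
    + by apply: cvg_at_right_filter; exact: cg.
    + by apply: cvg_at_left_filter; exact: cg.
  - by move=> s /subset_itv_oo_cc/sub/Dg[_ E]; rewrite derive1E E.
have mI : @measurable _ (measurableTypeR R) (`[u', v]%classic) by exact: measurable_itv.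
have i4 : leb.-integrable `[u', v] (EFin \o (fun s => 2 * dg s + 4 * ((s - u) * dp s * ((s - u) * dp s)))).
  have := integrableD mI (integrableZl mI 2 i3) (integrableZl mI 4 i2).
  by apply: eq_integrable.
have H : \int[leb]_(s in `[u', v]) (p s * p s) <=
    2 * ((v - u') * (p v * p v)) + 4 * \int[leb]_(s in `[u', v]) ((s - u) * dp s * ((s - u) * dp s)).
  rewrite -Ig -!RintegralZl// -RintegralD//; last 2 first.
  - by have := integrableZl mI 2 i3; apply: eq_integrable.
  - by have := integrableZl mI 4 i2; apply: eq_integrable.
  apply: le_Rintegral => // s; rewrite /= in_itv/= => /andP[su' sv].
  have su : 0 <= s - u' <= s - u by lra.
  rewrite /dg; move: (p s) (dp s) => P D.
  have -> : 2 * (P * P + (s - u') * (D * P + P * D)) + 4 * ((s - u) * D * ((s - u) * D)) =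
    P * P + ((P + 2 * (s - u') * D) ^+ 2 + 4 * ((s - u') * (s - u + (s - u')) * 0 + ((s - u) ^+ 2 - (s - u') ^+ 2) * D ^+ 2)).
    ring.
  rewrite lerDl addr_ge0 ?sqr_ge0// mulr0 add0r mulr_ge0// mulr_ge0 ?sqr_ge0//.
  by case/andP: su => s0 s1; rewrite subr_ge0 ler_sqr ?nnegrE// (le_trans s0).
have fin2 : (\int[leb]_(s in `[u', v]) ((s - u) * dp s * ((s - u) * dp s))%:E)%E \is a fin_num.
  exact: (integrable_fin_num mI i2).
have fin1 : (\int[leb]_(s in `[u', v]) (p s * p s)%:E)%E \is a fin_num.
  exact: (integrable_fin_num mI i1).
rewrite -(fineK fin1) -(fineK fin2) -EFinM -EFinD lee_fin; apply: (le_trans H).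
rewrite lerD2r mulrA ler_wpM2r//; first by rewrite -expr2 sqr_ge0.
by rewrite ler_pM2l// lerD2l lerN2 ltW.
Qed.

Lemma cont_oc_measurable (f : R -> R) (u v : R) : u < v ->
  (forall s : R, u < s <= v -> {for s, continuous f}) ->
  measurable_fun (`]u, v]%classic : set (measurableTypeR R)) (EFin \o f).
Proof.
move=> uv cf; pose F n : set (measurableTypeR R) := `[u + (v - u) / n.+2%:R, v]%classic.
have uc n : u < u + (v - u) / n.+2%:R by rewrite ltrDl divr_gt0// subr_gt0.
have -> : `]u, v]%classic = \bigcup_n F n.
  apply/seteqP; split => s; last first.
    by move=> [n _]; rewrite /F /= !in_itv/= => /andP[h1 ->]; rewrite (lt_le_trans (uc n)).
  rewrite /= in_itv/= => /andP[us sv].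
  have su : 0 < (s - u) / (v - u) by rewrite divr_gt0// subr_gt0.
  have [n] := ltr_add_invr su; rewrite add0r => nsu; exists n => //.
  rewrite /F /= in_itv/= sv andbT -lerBrDl.
  rewrite mulrC -ler_pdivlMr ?subr_gt0//; apply: le_trans (ltW nsu).
  by rewrite lef_pV2 ?posrE// ler_nat.
have mF n : measurable (F n) by exact: measurable_itv.
apply: (measurable_fun_bigcup _ mF).2 => n.
have w : {within F n, continuous f}.
  apply: continuous_in_subspaceT => s /set_mem; rewrite /F /= in_itv/= => /andP[h1 h2].
  by apply: cf; rewrite h2 (lt_le_trans (uc n)).
exact: (measurable_int leb (continuous_compact_integrable (@segment_compact _ _ _) w)).
Qed.

(** Hardy's inequality: let the left end of the segment in hardy_segment tend to u. *)
Lemma hardy1 (p dp : R -> R) (u v : R) : u < v ->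
  (forall s : R, u < s <= v -> is_derive s (1 : R) p (dp s)) ->
  (forall s : R, u < s <= v -> {for s, continuous dp}) ->
  (\int[leb]_(s in `]u, v]) (p s * p s)%:E <= (2 * (v - u) * (p v * p v))%:E +
    4%:E * \int[leb]_(s in `]u, v]) ((s - u) * dp s * ((s - u) * dp s))%:E)%E.
Proof.
move=> uv Dp cdp.
have cp (s : R) : u < s <= v -> {for s, continuous p}.
  by move=> /Dp[ds _]; apply: differentiable_continuous; exact/derivable1_diffP.
pose c n := u + (v - u) / n.+2%:R.
have uc n : u < c n by rewrite ltrDl divr_gt0// subr_gt0.
have cv n : c n < v.
  by rewrite -ltrBrDl ltr_pdivrMr// ltr_pMr ?subr_gt0// ltr1n.
pose F n := `[c n, v]%classic : set R.
have FE : \bigcup_n F n = `]u, v]%classic.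
  apply/seteqP; split => s.
    by move=> [n _]; rewrite /F /= !in_itv/= => /andP[h1 ->]; rewrite (lt_le_trans (uc n)).
  rewrite /= in_itv/= => /andP[us sv].
  have su : 0 < (s - u) / (v - u) by rewrite divr_gt0// subr_gt0.
  have [n] := ltr_add_invr su; rewrite add0r => nsu; exists n => //.
  rewrite /F /= in_itv/= sv andbT -lerBrDl.
  rewrite mulrC -ler_pdivlMr ?subr_gt0//; apply: le_trans (ltW nsu).
  by rewrite lef_pV2 ?posrE// ler_nat.
have mF n : @measurable _ (measurableTypeR R) (F n) by exact: measurable_itv.
have sub (s : R) n : F n s -> u < s <= v.
  by rewrite /F /= in_itv/= => /andP[h1 ->]; rewrite (lt_le_trans (uc n)).
have ndF : nondecreasing_seq F.
  move=> m n mn; apply/subsetPset => s; rewrite /F /= !in_itv/= => /andP[h1 ->]; rewrite andbT.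
  apply: le_trans h1; rewrite lerD2l ler_wpM2l ?subr_ge0 ?(ltW uv)//.
  by rewrite lef_pV2 ?posrE// ler_nat !ltnS.
have mf (f : R -> R) n : (forall s : R, u < s <= v -> {for s, continuous f}) -> measurable_fun (F n) (EFin \o f).
  move=> cf; have w : {within F n, continuous f} by apply: continuous_in_subspaceT => s /set_mem/sub; exact: cf.
  exact: (measurable_int leb (continuous_compact_integrable (@segment_compact _ _ _) w)).
have c1 (s : R) : u < s <= v -> {for s, continuous (fun s => p s * p s)}.
  by move=> us; apply: cvgM; exact: cp.
have H : (\int[leb]_(x in F i) (p x * p x)%:E)%E @[i --> \oo] --> (\int[leb]_(x in `]u, v]) (p x * p x)%:E)%E.
  rewrite -FE; apply: (@ge0_nondecreasing_set_cvg_integral _ (measurableTypeR R) R F _ leb ndF mF).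
    by move=> n; exact: (mf (fun s => p s * p s) n c1).
  by move=> n s _; rewrite lee_fin -expr2 sqr_ge0.
rewrite -(cvg_lim _ H)//; apply: lime_le; first by apply/cvg_ex; eexists; exact: H.
apply: nearW => n; apply: (le_trans (hardy_segment (uc n) (cv n) Dp cdp)).
rewrite leeD2l// lee_pmul2l//; apply: ge0_subset_integral => //.
- apply: (cont_oc_measurable (f := fun s => (s - u) * dp s * ((s - u) * dp s)) uv) => s us.
  have cs : {for s, continuous (fun s => s - u)} by apply: cvgB; [exact: cvg_id|exact: cvg_cst].
  by apply: cvgM; apply: cvgM => //; exact: cdp.
- by move=> s _; rewrite lee_fin -expr2 sqr_ge0.
- by move=> s /sub; rewrite /= in_itv/=.
Qed.
End hardy.

(** * Collars of Lipschitz graphs *)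

Section collars.
Context {R : realType}.
Local Notation P2 := (R * R)%type.
Local Notation mu := (@leb2 R).
Local Notation leb := (@lebesgue_measure R).
Local Notation MR := (measurableTypeR R).
Local Notation M2 := (measurableTypeR R * measurableTypeR R)%type.

(** Coordinates (lat, hgt) near a boundary point: moving along dir changes
    only the height, at unit speed. *)
Record collar (O : set P2) := Collar {
  dir : P2; lat : P2 -> R; hgt : P2 -> R; mid : R; wid : R; dep : R; lip : R;
  dir1 : dir.1 ^+ 2 + dir.2 ^+ 2 = 1;
  wid_gt0 : 0 < wid; dep_gt0 : 0 < dep; lip_ge1 : 1 <= lip;
  latD : forall y (s : R), lat (s *: dir + y) = lat y;
  hgtD : forall y (s : R), hgt (s *: dir + y) = s + hgt y;
  lat_lip : forall y y', `|lat y - lat y'| <= lip * `|y - y'|;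
  hgt_lip : forall y y', `|hgt y - hgt y'| <= lip * `|y - y'|;
  collar_sub : forall y, `|lat y - mid| < 2 * wid -> 0 < hgt y < 2 * dep -> O y }.

Lemma lip_continuous (f : P2 -> R) (L : R) : 1 <= L ->
  (forall y y', `|f y - f y'| <= L * `|y - y'|) -> continuous f.
Proof.
move=> L1 fL y; have L0 : 0 < L by exact: lt_le_trans L1.
apply/cvgrPdist_le => e e0; have d0 : 0 < e / L by rewrite divr_gt0.
apply: (filterS _ (nbhsx_ballx y _ d0)) => y'; rewrite -ball_normE /= => yy.
by rewrite (le_trans (fL y y'))// mulrC -ler_pdivlMr// ltW.
Qed.

Section one_collar.
Context (O : set P2) (oO : open O) (bO : bounded_set O) (Z : collar O).
Local Notation n := (dir Z).
Local Notation a := (dep Z).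
Local Notation hgt := (hgt Z).
Local Notation lat := (lat Z).

Definition cell : set P2 := [set y | `|lat y - mid Z| < wid Z /\ 0 < hgt y <= a].

Lemma hgt_cont : continuous hgt.
Proof. exact: lip_continuous (lip_ge1 Z) (@hgt_lip _ Z). Qed.
Lemma lat_cont : continuous lat.
Proof. exact: lip_continuous (lip_ge1 Z) (@lat_lip _ Z). Qed.

Lemma cell_sub : cell `<=` O.
Proof.
have w0 := wid_gt0 Z; have a0 := dep_gt0 Z.
by move=> y [h1 /andP[h2 h3]]; apply: (collar_sub (c := Z)); lra.
Qed.

Lemma measurable_hgt : measurable_fun [set: M2] (hgt : M2 -> MR).
Proof. by apply: cont_measurable; [exact: openT|move=> x _; exact: hgt_cont]. Qed.
Lemma measurable_lat : measurable_fun [set: M2] (lat : M2 -> MR).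
Proof. by apply: cont_measurable; [exact: openT|move=> x _; exact: lat_cont]. Qed.

Lemma measurable_cell : measurable cell.
Proof.
have -> : cell = (lat @^-1` `](mid Z - wid Z), (mid Z + wid Z)[) `&` (hgt @^-1` `]0, a]).
  apply/seteqP; split => y; rewrite /cell /= !in_itv/= ltr_norml.
    by move=> [/andP[h1 h2] h3]; split => //; lra.
  by move=> [/andP[h1 h2] h3]; split => //; lra.
apply: measurableI.
  by rewrite -[_ @^-1` _]setTI; apply: measurable_lat => //; exact: measurable_itv.
by rewrite -[_ @^-1` _]setTI; apply: measurable_hgt => //; exact: measurable_itv.
Qed.

Let k (t : R) : \bar R := (\1_(`]0, a]%classic : set R) t)%:E.

Lemma k_ge0 t : (0 <= k t)%E. Proof. by rewrite lee_fin. Qed.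

Lemma measurable_k : measurable_fun [set: MR] k.
Proof. by apply/measurable_EFinP; apply: measurable_indic; exact: measurable_itv. Qed.

Lemma measurable_line : measurable_fun [set: M2 * MR] (fun z : M2 * MR => (z.2 *: n + z.1)%R : M2).
Proof.
  have e1 : measurable_fun [set: M2 * MR] (fun z : M2 * MR => (z.2 * n.1 + z.1.1)%R : MR).
    apply: measurable_funD; first by apply: measurable_funM; [exact: measurable_snd|exact: measurable_cst].
    exact: (measurableT_comp (@measurable_fst _ _ _ _) (@measurable_fst _ _ _ _)).
  have e2 : measurable_fun [set: M2 * MR] (fun z : M2 * MR => (z.2 * n.2 + z.1.2)%R : MR).
    apply: measurable_funD; first by apply: measurable_funM; [exact: measurable_snd|exact: measurable_cst].
    exact: (measurableT_comp (@measurable_snd _ _ _ _) (@measurable_fst _ _ _ _)).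
  exact: (measurable_fun_pair e1 e2).
Qed.

(** Averaging w along dir over the slab of height a reproduces a times its
    integral, by Tonelli and translation invariance. *)
Lemma slab (w : P2 -> \bar R) : measurable_fun [set: M2] w -> (forall y, 0 <= w y)%E ->
  (a%:E * \int[mu]_y w y = \int[mu]_y (k (hgt y) * \int[leb]_s w (s *: n + y)%R))%E.
Proof.
move=> mw w0.
have mline := measurable_line.
pose f1 (z : M2 * MR) := (k (hgt z.1) * w (z.2 *: n + z.1)%R)%E.
pose f2 (z : M2 * MR) := (k (hgt z.1 - z.2)%R * w z.1)%E.
have mf1 : measurable_fun [set: M2 * MR] f1.
  apply: emeasurable_funM.
    exact: (measurableT_comp measurable_k (measurableT_comp measurable_hgt (@measurable_fst _ _ _ _))).
  exact: (measurableT_comp mw mline).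
have mf2 : measurable_fun [set: M2 * MR] f2.
  apply: emeasurable_funM; last exact: (measurableT_comp mw (@measurable_fst _ _ _ _)).
  apply: (measurableT_comp measurable_k); apply: measurable_funB; last exact: measurable_snd.
  exact: (measurableT_comp measurable_hgt (@measurable_fst _ _ _ _)).
have f10 z : (0 <= f1 z)%E by rewrite mule_ge0// k_ge0.
have f20 z : (0 <= f2 z)%E by rewrite mule_ge0// k_ge0.
transitivity (\int[mu]_y \int[leb]_s f2 (y, s))%E.
  rewrite -ge0_integralZl//; last by rewrite lee_fin ltW// dep_gt0.
  apply: eq_integral => y _; rewrite /f2 /= ge0_integralZr//; last 2 first.
  - apply: (measurableT_comp measurable_k); apply: measurable_funB; first exact: measurable_cst.
    exact: measurable_id.
  - by move=> s _; exact: k_ge0.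
  congr (_ * _)%E.
  transitivity (\int[leb]_s ((\1_(`[hgt y - a, hgt y[%classic : set R) s : R)%:E))%E.
    rewrite integral_indic//.
    rewrite setIT; transitivity (leb `[hgt y - a, hgt y[%classic); last by [].
    rewrite lebesgue_measure_itv/= lte_fin ltrBlDr ltrDl dep_gt0 -EFinB.
    by rewrite opprB addrCA subrr addr0.
  apply: eq_integral => s _; rewrite /k; congr EFin; rewrite !indicE; congr (nat_of_bool _)%:R.
  by apply/idP/idP; rewrite !inE /= !in_itv/= => /andP[h1 h2]; apply/andP; split; lra.
rewrite (fubini_tonelli f2)// [RHS](_ : _ = \int[mu]_y \int[leb]_s f1 (y, s))%E; last first.
  apply: eq_integral => y _; rewrite /f1 /=.
  have mwy : measurable_fun [set: MR] (fun s : MR => w (s *: n + y)%R).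
    exact: (measurableT_comp mw (measurable_fun_pair2 y mline)).
  by rewrite ge0_integralZl ?k_ge0.
have T1 := @fubini_tonelli _ _ M2 MR R mu leb f1 mf1 f10.
transitivity (\int[leb]_s \int[mu]_y f1 (y, s))%E; last by rewrite -T1.
apply: eq_integral => s _.
pose q (x : P2) : \bar R := (k (hgt x - s)%R * w x)%E.
have mq : measurable_fun [set: M2] q by exact: (measurable_fun_pair1 _ mf2).
rewrite -[LHS](ge0_int_shift (s *: n) mq); last by move=> x; exact: (f20 (x, s)).
by apply: eq_integral => y _; rewrite /q /f1 /= [(y + _)%R]addrC hgtD [(s + hgt y)%R]addrC addrK.
Qed.

Definition gsq (f : P2 -> R) (y : P2) : R := partial 0 f y ^+ 2 + partial 1 f y ^+ 2.

Lemma top_bounded f : smooth_on O f -> exists2 B : R, 0 <= B &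
  forall y, `|lat y - mid Z| < wid Z -> hgt y = a -> f y * f y <= B.
Proof.
move=> sf; have w0 := wid_gt0 Z; have a0 := dep_gt0 Z.
pose K : set P2 := [set y | mid Z - wid Z <= lat y <= mid Z + wid Z /\ hgt y = a].
have KO : K `<=` O.
  by move=> y [/andP[h1 h2] h3]; apply: (collar_sub (c := Z)); rewrite ?ltr_norml ?h3; lra.
have [M M0 HM] := bounded_sub_box bO.
have cK : compact K.
  apply: (@subclosed_compact _ _ _ _ (@compact_box R (- M) M (- M) M)); last first.
    by move=> y /KO/HM/boxP[/andP[? ?] /andP[? ?]]; split; rewrite /= in_itv/= !ltW.
  have -> : K = (lat @^-1` `[mid Z - wid Z, mid Z + wid Z]) `&` (hgt @^-1` [set a]).
    by apply/seteqP; split => y; rewrite /K /= in_itv/=.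
  apply: closedI; apply: closed_comp.
  - by move=> y _; exact: lat_cont.
  - exact: interval_closed.
  - by move=> y _; exact: hgt_cont.
  - exact: closed_eq.
have cF : compact (f @` K).
  by apply: continuous_compact => //; apply: continuous_in_subspaceT => y /set_mem/KO; exact: smooth_on_cont sf y.
have [B [Br HB]] := compact_bounded cF; exists ((`|B| + 1) * (`|B| + 1)); first by rewrite mulr_ge0 ?addr_ge0.
move=> y h1 h2; rewrite (le_trans (ler_norm _))// normrM.
have : `|f y| <= `|B| + 1.
  apply: HB; first by rewrite (le_lt_trans (ler_norm _))// ltrDl.
  by exists y => //; split => //; move: h1; rewrite ltr_norml; lra.
by move=> h; rewrite ler_pM.
Qed.

Lemma cell_lty : (mu cell < +oo)%E.
Proof.
apply: bounded_leb2_lty; first exact: measurable_cell.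
have [M [Mr H]] := bO; exists M; split => // N /H h y /cell_sub; exact: h.
Qed.

(** The one-dimensional inequality on each line in direction dir, integrated. *)
Lemma collar_hardy f : smooth_on O f ->
  (\int[mu]_(y in cell) (hgt y ^+ 2 * gsq f y)%:E < +oo)%E ->
  (\int[mu]_(y in cell) (f y * f y)%:E < +oo)%E.
Proof.
move=> sf fin; have a0 := dep_gt0 Z; have w0 := wid_gt0 Z; have mO := open_measurable2 oO.
have mC : @measurable _ M2 cell by exact: measurable_cell.
have mf : measurable_fun O f by exact: smooth_on_measurable.
have mp i : measurable_fun O (partial i f) by exact: (smooth_on_measurable oO (smooth_on_partial i sf)).
have toT (h : P2 -> R) : measurable_fun O h -> measurable_fun [set: M2] ((EFin \o h) \_ cell).
  move=> mh; have mh' : measurable_fun cell (EFin \o h).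
    by apply/measurable_EFinP; apply: measurable_funS mh => //; exact: cell_sub.
  exact: (measurable_restrictT _ mC).1 mh'.
pose w1 := (EFin \o (fun y => f y * f y)) \_ cell.
pose w2 := (EFin \o (fun y => hgt y ^+ 2 * gsq f y)) \_ cell.
have mw1 : measurable_fun [set: M2] w1 by apply: toT; exact: measurable_funM.
have mw2 : measurable_fun [set: M2] w2.
  apply: toT; apply: measurable_funM.
    by apply: measurable_funX; apply: measurable_funS measurable_hgt.
  by apply: measurable_funD; apply: measurable_funX.
have w10 y : (0 <= w1 y)%E by rewrite /w1 patchE; case: ifP => // _; rewrite lee_fin -expr2 sqr_ge0.
have w20 y : (0 <= w2 y)%E.
  by rewrite /w2 patchE; case: ifP => // _; rewrite lee_fin mulr_ge0 ?addr_ge0 ?sqr_ge0.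
rewrite integral_mkcond -/w1; rewrite integral_mkcond -/w2 in fin.
have [B B0 HB] := top_bounded sf.
pose b (y : P2) : \bar R := (2 * a * B * \1_cell y)%:E.
(* Hardy's inequality along the line through y, whose part in the cell is ]u, v]. *)
have line y : (k (hgt y) * \int[leb]_s w1 (s *: n + y)%R <=
    b y + 4%:E * (k (hgt y) * \int[leb]_s w2 (s *: n + y)%R))%E.
  have [hy|hy] := boolP (0 < hgt y <= a); last first.
    have -> : k (hgt y) = 0%E.
      by rewrite /k indicE memNset//= in_itv/=; exact/negP.
    rewrite !mul0e mule0 adde0 lee_fin mulr_ge0//.
    by rewrite !mulr_ge0// ltW.
  have -> : k (hgt y) = 1%E by rewrite /k indicE mem_set//= in_itv/=.
  rewrite !mul1e.
  have [ly|ly] := ltP `|lat y - mid Z| (wid Z); last first.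
    rewrite integral0_eq; last first.
      move=> s _; rewrite /w1 patchE memNset//= => -[]; rewrite latD.
      by rewrite ltNge ly.
    rewrite adde_ge0// ?lee_fin.
      by rewrite !mulr_ge0// ltW.
    by rewrite mule_ge0//; apply: integral_ge0.
  have yC : cell y by [].
  pose u := - hgt y; pose v := a - hgt y.
  have uv : u < v by rewrite /u /v; lra.
  have cellE s : cell (s *: n + y) <-> u < s <= v.
    rewrite /cell /= latD hgtD /u /v; split => [[_ /andP[h1 h2]]|/andP[h1 h2]].
      by apply/andP; split; lra.
    by split => //; apply/andP; split; lra.
  have inCE (s : R) : (s *: n + y \in cell) = (s \in (`]u, v]%classic : set R)).
    apply/idP/idP => /set_mem H'; apply/mem_set; first by rewrite /= in_itv/=; exact/cellE.
    by apply/cellE; move: H'; rewrite /= in_itv/=.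
  pose p s := f (s *: n + y).
  pose dp s := n.1 * partial 0 f (s *: n + y) + n.2 * partial 1 f (s *: n + y).
  have Op s : u < s <= v -> O (s *: n + y) by move/cellE; exact: cell_sub.
  have Dp (s : R) : u < s <= v -> is_derive s (1 : R) p (dp s).
    by move=> /Op Os; apply: is_derive_line; exact: (is_derive_dir n oO sf Os).
  have cl (s : R) : {for s, continuous (fun s : R => s *: n + y : P2)}.
    by apply: cvgD; [apply: cvgZr_tmp; exact: cvg_id|exact: cvg_cst].
  have cpl i (s : R) : u < s <= v -> {for s, continuous (fun s : R => partial i f (s *: n + y))}.
    move=> /Op Os; have ci : {for s *: n + y, continuous (partial i f)}.
      exact: smooth_on_cont (smooth_on_partial i sf) _ Os.
    exact: (continuous_comp (cl s) ci).
  have cdp (s : R) : u < s <= v -> {for s, continuous dp}.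
    move=> us; have c i : {for s, continuous (fun s : R => partial i f (s *: n + y))} by exact: cpl.
    by apply: cvgD; apply: cvgM; [exact: cvg_cst|exact: c|exact: cvg_cst|exact: c].
  have H := hardy1 uv Dp cdp.
  have -> : (\int[leb]_s w1 (s *: n + y)%R = \int[leb]_(s in `]u, v]) (p s * p s)%:E)%E.
    rewrite [RHS]integral_mkcond; apply: eq_integral => s _; rewrite /w1 !patchE.
    by rewrite inCE.
  apply: (le_trans H); apply: leeD.
    rewrite /b indicE mem_set// mulr1 lee_fin.
    have -> : v - u = a by rewrite /v /u; ring.
    rewrite ler_wpM2l//; first by rewrite mulr_ge0// ltW.
    by apply: HB; rewrite ?latD// hgtD /v subrK.
  rewrite lee_pmul2l//.
  have -> : (\int[leb]_s w2 (s *: n + y)%R =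
      \int[leb]_(s in `]u, v]) ((hgt (s *: n + y)) ^+ 2 * gsq f (s *: n + y)%R)%:E)%E.
    rewrite [RHS]integral_mkcond; apply: eq_integral => s _; rewrite /w2 !patchE.
    by rewrite inCE.
  apply: ge0_le_integral => //.
  - by move=> s _; rewrite lee_fin -expr2 sqr_ge0.
  - apply: (cont_oc_measurable (f := fun s => (s - u) * dp s * ((s - u) * dp s)) uv) => s us.
    have cs : {for s, continuous (fun s => s - u)} by apply: cvgB; [exact: cvg_id|exact: cvg_cst].
    by apply: cvgM; apply: cvgM => //; exact: cdp.
  - apply: (cont_oc_measurable (f := fun s => hgt (s *: n + y) ^+ 2 * gsq f (s *: n + y)) uv) => s us.
    have ch : {for s, continuous (fun s : R => hgt (s *: n + y))}.
      rewrite (_ : (fun s : R => hgt (s *: n + y)) = (fun s => s + hgt y)).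
        by apply: cvgD; [exact: cvg_id|exact: cvg_cst].
      by apply/funext => s'; rewrite hgtD.
    by apply: cvgM; [exact: cvgM|apply: cvgD; apply: cvgM; exact: cpl].
  move=> s /= su; rewrite lee_fin hgtD /u opprK -mulrACA -expr2 ler_wpM2l ?sqr_ge0//.
  rewrite /dp /gsq; move: (partial 0 f _) (partial 1 f _) => P Q.
  have -> : P ^+ 2 + Q ^+ 2 = (n.1 * P + n.2 * Q) ^+ 2 + (n.1 * Q - n.2 * P) ^+ 2.
    have -> : P ^+ 2 + Q ^+ 2 = (n.1 ^+ 2 + n.2 ^+ 2) * (P ^+ 2 + Q ^+ 2) by rewrite dir1 mul1r.
    ring.
  by rewrite -expr2 lerDl sqr_ge0.
have mk w : measurable_fun [set: M2] w -> (forall y, 0 <= w y)%E ->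
    measurable_fun [set: M2] (fun y => k (hgt y) * \int[leb]_s w (s *: n + y)%R)%E.
  move=> mw w0'; apply: emeasurable_funM; first exact: (measurableT_comp measurable_k measurable_hgt).
  exact: (@measurable_fun_fubini_tonelli_F _ _ M2 MR R leb _ (measurableT_comp mw measurable_line) (fun z => w0' _)).
have mb : measurable_fun [set: M2] b.
  apply/measurable_EFinP; apply: measurable_funM; first exact: measurable_cst.
  exact: measurable_indic.
have b0 y : (0 <= b y)%E by rewrite lee_fin !mulr_ge0// ltW.
have kw0 w y : (forall y, 0 <= w y)%E -> (0 <= k (hgt y) * \int[leb]_s w (s *: n + y)%R)%E.
  by move=> w0'; rewrite mule_ge0 ?k_ge0//; exact: integral_ge0.
have : (a%:E * \int[mu]_y w1 y <= \int[mu]_y b y + 4%:E * (a%:E * \int[mu]_y w2 y))%E.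
  rewrite slab// slab//.
  rewrite -ge0_integralZl//; [|exact: mk|by move=> y _; exact: kw0].
  rewrite -ge0_integralD//; last 2 first.
  - by move=> y _; rewrite mule_ge0// kw0.
  - by apply: emeasurable_funM; [exact: measurable_cst|exact: mk].
  apply: ge0_le_integral => //.
  - by move=> y _; exact: kw0.
  - exact: mk.
  - by apply: emeasurable_funD => //; apply: emeasurable_funM; [exact: measurable_cst|exact: mk].
have bfin : (\int[mu]_y b y < +oo)%E.
  rewrite /b; under eq_integral do rewrite EFinM.
  rewrite ge0_integralZl//; last by rewrite lee_fin !mulr_ge0// ltW.
    rewrite integral_indic// setIT.
    have fC : mu cell \is a fin_num by rewrite ge0_fin_numE//; exact: cell_lty.
    by rewrite -[X in (_ * X)%E](fineK fC) -EFinM ltry.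
  by apply/measurable_EFinP; exact: measurable_indic.
have fin2 : (\int[mu]_y w2 y)%E \is a fin_num.
  by rewrite ge0_fin_numE//; exact: integral_ge0.
move=> H; have : (a%:E * \int[mu]_y w1 y < +oo)%E.
  by apply: (le_lt_trans H); rewrite -(fineK fin2) -!EFinM lte_add_pinfty// ltry.
have : (0 <= \int[mu]_y w1 y)%E by exact: integral_ge0.
case: (\int[mu]_y w1 y)%E => [r _ _| _|//]; first exact: ltry.
by rewrite gt0_muley ?lte_fin.
Qed.

End one_collar.
End collars.

(** * Hardy inequality for harmonic gradients *)

Section collar_harmonic.
Context {R : realType}.
Local Notation P2 := (R * R)%type.
Local Notation mu := (@leb2 R).
Local Notation MR := (measurableTypeR R).
Local Notation M2 := (measurableTypeR R * measurableTypeR R)%type.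
Context (O : set P2) (oO : open O) (bO : bounded_set O) (Z : collar O).
Local Notation hgt := (hgt Z).
Local Notation lat := (lat Z).
Local Notation cell := (cell Z).

(** Squares of radius slope * hgt x around the points of the cell stay in O,
    and the height varies at most by half on them. *)
Definition slope : R := Num.min 1 (wid Z / dep Z) / (2 * lip Z).

Lemma slope_gt0 : 0 < slope.
Proof.
rewrite divr_gt0//; last by rewrite mulr_gt0// (lt_le_trans ltr01)// lip_ge1.
by rewrite lt_min ltr01 divr_gt0 ?wid_gt0 ?dep_gt0.
Qed.

Lemma slope_ball x y : cell x -> `|y - x| < slope * hgt x ->
  [/\ O y, hgt x <= 2 * hgt y & hgt y <= 2 * hgt x].
Proof.
move=> [hl /andP[h0 ha]] yx.
have L0 : 0 < lip Z by rewrite (lt_le_trans ltr01)// lip_ge1.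
have a0 := dep_gt0 Z; have w0 := wid_gt0 Z.
have yx' : lip Z * `|y - x| <= Num.min 1 (wid Z / dep Z) * hgt x / 2.
  rewrite -ler_pdivlMl//; apply: le_trans (ltW yx) _; rewrite /slope.
  by rewrite le_eqVlt; apply/orP; left; apply/eqP; field; rewrite gt_eqF.
have d1 : `|hgt y - hgt x| <= hgt x / 2.
  apply: (le_trans (hgt_lip Z y x)); apply: (le_trans yx').
  by rewrite ler_pM2r// ler_piMl ?(ltW h0)// ge_min lexx.
have d2 : `|lat y - lat x| <= wid Z / 2.
  apply: (le_trans (lat_lip Z y x)); apply: (le_trans yx'); rewrite ler_pM2r//.
  apply: (@le_trans _ _ (wid Z / dep Z * hgt x)).
    by rewrite ler_wpM2r ?(ltW h0)// ge_min lexx orbT.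
  by rewrite mulrAC ler_pdivrMr// ler_wpM2l// ltW.
move: d1; rewrite ler_norml => /andP[d11 d12].
split; [|lra|lra].
apply: (collar_sub (c := Z)); last lra.
have := ler_normD (lat y - lat x) (lat x - mid Z); rewrite addrA subrK.
lra.
Qed.

Lemma measurable_near (p q : M2 -> MR) : measurable_fun [set: M2] p -> measurable_fun [set: M2] q ->
  measurable [set z : M2 * M2 | `|q z.2 - q z.1| < p z.1].
Proof.
move=> mp mq; pose m (z : M2 * M2) : MR := p z.1 - `|q z.2 - q z.1|.
have mm : measurable_fun [set: M2 * M2] m.
  apply: measurable_funB; first exact: (measurableT_comp mp (@measurable_fst _ _ _ _)).
  apply: measurableT_comp => //; apply: measurable_funB.
    exact: (measurableT_comp mq (@measurable_snd _ _ _ _)).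
  exact: (measurableT_comp mq (@measurable_fst _ _ _ _)).
have -> : [set z : M2 * M2 | `|q z.2 - q z.1| < p z.1] = m @^-1` `]0, +oo[.
  by apply/seteqP; split => z; rewrite /m /= in_itv/= andbT subr_gt0.
by rewrite -[_ @^-1` _]setTI; apply: mm => //; exact: measurable_itv.
Qed.

Definition nearby : set (M2 * M2) := [set z | cell z.1 /\ `|z.2 - z.1| < slope * hgt z.1].

Lemma measurable_nearby : measurable nearby.
Proof.
have mp : measurable_fun [set: M2] (fun x : M2 => slope * hgt x : MR).
  by apply: measurable_funM; [exact: measurable_cst|exact: measurable_hgt].
have m1 := measurable_near mp (@measurable_fst _ _ MR MR).
have m2 := measurable_near mp (@measurable_snd _ _ MR MR).
have -> : nearby = (fst @^-1` cell) `&` ([set z : M2 * M2 | `|z.2.1 - z.1.1| < slope * hgt z.1] `&`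
   [set z : M2 * M2 | `|z.2.2 - z.1.2| < slope * hgt z.1]).
  apply/seteqP; split => z; rewrite /nearby /= prod_normE gt_max.
    by move=> [? /andP[? ?]].
  by move=> [? [? ?]]; split => //; apply/andP.
apply: measurableI; last exact: measurableI.
rewrite -[_ @^-1` _]setTI; apply: (@measurable_fst _ _ M2 M2) => //; exact: measurable_cell.
Qed.

Lemma measurable_inv_hgt : measurable_fun [set: M2] ((fun x => (hgt x ^+ 2)^-1) \_ cell : M2 -> MR).
Proof.
have mC : @measurable _ M2 cell by exact: measurable_cell.
apply/(measurable_restrictT _ mC); pose H : set P2 := hgt @^-1` `]0, +oo[.
have oH : open H by apply: open_comp => [y _|]; [exact: hgt_cont|exact: interval_open].
apply: (@measurable_funS _ _ _ _ H); first exact: open_measurable2.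
  by move=> y [_ /andP[h _]]; rewrite /H /= in_itv/= h.
apply: (cont_measurable oH) => y; rewrite /H /= in_itv/= andbT => h0.
apply: cvgV; first by rewrite expf_neq0// gt_eqF.
by apply: cvgM; exact: hgt_cont.
Qed.

(** The interior gradient estimate at scale slope * hgt, integrated over the
    cell; Tonelli counts each point boundedly often. *)
Lemma collar_harmonic T : L2 O T -> smooth_on O T -> weakly_harmonic O T ->
  (\int[mu]_(y in cell) (hgt y ^+ 2 * gsq T y)%:E < +oo)%E.
Proof.
move=> LT sT hT; have [C C0 HC] := @grad_bound R.
have mO := open_measurable2 oO; have s0 := slope_gt0.
have mC : @measurable _ M2 cell by exact: measurable_cell.
pose c0 := 2 * C / slope ^+ 4.
have c00 : 0 <= c0 by apply: divr_ge0; [exact: mulr_ge0|rewrite exprn_ge0// ltW].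
pose W := (EFin \o (fun y => T y * T y)) \_ O.
have mT := L2_meas LT.
have mW : measurable_fun [set: M2] W.
  have m1 : measurable_fun O (EFin \o (fun y => T y * T y)) by apply/measurable_EFinP; exact: measurable_funM.
  exact: (measurable_restrictT _ (mO : @measurable _ M2 O)).1 m1.
have W0 y : (0 <= W y)%E by rewrite /W patchE; case: ifP => // _; rewrite lee_fin -expr2 sqr_ge0.
pose K (z : M2 * M2) : \bar R := (c0 * ((fun x => (hgt x ^+ 2)^-1) \_ cell) z.1 * \1_nearby z)%:E.
have ih0 x : 0 <= ((fun x => (hgt x ^+ 2)^-1) \_ cell) x.
  by rewrite patchE; case: ifP => // _; rewrite invr_ge0 sqr_ge0.
have K0 z : (0 <= K z)%E.
  by rewrite lee_fin; apply: mulr_ge0; [exact: mulr_ge0 c00 (ih0 _)|rewrite indicE ler0n].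
have mK : measurable_fun [set: M2 * M2] K.
  apply/measurable_EFinP; apply: measurable_funM; last first.
    by apply: measurable_indic; exact: measurable_nearby.
  apply: measurable_funM; first exact: measurable_cst.
  exact: (measurableT_comp measurable_inv_hgt (@measurable_fst _ _ M2 M2)).
pose F (z : M2 * M2) : \bar R := (K z * W z.2)%E.
have mF : measurable_fun [set: M2 * M2] F.
  apply: emeasurable_funM => //; exact: (measurableT_comp mW (@measurable_snd _ _ M2 M2)).
have F0 z : (0 <= F z)%E by rewrite mule_ge0.
(* The gradient estimate at x bounds the integrand by an average of T ^ 2 over the
   points y near x. *)
have step1 : (\int[mu]_(y in cell) (hgt y ^+ 2 * gsq T y)%:E <= \int[mu]_x \int[mu]_y F (x, y))%E.
  rewrite integral_mkcond; apply: ge0_le_integral => //.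
  - move=> x _; rewrite patchE; case: ifP => // _.
    by rewrite lee_fin mulr_ge0 ?addr_ge0 ?sqr_ge0.
  - have mg : measurable_fun cell (EFin \o (fun y => hgt y ^+ 2 * gsq T y)).
      apply/measurable_EFinP; apply: measurable_funM.
        by apply: measurable_funX; apply: measurable_funS (measurable_hgt Z).
      have mp i : measurable_fun cell (partial i T).
        apply: (measurable_funS mO (@cell_sub _ _ Z)).
        by apply: smooth_on_measurable => //; exact: smooth_on_partial.
      by apply: measurable_funD; apply: measurable_funX.
    exact: (measurable_restrictT _ mC).1 mg.
  - exact: (@measurable_fun_fubini_tonelli_F _ _ M2 M2 R mu F mF F0).
  move=> x _; rewrite patchE; case: ifPn => xC; last exact: integral_ge0.
  move/set_mem in xC; have [_ /andP[h0 _]] := xC.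
  set r := slope * hgt x; have r0 : 0 < r by rewrite mulr_gt0.
  have xO : ball x r `<=` O.
    by move=> y; rewrite -ball_normE /= -opprB normrN => /(slope_ball xC)[].
  have oB : open (ball x r) by exact: ball_open.
  have mB := open_measurable2 oB.
  have LB : L2 (ball x r) T.
    have [_ Too] := LT; split; first exact: measurable_funS mT.
    apply: le_lt_trans Too; apply: ge0_subset_integral => //.
      by apply/measurable_EFinP; exact: measurable_funX.
    by move=> y _; rewrite lee_fin sqr_ge0.
  have H i := HC O T oO bO LT sT hT x r i r0 xO.
  have -> : (\int[mu]_y F (x, y) = (c0 / hgt x ^+ 2)%:E * \int[mu]_(y in ball x r) (T y * T y)%:E)%E.
    rewrite -ge0_integralZl//; last 3 first.
    - by apply/measurable_EFinP; apply: measurable_funM; exact: L2_meas LB.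
    - by move=> y _; rewrite lee_fin -expr2 sqr_ge0.
    - by rewrite lee_fin divr_ge0// sqr_ge0.
    rewrite [RHS]integral_mkcond; apply: eq_integral => y _; rewrite /F /K /W /= !patchE mem_set// indicE.
    have [xy|xy] := pselect (ball x r y).
      rewrite mem_set; last by split => //=; move: xy; rewrite -ball_normE /= -opprB normrN.
      by rewrite mem_set ?mulr1; [rewrite mem_set//|exact: xO].
    rewrite memNset; last by move=> -[_ /=] h; apply: xy; rewrite -ball_normE /= -opprB normrN.
    by rewrite mulr0 mul0e memNset.
  rewrite (nsq_fine mB LB) -EFinM lee_fin /gsq.
  have := H 0; have := H 1; move: (partial 0 T x ^+ 2) (partial 1 T x ^+ 2) (nsq _ _) => P Q N h1 h2.
  have -> : c0 / hgt x ^+ 2 * N = hgt x ^+ 2 * (C / r ^+ 4 * N + C / r ^+ 4 * N).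
    by rewrite /c0 /r; field; rewrite !gt_eqF.
  by rewrite ler_wpM2l ?sqr_ge0// lerD.
apply: (le_lt_trans step1); rewrite (fubini_tonelli F)//.
pose M := 64 * c0 * slope ^+ 2.
have M0 : 0 <= M by apply: mulr_ge0; [exact: mulr_ge0|exact: sqr_ge0].
have fW : (\int[mu]_y W y < +oo)%E.
  rewrite /W -integral_mkcond (nsq_fine mO LT); exact: ltry.
apply: (@le_lt_trans _ _ (\int[mu]_y (M%:E * W y))%E); last first.
  rewrite ge0_integralZl// ?lee_fin//.
  have fW' : (\int[mu]_y W y)%E \is a fin_num by rewrite ge0_fin_numE//; exact: integral_ge0.
  by rewrite -(fineK fW') -EFinM ltry.
have mKy y : measurable_fun [set: M2] (fun x => K (x, y)) by exact: measurable_fun_pair1.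
apply: ge0_le_integral => //.
- by move=> y _; exact: integral_ge0.
- exact: (@measurable_fun_fubini_tonelli_G _ _ M2 M2 R mu F mF F0).
- by apply: emeasurable_funM => //; exact: measurable_cst.
move=> y _; rewrite /F /= ge0_integralZr//.
apply: lee_wpmul2r => //.
have [hy|hy] := leP (hgt y) 0.
  rewrite integral0_eq ?lee_fin// => x _; rewrite /K indicE memNset ?mulr0//.
  by move=> -[/= xC /(slope_ball xC)[_ ? ?]]; have [_ /andP[h0 _]] := xC; lra.
(* The points x to which y is near lie in a ball whose area is comparable to
   hgt y ^+ 2. *)
pose r := 2 * (slope * hgt y).
have r0 : 0 < r by apply: mulr_gt0 => //; exact: mulr_gt0.
have mB : measurable (ball y r) by apply: open_measurable2; exact: ball_open.
have q0 : 0 <= 4 * c0 / hgt y ^+ 2 by apply: divr_ge0; [exact: mulr_ge0|exact: sqr_ge0].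
apply: (@le_trans _ _ (\int[mu]_x ((4 * c0 / hgt y ^+ 2)%:E * (\1_(ball y r) x)%:E))%E).
  apply: ge0_le_integral => //.
  - apply: emeasurable_funM; first exact: measurable_cst.
    by apply/measurable_EFinP; exact: measurable_indic.
  move=> x _; rewrite /K -EFinM lee_fin [\1_nearby _]indicE.
  have [xy|xy] := pselect (nearby (x, y)); last by rewrite memNset// mulr0 mulr_ge0.
  have [/= xC /(slope_ball xC)[Oy hx1 hx2]] := xy; have [_ /andP[h0 _]] := xC.
  rewrite mem_set// mulr1 indicE mem_set; last first.
    rewrite -ball_normE /=; case: xy => _ /=; move=> h; apply: (lt_le_trans h).
    by rewrite /r mulrCA ler_wpM2l// ltW.
  rewrite mulr1 patchE mem_set//.
  rewrite ler_pdivrMr ?exprn_gt0// mulrAC ler_pdivlMr ?exprn_gt0//.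
  rewrite (_ : 4 * c0 * hgt x ^+ 2 = c0 * (2 * hgt x) ^+ 2); last by ring.
  apply: ler_wpM2l => //; rewrite ler_sqr// nnegrE; lra.
rewrite ge0_integralZl//; last by apply/measurable_EFinP; exact: measurable_indic.
rewrite integral_indic// setIT.
apply: (@le_trans _ _ ((4 * c0 / hgt y ^+ 2)%:E * (2 * r * (2 * r))%:E)%E).
  by rewrite -(leb2_ball y (ltW r0)).
rewrite -EFinM lee_fin.
by rewrite le_eqVlt; apply/orP; left; apply/eqP; rewrite /M /r; field; rewrite gt_eqF.
Qed.

End collar_harmonic.

(** * Square integrability of harmonic conjugates *)

Section lipschitz_collars.
Context {R : realType}.
Local Notation P2 := (R * R)%type.
Local Notation mu := (@leb2 R).
Local Notation M2 := (measurableTypeR R * measurableTypeR R)%type.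
Context (O : set P2) (oO : open O) (bO : bounded_set O).

Lemma lipschitz_bound (h : R -> R) : lipschitz h -> exists2 L : R, 0 <= L & forall x y, `|h x - h y| <= L * `|x - y|.
Proof.
move=> [M [Mr HM]]; exists (`|M| + 1); first by rewrite addr_ge0.
move=> x y; apply: (HM (`|M| + 1) _ (x, y)) => //.
by rewrite (le_lt_trans (ler_norm _))// ltrDl.
Qed.

(** In the rotated frame of the Lipschitz chart, take the abscissa xi and the height
    t of a point above the graph. *)
Lemma collar_exists p : lipschitz_boundary O -> boundary O p ->
  exists Z : collar O, \forall y \near p, O y -> cell Z y.
Proof.
move=> lO bp; have [c [s [h [cs1 lh np]]]] := lO p bp.
have [L L0 HL] := lipschitz_bound lh.
have [c1 s1] : `|c| <= 1 /\ `|s| <= 1.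
  have h1 : c ^+ 2 <= 1 ^+ 2 by rewrite expr1n -cs1 lerDl sqr_ge0.
  have h2 : s ^+ 2 <= 1 ^+ 2 by rewrite expr1n -cs1 lerDr sqr_ge0.
  by split; rewrite -(ler_sqr (normr_ge0 _))// ?nnegrE// real_normK ?num_real.
pose xi (y : P2) := c * y.1 + s * y.2.
pose t (y : P2) := c * y.2 - s * y.1 - h (xi y).
have lin (a b u v : R) : `|a| <= 1 -> `|b| <= 1 -> `|a * u + b * v| <= `|u| + `|v|.
  move=> a1 b1; rewrite (le_trans (ler_normD _ _))// !normrM lerD// ler_piMl//.
have cmp (y y' : P2) : `|y.1 - y'.1| <= `|y - y'| /\ `|y.2 - y'.2| <= `|y - y'|.
  by rewrite [`|y - y'|]prod_normE !le_max !lexx orbT.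
have xil y y' : `|xi y - xi y'| <= 2 * `|y - y'|.
  have -> : xi y - xi y' = c * (y.1 - y'.1) + s * (y.2 - y'.2) by rewrite /xi; ring.
  by have [? ?] := cmp y y'; apply: (le_trans (lin _ _ _ _ c1 s1)); lra.
have tl y y' : `|t y - t y'| <= (2 + 2 * L) * `|y - y'|.
  have -> : t y - t y' = (c * (y.2 - y'.2) + (- s) * (y.1 - y'.1)) + (h (xi y') - h (xi y)) by rewrite /t; ring.
  have ns : `|- s| <= 1 by rewrite normrN.
  have [d1 d2] := cmp y y'; have e1 := lin c (- s) (y.2 - y'.2) (y.1 - y'.1) c1 ns.
  have e2 := HL (xi y') (xi y); have e3 := xil y' y.
  have e4 : L * `|xi y' - xi y| <= L * (2 * `|y - y'|) by rewrite ler_wpM2l// [in leRHS]distrC.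
  apply: (le_trans (ler_normD _ _)); move: e1 e2 e4 d1 d2.
  by move: `|y - y'| => N; lra.
have L2 : 1 <= 2 + 2 * L by lra.
have ct : continuous t by exact: lip_continuous L2 tl.
have cxi : continuous xi by apply: (@lip_continuous _ _ 2) => //; rewrite ler1n.
have [d d0 Hd] : exists2 d : R, 0 < d & forall y, ball p d y -> (O y <-> 0 < t y).
  move/nbhs_ballP : np => [d /= d0 Hd]; exists d => // y /Hd.
  by rewrite /t subr_gt0.
have tp : t p = 0.
  have pp := ballxx p d0; apply/eqP; rewrite eq_le; apply/andP; split.
    rewrite leNgt; apply/negP => /(Hd p pp) Op; case: bp => _; apply.
    exact: (open_nbhs_nbhs (conj oO Op)).
  rewrite leNgt; apply/negP => tp.
  have nt : \forall y \near p, t y < 0.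
    by have := ct p; move/cvgr_lt/(_ _ tp).
  have [y [Oy [yt yb]]] : (O `&` [set y | t y < 0 /\ ball p d y]) !=set0.
    by case: bp => clp _; apply: clp; apply: filterI => //; exact: nbhsx_ballx.
  by move/(Hd y yb) : Oy => ty; move: (lt_trans ty yt); rewrite ltxx.
pose w := d / (2 * (4 + 2 * L)).
have w0 : 0 < w by rewrite divr_gt0// mulr_gt0//; lra.
have sub (y : P2) : `|xi y - xi p| < 2 * w -> 0 < t y < 2 * w -> O y.
  move=> hx /andP[t0 t1]; apply/Hd => //.
  pose dx := xi y - xi p; pose dy := (c * y.2 - s * y.1) - (c * p.2 - s * p.1).
  have y1 : y.1 - p.1 = c * dx + (- s) * dy.
    have -> : y.1 - p.1 = (c ^+ 2 + s ^+ 2) * (y.1 - p.1) by rewrite cs1 mul1r.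
    by rewrite /dx /dy /xi; ring.
  have y2 : y.2 - p.2 = s * dx + c * dy.
    have -> : y.2 - p.2 = (c ^+ 2 + s ^+ 2) * (y.2 - p.2) by rewrite cs1 mul1r.
    by rewrite /dx /dy /xi; ring.
  have dyE : dy = t y + (h (xi y) - h (xi p)) by move: tp; rewrite /dy /t; lra.
  have dyb : `|dy| <= 2 * w + L * (2 * w).
    rewrite dyE (le_trans (ler_normD _ _))// lerD//; first by rewrite gtr0_norm// ltW.
    by rewrite (le_trans (HL _ _))// ler_wpM2l// ltW.
  have ns : `|- s| <= 1 by rewrite normrN.
  have e1 := lin c (- s) dx dy c1 ns; have e2 := lin s c dx dy s1 c1.
  have wd : 2 * (w * (4 + 2 * L)) = d by rewrite /w; field; lra.
  have tot : `|dx| + `|dy| < d.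
    have dxb : `|dx| < 2 * w by [].
    have wL : 0 <= w * (4 + 2 * L) by rewrite mulr_ge0 ?ltW//; lra.
    have : 2 * w + (2 * w + L * (2 * w)) = w * (4 + 2 * L) by ring.
    lra.
  rewrite -ball_normE /= -opprB normrN prod_normE gt_max /= y1 y2.
  by rewrite (le_lt_trans e1)// (le_lt_trans e2).
have n1 : ((- s, c) : P2).1 ^+ 2 + ((- s, c) : P2).2 ^+ 2 = 1 by rewrite /= sqrrN addrC.
have xD y (u : R) : xi (u *: ((- s, c) : P2) + y) = xi y.
  by rewrite /xi /= /GRing.scale /=; ring.
have tD y (u : R) : t (u *: ((- s, c) : P2) + y) = u + t y.
  rewrite /t xD /= /GRing.scale /=.
  have -> : c * (u * c + y.2) - s * (u * - s + y.1) = u * (c ^+ 2 + s ^+ 2) + (c * y.2 - s * y.1) by ring.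
  by rewrite cs1 mulr1 -addrA.
have xil' y y' : `|xi y - xi y'| <= (2 + 2 * L) * `|y - y'|.
  by apply: (le_trans (xil y y')); rewrite ler_wpM2r// lerDl mulr_ge0.
exists (Collar n1 w0 w0 L2 xD tD xil' tl sub).
have nx : \forall y \near p, `|xi p - xi y| < w by have /cvgrPdist_lt/(_ _ w0) := cxi p.
have nt : \forall y \near p, `|t p - t y| < w by have /cvgrPdist_lt/(_ _ w0) := ct p.
have nb : \forall y \near p, ball p d y by exact: nbhsx_ballx.
near=> y => Oy.
have h1 : `|xi p - xi y| < w by exact: (near nx y).
have h2 : `|t p - t y| < w by exact: (near nt y).
have yb : ball p d y by exact: (near nb y).
rewrite /cell /=; split; first by rewrite distrC.
have ty : 0 < t y by apply/Hd.
rewrite ty /=; move: h2; rewrite tp sub0r normrN gtr0_norm//; exact: ltW.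
Unshelve. all: by end_near. Qed.

Section ideal.
Context (w : P2 -> \bar R) (mw : measurable_fun [set: M2] w) (w0 : forall y, (0 <= w y)%E).

(** Sets on which w is integrable form an ideal; a compact set belongs to an
    ideal as soon as its points have neighbourhoods in it. *)
Definition small (A : set P2) := exists B : set P2, [/\ measurable B, A `<=` B & (\int[mu]_(y in B) w y < +oo)%E].

Lemma smallU A A' : small A -> small A' -> small (A `|` A').
Proof.
move=> [B [mB AB fB]] [B' [mB' AB' fB']]; exists (B `|` B'); split.
- exact: measurableU.
- by move=> y [/AB|/AB']; [left|right].
have -> : B `|` B' = B `|` (B' `\` B).
  by apply/seteqP; split => y; [move=> [?|?]; [left|have [|] := pselect (B y); [left|right]]|move=> [?|[? _]]; [left|right]].
have mD : measurable (B' `\` B) by exact: measurableD.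
rewrite ge0_integral_setU//; last 2 first.
- by apply: measurable_funS mw.
- by apply/disj_setPS => y [? []].
apply: lte_add_pinfty => //; apply: le_lt_trans fB'; apply: ge0_subset_integral => //.
by apply: measurable_funS mw.
Qed.

Lemma small_compact K : compact K -> (forall x, K x -> exists2 U, nbhs x U & small U) -> small K.
Proof.
move=> cK loc.
pose F : set_system P2 := [set S | small (~` S)].
have FF : Filter F.
  split.
  - by exists set0; split => //; [rewrite setCT|rewrite integral_set0].
  - by move=> S S' FS FS'; rewrite /F /= setCI; exact: smallU.
  - move=> S S' SS' [B [mB SB fB]]; exists B; split => //.
    by apply: subset_trans SB; exact: subsetC.
have cov x : K x -> \forall x' \near x & i \near F, (fun i x' => i <> x') i x'.
  move=> /loc[U nU sU]; exists (U, ~` U); first by split => //=; rewrite /F /= /nbhs /= setCK.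
  by move=> [x' i] /= [Ux' nUi] ix; apply: nUi; rewrite ix.
have := (compact_near_coveringP K).1 cK _ F (fun i x' => i <> x') FF cov.
move=> [B [mB KB fB]]; exists B; split => //; apply: subset_trans KB => x Kx /= H.
exact: (H x Kx).
Qed.

End ideal.

(** A point of O has a ball on which f is bounded, and a boundary point has a
    neighbourhood whose part in O lies in a cell; the closure of O is compact. *)
Lemma L2_of_collars f : lipschitz_boundary O -> smooth_on O f ->
  (forall Z : collar O, (\int[mu]_(y in cell Z) (f y * f y)%:E < +oo)%E) -> L2 O f.
Proof.
move=> lO sf fin; have mO := open_measurable2 oO.
have mf := smooth_on_measurable oO sf; split => //.
pose w := (EFin \o (fun y => f y * f y)) \_ O.
have mff : measurable_fun O (fun y => f y * f y) by exact: measurable_funM.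
have mw : measurable_fun [set: M2] w.
  have m1 : measurable_fun O (EFin \o (fun y => f y * f y)) by apply/measurable_EFinP.
  exact: (measurable_restrictT _ (mO : @measurable _ M2 O)).1 m1.
have w0 y : (0 <= w y)%E by rewrite /w patchE; case: ifP => // _; rewrite lee_fin -expr2 sqr_ge0.
have wE (B : set P2) : measurable B -> (\int[mu]_(y in B) w y = \int[mu]_(y in B `&` O) (f y * f y)%:E)%E.
  by move=> mB; rewrite /w [RHS]integral_mkcondr.
suff [B [mB OB fB]] : small w (closure O).
  apply: le_lt_trans fB; rewrite wE//; apply: ge0_subset_integral => //.
  - exact: measurableI.
  - by apply/measurable_EFinP; apply: measurable_funS mff => // y [].
  - by move=> y _; rewrite lee_fin sqr_ge0.
  - by move=> y Oy; split => //; apply: OB; exact: subset_closure.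
apply: small_compact => //.
  have [M M0 HM] := bounded_sub_box bO.
  apply: (@subclosed_compact _ _ _ _ (@compact_box R (- M) M (- M) M)); first exact: closed_closure.
  rewrite closureE => y; apply; split; first exact: closed_cbox.
  by apply: subset_trans HM _; exact: box_cbox.
move=> x clx; have [Ox|nOx] := pselect (O x).
  have [r r0 rO] := margin oO Ox.
  have xx := ballxx x r0; have sO := rO x xx.
  exists (ball x r); first exact: nbhsx_ballx.
  have mB : measurable (ball x r) by apply: open_measurable2; exact: ball_open.
  exists (ball x r); split => //.
  have cff y : O y -> {for y, continuous (fun y => f y * f y)}.
    by move=> Oy; apply: cvgM; exact: smooth_on_cont sf y Oy.
  have := cbox_integrable oO cff sO mff; rewrite -ball_boxE => ib.
  have BO : ball x r `<=` O by apply: subset_trans sO; rewrite ball_boxE; exact: box_cbox.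
  rewrite wE// setIidl//.
  have /integrableP[_] := ib; apply: le_lt_trans; rewrite le_eqVlt; apply/orP; left; apply/eqP.
  by apply: eq_integral => y _; rewrite /= ger0_norm// -expr2 sqr_ge0.
have bx : boundary O x by split => // /interior_subset.
have [Z nZ] := collar_exists lO bx.
move/nbhs_ballP : nZ => [d /= d0 Hd].
exists (ball x d); first exact: nbhsx_ballx.
have mB : measurable (ball x d) by apply: open_measurable2; exact: ball_open.
exists (ball x d); split => //; rewrite wE//; apply: le_lt_trans (fin Z).
have mC := measurable_cell Z.
apply: ge0_subset_integral => //.
- exact: measurableI.
- by apply/measurable_EFinP; apply: measurable_funS mff => //; exact: cell_sub.
- by move=> y _; rewrite lee_fin -expr2 sqr_ge0.
- by move=> y [/Hd]; exact.
Qed.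

(** The weight in collar_hardy is bounded by the depth of the collar. *)
Lemma L2_of_gradient f : lipschitz_boundary O -> smooth_on O f ->
  (forall i, L2 O (partial i f)) -> L2 O f.
Proof.
move=> lO sf Lf; apply: L2_of_collars => // Z; apply: collar_hardy => //.
have mO := open_measurable2 oO; have a0 := dep_gt0 Z.
have i2 := integrable2Z (dep Z ^+ 2) mO (integrable2D mO (L2_mul_integrable mO (Lf 0) (Lf 0)) (L2_mul_integrable mO (Lf 1) (Lf 1))).
have g0 y : 0 <= partial 0 f y * partial 0 f y + partial 1 f y * partial 1 f y by rewrite addr_ge0 // -expr2 sqr_ge0.
have fin : (\int[mu]_(y in O) (dep Z ^+ 2 * (partial 0 f y * partial 0 f y + partial 1 f y * partial 1 f y))%:E < +oo)%E.
  have /integrableP[_] := i2; apply: le_lt_trans; rewrite le_eqVlt; apply/orP; left; apply/eqP.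
  by apply: eq_integral => y _; rewrite /= ger0_norm// mulr_ge0// sqr_ge0.
apply: le_lt_trans fin.
have mC := measurable_cell Z; have mp i := L2_meas (Lf i).
have mg : measurable_fun O (fun y => partial 0 f y * partial 0 f y + partial 1 f y * partial 1 f y).
  by apply: measurable_funD; apply: measurable_funM.
apply: (@le_trans _ _ (\int[mu]_(y in cell Z) (dep Z ^+ 2 * (partial 0 f y * partial 0 f y + partial 1 f y * partial 1 f y))%:E)%E).
  apply: ge0_le_integral => //.
  - by move=> y _; rewrite lee_fin mulr_ge0 ?addr_ge0 ?sqr_ge0.
  - apply/measurable_EFinP; apply: measurable_funM.
      by apply: measurable_funX; apply: measurable_funS (measurable_hgt Z).
    by apply: (measurable_funS mO (@cell_sub _ _ Z)); exact: mg.
  - apply/measurable_EFinP; apply: measurable_funM => //.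
    by apply: (measurable_funS mO (@cell_sub _ _ Z)); exact: mg.
  move=> y [_ /andP[h0 h1]]; rewrite lee_fin /gsq -!expr2 ler_wpM2r ?addr_ge0 ?sqr_ge0//.
  by rewrite ler_sqr ?nnegrE ?(ltW h0) ?(ltW a0).
apply: ge0_subset_integral => //.
- by apply/measurable_EFinP; exact: measurable_funM.
- by move=> y _; rewrite lee_fin mulr_ge0// sqr_ge0.
- exact: cell_sub.
Qed.

(** The weighted gradient of f on a cell has the length of that of T, which
    collar_harmonic controls. *)
Lemma L2_of_conjugate f T : lipschitz_boundary O -> smooth_on O f -> L2 O T -> smooth_on O T ->
  weakly_harmonic O T -> (forall x, O x -> gsq f x = gsq T x) -> L2 O f.
Proof.
move=> lO sf LT sT hT fT; apply: L2_of_collars => // Z; apply: collar_hardy => //.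
apply: le_lt_trans (collar_harmonic oO bO Z LT sT hT); rewrite le_eqVlt; apply/orP; left; apply/eqP.
by apply: eq_integral => y /set_mem/cell_sub Oy; rewrite fT.
Qed.

End lipschitz_collars.

(** * Smooth strains *)

(** Inner products become atoms before linear arithmetic is called, which would
    otherwise try to identify their integrands. *)
Ltac lra_ip := repeat match goal with |- context [@ip ?a ?b ?c ?d] => generalize (@ip a b c d) end;
  intros; lra.

Ltac lra_pt := repeat match goal with |- context [@partial ?a ?b ?c ?d] => generalize (@partial a b c d) end;
  intros; lra.

Section saint_venant.
Context {R : realType}.
Local Notation P2 := (R * R)%type.
Local Notation mu := (@leb2 R).
Local Notation e := (unit_vec R).
Context (O : set P2) (oO : open O) (bO : bounded_set O).
Implicit Types (f u v w : P2 -> R) (g h : 'I_2 -> P2 -> R).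
Let mO : measurable O := open_measurable2 oO.
Let Ofin : (mu O < +oo)%E := bounded_leb2_lty mO bO.
Local Notation ip := (ip O).
Local Notation test := (test_function O).

Lemma partial_comm f i j : test f -> partial i (partial j f) = partial j (partial i f).
Proof. by move=> tf; apply/funext => x; exact: (partialC i j openT (test_smooth tf) I). Qed.

Lemma testP f i : test f -> L2 O (partial i f).
Proof. by move=> tf; exact: (gradL2 oO bO i tf). Qed.

(** A weak gradient has no rotation. *)
Lemma weak_swap u g f : weak_grad O u g -> test f -> ip (g 0) (partial 1 f) = ip (g 1) (partial 0 f).
Proof.
move=> /weak_gradP[Lg Hg] tf.
have := Hg 0 _ (test_partial 1 tf); have := Hg 1 _ (test_partial 0 tf).
rewrite (partial_comm 1 0 tf) => -> /eqP; rewrite eqr_opp => /eqP ->//.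
Qed.

Lemma eq_ip u v f : (forall x, O x -> u x = v x) -> ip u f = ip v f.
Proof. by move=> uv; apply: eq_Rintegral => x /set_mem Ox; rewrite uv. Qed.

Definition lin3 (a b c : R) u v w : P2 -> R := fun x => a * u x + b * v x + c * w x.

Lemma L2_lin3 a b c u v w : L2 O u -> L2 O v -> L2 O w -> L2 O (lin3 a b c u v w).
Proof.
by move=> Lu Lv Lw; exact: (L2_add mO (L2_add mO (L2_scale mO a Lu) (L2_scale mO b Lv)) (L2_scale mO c Lw)).
Qed.

Lemma ip_lin3 a b c u v w f : L2 O u -> L2 O v -> L2 O w -> L2 O f ->
  ip (lin3 a b c u v w) f = a * ip u f + b * ip v f + c * ip w f.
Proof.
move=> Lu Lv Lw Lf; have L1 := L2_scale mO a Lu; have L2 := L2_scale mO b Lv.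
rewrite (ipDl mO (L2_add mO L1 L2) (L2_scale mO c Lw) Lf) (ipDl mO L1 L2 Lf).
by rewrite (ipZl mO a Lu Lf) (ipZl mO b Lv Lf) (ipZl mO c Lw Lf).
Qed.

Lemma weakly_harmonicP u : L2 O u -> (weakly_harmonic O u <->
  forall f, test f -> ip u (partial 0 (partial 0 f)) + ip u (partial 1 (partial 1 f)) = 0).
Proof.
move=> Lu; have E f : test f -> ip u (partial 0 (partial 0 f)) + ip u (partial 1 (partial 1 f)) =
    \int[mu]_(x in O) (u x * (partial 0 (partial 0 f) x + partial 1 (partial 1 f) x)).
  by move=> tf; rewrite -(ipDr mO (testP 0 (test_partial 0 tf)) (testP 1 (test_partial 1 tf)) Lu).
by split=> H f tf; [rewrite E//; exact: H|rewrite -E//; exact: H].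
Qed.

(** The Cauchy-Riemann equations d_0 u + d_1 v = 0 and d_0 v - d_1 u = 0 in the sense
    of distributions. *)
Definition weak_cr u v := forall f, test f ->
  ip u (partial 0 f) + ip v (partial 1 f) = 0 /\ ip v (partial 0 f) - ip u (partial 1 f) = 0.

Lemma weak_cr_harmonic u v : L2 O u -> L2 O v -> weak_cr u v ->
  weakly_harmonic O u /\ weakly_harmonic O v.
Proof.
move=> Lu Lv cr; split; apply/weakly_harmonicP => // f tf.
  have [E1 _] := cr _ (test_partial 0 tf); have [_ E2] := cr _ (test_partial 1 tf).
  by move: E1 E2; rewrite (partial_comm 1 0 tf); lra_ip.
have [_ E1] := cr _ (test_partial 0 tf); have [E2 _] := cr _ (test_partial 1 tf).
by move: E1 E2; rewrite (partial_comm 1 0 tf); lra_ip.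
Qed.

(** The representative is the smoothing of u. *)
Lemma weyl u : L2 O u -> weakly_harmonic O u ->
  exists u', [/\ smooth_on O u', L2 O u', weakly_harmonic O u' & forall f, measurable_fun O f -> ip u f = ip u' f].
Proof.
move=> Lu hu; have iu := L2_integrable mO Ofin Lu.
have su := smooth_smoothing oO bO iu hu; have ae := smoothing_ae oO bO iu hu.
have mu' := smooth_on_measurable oO su.
have E f : measurable_fun O f -> ip u f = ip (smoothing O u) f.
  by move=> mf; exact: (ae_eq_ip mO (L2_meas Lu) mu' mf ae).
have Lu' := L2_ae_eq mO mu' ae Lu.
exists (smoothing O u); split => //; apply/weakly_harmonicP => // f tf.
have Lf i j := testP i (test_partial j tf).
have E0 := E _ (L2_meas (Lf 0 0)); have E1 := E _ (L2_meas (Lf 1 1)).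
have := (weakly_harmonicP Lu).1 hu f tf; move: E0 E1; lra_ip.
Qed.

Lemma smooth_by_parts u f i : smooth_on O u -> test f -> ip u (partial i f) = - ip (partial i u) f.
Proof. by move=> su tf; exact: int_by_parts. Qed.

Lemma smooth_weak_grad u : smooth_on O u -> (forall i, L2 O (partial i u)) -> weak_grad O u (grad u).
Proof. by move=> su Lu; apply/weak_gradP; split => // i f tf; exact: smooth_by_parts. Qed.

(** Integrate by parts and apply the fundamental lemma to the left-hand side, which
    is continuous. *)
Lemma pointwise_of_weak u v i j (c : R) : smooth_on O u -> smooth_on O v ->
  (forall f, test f -> ip u (partial i f) + c * ip v (partial j f) = 0) ->
  forall x, O x -> partial i u x + c * partial j v x = 0.
Proof.
move=> su sv H; apply: (cont_fund_lemma oO) => [x Ox|f tf].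
  apply: cvgD; first exact: smooth_on_cont (smooth_on_partial i su) x Ox.
  by apply: cvgMl_tmp; exact: smooth_on_cont (smooth_on_partial j sv) x Ox.
have i1 := test_mul_integrable oO tf (smooth_on_partial i su).
have i2 := test_mul_integrable oO tf (smooth_on_partial j sv).
have E : \int[mu]_(x in O) ((partial i u x + c * partial j v x) * f x) = ip (partial i u) f + c * ip (partial j v) f.
  rewrite /ip -(RintZ c mO i2) -(RintD mO i1 (integrable2Z c mO i2)).
  by apply: eq_Rintegral => x _; rewrite mulrDl mulrA.
rewrite E; have := H f tf; rewrite (smooth_by_parts i su tf) (smooth_by_parts j sv tf).
by rewrite mulrN -opprD => /eqP; rewrite oppr_eq0 => /eqP.
Qed.

Lemma harmonic_pointwise u : smooth_on O u -> L2 O u -> weakly_harmonic O u ->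
  forall x, O x -> partial 0 (partial 0 u) x + 1 * partial 1 (partial 1 u) x = 0.
Proof.
move=> su Lu /(weakly_harmonicP Lu) hu; apply: (pointwise_of_weak (smooth_on_partial 0 su) (smooth_on_partial 1 su)) => f tf.
have E0 := smooth_by_parts 0 su (test_partial 0 tf); have E1 := smooth_by_parts 1 su (test_partial 1 tf).
move: (hu f tf) E0 E1; lra_ip.
Qed.

(** The right-hand side is a functional of f bounded by the energy: this is the
    Dirichlet problem Laplace u = div h. *)
Lemma riesz_field h : (forall i, L2 O (h i)) -> exists u g, H10g O u g /\
  forall f, test f -> ip (g 0) (partial 0 f) + ip (g 1) (partial 1 f) =
                      ip (h 0) (partial 0 f) + ip (h 1) (partial 1 f).
Proof.
move=> Lh.
have [||u [g [Hu Hg]]] := @riesz R O oO bO (fun f => ipg O h (grad f)) (2 * energy O h).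
- by move=> f k c tf tk; exact: ipg_lin.
- by move=> f tf; apply: (ipg_le oO) => // i; exact: testP.
- by exists u, g.
Qed.

Hypotheses (sc : simply_connected O) (lO : lipschitz_boundary O) (neO : O !=set0).

(** Here (a, b) is a deviator and t a trace.  With s the harmonic conjugate of t,
    the fields (a + t, b - s) / 2 and (b + s, t - a) / 2 are closed, hence
    gradients; s is the rotation of the displacement (u, v). *)
Lemma smooth_displacement a b t : smooth_on O a -> smooth_on O b -> smooth_on O t ->
  L2 O a -> L2 O b -> L2 O t -> weakly_harmonic O t ->
  (forall x, O x -> partial 0 a x + 1 * partial 1 b x = 0) ->
  (forall x, O x -> partial 0 b x + (-1) * partial 1 a x = 0) ->
  exists u v s, [/\ L2 O u /\ L2 O v, smooth_on O u /\ smooth_on O v, L2 O s,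
    forall x, O x -> partial 0 u x = 2^-1 * a x + 2^-1 * t x /\ partial 1 u x = 2^-1 * b x + (- 2^-1) * s x &
    forall x, O x -> partial 0 v x = 2^-1 * b x + 2^-1 * s x /\ partial 1 v x = 2^-1 * t x + (- 2^-1) * a x].
Proof.
move=> sa sb st La Lb Lt ht cr1 cr2.
have harm := harmonic_pointwise st Lt ht.
pose gS (i : 'I_2) := if i == 0 then (fun x => - partial 1 t x) else partial 0 t.
have prE (G : 'I_2 -> P2 -> R) F x i : primitive O G F -> O x -> partial i F x = G i x.
  by move=> pF Ox; have [_ E] := pF x i Ox; exact: E.
have nearO (p q : P2 -> R) x i : (forall y, O y -> p y = q y) -> O x -> partial i p x = partial i q x.
  by move=> pq Ox; apply: partial_near; apply: filterS (open_nbhs_nbhs (conj oO Ox)) => y /pq.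
have p1 := smooth_on_partial 1 st; have p0 := smooth_on_partial 0 st.
have pN i (q : P2 -> R) x : smooth_on O q -> O x -> partial i (fun y => - q y) x = - partial i q x.
  move=> sq Ox; have := is_deriveN (smooth_onP sq i Ox) => -[_ E]; exact: E.
have pL i (c d : R) (q q' : P2 -> R) x : smooth_on O q -> smooth_on O q' -> O x ->
    partial i (fun y => c * q y + d * q' y) x = c * partial i q x + d * partial i q' x.
  move=> sq sq' Ox.
  have := is_derive_add (is_derive_mul (is_derive_cst c x (e i)) (smooth_onP sq i Ox))
    (is_derive_mul (is_derive_cst d x (e i)) (smooth_onP sq' i Ox)).
  by rewrite !mul0r !add0r => -[_ E]; exact: E.
have sL (c d : R) (q q' : P2 -> R) : smooth_on O q -> smooth_on O q' -> smooth_on O (fun y => c * q y + d * q' y).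
  by move=> sq sq'; exact: (smooth_on_add oO (smooth_on_scale c oO sq) (smooth_on_scale d oO sq')).
have [||s ss pS] := @closed_form_exact R O oO gS _ _ sc neO.
- by move=> i; rewrite /gS; case: (i == 0); [exact: (smooth_on_opp oO p1)|exact: p0].
- move=> x Ox; rewrite -[LHS]/(partial 1 (fun y => - partial 1 t y) x) (pN 1 _ x p1 Ox) -[RHS]/(partial 0 (partial 0 t) x).
  have := harm x Ox; lra_pt.
have s0 x : O x -> partial 0 s x = - partial 1 t x by move=> Ox; have := prE _ _ x 0 pS Ox.
have s1 x : O x -> partial 1 s x = partial 0 t x by move=> Ox; have := prE _ _ x 1 pS Ox.
have Ls : L2 O s.
  apply: (L2_of_conjugate oO bO lO ss Lt st ht) => x Ox.
  by rewrite /gsq (s0 x Ox) (s1 x Ox) sqrrN addrC.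
pose gu (i : 'I_2) := if i == 0 then (fun x => 2^-1 * a x + 2^-1 * t x) else (fun x => 2^-1 * b x + (- 2^-1) * s x).
pose gv (i : 'I_2) := if i == 0 then (fun x => 2^-1 * b x + 2^-1 * s x) else (fun x => 2^-1 * t x + (- 2^-1) * a x).
have [||u su pu] := @closed_form_exact R O oO gu _ _ sc neO.
- by move=> i; rewrite /gu; case: (i == 0); [exact: (sL _ _ _ _ sa st)|exact: (sL _ _ _ _ sb ss)].
- move=> x Ox; rewrite -[LHS]/(partial 1 (fun y => 2^-1 * a y + 2^-1 * t y) x) -[RHS]/(partial 0 (fun y => 2^-1 * b y + (- 2^-1) * s y) x).
  rewrite (pL 1 _ _ _ _ x sa st Ox) (pL 0 _ _ _ _ x sb ss Ox) (s0 x Ox).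
  have := cr2 x Ox; lra_pt.
have [||v sv pv] := @closed_form_exact R O oO gv _ _ sc neO.
- by move=> i; rewrite /gv; case: (i == 0); [exact: (sL _ _ _ _ sb ss)|exact: (sL _ _ _ _ st sa)].
- move=> x Ox; rewrite -[LHS]/(partial 1 (fun y => 2^-1 * b y + 2^-1 * s y) x) -[RHS]/(partial 0 (fun y => 2^-1 * t y + (- 2^-1) * a y) x).
  rewrite (pL 1 _ _ _ _ x sb ss Ox) (pL 0 _ _ _ _ x st sa Ox) (s1 x Ox).
  have := cr1 x Ox; lra_pt.
have LL (c d : R) (q q' : P2 -> R) : L2 O q -> L2 O q' -> L2 O (fun y => c * q y + d * q' y).
  by move=> Lq Lq'; exact: (L2_add mO (L2_scale mO c Lq) (L2_scale mO d Lq')).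
have Lpart (G : 'I_2 -> P2 -> R) F : smooth_on O F -> primitive O G F -> (forall i, L2 O (G i)) -> L2 O F.
  move=> sF pF LG; apply: (L2_of_gradient oO bO lO sF) => i.
  have mp := smooth_on_measurable oO (smooth_on_partial i sF).
  apply: (L2_ae_eq mO mp _ (LG i)); apply: aeW => x Ox; exact/esym/(prE _ _ _ _ pF).
exists u, v, s; split; [|by split| exact: Ls| |].
- split; [apply: (Lpart _ _ su pu)|apply: (Lpart _ _ sv pv)] => i; rewrite /gu /gv.
    by case: (i == 0); [exact: (LL _ _ _ _ La Lt)|exact: (LL _ _ _ _ Lb Ls)].
  by case: (i == 0); [exact: (LL _ _ _ _ Lb Ls)|exact: (LL _ _ _ _ Lt La)].
- by move=> x Ox; split; [exact: (prE _ _ x 0 pu Ox)|exact: (prE _ _ x 1 pu Ox)].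
- by move=> x Ox; split; [exact: (prE _ _ x 0 pv Ox)|exact: (prE _ _ x 1 pv Ox)].
Qed.

End saint_venant.

(** * The Saint-Venant problem in L^2 *)

Section arith.
Variables (R : realType) (u v w x y z a b d p r s A B T A' B' T' s00 s01 s11 : R).

(** The linear eliminations that end the proof of saint_venant, on real numbers
    standing for the inner products. *)
Lemma strain_diag : u = p + v -> w = v -> w = 2^-1 * A' + 2^-1 * T' -> A = A' -> T = T' ->
  A = 1 * a + -1 * p + 1 * r -> T = 1 * d + -1 * p + -1 * r ->
  a = 1 * s11 + -1 * s00 + 0 * s01 -> d = 1 * s11 + 1 * s00 + 0 * s01 -> u = s11.
Proof. by move=> -> <- -> <- <- -> -> -> ->; lra. Qed.

Lemma strain_diag' : u = r + v -> w = v -> w = 2^-1 * T' + - 2^-1 * A' -> A = A' -> T = T' ->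
  A = 1 * a + -1 * p + 1 * r -> T = 1 * d + -1 * p + -1 * r ->
  a = 1 * s11 + -1 * s00 + 0 * s01 -> d = 1 * s11 + 1 * s00 + 0 * s01 -> u = s00.
Proof. by move=> -> <- -> <- <- -> -> -> ->; lra. Qed.

Lemma strain_shear : u = p + v -> x = r + y -> w = v -> z = y ->
  w = 2^-1 * B' + - 2^-1 * s -> z = 2^-1 * B' + 2^-1 * s -> B = B' ->
  B = 1 * b + -1 * r + -1 * p -> b = 0 * s11 + 0 * s00 + -2 * s01 -> x + u = -2 * s01.
Proof. by move=> -> -> <- <- -> -> <- -> ->; lra. Qed.
End arith.

Section main.
Context {R : realType}.
Local Notation P2 := (R * R)%type.
Local Notation mu := (@leb2 R).
Local Notation e := (unit_vec R).
Context (O : set P2) (oO : open O) (bO : bounded_set O).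
Implicit Types (f u v w : P2 -> R) (g h : 'I_2 -> P2 -> R).
Let mO : measurable O := open_measurable2 oO.
Let Ofin : (mu O < +oo)%E := bounded_leb2_lty mO bO.
Local Notation ip := (ip O).
Local Notation test := (test_function O).

Section saint_venant.
Hypotheses (sc : simply_connected O) (lO : lipschitz_boundary O) (neO : O !=set0).

(** With a = s11 - s00, b = - 2 s01 and d = s00 + s11, subtracting the strain of (p, r),
    where p and r are the Riesz representatives of (a, b) and (b, - a), leaves a
    deviator (A, B) that satisfies the Cauchy-Riemann equations and a harmonic trace
    T, to which smooth_displacement applies. *)
Lemma saint_venant s00 s01 s11 : L2 O s00 -> L2 O s01 -> L2 O s11 ->
  (forall f, test f -> ip s00 (partial 0 (partial 0 f)) + 2 * ip s01 (partial 0 (partial 1 f)) +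
     ip s11 (partial 1 (partial 1 f)) = 0) ->
  exists u0 u1 g0 g1, [/\ L2 O u0 /\ L2 O u1, weak_grad O u0 g0 /\ weak_grad O u1 g1 &
    forall f, test f -> [/\ ip (g0 0) f = ip s11 f, ip (g1 1) f = ip s00 f &
      ip (g1 0) f + ip (g0 1) f = - 2 * ip s01 f]].
Proof.
move=> L00 L01 L11 H.
pose a := lin3 1 (-1) 0 s11 s00 s01; pose b := lin3 0 0 (-2) s11 s00 s01.
pose d := lin3 1 1 0 s11 s00 s01.
have La : L2 O a := L2_lin3 oO 1 (-1) 0 L11 L00 L01.
have Lb : L2 O b := L2_lin3 oO 0 0 (-2) L11 L00 L01.
have Ld : L2 O d := L2_lin3 oO 1 1 0 L11 L00 L01.
have Ea f (Lf : L2 O f) : ip a f = _ := ip_lin3 oO 1 (-1) 0 L11 L00 L01 Lf.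
have Eb f (Lf : L2 O f) : ip b f = _ := ip_lin3 oO 0 0 (-2) L11 L00 L01 Lf.
have Ed f (Lf : L2 O f) : ip d f = _ := ip_lin3 oO 1 1 0 L11 L00 L01 Lf.
have LNa := L2_opp mO La.
have ENa f (Lf : L2 O f) := ipNl mO La Lf.
have [|p [gp [Hp Ep]]] := riesz_field oO bO (h := fun i => if i == 0 then a else b).
  by move=> i; case: (i == 0); [exact: La|exact: Lb].
have [|r [gr [Hr Er]]] := riesz_field oO bO (h := fun i => if i == 0 then b else (fun x => - a x)).
  by move=> i; case: (i == 0); [exact: Lb|exact: LNa].
have {}Ep f (tf : test f) : ip (gp 0) (partial 0 f) + ip (gp 1) (partial 1 f) =
    ip a (partial 0 f) + ip b (partial 1 f) := Ep f tf.
have {}Er f (tf : test f) : ip (gr 0) (partial 0 f) + ip (gr 1) (partial 1 f) =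
    ip b (partial 0 f) + ip (fun x => - a x) (partial 1 f) := Er f tf.
have [Lp wp _] := Hp; have [Lr wr _] := Hr.
have Lgp i : L2 O (gp i) by have [] := wp i.
have Lgr i : L2 O (gr i) by have [] := wr i.
have Lpf i f := testP oO bO i (f := f).
pose A := lin3 1 (-1) 1 a (gp 0) (gr 1); pose B := lin3 1 (-1) (-1) b (gr 0) (gp 1).
pose T := lin3 1 (-1) (-1) d (gp 0) (gr 1).
have LA : L2 O A := L2_lin3 oO 1 (-1) 1 La (Lgp 0) (Lgr 1).
have LB : L2 O B := L2_lin3 oO 1 (-1) (-1) Lb (Lgr 0) (Lgp 1).
have LT : L2 O T := L2_lin3 oO 1 (-1) (-1) Ld (Lgp 0) (Lgr 1).
have EA f (Lf : L2 O f) : ip A f = _ := ip_lin3 oO 1 (-1) 1 La (Lgp 0) (Lgr 1) Lf.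
have EB f (Lf : L2 O f) : ip B f = _ := ip_lin3 oO 1 (-1) (-1) Lb (Lgr 0) (Lgp 1) Lf.
have ET f (Lf : L2 O f) : ip T f = _ := ip_lin3 oO 1 (-1) (-1) Ld (Lgp 0) (Lgr 1) Lf.
have crAB : weak_cr O A B.
  move=> f tf; have L0 := Lpf 0 f tf; have L1 := Lpf 1 f tf.
  move: (EA _ L0) (EA _ L1) (EB _ L0) (EB _ L1) (Ep f tf) (Er f tf) (ENa _ L1)
    (weak_swap wp tf) (weak_swap wr tf).
  move=> h1 h2 h3 h4 h5 h6 h7 h8 h9; split; move: h1 h2 h3 h4 h5 h6 h7 h8 h9; lra_ip.
have hT : weakly_harmonic O T.
  apply/(weakly_harmonicP oO bO LT) => f tf.
  have t0 := test_partial 0 tf; have t1 := test_partial 1 tf.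
  have L0 := Lpf 0 _ t0; have L1 := Lpf 1 _ t1; have Lm := Lpf 0 _ t1.
  have swp := weak_swap wp t1; have swr := weak_swap wr t0.
  have rp := Ep _ t0; have rr := Er _ t1.
  rewrite (partial_comm 1 0 tf) in swr; rewrite (partial_comm 1 0 tf) in rp.
  move: (ET _ L0) (ET _ L1) (Ea _ L0) (Ea _ L1) (Eb _ Lm) (Ed _ L0) (Ed _ L1) (ENa _ L1)
    swp swr rp rr (H f tf).
  lra_ip.
have [hA hB] := weak_cr_harmonic oO bO LA LB crAB.
have [A' [sA LA' _ AE]] := weyl oO bO LA hA.
have [B' [sB LB' _ BE]] := weyl oO bO LB hB.
have [T' [sT LT' hT' TE]] := weyl oO bO LT hT.
have cr1 : forall x, O x -> partial 0 A' x + 1 * partial 1 B' x = 0.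
  apply: (@pointwise_of_weak R O oO A' B' 0 1 1 sA sB) => f tf.
  have [c1 _] := crAB f tf.
  move: (AE _ (L2_meas (Lpf 0 f tf))) (BE _ (L2_meas (Lpf 1 f tf))) c1; lra_ip.
have cr2 : forall x, O x -> partial 0 B' x + (-1) * partial 1 A' x = 0.
  apply: (@pointwise_of_weak R O oO B' A' 0 1 (-1) sB sA) => f tf.
  have [_ c1] := crAB f tf.
  move: (AE _ (L2_meas (Lpf 1 f tf))) (BE _ (L2_meas (Lpf 0 f tf))) c1; lra_ip.
have [u [v [s [[Lu Lv] [su sv] Ls pu pv]]]] :=
  smooth_displacement oO bO sc lO neO sA sB sT LA' LB' LT' hT' cr1 cr2.
have eqL (q : P2 -> R) i (q' : P2 -> R) : smooth_on O q -> L2 O q' -> (forall x, O x -> q' x = partial i q x) ->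
    L2 O (partial i q).
  move=> sq Lq' E; apply: (L2_ae_eq mO (smooth_on_measurable oO (smooth_on_partial i sq)) _ Lq').
  by apply: aeW => x Ox; exact: E.
have L2c (c1 c2 : R) (q q' : P2 -> R) (Lq : L2 O q) (Lq' : L2 O q') :
  L2 O (fun x => c1 * q x + c2 * q' x) := L2_add mO (L2_scale mO c1 Lq) (L2_scale mO c2 Lq').
have Ec (c1 c2 : R) (q q' f : P2 -> R) (Lq : L2 O q) (Lq' : L2 O q') (Lf : L2 O f) :
    ip (fun x => c1 * q x + c2 * q' x) f = c1 * ip q f + c2 * ip q' f.
  have E1 := ipDl mO (L2_scale mO c1 Lq) (L2_scale mO c2 Lq') Lf.
  have E2 := ipZl mO c1 Lq Lf; have E3 := ipZl mO c2 Lq' Lf.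
  by rewrite E1; congr (_ + _).
have u0E x (Ox : O x) : 2^-1 * A' x + 2^-1 * T' x = partial 0 u x by have [] := pu x Ox.
have u1E x (Ox : O x) : 2^-1 * B' x + (- 2^-1) * s x = partial 1 u x by have [] := pu x Ox.
have v0E x (Ox : O x) : 2^-1 * B' x + 2^-1 * s x = partial 0 v x by have [] := pv x Ox.
have v1E x (Ox : O x) : 2^-1 * T' x + (- 2^-1) * A' x = partial 1 v x by have [] := pv x Ox.
have Lpu i : L2 O (partial i u).
  have [->|->] := ord2 i.
    exact: (eqL _ _ _ su (L2c _ _ _ _ LA' LT') u0E).
  exact: (eqL _ _ _ su (L2c _ _ _ _ LB' Ls) u1E).
have Lpv i : L2 O (partial i v).
  have [->|->] := ord2 i.
    exact: (eqL _ _ _ sv (L2c _ _ _ _ LB' Ls) v0E).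
  exact: (eqL _ _ _ sv (L2c _ _ _ _ LT' LA') v1E).
exists (fun x => p x + u x), (fun x => r x + v x), (fun i x => gp i x + partial i u x), (fun i x => gr i x + partial i v x).
split.
- by split; [exact: (L2_add mO Lp Lu)|exact: (L2_add mO Lr Lv)].
- split; first exact: (weak_gradD oO bO Lp Lu wp (smooth_weak_grad oO su Lpu)).
  exact: (weak_gradD oO bO Lr Lv wr (smooth_weak_grad oO sv Lpv)).
move=> f tf; have Lf : L2 O f := testL2 oO bO tf.
have mf := L2_meas Lf.
have D0 := ipDl mO (Lgp 0) (Lpu 0) Lf; have D1 := ipDl mO (Lgp 1) (Lpu 1) Lf.
have D2 := ipDl mO (Lgr 0) (Lpv 0) Lf; have D3 := ipDl mO (Lgr 1) (Lpv 1) Lf.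
have F0 := eq_ip f u0E; have F1 := eq_ip f u1E; have F2 := eq_ip f v0E; have F3 := eq_ip f v1E.
have K0 := Ec 2^-1 2^-1 _ _ f LA' LT' Lf; have K1 := Ec 2^-1 (- 2^-1) _ _ f LB' Ls Lf.
have K2 := Ec 2^-1 2^-1 _ _ f LB' Ls Lf; have K3 := Ec 2^-1 (- 2^-1) _ _ f LT' LA' Lf.
have M0 := AE f mf; have M1 := BE f mf; have M2 := TE f mf.
have N0 := EA f Lf; have N1 := EB f Lf; have N2 := ET f Lf.
have Q0 := Ea f Lf; have Q1 := Eb f Lf; have Q2 := Ed f Lf.
split.
- exact: (strain_diag D0 F0 K0 M0 M2 N0 N2 Q0 Q2).
- exact: (strain_diag' D3 F3 K3 M0 M2 N0 N2 Q0 Q2).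
- exact: (strain_shear D1 D2 F1 F2 K1 K2 M1 N1 Q1).
Qed.
End saint_venant.
End main.

(** * The decomposition *)

Section arith.
Variables (R : realType) (X Y Z p q r s c : R).

Lemma diag_arith : X = - Y -> Y = p -> p = - r -> r = c -> X = c.
Proof. by move=> -> -> -> ->; rewrite opprK. Qed.

Lemma diag_arith' : X = Y -> Y = - p -> p = - r -> r = c -> X = c.
Proof. by move=> -> -> -> ->; rewrite opprK. Qed.

Lemma shear_arith : X = (Y - Z) / 2 -> Y = p -> Z = - q -> p = - r -> q = - s -> r + s = - 2 * c -> X = c.
Proof. by move=> -> -> -> -> -> h; lra. Qed.

Lemma cancel_arith : X = Y -> p = q -> - X + (Y - p) / 2 + (Y - p) / 2 + q = 0.
Proof. by move=> -> ->; lra. Qed.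
End arith.

Section decomposition.
Context {R : realType}.
Local Notation P2 := (R * R)%type.
Local Notation mu := (@leb2 R).
Context (O : set P2) (oO : open O) (bO : bounded_set O).
Implicit Types (f u v w q : P2 -> R) (g h : 'I_2 -> P2 -> R) (t a b : P2 -> 'M[R]_2).
Let mO : measurable O := open_measurable2 oO.
Let Ofin : (mu O < +oo)%E := bounded_leb2_lty mO bO.
Local Notation ip := (ip O).
Local Notation test := (test_function O).

Definition entry t i j : P2 -> R := fun x => t x i j.
Definition divdiv t f := ddiv (dbdiv (distr_mx O t)) f.

Lemma sum2 (F : 'I_2 -> R) : \sum_(i < 2) F i = F 0 + F 1.
Proof. by rewrite big_ord_recl big_ord1; congr (_ + F _); apply: val_inj. Qed.

Lemma ddivE (T : 'I_2 -> 'I_2 -> functional R) f : test f -> ddiv (dbdiv T) f =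
  T 0 0 (partial 0 (partial 0 f)) + T 0 1 (partial 0 (partial 1 f)) +
  T 1 0 (partial 0 (partial 1 f)) + T 1 1 (partial 1 (partial 1 f)).
Proof.
move=> tf; have C := partial_comm 1 0 tf.
have E : ddiv (dbdiv T) f = T 0 0 (partial 0 (partial 0 f)) + T 0 1 (partial 1 (partial 0 f)) +
    T 1 0 (partial 0 (partial 1 f)) + T 1 1 (partial 1 (partial 1 f)).
  rewrite /dbdiv /ddiv /dpartial; move: (@partial R) => P.
  by rewrite !sum2 !opprD !opprK addrA.
have Q F G (x y z : R) : F = G -> x + T 0 1 F + y + z = x + T 0 1 G + y + z by move=> ->.
exact: etrans E (Q _ _ _ _ _ C).
Qed.

Lemma divdivE t f : test f -> divdiv t f =
  ip (entry t 0 0) (partial 0 (partial 0 f)) + ip (entry t 0 1) (partial 0 (partial 1 f)) +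
  ip (entry t 1 0) (partial 0 (partial 1 f)) + ip (entry t 1 1) (partial 1 (partial 1 f)).
Proof.
by move=> tf; exact: (ddivE (distr_mx O t) tf).
Qed.

Lemma entry_ae t t' i j : ae_eq mu O t t' -> ae_eq mu O (entry t i j) (entry t' i j).
Proof. by apply: filterS => x H Ox; rewrite /entry H. Qed.

Lemma ip_ae t t' i j f : L2mx O t -> L2mx O t' -> ae_eq mu O t t' -> L2 O f ->
  ip (entry t i j) f = ip (entry t' i j) f.
Proof.
move=> Lt Lt' tt Lf.
exact: (ae_eq_ip mO (L2_meas (Lt i j)) (L2_meas (Lt' i j)) (L2_meas Lf) (entry_ae i j tt)).
Qed.

Lemma L2mx_add a b : L2mx O a -> L2mx O b -> L2mx O (a \+ b).
Proof.
move=> La Lb i j; have := L2_add mO (La i j) (Lb i j).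
by congr (L2 O _); apply/funext => x; rewrite mxE.
Qed.

Lemma divdiv_ae t t' f : L2mx O t -> L2mx O t' -> ae_eq mu O t t' -> test f ->
  divdiv t f = divdiv t' f.
Proof.
move=> Lt Lt' tt tf; rewrite (divdivE t tf) (divdivE t' tf).
have Lf i j : L2 O (partial i (partial j f)) := testP oO bO i (test_partial j tf).
congr (_ + _ + _ + _); apply: ip_ae => //; exact: Lf.
Qed.

Lemma divdivD a b f : L2mx O a -> L2mx O b -> test f -> divdiv (a \+ b) f = divdiv a f + divdiv b f.
Proof.
move=> La Lb tf; rewrite (divdivE _ tf) (divdivE a tf) (divdivE b tf).
have Lf i j : L2 O (partial i (partial j f)) := testP oO bO i (test_partial j tf).
have E i j k l : ip (entry (a \+ b) i j) (partial k (partial l f)) =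
    ip (entry a i j) (partial k (partial l f)) + ip (entry b i j) (partial k (partial l f)).
  rewrite -(ipDl mO (La i j) (Lb i j) (Lf k l)); congr (ip _ _).
  by apply/funext => x; rewrite /entry mxE.
by rewrite !E; lra_ip.
Qed.

Lemma symcurlE (V : 'I_2 -> functional R) f :
  [/\ dsym (dbcurl V) 0 0 f = - V 0 (partial 1 f), dsym (dbcurl V) 1 1 f = V 1 (partial 0 f),
      dsym (dbcurl V) 0 1 f = (V 0 (partial 0 f) - V 1 (partial 1 f)) / 2 &
      dsym (dbcurl V) 1 0 f = (V 0 (partial 0 f) - V 1 (partial 1 f)) / 2].
Proof.
rewrite /dsym /dbcurl /dcurl /= /dpartial !opprK; split => //.
- by move: (V 0 _) => z; lra.
- by move: (V 1 _) => z; lra.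
- by rewrite addrC.
Qed.

Section symcurl.
Variables (a : P2 -> 'M[R]_2) (v : P2 -> 'cV[R]_2).
Hypotheses (La : L2mx O a)
  (va : forall i j, eq_distr O (dsym (dbcurl (distr_vec O v)) i j) (distr_mx O a i j)).

(** The two off-diagonal entries have the same pairing with test functions. *)
Lemma symcurl_sym : ae_eq mu O (entry a 0 1) (entry a 1 0).
Proof.
apply: (L2_distr_eq oO bO (La 0 1) (La 1 0)) => f tf.
have E0 := va 0 1 tf; have E1 := va 1 0 tf.
have [_ _ S01 S10] := symcurlE (distr_vec O v) f.
exact: etrans (esym E0) (etrans S01 (etrans (esym S10) E1)).
Qed.

(** The third derivatives of the potential cancel in pairs. *)
Lemma symcurl_divdiv f : test f -> divdiv a f = 0.
Proof.
move=> tf; rewrite (divdivE a tf).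
have t0 := test_partial 0 tf; have t1 := test_partial 1 tf.
have E i j k : test k -> ip (entry a i j) k = dsym (dbcurl (distr_vec O v)) i j k.
  by move=> tk; rewrite (va i j tk).
rewrite (E 0 0 _ (test_partial 0 t0)) (E 0 1 _ (test_partial 0 t1)) (E 1 0 _ (test_partial 0 t1)).
rewrite (E 1 1 _ (test_partial 1 t1)).
have [-> _ _ _] := symcurlE (distr_vec O v) (partial 0 (partial 0 f)).
have [_ _ -> ->] := symcurlE (distr_vec O v) (partial 0 (partial 1 f)).
have [_ -> _ _] := symcurlE (distr_vec O v) (partial 1 (partial 1 f)).
have C : partial 1 (partial 0 (partial 0 f)) = partial 0 (partial 0 (partial 1 f)).
  by rewrite (partial_comm 1 0 t0) (partial_comm 1 0 tf).
have C' := partial_comm 1 0 t1.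
exact: (cancel_arith (congr1 (distr_vec O v 0) C) (congr1 (distr_vec O v 1) C')).
Qed.
End symcurl.

Lemma entry_pi w i j : entry (pi_mx w) i j = if i == j then w else fun=> 0.
Proof. by apply/funext => x; rewrite /entry /pi_mx mxE; case: (i == j). Qed.

Lemma L2mx_pi w : L2 O w -> L2mx O (pi_mx w).
Proof.
move=> Lw i j; have := entry_pi w i j; rewrite /entry => ->.
by case: (i == j) => //; exact: L2_0.
Qed.

Lemma ip0l f : ip (fun=> 0) f = 0.
Proof. by rewrite /ip (@eq_Rintegral _ _ _ _ _ (cst 0)) ?Rintegral_cst ?mul0r// => x _; rewrite mul0r. Qed.

(** div div (w I) is the Laplacian of w. *)
Lemma pi_divdiv w g q f : weak_grad O w g -> (forall k, test k -> ipg O g (grad k) = - ip q k) ->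
  test f -> divdiv (pi_mx w) f = ip q f.
Proof.
move=> /weak_gradP[_ Hg] Hq tf; rewrite (divdivE _ tf).
have E i j := entry_pi w i j; rewrite (E 0 0) (E 0 1) (E 1 0) (E 1 1) /=.
have Z := ip0l (partial 0 (partial 1 f)).
have H0 := Hg 0 _ (test_partial 0 tf); have H1 := Hg 1 _ (test_partial 1 tf).
have := Hq f tf; rewrite /ipg /grad.
move: Z H0 H1; lra_ip.
Qed.

(** The difference is an element of H^1_0 with vanishing Laplacian. *)
Lemma pi_unique w w' g g' q q' : H10g O w g -> H10g O w' g' ->
  (forall k, test k -> ipg O g (grad k) = - ip q k) ->
  (forall k, test k -> ipg O g' (grad k) = - ip q' k) ->
  (forall k, test k -> ip q k = ip q' k) -> ae_eq mu O w w'.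
Proof.
move=> Hw Hw' Hq Hq' qq.
have [Lw wg _] := Hw; have [Lw' wg' _] := Hw'.
have Lg i : L2 O (g i) by have [] := wg i.
have Lg' i : L2 O (g' i) by have [] := wg' i.
apply: (ae_sub0 (L2_meas Lw) (L2_meas Lw')).
apply: (H10g_harmonic0 oO bO (H10gB oO bO Hw Hw')) => f tf.
have E0 := ipBl mO (Lg 0) (Lg' 0) (gradL2 oO bO 0 tf).
have E1 := ipBl mO (Lg 1) (Lg' 1) (gradL2 oO bO 1 tf).
move: E0 E1 (Hq f tf) (Hq' f tf) (qq f tf); rewrite /ipg; lra_ip.
Qed.

(** Rotated by a right angle, the field is the strain of a displacement (u0, u1),
    and (u1, - u0) is the potential. *)
Lemma divdiv0_symcurl a : simply_connected O -> lipschitz_boundary O -> O !=set0 ->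
  L2mx O a -> ae_eq mu O (entry a 0 1) (entry a 1 0) -> (forall f, test f -> divdiv a f = 0) ->
  symcurlH1 O a.
Proof.
move=> sc lO neO La sa Ha; split=> //.
have off f : L2 O f -> ip (entry a 0 1) f = ip (entry a 1 0) f.
  by move=> Lf; exact: (ae_eq_ip mO (L2_meas (La 0 1)) (L2_meas (La 1 0)) (L2_meas Lf) sa).
have Lf i j f (tf : test f) : L2 O (partial i (partial j f)) := testP oO bO i (test_partial j tf).
have [|u0 [u1 [g0 [g1 [[Lu0 Lu1] [w0 w1] H]]]]] := saint_venant oO bO sc lO neO (La 0 0) (La 0 1) (La 1 1).
  move=> f tf; move: (Ha f tf); rewrite (divdivE a tf).
  move: (off _ (Lf 0 1 f tf)); rewrite /entry; lra_ip.
have [_ G0] := (weak_gradP _ _ _).1 w0; have [_ G1] := (weak_gradP _ _ _).1 w1.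
pose v x : 'cV[R]_2 := \col_i (if i == 0 then u1 x else - u0 x).
have v0 : (fun x => v x 0 0) = u1 by apply/funext => x; rewrite mxE.
have v1 : (fun x => v x 1 0) = (fun x => - u0 x) by apply/funext => x; rewrite mxE.
exists v.
  move=> i; case: (ord2 i) => ->; [rewrite v0|rewrite v1]; split => //.
  - by exists g1.
  - exact: L2_opp.
  - by exists (fun i x => - g0 i x); exact: (weak_gradN oO bO Lu0 w0).
have V0 f : distr_vec O v 0 f = ip u1 f by rewrite /distr_vec v0.
have V1 f : test f -> distr_vec O v 1 f = - ip u0 f.
  by move=> tf; rewrite /distr_vec v1; exact: (ipNl mO Lu0 (testL2 oO bO tf)).
move=> i j f tf; have [S00 S11 S01 S10] := symcurlE (distr_vec O v) f.
have [H0 H1 H2] := H f tf.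
have K00 := G0 0 f tf; have K01 := G0 1 f tf; have K10 := G1 0 f tf; have K11 := G1 1 f tf.
rewrite -[distr_mx _ _ _ _ f]/(ip (entry a i j) f).
have ot := off f (testL2 oO bO tf).
have A0 := V0 (partial 0 f); have A1 := V0 (partial 1 f).
have B0 := V1 _ (test_partial 0 tf); have B1 := V1 _ (test_partial 1 tf).
case: (ord2 i) => ->; case: (ord2 j) => ->.
- by exact: (diag_arith S00 A1 K11 H1).
- by exact: (shear_arith S01 A0 B1 K10 K01 H2).
- by exact: (etrans (shear_arith S10 A0 B1 K10 K01 H2) ot).
- by exact: (diag_arith' S11 B0 K00 H0).
Qed.

Lemma symcurl_pi_direct_sum : O !=set0 -> lipschitz_boundary O -> simply_connected O ->
  is_direct_sum O (Hdivdiv O) (symcurlH1 O) (pi_inv_laplacian_L2 O).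
Proof.
move=> neO lO sc; split=> [t Lt|a a' b b' [La [v _ va]] [La' [v' _ va']]].
  split=> [[[_ st] [q Lq tq]]|[a [b [[La [v _ va]] [Lb [q [w [Lq wq bw]]]] tab]]]].
    have [w [g [Hw wq Hg]]] := inv_laplacian_exists oO bO Lq.
    have [Lw wg _] := Hw; have Lpi := L2mx_pi Lw.
    pose a := fun x => t x - pi_mx w x.
    have La : L2mx O a.
      move=> i j; have := L2_sub mO (Lt i j) (Lpi i j).
      by rewrite (_ : (fun x => _ - _) = (fun x => a x i j))//; apply/funext => x; rewrite !mxE.
    have tE : t = a \+ pi_mx w by apply/funext => x; rewrite /a /= subrK.
    exists a, (pi_mx w); split; last by rewrite -tE; exact: aeW.
      apply: (divdiv0_symcurl sc lO neO La) => [|f tf].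
        move: st; apply: filterS => x H Ox; rewrite /entry /a !mxE /= !mulr0n.
        by have := congr1 (fun m : 'M[R]_2 => m 1 0) (H Ox); rewrite mxE => ->.
      have := tq f tf; rewrite -/(divdiv t f) {1}tE (divdivD La Lpi tf) (pi_divdiv wg Hg tf).
      by rewrite -[distr O q f]/(ip q f) -[RHS]add0r => /addIr.
    by split => //; exists q, w; split => //; exact: aeW.
  have [g Hw Hg] := inv_laplacian_H10g oO bO Lq wq.
  have [Lw wg _] := Hw; have Lpi := L2mx_pi Lw.
  have Lab := L2mx_add La Lb.
  split; first split => //.
    have sa := symcurl_sym La va.
    move: tab bw sa; apply: filterS3 => x H1 H2 H3 Ox.
    rewrite H1// /= H2//; apply/matrixP => i j; rewrite !mxE.
    have := H3 Ox; rewrite /entry => E.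
    by case: (ord2 i) => ->; case: (ord2 j) => ->; rewrite ?E.
  exists q => // f tf; rewrite -/(divdiv t f) (divdiv_ae Lt Lab tab tf) (divdivD La Lb tf).
  by rewrite (symcurl_divdiv va tf) add0r (divdiv_ae Lb Lpi bw tf) (pi_divdiv wg Hg tf).
move=> [Lb [q [w [Lq wq bw]]]] [Lb' [q' [w' [Lq' wq' bw']]]] E.
have [g Hw Hg] := inv_laplacian_H10g oO bO Lq wq.
have [g' Hw' Hg'] := inv_laplacian_H10g oO bO Lq' wq'.
have [Lw wg _] := Hw; have [Lw' wg' _] := Hw'.
have ww : ae_eq mu O w w'.
  apply: (pi_unique Hw Hw' Hg Hg') => f tf.
  have := divdiv_ae (L2mx_add La Lb) (L2mx_add La' Lb') E tf.
  rewrite (divdivD La Lb tf) (divdivD La' Lb' tf) (symcurl_divdiv va tf) (symcurl_divdiv va' tf) !add0r.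
  rewrite (divdiv_ae Lb (L2mx_pi Lw) bw tf) (divdiv_ae Lb' (L2mx_pi Lw') bw' tf).
  by rewrite (pi_divdiv wg Hg tf) (pi_divdiv wg' Hg' tf).
have bb : ae_eq mu O b b'.
  move: bw bw' ww; apply: filterS3 => x H1 H2 H3 Ox.
  by rewrite H1// H2// /pi_mx H3.
split=> //; move: E bb; apply: filterS2 => x H1 H2 Ox.
by have := H1 Ox; rewrite /= H2// => /addIr.
Qed.

End decomposition.

Theorem mainTheorem4 (R : realType) (Omega : set (R * R))
    (hOmega : bounded_lipschitz_domain Omega)
    (hsc : simply_connected Omega)
    (hbd : connected (boundary Omega)) :
  is_direct_sum Omega (Hdivdiv Omega)
    (symcurlH1 Omega) (pi_inv_laplacian_L2 Omega).
Proof. by have [neO oO _ bO lO] := hOmega; exact: symcurl_pi_direct_sum. Qed.
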